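(* Let $\mathbf{x}^{(t)}\in\mathbf{R}^d$, $t\in\mathbf{Z}$, satisfy the vector autoregression $\mathbf{x}^{(t)}=\sum_{j=1}^p\mathbf{A}^{(j)}\mathbf{x}^{(t-j)}+\boldsymbol\epsilon^{(t)}$ with $\mathbf{A}^{(j)}\in\mathbf{R}^{d\times d}$ and white noise innovations: $\mathbf{E}\boldsymbol\epsilon^{(t)}=0$, $\mathbf{E}\boldsymbol\epsilon^{(t)}\boldsymbol\epsilon^{(t)\top}=\boldsymbol\Sigma_{\boldsymbol\epsilon}$ for all $t$, $\mathbf{E}\boldsymbol\epsilon^{(t_1)}\boldsymbol\epsilon^{(t_2)\top}=0$ for $t_1\ne t_2$. The vectors $\mathbf{x}^{(t)}$, $t=1,\dots,T$, are observed. Let $\mathbf{W},\mathbf{S},\mathbf{y}^{(l)},\boldsymbol\eta^{(l)},\mathbf{z}^{(t)},\mathbf{S}^\dagger,\boldsymbol\Sigma^{(0)},\mathcal{B}_l,\widetilde{\mathbf{S}},\widetilde{\mathcal{B}}_l,\mathcal{F}_{\mathcal B}(\cdot),\boldsymbol\Lambda^{(l_1,l_2)}$ and the post-selection estimator $\widehat{\mathbf{S}}$ be as defined in the context. Assume: (1) $\mathbf{x}^{(t)},t\in\mathbf{Z}$, are $(m,\alpha)$-short range dependent with constants $m>8$, $\alpha>1$; $p=O(1)$; $d=O(T^{\alpha_d})$ with a constant $0\le\alpha_d<\frac{m\alpha}{2+24\alpha}$. (2) $\lambda=c_\lambda T^{-\alpha_\lambda}$ with constants $c_\lambda>0$ and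 $0<\alpha_\lambda<\frac12-\frac{4\alpha_d}{m}$; $b_T\to0$ and $b_T/\lambda\to\infty$ as $T\to\infty$; $\max_{l=1,\dots,d}\vert\mathcal{B}_l\vert=O(1)$ and $\max_{l=1,\dots,d}\vert\mathcal{B}_l\vert>0$; $\min_{l=1,\dots,d,\ j\in\mathcal{B}_l}\vert\mathbf{S}_{jl}\vert>2b_T$; all eigenvalues of $\mathbf{S}^\dagger$ are less than $1$ in absolute value; the minimum eigenvalue of $\boldsymbol\Sigma^{(0)}$ is greater than a constant $c>0$. (3) There is a constant $c'>0$ such that for all sufficiently large $T$, $\boldsymbol\Lambda^{(l,l)}_{jj}>c'$ for all $l=1,\dots,d$ and $j\in\mathcal{B}_l$. Then $$\sup_{x\in\mathbf{R}}\Big\vert\mathrm{Prob}\Big(\max_{j=1,\dots,pd,\ l=1,\dots,d}\sqrt{T}\,\vert\widehat{\mathbf{S}}_{jl}-\mathbf{S}_{jl}\vert\le x\Big)-\mathrm{Prob}\Big(\max_{l=1,\dots,d,\ j\in\mathcal{B}_l}\vert\boldsymbol\Gamma_{jl}\vert\le x\Big)\Big\vert=o(1),$$ where $\boldsymbol\Gamma_{jl}$ are joint normal random variables with $\mathbf{E}\boldsymbol\Gamma_{jl}=0$ and $\mathrm{Cov}(\boldsymbol\Gamma_{j_1l_1},\boldsymbol\Gamma_{j_2l_2})=\boldsymbol\Lambda^{(l_1,l_2)}_{j_1j_2}$.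
   Context: $T$ is the sample size; $d$, $p$, the matrices $\mathbf{A}^{(j)}$ and the laws of the processes may depend on $T$; $O,o,O_p$ refer to $T\to\infty$, and ''constant'' means independent of $T$. $\Vert X\Vert_m=(\mathbf{E}\vert X\vert^m)^{1/m}$. $\vert\cdot\vert_1,\vert\cdot\vert_2$ are the vector $\ell_1,\ell_2$ norms; $\vert\mathcal{B}\vert$ is the cardinality of a set; $\mathbf{M}_{\cdot l}$ is the $l$th column of $\mathbf{M}$. $(m,\alpha)$-short range dependence of random vectors $\mathbf{v}^{(t)}\in\mathbf{R}^d$, $t\in\mathbf{Z}$: there are independent (not necessarily identically distributed) random variables $e_t,t\in\mathbf{Z}$, and measurable functions with $\mathbf{v}^{(t)}_i=g^{(t,T)}_i(\dots,e_{t-1},e_t)$. Let $e_t^\dagger$ be independent random variables, independent of $(e_s)_{s\in\mathbf{Z}}$, with $e^\dagger_t$ distributed as $e_t$; for $j\ge0$ let $\mathbf{v}^{(t,j)}_i=g^{(t,T)}_i(\dots,e_{t-j-1},e^\dagger_{t-j},e_{t-j+1},\dots,e_t)$ and $\delta^{(j)}=\sup_{i,\,t\in\mathbf{Z}}\Vert\mathbf{v}^{(t)}_i-\mathbf{v}^{(t,j)}_i\Vert_m$. It is required that $\mathbf{E}\mathbf{v}^{(t)}=0$ for all $t$, $\sup_{t,i}\Vert\mathbf{v}^{(t)}_i\Vert_m=O(1)$, and $\sup_{k\ge0}(1+k)^\alpha\sum_{j=k}^\infty\delta^{(j)}=O(1)$. Definitions. $\mathbf{z}^{(t)}=(\mathbf{x}^{(t)\top},\mathbf{x}^{(t-1)\top},\dots,\mathbf{x}^{(t-p+1)\top})^\top\in\mathbf{R}^{pd}$.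 $\mathbf{W}$ is the $(T-p)\times pd$ matrix with rows $\mathbf{z}^{(p)\top},\mathbf{z}^{(p+1)\top},\dots,\mathbf{z}^{(T-1)\top}$. $\mathbf{S}=[\mathbf{A}^{(1)},\dots,\mathbf{A}^{(p)}]^\top\in\mathbf{R}^{pd\times d}$. For $l=1,\dots,d$: $\mathbf{y}^{(l)}=(\mathbf{x}^{(p+1)}_l,\dots,\mathbf{x}^{(T)}_l)^\top$ and $\boldsymbol\eta^{(l)}=(\boldsymbol\epsilon^{(p+1)}_l,\dots,\boldsymbol\epsilon^{(T)}_l)^\top$, so $\mathbf{y}^{(l)}=\mathbf{W}\mathbf{S}_{\cdot l}+\boldsymbol\eta^{(l)}$. $\mathcal{B}_l=\{j\in\{1,\dots,pd\}:\mathbf{S}_{jl}\ne0\}$. $\boldsymbol\Sigma^{(0)}=\mathbf{E}\mathbf{z}^{(p)}\mathbf{z}^{(p)\top}$. $\mathbf{S}^\dagger$ is the $pd\times pd$ transpose of the block companion matrix whose first $d$ rows are $\mathbf{S}^\top$ and whose remaining $(p-1)d$ rows are $[\mathbf{I}_{(p-1)d}\ \ 0]$. Lasso with parameter $\lambda$: $\widetilde{\mathbf{S}}\in\mathbf{R}^{pd\times d}$ has columns $\widetilde{\mathbf{S}}_{\cdot l}\in\mathrm{argmin}_{\mathbf{s}\in\mathbf{R}^{pd}}\frac{1}{2T}\vert\mathbf{y}^{(l)}-\mathbf{W}\mathbf{s}\vert_2^2+\lambda\vert\mathbf{s}\vert_1$. With threshold $b_T$: $\widetilde{\mathcal{B}}_l=\{j\in\{1,\dots,pd\}:\vert\widetilde{\mathbf{S}}_{jl}\vert>b_T\}$.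 Partial inverse operator: for a square matrix $\mathbf{A}\in\mathbf{R}^{n\times n}$ and $\mathcal{B}=\{k_1<\dots<k_v\}\subset\{1,\dots,n\}$, let $\mathbf{A}_{\mathcal{B}}=(\mathbf{A}_{k_sk_t})_{s,t=1,\dots,v}$ and let $\mathbf{Z}$ be the Moore–Penrose pseudo-inverse of $\mathbf{A}_{\mathcal{B}}$; $\mathcal{F}_{\mathcal{B}}(\mathbf{A})\in\mathbf{R}^{n\times n}$ has $(k_s,k_t)$ entry $\mathbf{Z}_{st}$ and all other entries $0$. Post-selection estimator: $\widehat{\mathbf{S}}\in\mathbf{R}^{pd\times d}$ with columns $\widehat{\mathbf{S}}_{\cdot l}=\mathcal{F}_{\widetilde{\mathcal{B}}_l}\big(\frac1T\mathbf{W}^\top\mathbf{W}\big)\frac1T\mathbf{W}^\top\mathbf{y}^{(l)}$, $l=1,\dots,d$. $\boldsymbol\Lambda^{(l_1,l_2)}=\mathcal{F}_{\mathcal{B}_{l_1}}(\boldsymbol\Sigma^{(0)})\big(\frac1T\mathbf{E}\mathbf{W}^\top\boldsymbol\eta^{(l_1)}\boldsymbol\eta^{(l_2)\top}\mathbf{W}\big)\mathcal{F}_{\mathcal{B}_{l_2}}(\boldsymbol\Sigma^{(0)})$ for $l_1,l_2=1,\dots,d$. *)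

(* Defs.v *)
From HB Require Import structures.
From mathcomp Require Import all_boot all_order all_algebra.
From mathcomp Require Import complex.
From mathcomp Require Import all_classical all_reals all_analysis.

Set Implicit Arguments.
Unset Strict Implicit.
Unset Printing Implicit Defensive.

Import Order.TTheory GRing.Theory Num.Theory.
Import numFieldNormedType.Exports.

Local Open Scope classical_set_scope.
Local Open Scope ring_scope.

Section LinearAlgebra.
Variable R : realType.

Definition l1norm n (v : 'cV[R]_n) : R := \sum_(i < n) `|v i 0|.

Definition l2norm n (v : 'cV[R]_n) : R := Num.sqrt (\sum_(i < n) v i 0 ^+ 2).

Definition is_pinv m n (A : 'M[R]_(m, n)) (Z : 'M[R]_(n, m)) : Prop :=
  [/\ A *m Z *m A = A, Z *m A *m Z = Z,
      (A *m Z)^T = A *m Z & (Z *m A)^T = Z *m A].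

(* Moore-Penrose pseudo-inverse; existence and uniqueness of a matrix
   satisfying the four Penrose equations are [pinvP] and [is_pinv_inj]. *)
Definition pinv m n (A : 'M[R]_(m, n)) : 'M[R]_(n, m) := xget 0 (is_pinv A).

Lemma is_pinv_inj m n (A : 'M[R]_(m, n)) Z1 Z2 :
  is_pinv A Z1 -> is_pinv A Z2 -> Z1 = Z2.
Proof.
move=> [a1 b1 c1 d1] [a2 b2 c2 d2].
have e1 : A *m Z1 = A *m Z2.
  have E : A *m Z2 *m (A *m Z1) = A *m Z1 by rewrite mulmxA a2.
  by rewrite -c1 -E trmx_mul c1 c2 mulmxA a1.
have e2 : Z1 *m A = Z2 *m A.
  have E : Z1 *m A *m (Z2 *m A) = Z1 *m A by rewrite -!mulmxA [A *m _]mulmxA a2.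
  by rewrite -d1 -E trmx_mul d1 d2 -!mulmxA [A *m _]mulmxA a1.
by rewrite -b1 e2 -mulmxA e1 mulmxA.
Qed.

Lemma mulmx_tr_eq0 m n (A : 'M[R]_(m, n)) : A *m A^T = 0 -> A = 0.
Proof.
move=> A0; apply/matrixP => i j; rewrite mxE; apply/eqP.
have := congr1 (fun M : 'M[R]_m => M i i) A0; rewrite !mxE => /eqP.
rewrite psumr_eq0 => [|k _]; last by rewrite mxE -expr2 sqr_ge0.
by move=> /allP/(_ j (mem_index_enum j)); rewrite mxE /= mulf_eq0 orbb.
Qed.

Lemma gram_unit m n (A : 'M[R]_(m, n)) : row_free A -> A *m A^T \in unitmx.
Proof.
move=> fA; rewrite -row_free_unit -kermx_eq0; apply/eqP.
set K := kermx _; have K0 : K *m (A *m A^T) = 0 by exact: mulmx_ker.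
have KA0 : K *m A = 0.
  by apply: mulmx_tr_eq0; rewrite trmx_mul mulmxA -[K *m A *m A^T]mulmxA K0
    mul0mx.
by apply: (row_free_inj fA); rewrite KA0 mul0mx.
Qed.

Lemma is_pinv_factor m r n (C : 'M[R]_(m, r)) (B : 'M[R]_(r, n)) :
    C^T *m C \in unitmx -> B *m B^T \in unitmx ->
  is_pinv (C *m B) (B^T *m invmx (B *m B^T) *m invmx (C^T *m C) *m C^T).
Proof.
move=> uC uB; set iB := invmx _; set iC := invmx _.
have VB : B *m B^T *m iB = 1%:M by exact: mulmxV.
have VC : iC *m (C^T *m C) = 1%:M by exact: mulVmx.
have siB : iB^T = iB by rewrite /iB trmx_inv trmx_mul trmxK.
have siC : iC^T = iC by rewrite /iC trmx_inv trmx_mul trmxK.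
have AZ : C *m B *m (B^T *m iB *m iC *m C^T) = C *m iC *m C^T.
  by rewrite !mulmxA -[C *m B *m B^T]mulmxA -[C *m _ *m iB]mulmxA VB mulmx1.
have ZA : B^T *m iB *m iC *m C^T *m (C *m B) = B^T *m iB *m B.
  by rewrite !mulmxA -[_ *m C^T *m C]mulmxA -[_ *m iC *m _]mulmxA VC mulmx1.
split; rewrite ?AZ ?ZA.
- by rewrite mulmxA -[_ *m C^T *m C]mulmxA -[_ *m iC *m _]mulmxA VC mulmx1.
- by rewrite -!mulmxA; congr (_ *m (_ *m _)); rewrite !mulmxA VB mul1mx.
- by rewrite !trmx_mul trmxK siC mulmxA.
- by rewrite !trmx_mul trmxK siB mulmxA.
Qed.

Lemma pinvP m n (A : 'M[R]_(m, n)) : is_pinv A (pinv A).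
Proof.
apply: xgetPex.
have uB : row_base A *m (row_base A)^T \in unitmx.
  exact/gram_unit/row_base_free.
have uC : (col_base A)^T *m col_base A \in unitmx.
  rewrite -{2}[col_base A]trmxK; apply: gram_unit.
  by rewrite /row_free mxrank_tr; exact: col_base_full.
by have := is_pinv_factor uC uB; rewrite mulmx_base; eexists; eassumption.
Qed.

(* [enum_val] lists B increasingly: k_s = enum_val s.  Each of the two sums
   below has at most one term. *)
Definition partial_inv n (B : {set 'I_n}) (A : 'M[R]_n) : 'M[R]_n :=
  let Z := pinv (\matrix_(s < #|B|, t < #|B|) A (enum_val s) (enum_val t)) in
  \matrix_(i, j) \sum_(s | enum_val s == i) \sum_(t | enum_val t == j) Z s t.

End LinearAlgebra.

Section Autoregression.
Variables (R : realType) (p d : nat).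
Implicit Types (x : int -> 'cV[R]_d) (S : 'M[R]_(p * d, d)).

(* [mxvec] is row-major: coordinate i of the block of lag j has index
   j * d + i. *)
Definition lagged x (t : int) : 'cV[R]_(p * d) :=
  (mxvec (\matrix_(j < p, i < d) x (t - j%:Z) i 0))^T.

(* Row s (from 0) is z^(p+s); the times are p, ..., T - 1. *)
Definition design T x : 'M[R]_(T - p, p * d) :=
  \matrix_(s < T - p) (lagged x (p + s)%N%:Z)^T.

(* Coordinate l at the times p + 1, ..., T; gives y^(l) from the observations
   and eta^(l) from the innovations. *)
Definition response T x (l : 'I_d) : 'cV[R]_(T - p) :=
  \col_(s < T - p) x (p + s).+1%:Z l 0.

(* A j (j < p) is the coefficient of lag j + 1. *)
Definition coef_mx (A : 'I_p -> 'M[R]_d) : 'M[R]_(p * d, d) :=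
  \matrix_(k < p * d, l < d) mxvec (\matrix_(j < p, i < d) A j l i) 0 k.

Definition companion S : 'M[R]_(p * d) :=
  \matrix_(k, k') if insub (val k) is Some l then S k' l
                  else (k' + d == k)%N%:R.

Definition companion_tr S : 'M[R]_(p * d) := (companion S)^T.

Definition supp S (l : 'I_d) : {set 'I_(p * d)} := [set k | S k l != 0]%SET.

Definition threshold_supp (b : R) S (l : 'I_d) : {set 'I_(p * d)} :=
  [set k | b < `|S k l|]%SET.

Definition lasso_obj T (lam : R) x (l : 'I_d) (s : 'cV[R]_(p * d)) : R :=
  (2 * T%:R)^-1 * l2norm (response T x l - design T x *m s) ^+ 2
  + lam * l1norm s.

Definition is_lasso T (lam : R) x S : Prop :=
  forall l s, lasso_obj T lam x l (col l S) <= lasso_obj T lam x l s.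

Definition post_selection T (b : R) x (Stilde : 'M[R]_(p * d, d)) :
    'M[R]_(p * d, d) :=
  \matrix_(k, l)
    (partial_inv (threshold_supp b Stilde l)
       (T%:R^-1 *: ((design T x)^T *m design T x))
     *m (T%:R^-1 *: ((design T x)^T *m response T x l))) k 0.

End Autoregression.

Section Probability.
Variable R : realType.

Definition measurable_mx disp (Om : measurableType disp) m n
    (M : Om -> 'M[R]_(m, n)) : Prop :=
  forall i j, measurable_fun setT (fun w => M w i j).

(* Entrywise; only meaningful when the entries are integrable. *)
Definition mean_mx disp (Om : measurableType disp) (P : probability Om R) m n
    (M : Om -> 'M[R]_(m, n)) : 'M[R]_(m, n) :=
  \matrix_(i, j) fine (expectation P (fun w => M w i j)).

Definition mutually_independent disp (Om : measurableType disp)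
    (P : probability Om R) (I : eqType) (X : I -> {RV P >-> R}) : Prop :=
  forall (s : seq I) (B : I -> set R), uniq s -> (forall i, measurable (B i)) ->
  P (\big[setI/setT]_(i <- s) (X i @^-1` B i)) =
  (\prod_(i <- s) P (X i @^-1` B i))%E.

(* Every linear combination has the law of m + s N with N standard normal;
   s may be 0, so the covariance matrix may be singular. *)
Definition jointly_normal disp (Om : measurableType disp)
    (P : probability Om R) (I : finType) (G : I -> Om -> R) : Prop :=
  forall a : I -> R, exists m s : R, forall B : set R, measurable B ->
  P [set w | B (\sum_i a i * G i w)] =
  normal_prob 0 1 [set u : R | B (m + s * u)].

Definition cylinders : set (set (nat -> R)) :=
  [set C | exists (k : nat) (B : set R),
     measurable B /\ C = [set u | B (u k)]].

(* Measurability for the product sigma-algebra on R^nat. *)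
Definition measurable_seq_fun (g : (nat -> R) -> R) : Prop :=
  @measurable_fun _ _ (g_sigma_algebraType cylinders) R setT g.

Definition bounded_as_T (u : nat -> \bar R) : Prop :=
  exists C : R, \forall T \near \oo, (u T <= C%:E)%E.

(* (e_t, e_{t-1}, e_{t-2}, ...) *)
Definition past (e : int -> R) (t : int) : nat -> R := fun k => e (t - k%:Z).

(* past e t with e_{t-j} replaced by e'_{t-j} *)
Definition past_subst (e e' : int -> R) (t : int) (j : nat) : nat -> R :=
  fun k => if k == j then e' (t - k%:Z) else e (t - k%:Z).

(* The independent copy of e is realised on the product space, as
   e^dagger_t (w, w') = e_t w' next to e_t (w, w') = e_t w.  The coefficient
   depends only on the joint law of (e, e^dagger), so any other realisation
   gives the same value, and P need not carry a copy of e. *)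
Definition dep_coef disp (Om : measurableType disp) (P : probability Om R)
    (m : R) d (e : int -> Om -> R) (g : int -> 'I_d -> (nat -> R) -> R)
    (j : nat) : \bar R :=
  ereal_sup (range (fun ti : int * 'I_d =>
    Lnorm (P \x P)%E m%:E (fun ww : Om * Om =>
      (g ti.1 ti.2 (past (fun t => e t ww.1) ti.1)
        - g ti.1 ti.2 (past_subst (fun t => e t ww.1) (fun t => e t ww.2)
                         ti.1 j))%:E))).

Definition short_range_dependent (disp : nat -> measure_display)
    (Om : forall T, measurableType (disp T))
    (P : forall T, probability (Om T) R) (d : nat -> nat) (m alpha : R)
    (v : forall T, int -> Om T -> 'cV[R]_(d T)) : Prop :=
  exists (e : forall T, int -> {RV P T >-> R})
         (g : forall T, int -> 'I_(d T) -> (nat -> R) -> R),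
  [/\ (forall T, mutually_independent (e T)) /\
      (forall T t i, measurable_seq_fun (g T t i)),
      forall T t, {ae P T, forall w, forall i,
        v T t w i 0 = g T t i (past (fun s => e T s w) t)},
      forall T t i, expectation (P T) (fun w => v T t w i 0) = 0%E,
      bounded_as_T (fun T => ereal_sup (range (fun ti : int * 'I_(d T) =>
        Lnorm (P T) m%:E (fun w => (v T ti.1 w ti.2 0)%:E)))) &
      bounded_as_T (fun T => ereal_sup (range (fun k : nat =>
        (((1 + k%:R) `^ alpha)%:E *
         \sum_(k <= j <oo) dep_coef (P T) m (e T) (g T) j)%E)))].

Definition white_noise disp (Om : measurableType disp) (P : probability Om R) d
    (eps : int -> Om -> 'cV[R]_d) (Sig : 'M[R]_d) : Prop :=
  [/\ forall t i, expectation P (fun w => eps t w i 0) = 0%E,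
      forall t i j,
        expectation P (fun w => eps t w i 0 * eps t w j 0) = (Sig i j)%:E &
      forall t1 t2 i j, t1 != t2 ->
        expectation P (fun w => eps t1 w i 0 * eps t2 w j 0) = 0%E].

Definition is_VAR disp (Om : measurableType disp) (P : probability Om R) p d
    (A : 'I_p -> 'M[R]_d) (x eps : int -> Om -> 'cV[R]_d) : Prop :=
  forall t, {ae P, forall w,
    x t w = \sum_(j < p) A j *m x (t - j.+1%:Z) w + eps t w}.

Section Moments.
Variables (disp : measure_display) (Om : measurableType disp).
Variables (P : probability Om R) (p d : nat).
Implicit Types x eps : int -> Om -> 'cV[R]_d.

Definition Sigma0 x : 'M[R]_(p * d) :=
  mean_mx P (fun w => let z := lagged p (fun t => x t w) p%:Z in z *m z^T).

Definition Lambda T x eps (S : 'M[R]_(p * d, d)) (l1 l2 : 'I_d) :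
    'M[R]_(p * d) :=
  partial_inv (supp S l1) (Sigma0 x)
  *m (T%:R^-1 *: mean_mx P (fun w =>
        let W := design p T (fun t => x t w) in
        let eta := response p T (fun t => eps t w) in
        W^T *m eta l1 *m (eta l2)^T *m W))
  *m partial_inv (supp S l2) (Sigma0 x).

End Moments.

(* sup over u of the distance between the distribution functions; the two
   variables may live on different spaces. *)
Definition kolmogorov_dist disp (Om : measurableType disp)
    (P : probability Om R) (X : Om -> R)
    disp' (Om' : measurableType disp') (Q : probability Om' R) (Y : Om' -> R) :
    \bar R :=
  ereal_sup (range (fun u : R =>
    `|P [set w | (X w <= u)%R] - Q [set w | (Y w <= u)%R]|%E)).

End Probability.

(* Main.v *)
(* Off an event of small probability the empirical Gram matrix and the score
   W^T eta / T are uniformly close to their means (von Bahr--Esseen--Rio type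
   moment bounds for short-range dependent sums, and a union bound). There the
   basic inequality for the Lasso gives an error of order lambda in each
   coordinate, so thresholding recovers every B_l exactly, and
   sqrt T (Shat - S) is, up to a negligible remainder, the vector of normalized
   sums of the influence variables F_(B_l)(Sigma0) z^(t-1) eps_l^(t); their
   covariance is exactly Lambda, because the recursion with spectral radius
   less than 1 forces E z^(t) eps^(s)T = 0 for t < s.

   For the maximum of these sums, each summand is replaced by one that depends
   on finitely many e_t only. The indicator of {max_i x_i <= x} is smoothed to
   1 / (1 + sum_i exp (beta (x_i - x))), and the sums are compared with the
   Gaussian vector along the path cos th S + sin th G. Stein's method for local
   dependence, applied to S, needs no blocks. Gaussian anti-concentration comes
   from Stein's identity too: beta E f (1 - f) <= E max |G| / min Var G, for the
   smoothed indicator f. All the error terms are negative powers of T. *)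

Require Import Defs.
From HB Require Import structures.
From mathcomp Require Import all_boot all_order all_algebra.
From mathcomp Require Import complex.
From mathcomp Require Import all_classical all_reals all_analysis.
From mathcomp Require Import spectral sesquilinear measurable_realfun ring lra zify.

Set Implicit Arguments.
Unset Strict Implicit.
Unset Printing Implicit Defensive.

Import Order.TTheory GRing.Theory Num.Theory.
Import numFieldNormedType.Exports.

Local Open Scope classical_set_scope.
Local Open Scope ring_scope.

(** * Expectations and moments *)

(** The innovations are moved to their law on R^Z, where conditioning is integration over some
    coordinates; independence is then used through one invariance, the exchange of coordinates
    between two independent sequences. The obstacle is a dimension that may grow as a power of T.
    Derivatives of the smoothed indicator are therefore bounded by sup norms only, the Gibbs weights
    having mass at most 1, and the dimension enters the Stein error through the L^q norm of a
    maximum, as a power 1 / q. The influence variables are products of two variables with m moments,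
    so q = m / 2 > 4, which covers the fourth moments in that error. The process is not assumed
    stationary: covariance stationarity, like the orthogonality of states and later innovations,
    comes from the fact that a bounded backward orbit of a matrix with spectrum inside the unit disk
    vanishes. Joint normality is given through the laws of linear combinations, hence the passage
    through characteristic functions before a pair of Gaussian copies can be rotated. *)

Section Expectation.
Context d (T : measurableType d) (R : realType) (P : probability T R).
Implicit Types X Y : T -> R.

Definition itg X : Prop := P.-integrable setT (EFin \o X).
Definition Ex X : R := \int[P]_w X w.

Lemma itg_meas X : itg X -> measurable_fun setT X.
Proof. by move=> /integrableP[/measurable_EFinP]. Qed.

Lemma itg_le X Y : measurable_fun setT X -> itg Y ->
  (forall w, `|X w| <= Y w) -> itg X.
Proof.
move=> mX iY XY; apply: (le_integrable _ _ _ iY) => //.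
  exact/measurable_EFinP.
by move=> w _ /=; rewrite lee_fin (le_trans (XY w))// ler_norm.
Qed.

Lemma itg_cst (k : R) : itg (fun=> k).
Proof. exact: finite_measure_integrable_cst. Qed.

Lemma itg_bnd X (k : R) : measurable_fun setT X -> (forall w, `|X w| <= k) -> itg X.
Proof. by move=> mX Xk; exact: (itg_le mX (itg_cst k)). Qed.

Lemma itgD X Y : itg X -> itg Y -> itg (fun w => X w + Y w).
Proof. by move=> iX iY; exact: (integrableD _ iX iY). Qed.

Lemma itgN X : itg X -> itg (fun w => - X w).
Proof. by move=> iX; exact: (integrableN iX). Qed.

Lemma itgB X Y : itg X -> itg Y -> itg (fun w => X w - Y w).
Proof. by move=> iX iY; apply: itgD => //; exact: itgN. Qed.

Lemma itgZ (k : R) X : itg X -> itg (fun w => k * X w).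
Proof. by move=> iX; exact: (integrableZl _ k iX). Qed.

Lemma itg_norm X : itg X -> itg (fun w => `|X w|).
Proof. exact: integrable_norm. Qed.

Lemma itg_sum I (r : seq I) (p : pred I) (X : I -> T -> R) :
  (forall i, p i -> itg (X i)) -> itg (fun w => \sum_(i <- r | p i) X i w).
Proof.
move=> iX; elim: r => [|i r IH].
  have -> : (fun w => \sum_(i <- [::] | p i) X i w) = fun=> 0.
    by apply/funext => w; rewrite big_nil.
  exact: itg_cst.
case pi : (p i); last first.
  have -> // : (fun w => \sum_(j <- i :: r | p j) X j w) =
      fun w => \sum_(j <- r | p j) X j w.
    by apply/funext => w; rewrite big_cons pi.
have -> : (fun w => \sum_(j <- i :: r | p j) X j w) =
    fun w => X i w + \sum_(j <- r | p j) X j w.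
  by apply/funext => w; rewrite big_cons pi.
by apply: itgD => //; exact: iX.
Qed.

Lemma ExE X : itg X -> (\int[P]_w (X w)%:E)%E = (Ex X)%:E.
Proof. by move=> iX; rewrite /Ex /Rintegral fineK//; exact: integrable_fin_num. Qed.

Lemma ExD X Y : itg X -> itg Y -> Ex (fun w => X w + Y w) = Ex X + Ex Y.
Proof. exact: RintegralD. Qed.

Lemma ExB X Y : itg X -> itg Y -> Ex (fun w => X w - Y w) = Ex X - Ex Y.
Proof. exact: RintegralB. Qed.

Lemma ExZ (k : R) X : itg X -> Ex (fun w => k * X w) = k * Ex X.
Proof. exact: RintegralZl. Qed.

Lemma Ex_cst (k : R) : Ex (fun=> k) = k.
Proof. by rewrite /Ex Rintegral_cst//= probability_setT mulr1. Qed.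

Lemma Ex_sum I (r : seq I) (p : pred I) (X : I -> T -> R) :
  (forall i, p i -> itg (X i)) ->
  Ex (fun w => \sum_(i <- r | p i) X i w) = \sum_(i <- r | p i) Ex (X i).
Proof.
move=> iX; elim: r => [|i r IH].
  rewrite big_nil -[RHS]Ex_cst; congr Ex.
  by apply/funext => w; rewrite big_nil.
rewrite big_cons; case pi : (p i); last first.
  by rewrite -IH; congr Ex; apply/funext => w; rewrite big_cons pi.
rewrite -IH -ExD; [|exact: iX|exact: itg_sum].
by congr Ex; apply/funext => w; rewrite big_cons pi.
Qed.

Lemma le_Ex X Y : itg X -> itg Y -> (forall w, X w <= Y w) -> Ex X <= Ex Y.
Proof. by move=> iX iY XY; exact: le_Rintegral. Qed.

Lemma Ex_ge0 X : (forall w, 0 <= X w) -> 0 <= Ex X.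
Proof. by move=> X0; exact: Rintegral_ge0. Qed.

Lemma norm_Ex X : itg X -> `|Ex X| <= Ex (fun w => `|X w|).
Proof. exact: le_normr_Rintegral. Qed.

Lemma norm_Ex_le X Y : measurable_fun setT X -> itg Y ->
  (forall w, `|X w| <= Y w) -> `|Ex X| <= Ex Y.
Proof.
move=> mX iY XY; have iX := itg_le mX iY XY.
by apply: (le_trans (norm_Ex iX)); apply: le_Ex => //; exact: itg_norm.
Qed.

Lemma Ex_ae X Y : measurable_fun setT X -> measurable_fun setT Y ->
  {ae P, forall w, X w = Y w} -> Ex X = Ex Y.
Proof.
move=> mX mY XY; congr fine; apply: ae_eq_integral => //.
- exact/measurable_EFinP.
- exact/measurable_EFinP.
- by apply: filterS XY => w /= ->.
Qed.

Lemma itg_ae X Y : itg X -> measurable_fun setT Y ->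
  {ae P, forall w, X w = Y w} -> itg Y.
Proof.
move=> /integrableP[mX iX] mY XY.
apply/integrableP; split; first exact/measurable_EFinP.
rewrite (_ : (\int[P]_w _)%E = (\int[P]_w `|(EFin \o X) w|)%E)//.
apply: ae_eq_integral => //.
- by apply: measurableT_comp => //; exact/measurable_EFinP.
- by apply: measurableT_comp.
- by apply: filterS XY => w /= ->.
Qed.

Lemma Ex_indic (A : set T) : measurable A -> Ex \1_A = fine (P A).
Proof. by move=> mA; rewrite /Ex /Rintegral integral_indic// setIT. Qed.

Lemma itg_indic (A : set T) : measurable A -> itg \1_A.
Proof.
move=> mA; apply: (@itg_bnd _ 1); first exact: measurable_indic.
by move=> w; rewrite indicE; case: (_ \in _); rewrite ?normr1 ?normr0.
Qed.

Lemma ge0_ltpinfty_itg X (k : R) : measurable_fun setT X -> (forall w, 0 <= X w) ->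
  (\int[P]_w (X w)%:E <= k%:E)%E -> itg X.
Proof.
move=> mX X0 Xk; apply/integrableP; split; first exact/measurable_EFinP.
apply: (le_lt_trans _ (ltry k)); apply: le_trans Xk.
by rewrite le_eqVlt; apply/orP; left; apply/eqP/eq_integral => w _ /=; rewrite ger0_norm.
Qed.

Lemma Ex_cvg (X_ : nat -> T -> R) X Y :
  (forall n, measurable_fun setT (X_ n)) -> measurable_fun setT X ->
  (forall n w, `|X_ n w| <= Y w) -> itg Y ->
  (forall w, X_ n w @[n --> \oo] --> X w) ->
  Ex (X_ n) @[n --> \oo] --> Ex X.
Proof.
move=> mX_ mX XY iY cX.
have mE n : measurable_fun setT (EFin \o X_ n) by exact/measurable_EFinP.
have mEX : measurable_fun setT (EFin \o X) by exact/measurable_EFinP.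
have cE : {ae P, forall w, setT w -> (EFin \o X_ n) w @[n --> \oo] --> (EFin \o X) w}.
  by apply: aeW => w _; apply: cvg_EFin; [exact: nearW|exact: cX].
have dE : {ae P, forall w n, setT w -> (`|(EFin \o X_ n) w| <= (EFin \o Y) w)%E}.
  by apply: aeW => w n _ /=; rewrite lee_fin.
have [iX _ cI] := dominated_convergence measurableT mE mEX cE iY dE.
by apply: fine_cvg; rewrite -ExE.
Qed.

End Expectation.

Tactic Notation "lraw" ne_hyp_list(hs) := (clear - hs; lra).

(** * Power functions: convexity, signed powers, second-order expansions *)

Section PowerInequalities.
Context (R : realType).
Implicit Types (x y u v r q c : R).

(** Bernoulli's inequality. Young's inequality for x and 1 with the conjugate exponents r and r / (r
    - 1), multiplied by r, gives it without differentiation. *)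
Lemma powR_young r x : 0 <= x -> 1 <= r -> 1 + r * (x - 1) <= x `^ r.
Proof.
move=> x0; rewrite le_eqVlt => /predU1P[<-|r1]; first by rewrite powRr1//; lra.
have r0 : 0 < r by lra.
have r10 : 0 < r - 1 by lra.
have := @conjugate_powR R x 1 r (r / (r - 1)) x0 ler01 r0 (divr_gt0 r0 r10).
rewrite powR1 mulr1 invf_div => /(_ _)/wrap[|h].
  by field; rewrite gt_eqF.
have := ler_wpM2l (ltW r0) h; rewrite mulrDr mulrCA mulfV ?gt_eqF// mulr1.
rewrite mul1r [r * (_ / _)]mulrCA mulfV ?gt_eqF// mulr1 => h'.
lra.
Qed.

(** By homogeneity: Bernoulli's inequality at v / u, multiplied by u^r. *)
Lemma powR_tangent r u v : 0 <= u -> 0 <= v -> 1 < r ->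
  u `^ r + r * u `^ (r - 1) * (v - u) <= v `^ r.
Proof.
move=> u0 v0 r1; have [->|un0] := eqVneq u 0.
  by rewrite !powR0 ?powR_ge0 ?mulr0 ?mul0r ?addr0 ?powR_ge0//;
    rewrite ?subr_eq0 gt_eqF//; lra.
have up : 0 < u by rewrite lt_neqAle eq_sym un0.
have -> : v `^ r = u `^ r * (v / u) `^ r.
  by rewrite -powRM ?divr_ge0// mulrCA mulfV// mulr1.
have -> : u `^ r + r * u `^ (r - 1) * (v - u) = u `^ r * (1 + r * (v / u - 1)).
  by rewrite -(mulr_powRB1 u0 (_ : 0 < r)); [field|lra].
by rewrite ler_wpM2l ?powR_ge0// powR_young ?divr_ge0//; lra.
Qed.

Lemma ler_powR2 q x y : 0 <= q -> 0 <= x -> x <= y -> x `^ q <= y `^ q.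
Proof.
by move=> q0 x0 xy; apply: ge0_ler_powR => //; rewrite nnegrE// (le_trans x0).
Qed.

Lemma powR_div r x c : 0 < c -> 0 <= x -> (x / c) `^ r = x `^ r / c `^ r.
Proof.
move=> c0 x0; rewrite powRM ?invr_ge0 ?(ltW c0)//.
by rewrite -(powR_inv1 (ltW c0)) -powRrM mulN1r powRN.
Qed.

(** Bernoulli's inequality with exponent 1 / r at the point x^r. *)
Lemma powR_concave r x : 0 <= x -> 0 < r <= 1 -> x `^ r <= 1 + r * (x - 1).
Proof.
move=> x0 /andP[r0 r1].
have := @powR_young r^-1 (x `^ r) (powR_ge0 _ _).
rewrite -powRrM mulfV ?gt_eqF// powRr1// => /(_ _)/wrap[|h].
  by rewrite invf_ge1.
have := ler_wpM2l (ltW r0) h; rewrite mulrDr mulrA mulfV ?gt_eqF// mul1r => h'.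
lra.
Qed.

(* The derivative of |x|^(r + 1) / (r + 1). *)
Definition spow r x := Num.max x 0 `^ r - Num.max (- x) 0 `^ r.

Lemma spowE r x : 0 < r -> 0 <= x -> spow r x = x `^ r.
Proof.
move=> r0 x0; rewrite /spow max_l// max_r ?oppr_le0//.
by rewrite powR0 ?subr0// gt_eqF.
Qed.

Lemma spowN r x : spow r (- x) = - spow r x.
Proof. by rewrite /spow opprK opprB. Qed.

Lemma norm_spow r x : 0 < r -> `|spow r x| = `|x| `^ r.
Proof.
move=> r0; wlog x0 : x / 0 <= x.
  move=> h; have [x0|/ltW x0] := leP 0 x; first exact: h.
  by have := h (- x); rewrite oppr_ge0 spowN !normrN; apply.
by rewrite spowE// !ger0_norm// powR_ge0.
Qed.

Lemma measurable_spow d (T : measurableType d) r (X : T -> R) :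
  measurable_fun setT X -> measurable_fun setT (fun w => spow r (X w)).
Proof.
move=> mX; apply: measurable_funB; apply: (measurableT_comp (measurable_powR _)).
  exact: measurable_maxr.
by apply: measurable_maxr => //; exact: measurableT_comp.
Qed.

(** The tangent of the convex function |.|^q, whose derivative is q [spow] (q - 1). For x on the
    other side of 0 from z its value is already nonpositive. *)
Lemma norm_powR_tangent q x z : 1 < q ->
  `|z| `^ q + q * spow (q - 1) z * (x - z) <= `|x| `^ q.
Proof.
move=> q1; wlog z0 : x z / 0 <= z.
  move=> h; have [z0|/ltW z0] := leP 0 z; first exact: h.
  have := h (- x) (- z); rewrite oppr_ge0 => /(_ z0).
  by rewrite !normrN spowN opprK mulrN mulNr -mulrN opprD opprK.
rewrite spowE// ?(ger0_norm z0); last lra.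
have [x0|/ltW x0] := leP 0 x.
  by rewrite ger0_norm// powR_tangent.
apply: le_trans (powR_ge0 _ _).
have := powR_tangent z0 (lexx 0) q1; rewrite powR0 ?gt_eqF//; last lra.
rewrite sub0r => h; apply: le_trans h; rewrite lerD2l ler_wpM2l//; last lra.
by rewrite mulr_ge0 ?powR_ge0//; lra.
Qed.

(** By symmetry and oddness, |v| <= u. Equal signs are settled by the tangent at u, and opposite
    signs by u^r + |v|^r <= (u + |v|) u^(r - 1). *)
Lemma spow_lip r s u v : 1 < r -> s = r - 1 ->
  `|spow r u - spow r v| <= r * `|u - v| * (`|u| + `|v|) `^ s.
Proof.
move=> r1 ->; wlog uv : u v / `|v| <= `|u|.
  move=> h; have [/h//|/ltW uv] := leP `|v| `|u|.
  by rewrite distrC [`|u - v|]distrC [`|u| + _]addrC h.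
wlog u0 : u v uv / 0 <= u.
  move=> h; have [u0|/ltW u0] := leP 0 u; first exact: h.
  have := h (- u) (- v); rewrite !normrN oppr_ge0 => /(_ uv u0).
  have e a b : `|- a - - b| = `|a - b| :> R by rewrite opprK addrC distrC.
  by rewrite !spowN !e.
have r10 : 0 <= r - 1 by lra.
apply: (@le_trans _ _ (r * `|u - v| * u `^ (r - 1))); last first.
  rewrite ler_wpM2l ?mulr_ge0//; first lra.
  by apply: ler_powR2 => //; rewrite ger0_norm// lerDl.
rewrite (ger0_norm u0) in uv.
rewrite spowE//; last lra.
have [v0|/ltW v0] := leP 0 v.
  rewrite (ger0_norm v0) in uv.
  rewrite spowE//; last lra.
  rewrite !ger0_norm ?subr_ge0//; last by apply: ler_powR2 => //; lra.
  by have := powR_tangent u0 v0 r1; lra.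
rewrite -[v]opprK spowN spowE ?oppr_ge0//; last lra.
rewrite !opprK !ger0_norm ?addr_ge0 ?powR_ge0//; last by rewrite oppr_ge0.
rewrite (ler0_norm v0) in uv.
have h1 := mulr_powRB1 u0 (lt_trans ltr01 r1).
have nv0 : 0 <= - v by lra.
have h2 := mulr_powRB1 nv0 (lt_trans ltr01 r1).
rewrite -h1 -h2 -mulrA.
apply: (@le_trans _ _ ((u - v) * u `^ (r - 1))); last first.
  by rewrite ler_peMl ?mulr_ge0 ?powR_ge0//; lra.
rewrite mulrDl lerD2l ler_wpM2l//.
exact: ler_powR2.
Qed.

Lemma powRD_le r x y : 0 <= r -> 0 <= x -> 0 <= y ->
  (x + y) `^ r <= 2 `^ r * (x `^ r + y `^ r).
Proof.
move=> r0; wlog xy : x y / x <= y.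
  move=> h x0 y0; have [/h|/ltW/h] := leP x y; first exact.
  by rewrite [x + y]addrC [_ `^ r + _]addrC; apply.
move=> x0 y0; apply: (@le_trans _ _ ((2 * y) `^ r)).
  by apply: ler_powR2 => //; lra.
by rewrite powRM// ler_wpM2l ?powR_ge0// lerDr powR_ge0.
Qed.

(** The constant of [norm_powRD_le]: q (q - 1) comes from the derivative and from the Lipschitz
    bound of [spow (q - 1)], one factor 2^(q - 2) from |x + y| + |x| <= 2 (|x| + |y|), the other
    from [powRD_le]. *)
Definition mart_cst q := q * (q - 1) * (2 `^ (q - 2) * 2 `^ (q - 2)).

(** The tangent at x + y bounds the left side with the derivative taken at x + y, and [spow_lip]
    moves the derivative back to x. The linear term is kept apart because its expectation vanishes
    for orthogonal increments. *)
Lemma norm_powRD_le q x y : 2 < q ->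
  `|x + y| `^ q <= `|x| `^ q + q * (spow (q - 1) x * y)
    + mart_cst q * (`|x| `^ (q - 2) * `|y| `^ 2 + `|y| `^ q).
Proof.
move=> q2.
have q1 : 1 < q by lra.
have := @norm_powR_tangent q x (x + y) q1.
rewrite opprD addrA subrr add0r => h.
have {h} : `|x + y| `^ q <= `|x| `^ q + q * (spow (q - 1) x * y)
    + q * ((spow (q - 1) (x + y) - spow (q - 1) x) * y) by lra.
move=> /le_trans; apply; rewrite lerD2l.
have q11 : 1 < q - 1 by lra.
have qq : q - 2 = (q - 1) - 1 by lra.
have := @spow_lip (q - 1) (q - 2) (x + y) x q11 qq.
rewrite [x + y]addrC addrK [y + x]addrC.
set D := spow _ _ - _ => hD.
have [X0 Y0] := (normr_ge0 x, normr_ge0 y).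
have q20 : 0 <= q - 2 by lra.
have h1 : (`|x + y| + `|x|) `^ (q - 2) <=
    2 `^ (q - 2) * 2 `^ (q - 2) * (`|x| `^ (q - 2) + `|y| `^ (q - 2)).
  apply: (@le_trans _ _ ((2 * (`|x| + `|y|)) `^ (q - 2))).
    apply: ler_powR2 => //.
    by have := ler_normD x y; lra.
  by rewrite powRM ?addr_ge0// -!mulrA ler_wpM2l ?powR_ge0// powRD_le.
apply: (@le_trans _ _ (q * (`|D| * `|y|))).
  by apply: ler_wpM2l; [lra|rewrite -normrM ler_norm].
have -> : `|y| `^ q = `|y| `^ (q - 2) * `|y| `^ 2.
  by rewrite -powRD; [congr powR; lra|apply/implyP => /eqP; lra].
rewrite -mulrDl /mart_cst -!mulrA ler_pM2l; last lra.
rewrite powR_mulrn// expr2.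
apply: (@le_trans _ _ ((q - 1) * `|y| * (2 `^ (q - 2) * 2 `^ (q - 2) *
    (`|x| `^ (q - 2) + `|y| `^ (q - 2))) * `|y|)); last lra.
rewrite ler_wpM2r// (le_trans hD)// ler_wpM2l// mulr_ge0//; lra.
Qed.

(** Write the right side as (x + k y) (x + k y)^(s - 1): the second factor dominates both x^(s - 1)
    and y^(s - 1). With x = a^2, y = b^2 and s = q / 2 this turns q-th moments into a recursion for
    squared norms. *)
Lemma powR_superadd s x y (k C : R) : 1 < s -> 1 <= k -> 2 * C <= k -> 0 < C ->
  0 < x -> 0 < y ->
  x `^ s + C * (x `^ (s - 1) * y + y `^ s) <= (x + k * y) `^ s.
Proof.
move=> s1 k1 Ck C0 x0 y0; have s0 : 0 < s by lra.
have ky0 : 0 < k * y by rewrite mulr_gt0//; lra.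
have xky0 : 0 < x + k * y by exact: addr_gt0.
rewrite -(mulr_powRB1 (ltW xky0) s0) -(mulr_powRB1 (ltW x0) s0).
rewrite -(mulr_powRB1 (ltW y0) s0) mulrDl.
have s10 : 0 <= s - 1 by lra.
set S := (x + k * y) `^ _.
have S1 : x `^ (s - 1) <= S.
  by apply: ler_powR2 => //; [exact: ltW|rewrite lerDl ltW].
have S2 : y `^ (s - 1) <= S.
  apply: ler_powR2 => //; first exact: ltW.
  by rewrite (@le_trans _ _ (k * y))// ?lerDr ?(ltW x0)// ler_peMl// ltW.
have h1 : x * x `^ (s - 1) <= x * S by rewrite ler_pM2l.
apply: lerD => //; rewrite [x `^ _ * y]mulrC -mulrDr.
have h3 : C * (y * (x `^ (s - 1) + y `^ (s - 1))) <= C * (y * (2 * S)).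
  by rewrite ler_pM2l// ler_pM2l//; lra.
apply: (le_trans h3).
have -> : C * (y * (2 * S)) = 2 * C * (S * y) by lra.
rewrite -[leRHS]mulrA [leRHS](_ : _ = k * (S * y)); last by congr (_ * _); rewrite mulrC.
apply: ler_wpM2r => //.
by rewrite mulr_ge0 ?powR_ge0// ltW.
Qed.

End PowerInequalities.

Section MeasurableSublevel.
Context d (T : measurableType d) (R : realType).
Implicit Types (X : T -> R) (r : R).

Lemma measurable_le_set X r : measurable_fun setT X -> measurable [set w | X w <= r].
Proof.
move=> mX; have := mX measurableT `]-oo, r]%classic (measurable_itv _).
by rewrite setTI; congr measurable; apply/seteqP; split => w /=; rewrite in_itv.
Qed.

Lemma measurable_ge_set X r : measurable_fun setT X -> measurable [set w | r <= X w].
Proof.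
move=> mX; have := mX measurableT `[r, +oo[%classic (measurable_itv _).
by rewrite setTI; congr measurable; apply/seteqP; split => w /=; rewrite in_itv/= andbT.
Qed.

End MeasurableSublevel.

(** * Bounds on L^q norms *)

Section Moments.
Context d (T : measurableType d) (R : realType) (P : probability T R).
Implicit Types (X Y : T -> R) (q c : R).

(** A bound in place of the norm itself: the real number [c] carries the finiteness of the moment,
    and such bounds combine without extended reals. *)
Definition mom q X c : Prop :=
  measurable_fun setT X /\ ('N[P]_q%:E[EFin \o X] <= c%:E)%E.

Lemma mom_meas q X c : mom q X c -> measurable_fun setT X.
Proof. by case. Qed.

Lemma mom_ge0 q X c : mom q X c -> 0 <= c.
Proof. by move=> [_ h]; rewrite -lee_fin (le_trans _ h)// Lnorm_ge0. Qed.

Lemma mom_le q X c c' : c <= c' -> mom q X c -> mom q X c'.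
Proof. by move=> cc [mX h]; split => //; rewrite (le_trans h)// lee_fin. Qed.

Lemma mom_int q X c : 0 < q -> measurable_fun setT X -> 0 <= c ->
  mom q X c <-> (\int[P]_w (`|X w| `^ q)%:E <= (c `^ q)%:E)%E.
Proof.
move=> q0 mX c0.
have e : (\int[P]_w (`|X w| `^ q)%:E = 'N[P]_q%:E[EFin \o X] `^ q)%E.
  by rewrite powR_Lnorm ?gt_eqF//; apply: eq_integral => w _ /=.
split => [[_ h]|h].
  rewrite e -poweR_EFin; apply: gt0_ler_poweR => //; first exact: ltW.
    by rewrite in_itv/= leey andbT Lnorm_ge0.
  by rewrite in_itv/= leey andbT lee_fin.
split => //; rewrite e -poweR_EFin in h.
have := gt0_ler_poweR (ltW (_ : 0 < q^-1)).
move=> /(_ (eqbRL (invr_gt0 q) q0) _ _ _ _ h).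
rewrite -!poweRrM mulfV ?gt_eqF// !poweRe1 ?Lnorm_ge0 ?lee_fin//.
by apply; rewrite in_itv/= leey andbT ?poweR_ge0 ?lee_fin ?powR_ge0.
Qed.

Lemma measurable_norm_powR q X : measurable_fun setT X ->
  measurable_fun setT (fun w => `|X w| `^ q).
Proof.
by move=> mX; apply: (measurableT_comp (measurable_powR _));
  exact: measurableT_comp.
Qed.

Lemma mom_itg_pow q X c : 0 < q -> mom q X c ->
  itg P (fun w => `|X w| `^ q) /\ Ex P (fun w => `|X w| `^ q) <= c `^ q.
Proof.
move=> q0 mX; have c0 := mom_ge0 mX; have mmX := mom_meas mX.
have h := (mom_int q0 mmX c0).1 mX.
have iX : itg P (fun w => `|X w| `^ q).
  by apply: ge0_ltpinfty_itg h => [|w]; [exact: measurable_norm_powR|exact: powR_ge0].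
by split => //; rewrite -lee_fin -ExE.
Qed.

Lemma mom_Ex q X c : 0 < q -> measurable_fun setT X -> 0 <= c ->
  itg P (fun w => `|X w| `^ q) -> Ex P (fun w => `|X w| `^ q) <= c `^ q ->
  mom q X c.
Proof. by move=> q0 mX c0 iX h; apply/mom_int => //; rewrite ExE// lee_fin. Qed.

(** Lets later proofs assume positive bounds, by which they divide. *)
Lemma mom_eps q X c : (forall e, 0 < e -> mom q X (c + e)) -> mom q X c.
Proof.
move=> h; split; first exact: mom_meas (h 1 ltr01).
by apply/lee_addgt0Pr => e e0; have [_] := h e e0; rewrite EFinD.
Qed.

Lemma momD q X Y a b : 1 <= q -> mom q X a -> mom q Y b ->
  mom q (fun w => X w + Y w) (a + b).
Proof.
move=> q1 [mX hX] [mY hY]; split; first exact: measurable_funD.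
by rewrite EFinD (le_trans (minkowski P mX mY q1))// leeD.
Qed.

Lemma mom_dom q X Y c : 0 < q -> measurable_fun setT Y ->
  (forall w, `|Y w| <= `|X w|) -> mom q X c -> mom q Y c.
Proof.
move=> q0 mY YX mX; have c0 := mom_ge0 mX.
have [iX hX] := mom_itg_pow q0 mX.
have YX' w : `|Y w| `^ q <= `|X w| `^ q by apply: ler_powR2 => //; exact: ltW.
have iY : itg P (fun w => `|Y w| `^ q).
  apply: (itg_le _ iX); first exact: measurable_norm_powR.
  by move=> w; rewrite ger0_norm ?powR_ge0.
apply: mom_Ex => //; apply: le_trans hX; exact: le_Ex.
Qed.

Lemma momZ q X c (a : R) : 0 < q -> mom q X c -> mom q (fun w => a * X w) (`|a| * c).
Proof.
move=> q0 mX; have c0 := mom_ge0 mX; have mmX := mom_meas mX.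
have [iX hX] := mom_itg_pow q0 mX.
have e w : `|a * X w| `^ q = `|a| `^ q * `|X w| `^ q by rewrite normrM powRM.
apply: mom_Ex; rewrite ?mulr_ge0//.
- by apply: measurable_funM.
- by under [X in itg P X]eq_fun do rewrite e; exact: itgZ.
- by under eq_fun do rewrite e; rewrite ExZ// powRM// ler_wpM2l ?powR_ge0.
Qed.

Lemma momN q X c : 0 < q -> mom q X c -> mom q (fun w => - X w) c.
Proof.
move=> q0 mX; apply: (@mom_dom _ X) => //.
  by apply: measurableT_comp => //; exact: mom_meas mX.
by move=> w; rewrite normrN.
Qed.

Lemma momB q X Y a b : 1 <= q -> mom q X a -> mom q Y b ->
  mom q (fun w => X w - Y w) (a + b).
Proof. by move=> q1 mX mY; apply: momD => //; apply: momN => //; lra. Qed.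

Lemma mom_cst q (k : R) : 0 < q -> mom q (fun=> k) `|k|.
Proof. by move=> q0; apply: mom_Ex => //; [exact: itg_cst|rewrite Ex_cst]. Qed.

Lemma mom_bnd q X (k : R) : 0 < q -> measurable_fun setT X ->
  (forall w, `|X w| <= k) -> 0 <= k -> mom q X k.
Proof.
move=> q0 mX Xk k0; have := @mom_cst q k q0; rewrite (ger0_norm k0).
by apply: mom_dom => // w; rewrite (ger0_norm k0).
Qed.

Lemma mom_sum q I (r : seq I) (p : pred I) (X : I -> T -> R) (c : I -> R) :
  1 <= q -> (forall i, p i -> mom q (X i) (c i)) ->
  mom q (fun w => \sum_(i <- r | p i) X i w) (\sum_(i <- r | p i) c i).
Proof.
move=> q1 mX; elim: r => [|i r IH].
  have -> : (fun w => \sum_(i <- [::] | p i) X i w) = fun=> 0.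
    by apply/funext => w; rewrite big_nil.
  by rewrite big_nil; have := @mom_cst q 0; rewrite normr0; apply; lra.
rewrite big_cons; case pi : (p i); last first.
  have -> // : (fun w => \sum_(j <- i :: r | p j) X j w) =
      fun w => \sum_(j <- r | p j) X j w.
    by apply/funext => w; rewrite big_cons pi.
have -> : (fun w => \sum_(j <- i :: r | p j) X j w) =
    fun w => X i w + \sum_(j <- r | p j) X j w.
  by apply/funext => w; rewrite big_cons pi.
by apply: momD => //; exact: mX.
Qed.

(** The Cauchy-Schwarz inequality, by integrating 2 |XY|^q <= (b / a)^q |X|^(2q) + (a / b)^q
    |Y|^(2q); hence the reduction to positive a and b. *)
Lemma momM q X Y a b : 1 <= q -> mom (2 * q) X a -> mom (2 * q) Y b ->
  mom q (fun w => X w * Y w) (a * b).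
Proof.
move=> q1; have q0 : 0 < 2 * q by lra.
have {}q0' : 0 < q by lra.
wlog : a b / 0 < a /\ 0 < b.
  move=> h mX mY; have [a0 b0] := (mom_ge0 mX, mom_ge0 mY).
  apply: mom_eps => e e0.
  (* (a + t) (b + t) = a b + t (a + b + t), and t <= 1 bounds the excess by t (a + b + 1) <= e. *)
  pose t := Num.min 1 (e / (a + b + 1)).
  have t0 : 0 < t by rewrite /t lt_min ltr01 divr_gt0//; lra.
  have t1 : t <= 1 by rewrite /t ge_min lexx.
  have t2 : t * (a + b + 1) <= e by rewrite -ler_pdivlMr ?ge_min ?lexx ?orbT//; lra.
  have lea : a <= a + t by lra.
  have leb : b <= b + t by lra.
  have /h : 0 < a + t /\ 0 < b + t by split; lra.
  move=> /(_ (mom_le lea mX) (mom_le leb mY)); apply: mom_le.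
  nra.
move=> [a0 b0] mX mY; have [mmX mmY] := (mom_meas mX, mom_meas mY).
have [iX hX] := mom_itg_pow q0 mX; have [iY hY] := mom_itg_pow q0 mY.
have mXY : measurable_fun setT (fun w => X w * Y w) by exact: measurable_funM.
have e x y : 0 <= x -> 0 <= y ->
    (x * y) `^ q <= 2^-1 * (b / a) `^ q * x `^ (2 * q) + 2^-1 * (a / b) `^ q * y `^ (2 * q).
  move=> x0 y0; have [an0 bn0] := (lt0r_neq0 a0, lt0r_neq0 b0).
  have e1 z w : 0 < z -> 0 <= w -> z `^ q * w `^ (2 * q) = (z `^ (q / 2) * w `^ q) ^+ 2.
    move=> z0 w0; rewrite exprMn -!powR_mulrn ?powR_ge0// -!powRrM [2 * q]mulrC.
    by rewrite divfK ?pnatr_eq0.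
  rewrite -!mulrA !e1 ?divr_gt0//.
  have -> : (x * y) `^ q = ((b / a) `^ (q / 2) * x `^ q) * ((a / b) `^ (q / 2) * y `^ q).
    rewrite mulrACA -powRM ?divr_ge0 ?ltW// -powRM//.
    have -> : b / a * (a / b) = 1 by field; rewrite an0 bn0.
    by rewrite powR1 mul1r.
  set u := _ * _ `^ _; set v := _ * _ `^ q.
  by clear; have := sqr_ge0 (u - v); nra.
have i1 : itg P (fun w => 2^-1 * (b / a) `^ q * `|X w| `^ (2 * q)) by exact: itgZ.
have i2 : itg P (fun w => 2^-1 * (a / b) `^ q * `|Y w| `^ (2 * q)) by exact: itgZ.
have iXY : itg P (fun w => `|X w * Y w| `^ q).
  apply: (itg_le _ (itgD i1 i2)); first exact: measurable_norm_powR.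
  by move=> w; rewrite ger0_norm ?powR_ge0// normrM e.
apply: (mom_Ex q0' mXY (mulr_ge0 (ltW a0) (ltW b0)) iXY).
apply: le_trans (le_Ex iXY (itgD i1 i2) _) _.
  by move=> w; rewrite normrM e.
rewrite ExD// !ExZ//.
have e2 z t : 0 < z -> 0 < t -> (t / z) `^ q * z `^ (2 * q) = (z * t) `^ q.
  move=> z0 t0; rewrite powRrM -powRM ?divr_ge0 ?powR_ge0 ?ltW// powR_mulrn ?ltW//.
  by congr powR; field; rewrite gt_eqF.
have h1 : (b / a) `^ q * Ex P (fun w => `|X w| `^ (2 * q)) <= (a * b) `^ q.
  by rewrite -(e2 _ _ a0 b0) ler_wpM2l ?powR_ge0.
have h2 : (a / b) `^ q * Ex P (fun w => `|Y w| `^ (2 * q)) <= (a * b) `^ q.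
  by rewrite [a * b]mulrC -(e2 _ _ b0 a0) ler_wpM2l ?powR_ge0.
by move: h1 h2; rewrite -!mulrA; set x1 := _ `^ q * Ex P _; set y1 := _ `^ q * Ex P _; move: x1 y1 => x1 y1; clear; lra.
Qed.

(** Lyapunov's inequality: the tangent bound [powR_concave] at (|X| / c)^q is integrated. *)
Lemma mom_expo q r X c : 0 < r -> r <= q -> mom q X c -> mom r X c.
Proof.
move=> r0 rq; have q0 : 0 < q by lra.
wlog c0 : c / 0 < c.
  move=> h mX; have c0 := mom_ge0 mX; apply: mom_eps => e e0.
  by apply: h; [lra|apply: mom_le mX; lra].
move=> mX; have mmX := mom_meas mX; have [iX hX] := mom_itg_pow q0 mX.
have rq01 : 0 < r / q <= 1 by rewrite divr_gt0//= ler_pdivrMr// mul1r.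
have cr : 0 < c `^ r by exact: powR_gt0.
have cq : 0 < c `^ q by exact: powR_gt0.
have e w : `|X w| `^ r <= c `^ r * (1 - r / q) + c `^ r * (r / q) / c `^ q * `|X w| `^ q.
  have := @powR_concave _ (r / q) ((`|X w| / c) `^ q) (powR_ge0 _ _) rq01.
  rewrite -powRrM (_ : q * (r / q) = r); last by field; rewrite gt_eqF.
  rewrite !powR_div// ler_pdivrMr// => h; apply: (le_trans h).
  by rewrite le_eqVlt; apply/orP; left; apply/eqP; field; rewrite !gt_eqF.
have i1 := itgD (itg_cst P (c `^ r * (1 - r / q))) (itgZ (c `^ r * (r / q) / c `^ q) iX).
have iXr : itg P (fun w => `|X w| `^ r).
  apply: (itg_le _ i1); first exact: measurable_norm_powR.
  by move=> w; rewrite ger0_norm ?powR_ge0.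
apply: mom_Ex => //; first exact: ltW.
apply: le_trans (le_Ex iXr i1 e) _.
rewrite ExD; [|exact: itg_cst|exact: itgZ].
rewrite Ex_cst ExZ//.
have : c `^ r * (r / q) / c `^ q * Ex P (fun w => `|X w| `^ q) <= c `^ r * (r / q).
  rewrite -[leRHS](divfK (lt0r_neq0 cq)) ler_wpM2l//.
  by rewrite !mulr_ge0 ?invr_ge0 ?powR_ge0// ltW//; case/andP: rq01.
lra.
Qed.

Lemma mom_itg q X c : 1 <= q -> mom q X c -> itg P X /\ Ex P (fun w => `|X w|) <= c.
Proof.
move=> q1 mX; have mmX := mom_meas mX; have c0 := mom_ge0 mX.
have [] := mom_itg_pow ltr01 (mom_expo ltr01 q1 mX).
rewrite powRr1// (_ : (fun w => `|X w| `^ 1) = fun w => `|X w|); last first.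
  by apply/funext => w; rewrite powRr1.
by move=> iX hX; split => //; apply: (itg_le mmX iX).
Qed.

Lemma mom_markov q X c (r : R) : 0 < q -> 0 < r -> mom q X c ->
  fine (P [set w | r <= `|X w|]) <= (c / r) `^ q.
Proof.
move=> q0 r0 mX; have mmX := mom_meas mX; have c0 := mom_ge0 mX.
have [iX hX] := mom_itg_pow q0 mX.
have mA : measurable [set w | r <= `|X w|].
  by apply: measurable_ge_set; exact: measurableT_comp.
rewrite -Ex_indic// powR_div//.
rewrite ler_pdivlMr ?powR_gt0// mulrC -ExZ; last exact: itg_indic.
apply: le_trans hX; apply: le_Ex => //; first exact/itgZ/itg_indic.
move=> w; rewrite indicE; case: (boolP (w \in _)) => [|_]; last by rewrite mulr0 powR_ge0.
by rewrite inE /= => h; rewrite mulr1; apply: ler_powR2 => //; exact: ltW.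
Qed.

(** One step of Rio's inequality, ||X + Y||^2 <= ||X||^2 + k ||Y||^2: the linear term of
    [norm_powRD_le] has mean 0, and Young's inequality separates the mixed term. The sup bounds make
    the linear term integrable. *)
Lemma mom_mart_step q X Y (a b k kx ky : R) : 2 < q -> 1 <= k -> 2 * mart_cst q <= k ->
  0 < a -> 0 < b ->
  (forall w, `|X w| <= kx) -> (forall w, `|Y w| <= ky) ->
  Ex P (fun w => spow (q - 1) (X w) * Y w) = 0 ->
  mom q X a -> mom q Y b ->
  mom q (fun w => X w + Y w) (Num.sqrt (a ^+ 2 + k * b ^+ 2)).
Proof.
move=> q2 k1 Ck a0 b0.
have q0 : 0 < q by lra.
have q10 : 0 < q - 1 by lra.
have q20 : 0 < q - 2 by lra.
have qn0 : q != 0 by rewrite gt_eqF.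
have q2n0 : q - 2 != 0 by rewrite gt_eqF.
have hq1 : (q - 2) * (q / (q - 2)) = q by field.
have hq2 : 2 * (q / 2) = q by field.
have d1 : 0 < q / (q - 2) by exact: divr_gt0.
have d2 : 0 < q / 2 by exact: divr_gt0.
have d3 : (q / (q - 2))^-1 + (q / 2)^-1 = 1 by field; rewrite qn0 q2n0.
have d4 : 1 < q / 2 by lra.
have C0 : 0 < mart_cst q by rewrite /mart_cst !mulr_gt0 ?powR_gt0.
have e1 (z : R) : z * ((q - 2) / q) + z * (2 / q) = z by field.
have f1 : 0 <= (q - 2) / q by rewrite divr_ge0// ltW.
have f2 : 0 <= 2 / q by rewrite divr_ge0// ltW.
have D0 : 0 < a ^+ 2 + k * b ^+ 2.
  by apply: addr_gt0; rewrite ?mulr_gt0 ?exprn_gt0// (lt_le_trans ltr01).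
have s0 (x : R) : 0 < x -> x `^ q = (x ^+ 2) `^ (q / 2).
  by move=> x0; rewrite -powR_mulrn ?(ltW x0)// -powRrM mulrC divfK.
have s1 : a `^ (q - 2) = (a ^+ 2) `^ (q / 2 - 1).
  by rewrite -powR_mulrn ?(ltW a0)// -powRrM; congr powR; lra.
have sq0 : 0 < q / 2 - 1 by lra.
move=> Xk Yk XY0 mX mY.
have [mmX mmY] := (mom_meas mX, mom_meas mY).
have [iX hX] := mom_itg_pow q0 mX; have [iY hY] := mom_itg_pow q0 mY.
have aq : 0 < a `^ q by exact: powR_gt0.
have bq : 0 < b `^ q by exact: powR_gt0.
(* Young's inequality with exponents q / (q - 2) and q / 2. *)
have yg w : `|X w| `^ (q - 2) * `|Y w| `^ 2 <=
    a `^ (q - 2) * b `^ 2 * ((q - 2) / q) / a `^ q * `|X w| `^ q +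
    a `^ (q - 2) * b `^ 2 * (2 / q) / b `^ q * `|Y w| `^ q.
  have := @conjugate_powR R ((`|X w| / a) `^ (q - 2)) ((`|Y w| / b) `^ 2)
    (q / (q - 2)) (q / 2) (powR_ge0 _ _) (powR_ge0 _ _).
  rewrite -!powRrM hq1 hq2 => /(_ d1 d2 d3).
  rewrite !powR_div// mulrACA -invfM ler_pdivrMr ?mulr_gt0 ?powR_gt0// => h.
  apply: (le_trans h); rewrite !invf_div.
  by rewrite le_eqVlt; apply/orP; left; apply/eqP; field; rewrite !gt_eqF.
have ms : measurable_fun setT (fun w => spow (q - 1) (X w) * Y w).
  by apply: measurable_funM => //; exact: measurable_spow.
have is_ : itg P (fun w => spow (q - 1) (X w) * Y w).
  apply: (@itg_bnd _ _ _ _ _ (kx `^ (q - 1) * ky)) => // w.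
  rewrite normrM norm_spow//.
  by apply: ler_pM => //; rewrite ?powR_ge0//; apply: ler_powR2 => //; exact: ltW.
set A1 := a `^ (q - 2) * b `^ 2 * ((q - 2) / q) / a `^ q in yg.
set B1 := a `^ (q - 2) * b `^ 2 * (2 / q) / b `^ q in yg.
have iZ : itg P (fun w => `|X w| `^ q + q * (spow (q - 1) (X w) * Y w)
    + mart_cst q * (A1 * `|X w| `^ q + B1 * `|Y w| `^ q + `|Y w| `^ q)).
  by apply: itgD; [apply: itgD => //; exact: itgZ|apply: itgZ; apply: itgD => //;
    apply: itgD; exact: itgZ].
have hw w : `|X w + Y w| `^ q <= `|X w| `^ q + q * (spow (q - 1) (X w) * Y w)
    + mart_cst q * (A1 * `|X w| `^ q + B1 * `|Y w| `^ q + `|Y w| `^ q).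
  apply: (le_trans (norm_powRD_le _ _ q2)); rewrite lerD2l ler_wpM2l ?(ltW C0)//.
  by rewrite lerD2r.
have mXY : measurable_fun setT (fun w => X w + Y w) by exact: measurable_funD.
have iXY : itg P (fun w => `|X w + Y w| `^ q).
  apply: (itg_le _ iZ); first exact: measurable_norm_powR.
  by move=> w; rewrite ger0_norm ?powR_ge0.
apply: mom_Ex => //; apply: (le_trans (le_Ex iXY iZ hw)).
have iQ := itgZ q is_; have iA := itgZ A1 iX; have iB := itgZ B1 iY.
have iAB := itgD iA iB; have iABY := itgD iAB iY.
rewrite (ExD (itgD iX iQ) (itgZ (mart_cst q) iABY)) (ExD iX iQ) (ExZ _ is_).
rewrite (ExZ _ iABY) (ExD iAB iY) (ExD iA iB) (ExZ _ iX) (ExZ _ iY).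
rewrite XY0 mulr0 addr0.
have hA : A1 * Ex P (fun w => `|X w| `^ q) <= a `^ (q - 2) * b `^ 2 * ((q - 2) / q).
  rewrite /A1 -[leRHS](divfK (lt0r_neq0 aq)) ler_wpM2l//.
  apply: mulr_ge0; last by rewrite invr_ge0 powR_ge0.
  by apply: mulr_ge0 f1; rewrite mulr_ge0 ?powR_ge0.
have hB : B1 * Ex P (fun w => `|Y w| `^ q) <= a `^ (q - 2) * b `^ 2 * (2 / q).
  rewrite /B1 -[leRHS](divfK (lt0r_neq0 bq)) ler_wpM2l//.
  apply: mulr_ge0; last by rewrite invr_ge0 powR_ge0.
  by apply: mulr_ge0 f2; rewrite mulr_ge0 ?powR_ge0.
apply: (@le_trans _ _ (a `^ q + mart_cst q * (a `^ (q - 2) * b `^ 2 + b `^ q))).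
  by apply: lerD => //; rewrite ler_pM2l// -[a `^ (q - 2) * _](e1) lerD// lerD.
have -> : Num.sqrt (a ^+ 2 + k * b ^+ 2) `^ q = (a ^+ 2 + k * b ^+ 2) `^ (q / 2).
  by rewrite s0 ?sqrtr_gt0// sqr_sqrtr// ltW.
rewrite (s0 a a0) (s0 b b0) s1 (powR_mulrn 2 (ltW b0)).
by apply: powR_superadd => //; rewrite exprn_gt0.
Qed.

End Moments.

(** * Sequence space and conditional expectations *)

Section ProductProbability.
Context d1 d2 (T1 : measurableType d1) (T2 : measurableType d2) (R : realType).
Variables (P : probability T1 R) (Q : probability T2 R).
Implicit Types H : T1 * T2 -> R.

(** The product measure under a name of its own, to which the structure of a probability is
    attached. *)
Definition pprod : set (T1 * T2) -> \bar R := (P \x Q)%E.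
HB.instance Definition _ := Measure.on pprod.
Lemma pprod_setT : pprod setT = 1%E.
Proof.
by rewrite /pprod -setXTT product_measure1E//= !probability_setT mule1.
Qed.
HB.instance Definition _ := Measure_isProbability.Build _ _ _ pprod pprod_setT.

Lemma measurable_sec1 H u : measurable_fun setT H -> measurable_fun setT (fun v => H (u, v)).
Proof. by move=> mH; exact: (measurableT_comp mH (pair1_measurable u)). Qed.

Lemma measurable_sec2 H v : measurable_fun setT H -> measurable_fun setT (fun u => H (u, v)).
Proof. by move=> mH; exact: (measurableT_comp mH (pair2_measurable v)). Qed.

Lemma measurable_Ex_sec1 H : itg pprod H ->
  measurable_fun setT (fun u => Ex Q (fun v => H (u, v))).
Proof.
move=> iH; apply: (measurableT_comp (@fine_measurable _ _ measurableT)).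
by have := @measurable_fubini_F _ _ _ _ _ P Q (EFin \o H) iH.
Qed.

Lemma measurable_Ex_sec2 H : itg pprod H ->
  measurable_fun setT (fun v => Ex P (fun u => H (u, v))).
Proof.
move=> iH; apply: (measurableT_comp (@fine_measurable _ _ measurableT)).
by have := @measurable_fubini_G _ _ _ _ _ P Q (EFin \o H) iH.
Qed.

Lemma Ex_pprod1 H : itg pprod H -> Ex pprod H = Ex P (fun u => Ex Q (fun v => H (u, v))).
Proof.
move=> iH; rewrite {1}/Ex /Rintegral -(@integral12_prod_meas1 _ _ _ _ _ P Q (EFin \o H) iH).
congr fine; apply: ae_eq_integral => //.
- exact: (measurable_fubini_F iH).
- by apply/measurable_EFinP; exact: measurable_Ex_sec1.
apply: filterS (ae_integrable1 iH) => u iu _.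
by rewrite [RHS]/= /Ex /Rintegral fineK//; exact: integrable_fin_num.
Qed.

Lemma Ex_pprod2 H : itg pprod H -> Ex pprod H = Ex Q (fun v => Ex P (fun u => H (u, v))).
Proof.
move=> iH; rewrite {1}/Ex /Rintegral -(@integral21_prod_meas1 _ _ _ _ _ P Q (EFin \o H) iH).
congr fine; apply: ae_eq_integral => //.
- exact: (measurable_fubini_G iH).
- by apply/measurable_EFinP; exact: measurable_Ex_sec2.
apply: filterS (ae_integrable2 iH) => u iu _.
by rewrite [RHS]/= /Ex /Rintegral fineK//; exact: integrable_fin_num.
Qed.

Lemma Ex_swap H : itg pprod H ->
  Ex P (fun u => Ex Q (fun v => H (u, v))) = Ex Q (fun v => Ex P (fun u => H (u, v))).
Proof. by move=> iH; rewrite -Ex_pprod1// Ex_pprod2. Qed.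

Lemma itg_fst X : itg P X -> itg pprod (fun z => X z.1).
Proof.
move=> iX; have mX := itg_meas iX.
have m1 : measurable_fun setT (fun z : T1 * T2 => X z.1).
  exact: (measurableT_comp mX measurable_fst).
apply/(integrable12ltyP P Q); first exact/measurable_EFinP.
rewrite (@eq_integral _ _ _ P _ (fun u => `|X u|%:E)); last first.
  move=> u _; transitivity (\int[Q]_y (cst `|X u|%:E) y)%E; first by [].
  by rewrite integral_cst//= probability_setT mule1.
by have /integrableP[] := iX.
Qed.

Lemma itg_snd Y : itg Q Y -> itg pprod (fun z => Y z.2).
Proof.
move=> iY; have mY := itg_meas iY.
have m1 : measurable_fun setT (fun z : T1 * T2 => Y z.2).
  exact: (measurableT_comp mY measurable_snd).
apply/(integrable12ltyP P Q); first exact/measurable_EFinP.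
rewrite (_ : (\int[P]_x _)%E = \int[P]_x (cst (\int[Q]_y `|Y y|%:E) x))%E//.
rewrite integral_cst//= probability_setT mule1.
by have /integrableP[] := iY.
Qed.

Lemma Ex_fst X : itg P X -> Ex pprod (fun z => X z.1) = Ex P X.
Proof.
move=> iX; rewrite (Ex_pprod1 (itg_fst iX)); congr Ex.
by apply/funext => u; rewrite -[RHS](Ex_cst Q).
Qed.

Lemma Ex_snd Y : itg Q Y -> Ex pprod (fun z => Y z.2) = Ex Q Y.
Proof. by move=> iY; rewrite (Ex_pprod1 (itg_snd iY)) -[RHS](Ex_cst P). Qed.

Lemma itg_tensor X Y : itg P X -> itg Q Y -> itg pprod (fun z => X z.1 * Y z.2).
Proof.
move=> iX iY; have [mX mY] := (itg_meas iX, itg_meas iY).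
have m1 : measurable_fun setT (fun z : T1 * T2 => X z.1 * Y z.2).
  apply: measurable_funM; first exact: (measurableT_comp mX measurable_fst).
  exact: (measurableT_comp mY measurable_snd).
apply/(integrable12ltyP P Q); first exact/measurable_EFinP.
under eq_integral => u _.
  under eq_integral do rewrite /= normrM EFinM.
  rewrite integralZl//; last exact/itg_norm.
  rewrite (ExE (itg_norm iY)) muleC; over.
rewrite integralZl//; last exact/itg_norm.
by rewrite (ExE (itg_norm iX)) ltry.
Qed.

Lemma Ex_tensor X Y : itg P X -> itg Q Y ->
  Ex pprod (fun z => X z.1 * Y z.2) = Ex P X * Ex Q Y.
Proof.
move=> iX iY; rewrite (Ex_pprod1 (itg_tensor iX iY)) mulrC -ExZ//; congr Ex.
by apply/funext => u /=; rewrite ExZ// mulrC.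
Qed.

End ProductProbability.

(** * Families of reals with the product sigma-algebra, and exchanges of coordinates *)

Section RealSequences.
Context (K : choiceType) (R : realType).

Definition kcyl : set (set (K -> R)) :=
  [set C | exists (k : K) (B : set R), measurable B /\ C = [set u | B (u k)]].

Definition prodR := g_sigma_algebraType kcyl.
HB.instance Definition _ := Measurable.on prodR.

Lemma measurable_coord k : measurable_fun setT (fun u : prodR => u k).
Proof.
move=> _ B mB; rewrite setTI; apply: sub_sigma_algebra.
by exists k, B.
Qed.

Lemma measurable_to_prodR d (T : measurableType d) (f : T -> prodR) :
  (forall k, measurable_fun setT (fun w => f w k)) -> measurable_fun setT f.
Proof.
move=> mf; apply: (@measurability _ _ T prodR setT f kcyl) => //.
move=> _ [_ [k [B [mB ->]]] <-]; exact: mf.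
Qed.

Definition merge (A : pred K) (u v : prodR) : prodR := fun k => if A k then u k else v k.

Lemma measurable_merge d (T : measurableType d) A (f g : T -> prodR) :
  measurable_fun setT f -> measurable_fun setT g ->
  measurable_fun setT (fun w => merge A (f w) (g w)).
Proof.
move=> mf mg; apply: measurable_to_prodR => k; rewrite /merge.
by case: (A k); exact: (measurableT_comp (measurable_coord k)).
Qed.

Definition swap A (z : prodR * prodR) : prodR * prodR :=
  (merge A z.1 z.2, merge A z.2 z.1).

Lemma measurable_swap A : measurable_fun setT (swap A).
Proof.
by apply: measurable_fun_pair; apply: measurable_merge;
  try exact: measurable_fst; exact: measurable_snd.
Qed.

Definition indep_coord (mu : probability prodR R) : Prop :=
  forall (s : seq K) (B : K -> set R), uniq s -> (forall k, measurable (B k)) ->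
  mu [set u : prodR | forall k, k \in s -> B k (u k)] =
  (\prod_(k <- s) mu [set u : prodR | B k (u k)])%E.

(** A pi-system generating the sigma-algebra of pairs. Both sides use the same finite list of
    coordinates, so that an exchange of coordinates maps a rectangle to a rectangle. *)
Definition rcyl : set (set (prodR * prodR)) :=
  [set C | exists s (B1 B2 : K -> set R), [/\ uniq s,
    forall k, measurable (B1 k), forall k, measurable (B2 k) &
    C = [set u : prodR | forall k, k \in s -> B1 k (u k)] `*`
        [set u : prodR | forall k, k \in s -> B2 k (u k)]]].

Lemma measurable_fcyl (s : seq K) (B : K -> set R) : (forall k, measurable (B k)) ->
  measurable [set u : prodR | forall k, k \in s -> B k (u k)].
Proof.
move=> mB; rewrite (_ : mkset _ = \big[setI/setT]_(k <- s) [set u : prodR | B k (u k)]).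
  apply: bigsetI_measurable => k _; apply: sub_sigma_algebra.
  by exists k, (B k).
apply/seteqP; split => u /=; rewrite -bigcap_seq => h k ks; exact: h.
Qed.

Lemma rcyl_gen : @measurable _ (prodR * prodR)%type = <<s rcyl >>.
Proof.
apply/seteqP; split => [C mC|]; last first.
  apply: smallest_sub; first exact: sigma_algebra_measurable.
  move=> _ [s [B1 [B2 [us m1 m2 ->]]]].
  by apply: measurableX; exact: measurable_fcyl.
suff : measurable_fun setT (idfun : g_sigma_algebraType rcyl -> prodR * prodR).
  by move=> /(_ measurableT _ mC); rewrite setTI.
apply/measurable_fun_pairP; split; apply: measurable_to_prodR => k _ B mB;
  rewrite setTI; apply: sub_sigma_algebra.
- exists [:: k], (fun=> B), (fun=> setT); split => //.
  apply/seteqP; split => u /=.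
    by move=> h; split => // j; rewrite inE => /eqP ->.
  by move=> [+ _]; apply; rewrite inE.
- exists [:: k], (fun=> setT), (fun=> B); split => //.
  apply/seteqP; split => u /=.
    by move=> h; split => // j; rewrite inE => /eqP ->.
  by move=> [_]; apply; rewrite inE.
Qed.

Lemma rcyl_setI : setI_closed rcyl.
Proof.
move=> _ _ [s [B1 [B2 [us m1 m2 ->]]]] [s' [B1' [B2' [us' m1' m2' ->]]]].
pose I (r r' : K -> set R) k := (if k \in s then r k else setT) `&` (if k \in s' then r' k else setT).
exists (undup (s ++ s')), (I B1 B1'), (I B2 B2'); split => //.
- exact: undup_uniq.
- by move=> k; apply: measurableI; case: ifP.
- by move=> k; apply: measurableI; case: ifP.
have E (r r' : K -> set R) (u : prodR) :
    (forall k, k \in undup (s ++ s') -> I r r' k (u k)) <->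
    (forall k, k \in s -> r k (u k)) /\ (forall k, k \in s' -> r' k (u k)).
  split=> [h|[h h'] k].
    by split=> k ks; have := h k; rewrite mem_undup mem_cat ks ?orbT => /(_ isT) [];
      rewrite ks.
  by rewrite mem_undup mem_cat /I => _; split; case: ifP => // ?; [exact: h|exact: h'].
apply/seteqP; split => -[u v] /=.
  by move=> [[h1 h2] [h3 h4]]; split; apply/E.
by move=> [/E[? ?] /E[? ?]].
Qed.

Section Swap.
Variables (mu : probability prodR R) (imu : indep_coord mu).

(** On a rectangle independence factors the measure over the coordinates, and exchanging the
    coordinates in [A] only commutes the two factors at each of them. The facts on resampling and
    conditioning below rest on this invariance. *)
Lemma pprod_swap A (C : set (prodR * prodR)) : measurable C ->
  pprod mu mu C = pprod mu mu (swap A @^-1` C).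
Proof.
move=> mC; pose phi : {mfun _ >-> _} := mfun_Sub (mem_set (measurable_swap A)).
have := @measure_unique _ R _ rcyl (fun=> setT) rcyl_gen rcyl_setI _ _
  (pprod mu mu) (pushforward (pprod mu mu) phi) _ _ C mC.
apply.
- move=> _; exists [::], (fun=> setT), (fun=> setT); split => //.
  by apply/seteqP; split.
- by rewrite bigcup_const//; exists 0%N.
- move=> _ [s [B1 [B2 [us m1 m2 ->]]]].
  pose D1 k := if A k then B1 k else B2 k.
  pose D2 k := if A k then B2 k else B1 k.
  transitivity (pprod mu mu ([set u : prodR | forall k, k \in s -> D1 k (u k)] `*`
      [set u : prodR | forall k, k \in s -> D2 k (u k)])); last first.
    congr (pprod mu mu); rewrite /D1 /D2 /phi /= /swap /merge; apply/seteqP.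
    by split => -[u v] /= [h1 h2]; split => k ks; have := h1 k ks; have := h2 k ks;
      case: (A k).
  have mD1 k : measurable (D1 k) by rewrite /D1; case: ifP.
  have mD2 k : measurable (D2 k) by rewrite /D2; case: ifP.
  have mE (B B' : K -> set R) : (forall k, measurable (B k)) -> (forall k, measurable (B' k)) ->
      pprod mu mu ([set u : prodR | forall k, k \in s -> B k (u k)] `*`
        [set u : prodR | forall k, k \in s -> B' k (u k)]) =
      (\prod_(k <- s) (mu [set u : prodR | B k (u k)] * mu [set u : prodR | B' k (u k)]))%E.
    move=> mB mC'; rewrite /pprod product_measure1E; [|exact: measurable_fcyl..].
    by rewrite big_split /=; congr (_ * _)%E; exact: imu.
  transitivity (\prod_(k <- s) (mu [set u : prodR | B1 k (u k)] * mu [set u : prodR | B2 k (u k)]))%E; first exact: mE.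
  rewrite (mE _ _ mD1 mD2); apply: eq_bigr => k _; rewrite /D1 /D2.
  by case: (A k) => //; rewrite muleC.
- by move=> _; apply: (le_lt_trans _ (ltry 1)); rewrite -(pprod_setT mu mu).
Qed.

Lemma Ex_swapE A (H : prodR * prodR -> R) : measurable_fun setT H ->
  itg (pprod mu mu) (fun z => H (swap A z)) ->
  itg (pprod mu mu) H /\
  Ex (pprod mu mu) H = Ex (pprod mu mu) (fun z => H (swap A z)).
Proof.
move=> mH iH; pose phi : {mfun _ >-> _} := mfun_Sub (mem_set (measurable_swap A)).
have mEH : measurable_fun setT (EFin \o H) by exact/measurable_EFinP.
have e (f : prodR * prodR -> \bar R) :
    (\int[pprod mu mu]_z f z = \int[pushforward (pprod mu mu) phi]_z f z)%E.
  by apply: eq_measure_integral => C mC _; rewrite /pushforward; exact: pprod_swap.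
split.
  apply/integrableP; split => //; rewrite e ge0_integral_pushforward//.
    by have /integrableP[] := iH.
  exact: measurableT_comp.
rewrite /Ex /Rintegral; congr fine.
transitivity (\int[pushforward (pprod mu mu) phi]_z (EFin \o H) z)%E; first exact: e.
exact: (integral_pushforward (measurable_swap A) mEH iH measurableT).
Qed.

End Swap.
End RealSequences.

Section Jensen.
Context d (T : measurableType d) (R : realType) (P : probability T R).

(** Jensen's inequality: the tangent of the q-th power at E |X| is integrated. *)
Lemma Ex_powR_le (q : R) (X : T -> R) : 1 < q -> itg P X ->
  itg P (fun w => `|X w| `^ q) -> `|Ex P X| `^ q <= Ex P (fun w => `|X w| `^ q).
Proof.
move=> q1 iX iXq; have q0 : 0 < q by lraw q1.
set a := Ex P (fun w => `|X w|).
have a0 : 0 <= a by exact: Ex_ge0.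
apply: (@le_trans _ _ (a `^ q)).
  by apply: ler_powR2 => //; [exact: ltW|exact: norm_Ex].
have iZ : itg P (fun w => a `^ q + q * a `^ (q - 1) * (`|X w| - a)).
  apply: itgD; first exact: itg_cst.
  by apply: itgZ; apply: itgB; [exact: itg_norm|exact: itg_cst].
have -> : a `^ q = Ex P (fun w => a `^ q + q * a `^ (q - 1) * (`|X w| - a)).
  rewrite ExD; [|exact: itg_cst|by apply: itgZ; apply: itgB; [exact: itg_norm|exact: itg_cst]].
  rewrite Ex_cst ExZ; last by apply: itgB; [exact: itg_norm|exact: itg_cst].
  by rewrite ExB; [|exact: itg_norm|exact: itg_cst]; rewrite Ex_cst subrr mulr0 addr0.
by apply: le_Ex => // w; exact: powR_tangent.
Qed.

End Jensen.

(** * Conditioning as integration over coordinates *)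

Section ConditionalExpectation.
Context (K : choiceType) (R : realType) (mu : probability (prodR K R) R).
Hypothesis imu : indep_coord mu.
Local Notation E := (prodR K R).
Implicit Types (A : pred K) (F G : E -> R).

(** For bounded functions all the sections below are integrable, so conditional expectations are
    defined at every point; general variables are brought here by the truncation [clip]. *)
Definition bmeas (k : R) F := measurable_fun setT F /\ forall u, `|F u| <= k.

(** Plays the part of measurability with respect to the coordinates in [A]. *)
Definition dep A F := forall u v, (forall k, A k -> u k = v k) -> F u = F v.

(* Average over the coordinates outside A: the conditional expectation given
   the coordinates in A. *)
Definition cE A F : E -> R := fun u => Ex mu (fun v => F (merge A u v)).

Lemma dep_sub A A' F : {subset A <= A'} -> dep A F -> dep A' F.
Proof. by move=> AA' dF u v uv; apply: dF => k Ak; apply: uv; exact: AA'. Qed.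

Lemma bmeas_ge0 k F : bmeas k F -> 0 <= k.
Proof. by move=> [_ h]; exact: le_trans (normr_ge0 _) (h point). Qed.

Lemma bmeas_itg k F : bmeas k F -> itg mu F.
Proof. by move=> [mF Fk]; exact: itg_bnd Fk. Qed.

Lemma bmeas_itg_pow k F q : 0 <= q -> bmeas k F -> itg mu (fun u => `|F u| `^ q).
Proof.
move=> q0 [mF Fk]; apply: (@itg_bnd _ _ _ _ _ (k `^ q)); first exact: measurable_norm_powR.
by move=> u; rewrite ger0_norm ?powR_ge0//; exact: ler_powR2.
Qed.

Lemma bmeasB k k' F G : bmeas k F -> bmeas k' G -> bmeas (k + k') (fun u => F u - G u).
Proof.
move=> [mF Fk] [mG Gk]; split; first exact: measurable_funB.
by move=> u; rewrite (le_trans (ler_normB _ _))// lerD.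
Qed.

Lemma bmeas_sum I (r : seq I) (F : I -> E -> R) (k : I -> R) :
  (forall i, bmeas (k i) (F i)) ->
  bmeas (\sum_(i <- r) k i) (fun u => \sum_(i <- r) F i u).
Proof.
move=> h; split => [|u].
  by apply: measurable_sum => i; have [] := h i.
by apply: le_trans (ler_norm_sum _ _ _) _; apply: ler_sum => i _; have [] := h i.
Qed.

Lemma measurable_mergeF A F : measurable_fun setT F ->
  measurable_fun setT (fun z : E * E => F (merge A z.1 z.2)).
Proof.
move=> mF; apply: (measurableT_comp mF).
by apply: measurable_merge; [exact: measurable_fst|exact: measurable_snd].
Qed.

Lemma itg_mergeF A F k : bmeas k F -> itg (pprod mu mu) (fun z : E * E => F (merge A z.1 z.2)).
Proof. by move=> [mF Fk]; apply: itg_bnd => //; exact: measurable_mergeF. Qed.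

Lemma itg_merge_sec A F k u : bmeas k F -> itg mu (fun v => F (merge A u v)).
Proof.
move=> [mF Fk]; apply: (@itg_bnd _ _ _ _ _ k) => //.
exact: (measurable_sec1 u (measurable_mergeF A mF)).
Qed.

Lemma cE_bmeas A F k : bmeas k F -> bmeas k (cE A F).
Proof.
move=> bF; have k0 := bmeas_ge0 bF; split; first exact: measurable_Ex_sec1 (itg_mergeF A bF).
move=> u; apply: le_trans (norm_Ex (itg_merge_sec A u bF)) _.
rewrite -[leRHS](Ex_cst mu); apply: le_Ex; last by move=> v; case: bF.
  exact/itg_norm/(itg_merge_sec A u bF).
exact: itg_cst.
Qed.

Lemma dep_cE A B F : dep B F -> dep [predI A & B] (cE A F).
Proof.
move=> dF u v uv; rewrite /cE; congr Ex; apply/funext => w; apply: dF => k Bk.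
by rewrite /merge; case: (boolP (A k)) => // Ak; apply: uv; apply/andP; split.
Qed.

Lemma cE_dep A F : dep A F -> cE A F = F.
Proof.
move=> dF; apply/funext => u; rewrite -[RHS](Ex_cst mu); congr Ex.
by apply/funext => v; apply: dF => k Ak; rewrite /merge Ak.
Qed.

Lemma cE_cst A F : dep (predC A) F -> cE A F = fun=> Ex mu F.
Proof.
move=> dF; apply/funext => u; congr Ex; apply/funext => v; apply: dF => k.
by rewrite /= /merge => /negbTE ->.
Qed.

Lemma cEB A F G k k' : bmeas k F -> bmeas k' G ->
  cE A (fun u => F u - G u) = fun u => cE A F u - cE A G u.
Proof.
move=> bF bG; apply/funext => u; rewrite /cE ExB//.
  exact: itg_merge_sec bF.
exact: itg_merge_sec bG.
Qed.

(** [merge A z.1 z.2] is the first component of [swap A z], hence has law [mu]. *)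
Lemma Ex_merge A F k : bmeas k F ->
  Ex (pprod mu mu) (fun z : E * E => F (merge A z.1 z.2)) = Ex mu F.
Proof.
move=> bF; have i1 := itg_fst mu (bmeas_itg bF).
rewrite -(Ex_fst mu (bmeas_itg bF)); apply/esym.
by apply: (Ex_swapE imu (A := A) (itg_meas i1) _).2; exact: itg_mergeF bF.
Qed.

Lemma Ex_cE A F k : bmeas k F -> Ex mu (cE A F) = Ex mu F.
Proof. by move=> bF; rewrite -(Ex_merge A bF) (Ex_pprod1 (itg_mergeF A bF)). Qed.

Lemma Ex_cEM A F G k k' : bmeas k F -> bmeas k' G -> dep A G ->
  Ex mu (fun u => F u * G u) = Ex mu (fun u => cE A F u * G u).
Proof.
move=> bF bG dG.
have bFG : bmeas (k * k') (fun u => F u * G u).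
  case: bF bG => mF Fk [mG Gk]; split; first exact: measurable_funM.
  by move=> u; rewrite normrM ler_pM.
rewrite -(Ex_merge A bFG) (Ex_pprod1 (itg_mergeF A bFG)); congr Ex.
apply/funext => u /=; rewrite mulrC /cE -ExZ; last exact: itg_merge_sec bF.
congr Ex; apply/funext => v; rewrite mulrC; congr (_ * _).
by apply: dG => j Aj; rewrite /merge Aj.
Qed.

Lemma Ex_indep A F G k k' : bmeas k F -> bmeas k' G -> dep (predC A) F -> dep A G ->
  Ex mu (fun u => F u * G u) = Ex mu F * Ex mu G.
Proof.
move=> bF bG dF dG; rewrite (Ex_cEM bF bG dG) (cE_cst dF) ExZ//.
exact: bmeas_itg bG.
Qed.

Lemma cE_contract1 A F k : bmeas k F ->
  Ex mu (fun u => `|cE A F u|) <= Ex mu (fun u => `|F u|).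
Proof.
move=> bF.
have bN : bmeas k (fun u => `|F u|).
  by case: bF => mF Fk; split; [exact: measurableT_comp|move=> u; rewrite normr_id].
rewrite -(Ex_cE A bN); apply: le_Ex.
- exact/itg_norm/(bmeas_itg (cE_bmeas A bF)).
- exact: bmeas_itg (cE_bmeas A bN).
- by move=> u; exact: norm_Ex (itg_merge_sec A u bF).
Qed.

(** Jensen's inequality in each section, then Fubini's theorem. *)
Lemma mom_sec q (H : E * E -> R) (k c : R) : 1 < q -> measurable_fun setT H ->
  (forall z, `|H z| <= k) -> mom (pprod mu mu) q H c ->
  mom mu q (fun u => Ex mu (fun v => H (u, v))) c.
Proof.
move=> q1 mH Hk mmH; have q0 : 0 < q by lraw q1.
have [iHq hHq] := mom_itg_pow q0 mmH.
have iH : itg (pprod mu mu) H by exact: itg_bnd Hk.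
have iu u : itg mu (fun v => H (u, v)).
  by apply: (@itg_bnd _ _ _ _ _ k) => //; exact: measurable_sec1.
have iuq u : itg mu (fun v => `|H (u, v)| `^ q).
  apply: (@itg_bnd _ _ _ _ _ (k `^ q)).
    by apply: measurable_norm_powR; exact: measurable_sec1.
  by move=> v; rewrite ger0_norm ?powR_ge0//; apply: ler_powR2 => //; exact: ltW.
have mI := measurable_Ex_sec1 iH.
have Ik u : `|Ex mu (fun v => H (u, v))| <= k.
  apply: le_trans (norm_Ex (iu u)) _; rewrite -[leRHS](Ex_cst mu).
  by apply: le_Ex => //; [exact: itg_norm|exact: itg_cst].
apply: mom_Ex => //; first exact: mom_ge0 mmH.
  by apply: (@bmeas_itg_pow k); [exact: ltW|split].
apply: le_trans hHq; rewrite (Ex_pprod1 iHq); apply: le_Ex.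
- by apply: (@bmeas_itg_pow k); [exact: ltW|split].
- apply: (@itg_bnd _ _ _ _ _ (k `^ q)); first exact: measurable_Ex_sec1 iHq.
  move=> u; rewrite ger0_norm; last by apply: Ex_ge0 => v; exact: powR_ge0.
  rewrite -[leRHS](Ex_cst mu); apply: le_Ex => //; first exact: itg_cst.
  by move=> v; apply: ler_powR2 => //; exact: ltW.
- by move=> u; exact: Ex_powR_le.
Qed.

Lemma mom_swap q A (H : E * E -> R) (k c : R) : 0 < q -> measurable_fun setT H ->
  (forall z, `|H z| <= k) -> mom (pprod mu mu) q H c ->
  mom (pprod mu mu) q (fun z => H (swap A z)) c.
Proof.
move=> q0 mH Hk mmH; have [iHq hHq] := mom_itg_pow q0 mmH.
have mS : measurable_fun setT (fun z : E * E => H (swap A z)).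
  exact: (measurableT_comp mH (measurable_swap A)).
have iS : itg (pprod mu mu) (fun z => `|H (swap A z)| `^ q).
  apply: (@itg_bnd _ _ _ _ _ (k `^ q)); first exact: measurable_norm_powR.
  by move=> z; rewrite ger0_norm ?powR_ge0//; apply: ler_powR2 => //; exact: ltW.
apply: mom_Ex => //; first exact: mom_ge0 mmH.
by rewrite -(Ex_swapE imu (A := A) (itg_meas iHq) iS).2.
Qed.

Lemma mom_cE q A F k c : 1 < q -> bmeas k F -> mom mu q F c -> mom mu q (cE A F) c.
Proof.
move=> q1 bF mF; have q0 : 0 < q by lraw q1.
apply: (@mom_sec q (fun z => F (merge A z.1 z.2)) k c q1).
- by apply: measurable_mergeF; case: bF.
- by move=> z; case: bF.
have [iF hF] := mom_itg_pow q0 mF.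
apply: (@mom_swap q A (fun z : E * E => F z.1) k c q0).
- by apply: (measurableT_comp _ measurable_fst); case: bF.
- by move=> z; case: bF.
apply: mom_Ex => //.
- by apply: (measurableT_comp _ measurable_fst); case: bF.
- exact: mom_ge0 mF.
- exact: (itg_fst mu iF).
- by rewrite (Ex_fst mu iF).
Qed.

Definition set_coord (k0 : K) (u : E) (x : R) : E := fun k => if k == k0 then x else u k.

Lemma measurable_set_coord k0 :
  measurable_fun setT (fun z : E * E => set_coord k0 z.1 (z.2 k0)).
Proof.
apply: measurable_to_prodR => k; rewrite /set_coord; case: (k == k0).
  exact: (measurableT_comp (measurable_coord _) measurable_snd).
exact: (measurableT_comp (measurable_coord _) measurable_fst).
Qed.

(** The two merged sequences differ at [k0] only, where the second one carries an independent copy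
    of the value. Up to a swap, the difference is that between F and F with [k0] resampled; dropping
    one coordinate from the conditioning therefore costs at most a dependence coefficient. *)
Lemma mom_cE_step q A A' k0 F k c : 1 < q -> bmeas k F ->
  (forall j, A' j = A j && (j != k0)) -> A k0 ->
  mom (pprod mu mu) q (fun z : E * E => F z.1 - F (set_coord k0 z.1 (z.2 k0))) c ->
  mom mu q (fun u => cE A F u - cE A' F u) c.
Proof.
move=> q1 bF AA' Ak0 hc; have q0 : 0 < q by lraw q1.
have [mF Fk] := bF.
have -> : (fun u => cE A F u - cE A' F u) =
    fun u => Ex mu (fun v => F (merge A u v) - F (merge A' u v)).
  by apply/funext => u; rewrite ExB//; exact: itg_merge_sec bF.
pose H (z : E * E) := F z.1 - F (set_coord k0 z.1 (z.2 k0)).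
have mH : measurable_fun setT H.
  apply: measurable_funB; first exact: (measurableT_comp mF measurable_fst).
  exact: (measurableT_comp mF (measurable_set_coord k0)).
have Hk z : `|H z| <= k + k by rewrite (le_trans (ler_normB _ _))// lerD.
have e (z : E * E) : F (merge A z.1 z.2) - F (merge A' z.1 z.2) = H (swap A z).
  rewrite /H /=; congr (_ - F _); apply/funext => j; rewrite /set_coord /merge AA'.
  by case: eqVneq => [->|_]; rewrite ?andbF ?andbT//= Ak0.
apply: (@mom_sec q (fun z => F (merge A z.1 z.2) - F (merge A' z.1 z.2)) (k + k) c q1).
- by apply: measurable_funB; exact: measurable_mergeF.
- by move=> z; rewrite e.
have -> : (fun z : E * E => F (merge A z.1 z.2) - F (merge A' z.1 z.2)) =
    fun z => H (swap A z) by apply/funext => z; exact: e.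
exact: mom_swap Hk hc.
Qed.

End ConditionalExpectation.

(** * Approximation in L^1 by functions that ignore the remote past *)

Section RemotePast.
Context (R : realType) (mu : probability (prodR int R) R).
Hypothesis imu : indep_coord mu.
Local Notation E := (prodR int R).
Implicit Types (F G : E -> R) (a : int).

Definition ge_coord a : pred int := fun k => (a <= k)%R.

Let L1 F := Ex mu (fun u => `|F u|).

(** Such sets form a sigma-algebra containing the cylinders, so all measurable sets are of this
    kind. Through [cE_cvg] this takes the place of martingale convergence along [ge_coord a] as a
    tends to minus infinity. *)
Definition past_approx_set (B : set E) : Prop := measurable B /\
  forall e : R, 0 < e -> exists a (C : set E), [/\ measurable C, dep (ge_coord a) (\1_C : E -> R) &
    Ex mu (fun u => `|\1_B u - \1_C u|) <= e].

Lemma ge_coord_sub a a' : (a' <= a)%R -> {subset ge_coord a <= ge_coord a'}.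
Proof. by move=> aa k; rewrite !unfold_in /ge_coord; exact: le_trans. Qed.

Lemma itg_indicB (B C : set E) : measurable B -> measurable C ->
  itg mu (fun u => `|\1_B u - \1_C u|).
Proof. by move=> mB mC; apply: itg_norm; apply: itgB; exact: itg_indic. Qed.

Lemma past_approx_setU B B' :
  past_approx_set B -> past_approx_set B' -> past_approx_set (B `|` B').
Proof.
move=> [mB hB] [mB' hB']; split; first exact: measurableU.
move=> e e0; have e20 : 0 < e / 2 by rewrite divr_gt0.
have [a [C [mC dC BC]]] := hB _ e20.
have [a' [C' [mC' dC' BC']]] := hB' _ e20.
exists (Num.min a a'), (C `|` C'); split; first exact: measurableU.
  move=> u v uv; rewrite !indicE !in_setU.
  have := dC u v (fun k ak => uv k (ge_coord_sub _ ak)).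
  rewrite !indicE ge_min lexx => /(_ isT) h.
  have := dC' u v (fun k ak => uv k (ge_coord_sub _ ak)).
  rewrite !indicE ge_min lexx orbT => /(_ isT) h'.
  have inj (b b' : bool) : b%:R = b'%:R :> R -> b = b'.
    by case: b b' => -[] //= /eqP; rewrite ?oner_eq0 // eq_sym oner_eq0.
  by rewrite (inj _ _ h) (inj _ _ h').
have i1 := itg_indicB mB mC; have i2 := itg_indicB mB' mC'.
have i3 := itg_indicB (measurableU _ _ mB mB') (measurableU _ _ mC mC').
apply: (@le_trans _ _ (Ex mu (fun u => `|\1_B u - \1_C u| + `|\1_B' u - \1_C' u|))).
  apply: le_Ex => //; first exact: itgD.
  move=> u; rewrite !indicE !in_setU.
  case: (u \in B); case: (u \in B'); case: (u \in C); case: (u \in C') => /=;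
    rewrite ?subrr ?normr0 ?addr0 ?add0r ?subr0 ?sub0r ?normrN ?normr1 ?addr_ge0 ?lerDl//.
by rewrite ExD//; clear -BC BC'; lra.
Qed.

Lemma past_approx_setC B : past_approx_set B -> past_approx_set (~` B).
Proof.
move=> [mB hB]; split; first exact: measurableC.
move=> e /hB[a [C [mC dC BC]]]; exists a, (~` C); split; first exact: measurableC.
  move=> u v /(dC u v); rewrite !indicE !in_setC.
  by case: (u \in C); case: (v \in C) => //= /eqP; rewrite ?oner_eq0// eq_sym oner_eq0.
apply: le_trans BC; apply: le_Ex; [exact: itg_indicB (measurableC _) (measurableC _)|
  exact: itg_indicB|].
move=> u; rewrite !indicE !in_setC.
by case: (u \in B); case: (u \in C) => /=; rewrite ?subrr ?subr0 ?sub0r ?normrN.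
Qed.

Lemma past_approx_bigcup (B : nat -> set E) :
  (forall i, past_approx_set (B i)) -> past_approx_set (\bigcup_i B i).
Proof.
move=> hB; have mB i : measurable (B i) by have [] := hB i.
pose U n := \big[setU/set0]_(i < n) B i.
have hU n : past_approx_set (U n).
  elim: n => [|n IH]; rewrite /U; last by rewrite big_ord_recr; exact: past_approx_setU.
  rewrite big_ord0; split => // e e0; exists 0, set0; split => //.
  under [X in Ex mu X]eq_fun do rewrite subrr normr0.
  by rewrite Ex_cst ltW.
have mU n : measurable (U n) by have [] := hU n.
have mBU : measurable (\bigcup_i B i) by exact: bigcup_measurable.
split => // e e0; have e20 : 0 < e / 2 by rewrite divr_gt0.
have UE u n : u \in U n -> u \in \bigcup_i B i.
  by rewrite !inE /U => /(@bigsetU_bigcup _ B n).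
have cU : Ex mu (fun u => `|\1_(\bigcup_i B i) u - \1_(U n) u|) @[n --> \oo] --> Ex mu (fun=> 0 : R).
  apply: (@Ex_cvg _ _ _ _ _ _ (fun=> 1)).
  - by move=> n; exact: itg_meas (itg_indicB mBU (mU n)).
  - exact: measurable_cst.
  - move=> n u; rewrite normr_id !indicE; have := UE u n.
    by case: (u \in U n) => [->//|_]; case: (u \in \bigcup_i B i);
      rewrite ?subrr ?subr0 ?normr1 ?normr0.
  - exact: itg_cst.
  move=> u; have [ui|ui] := boolP (u \in \bigcup_i B i); last first.
    apply: cvg_near_cst; apply: nearW => n; rewrite !indicE (negbTE ui).
    have := UE u n; case: (u \in U n) => [/(_ isT)|_]; first by rewrite (negbTE ui).
    by rewrite subrr normr0.
  have := ui; rewrite inE => -[i _ Bi].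
  apply: cvg_near_cst; exists i.+1 => // n /= ni; rewrite !indicE ui.
  have -> : u \in U n.
    rewrite inE /U -bigcup_mkord; exists i => //.
  by rewrite subrr normr0.
rewrite Ex_cst in cU; move/cvgrPdist_le : cU => /(_ _ e20)[N _ /(_ N (leqnn N))].
rewrite sub0r normrN ger0_norm; last by apply: Ex_ge0.
move=> hN; have [mUN /(_ _ e20)[a [C [mC dC UC]]]] := hU N.
exists a, C; split => //.
apply: (@le_trans _ _ (Ex mu (fun u => `|\1_(\bigcup_i B i) u - \1_(U N) u| + `|\1_(U N) u - \1_C u|))).
  apply: le_Ex; [exact: itg_indicB|by apply: itgD; exact: itg_indicB|].
  by move=> u; apply: le_trans (ler_normD _ _); rewrite addrA subrK.
by rewrite ExD; [clear -hN UC; lra|exact: itg_indicB..].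
Qed.

Lemma past_approx_measurable (B : set E) : measurable B -> past_approx_set B.
Proof.
apply: smallest_sub => [|_ [k [B' [mB' ->]]]].
  split.
  - split => // e e0; exists 0, set0; split => //.
      under [X in Ex mu X]eq_fun do rewrite subrr normr0.
    by rewrite Ex_cst ltW.
  - by move=> A hA; rewrite setTD; exact: past_approx_setC.
  - by move=> A hA; exact: past_approx_bigcup.
have mC : measurable ([set u : E | B' (u k)] : set E).
  by have := measurable_coord k measurableT mB'; rewrite setTI.
split => // e e0; exists k, [set u : E | B' (u k)]; split => //.
  move=> u v /(_ k) uv; rewrite !indicE; congr ((_ : bool)%:R).
  by apply/idP/idP; rewrite !inE /= ?uv ?/ge_coord// -?uv /ge_coord.
under [X in Ex mu X]eq_fun do rewrite subrr normr0.
by rewrite Ex_cst ltW.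
Qed.

(** The sum counts the positive integers up to y: it is the integer part of y, a staircase with unit
    steps. *)
Lemma layer_approx (N : nat) (y : R) : 0 <= y <= N%:R ->
  `|y - \sum_(j < N) (j.+1%:R <= y)%R%:R| <= 1.
Proof.
move=> /andP[y0]; elim: N => [|N IH] yN.
  by rewrite big_ord0 subr0 ger0_norm// (le_trans yN).
rewrite big_ord_recr /=; have [yN'|Ny] := leP y N%:R.
  rewrite (_ : (N.+1%:R <= y)%R = false) ?addr0 ?IH//.
  apply/negbTE; rewrite -ltNge (le_lt_trans yN')// ltr_nat//.
rewrite (eq_bigr (fun=> 1)) => [|j _]; last first.
  by rewrite (_ : (_ <= y)%R)// (le_trans _ (ltW Ny))// ler_nat.
rewrite sumr_const card_ord; rewrite -natr1 in yN *.
by case: (_ <= y) => /=; rewrite ler_norml; clear -Ny yN; lra.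
Qed.

Lemma past_approx_fun F k (e : R) : bmeas k F -> 0 < e ->
  exists a k' G, [/\ bmeas k' G, dep (ge_coord a) G & L1 (fun u => F u - G u) <= e].
Proof.
move=> [mF Fk] e0; have k0 := le_trans (normr_ge0 _) (Fk point).
have [h h0 he] : exists2 h : R, 0 < h & h + h = e.
  by exists (e / 2); [rewrite divr_gt0|rewrite -splitr].
(* F is shifted and rescaled to [0, N] with step h = e / 2. The staircase costs h, and replacing its
   N level sets by sets that ignore the remote past costs at most h N / (N + 1). *)
pose y u := (F u + k) / h.
have [N hN] : exists N : nat, forall u, 0 <= y u <= N%:R.
  exists (Num.truncn (2 * k / h)).+1 => u; have := Fk u; rewrite ler_norml => /andP[F1 F2].
  rewrite /y divr_ge0 ?(ltW h0)//=; last by clear -F1; lra.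
  apply: le_trans (ltW (truncnS_gt _)); rewrite ler_pM2r ?invr_gt0//; clear -F2; lra.
pose B (j : 'I_N) := [set u : E | j.+1%:R <= y u].
have my : measurable_fun setT (y : E -> R).
  by apply: measurable_funM => //; exact: measurable_funD.
have mB j : measurable (B j) by exact: measurable_ge_set.
have N0 : 0 < (N.+1%:R)^-1 :> R by rewrite invr_gt0.
have /choice[aC hC] : forall j : 'I_N, exists aC : int * set E, [/\ measurable aC.2,
    dep (ge_coord aC.1) (\1_(aC.2) : E -> R) & Ex mu (fun u => `|\1_(B j) u - \1_(aC.2) u|) <= N.+1%:R^-1].
  move=> j; have [_ /(_ _ N0)[a [C [h1 h2 h3]]]] := past_approx_measurable (mB j).
  by exists (a, C).
pose G u : R := h * (\sum_(j < N) \1_((aC j).2) u) - k.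
have iC j : itg mu (\1_((aC j).2)) by apply: itg_indic; have [] := hC j.
have iB j : itg mu (\1_(B j)) by exact: itg_indic.
have iF : itg mu F by exact: itg_bnd Fk.
have iG : itg mu G.
  by apply: itgB; [apply: itgZ; exact: itg_sum|exact: itg_cst].
exists (\big[Num.min/0]_(j < N) (aC j).1), (h * N%:R + k), G; split.
- split; first exact: itg_meas iG.
  move=> u; rewrite /G (le_trans (ler_normB _ _))// (ger0_norm k0) lerD2r.
  rewrite normrM (gtr0_norm h0) ler_pM2l// ger0_norm; last by apply: sumr_ge0.
  have -> : N%:R = \sum_(j < N) 1 :> R by rewrite sumr_const card_ord.
  apply: ler_sum => j _.
  by rewrite indicE; case: (_ \in _).
- move=> u v uv; rewrite /G; congr (_ * _ - _); apply: eq_bigr => j _.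
  have [_ dj _] := hC j; apply: dj => i ji; apply: uv; apply: ge_coord_sub ji.
  by rewrite (bigD1 j)//= ge_min lexx.
have iZ : itg mu (fun u => h + h * \sum_(j < N) `|\1_(B j) u - \1_((aC j).2) u|).
  apply: itgD; first exact: itg_cst.
  by apply: itgZ; apply: itg_sum => j _; apply: itg_norm; exact: itgB.
have iS j : itg mu (fun u => `|\1_(B j) u - \1_((aC j).2) u|).
  by apply: itg_norm; exact: itgB.
apply: (@le_trans _ _ (Ex mu (fun u => h + h * \sum_(j < N) `|\1_(B j) u - \1_((aC j).2) u|))).
  apply: le_Ex => //; first by apply: itg_norm; exact: itgB.
  move=> u; have := layer_approx (hN u).
  have -> : \sum_(j < N) (j.+1%:R <= y u)%R%:R = \sum_(j < N) \1_(B j) u :> R.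
    by apply: eq_bigr => j _; rewrite indicE; congr ((_ : bool)%:R); apply/idP/idP; rewrite inE.
  move=> hl; have -> : F u - G u = h * (y u - \sum_(j < N) \1_(B j) u)
      + h * (\sum_(j < N) (\1_(B j) u - \1_((aC j).2) u)).
    rewrite /G /y sumrB; have hn0 : h != 0 by rewrite gt_eqF.
    set s1 := \sum_(_ < N) _; set s2 := \sum_(_ < N) _; move: s1 s2 => s1 s2.
    by clear -hn0; field.
  apply: le_trans (ler_normD _ _) _; rewrite !normrM (gtr0_norm h0) lerD//.
    by rewrite -[leRHS]mulr1 ler_pM2l.
  by rewrite ler_pM2l// ler_norm_sum.
rewrite ExD; [|exact: itg_cst|by apply: itgZ; exact: itg_sum].
rewrite Ex_cst ExZ; last exact: itg_sum.
rewrite Ex_sum//.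
have : \sum_(j < N) Ex mu (fun u => `|\1_(B j) u - \1_((aC j).2) u|) <= 1.
  apply: (@le_trans _ _ (\sum_(j < N) N.+1%:R^-1)).
    by apply: ler_sum => j _; have [] := hC j.
  rewrite sumr_const card_ord -[_ *+ N]mulr_natr mulrC ler_pdivrMr ?ltr0n//.
  by rewrite mul1r ler_nat.
move: (\sum_(j < N) _) => s s1; clear -s1 h0 he.
by have := ler_wpM2l (ltW h0) s1; lra.
Qed.

(** An approximant G that ignores the remote past is its own conditional expectation for small a,
    and conditioning contracts the L^1 distance from F to G. *)
Lemma cE_cvg F k (e : R) : bmeas k F -> 0 < e ->
  exists a0, forall a, (a <= a0)%R -> L1 (fun u => cE mu (ge_coord a) F u - F u) <= e.
Proof.
move=> bF e0; have e20 : 0 < e / 2 by rewrite divr_gt0.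
have [a0 [k' [G [bG dG FG]]]] := past_approx_fun bF e20.
exists a0 => a aa0.
have cG : cE mu (ge_coord a) G = G.
  by apply: cE_dep; apply: dep_sub dG; exact: ge_coord_sub.
have bFG := bmeasB bF bG.
have bC := cE_bmeas mu (ge_coord a) bF.
have bD := cE_bmeas mu (ge_coord a) bFG.
apply: (@le_trans _ _ (Ex mu (fun u => `|cE mu (ge_coord a) (fun u => F u - G u) u| + `|F u - G u|))).
  apply: le_Ex.
  - by apply: itg_norm; apply: itgB; [exact: bmeas_itg bC|exact: bmeas_itg bF].
  - by apply: itgD; apply: itg_norm; [exact: bmeas_itg bD|exact: bmeas_itg bFG].
  - by move=> u; rewrite (cEB mu _ bF bG) cG (le_trans _ (ler_normB _ _))// opprB addrA subrK.
rewrite ExD; [|by apply: itg_norm; exact: bmeas_itg bD|by apply: itg_norm; exact: bmeas_itg bFG].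
have := cE_contract1 imu (ge_coord a) bFG; move: FG; rewrite /L1.
move: (Ex mu (fun u => `|F u - G u|)) (Ex mu (fun u => `|cE mu _ _ u|)) => x1 x2.
by clear; lra.
Qed.

End RemotePast.

(** * Moments and window approximations of dependent sums *)

Section DependentSums.
Context (R : realType) (mu : probability (prodR int R) R).
Hypothesis imu : indep_coord mu.
Local Notation E := (prodR int R).
Implicit Types (F G : E -> R) (a t : int) (q : R).

Definition le_coord t : pred int := fun k => (k <= t)%R.

(** Chosen to meet both conditions on [k] in [mom_mart_step]. *)
Definition rio_cst q : R := 1 + 2 * mart_cst q.

(* Blockwise orthogonality from the past: each Y j is a function of the
   coordinates from (c - j) on and is orthogonal to the functions of the later ones. *)
Lemma mom_mart_sum q (Y : nat -> E -> R) (k b : R) (c : int) (n : nat) : 2 < q -> 0 <= b ->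
  (forall j, bmeas k (Y j)) -> (forall j, dep (ge_coord (c - j%:Z)) (Y j)) ->
  (forall j G k', bmeas k' G -> dep (ge_coord (c - j%:Z + 1)) G ->
     Ex mu (fun u => G u * Y j u) = 0) ->
  (forall j, mom mu q (Y j) b) ->
  mom mu q (fun u => \sum_(j < n) Y j u) (Num.sqrt (rio_cst q * n.+1%:R) * b).
Proof.
move=> q2 b0 bY dY oY mY; have q0 : 0 < q by lraw q2.
have q10 : 0 < q - 1 by lraw q2.
have C0 : 0 < mart_cst q.
  by rewrite /mart_cst !mulr_gt0 ?powR_gt0.
have K1 : 1 <= rio_cst q by rewrite /rio_cst; clear -C0; lra.
have CK : 2 * mart_cst q <= rio_cst q by rewrite /rio_cst; clear; lra.
have K0 : 0 < rio_cst q by exact: lt_le_trans ltr01 K1.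
have {}mY j e : 0 < e -> mom mu q (Y j) (b + e).
  by move=> e0; apply: mom_le (mY j); rewrite lerDl ltW.
(* [mom_mart_step] works with positive bounds: [m.+1] and the slack [e] provide them already for the
   empty sum. *)
pose s m := Num.sqrt (rio_cst q * m.+1%:R).
have s0 m : 0 < s m by rewrite sqrtr_gt0 mulr_gt0// ltr0n.
rewrite -/(s n); suff h e : 0 < e -> mom mu q (fun u => \sum_(j < n) Y j u) (s n * (b + e)).
  apply: mom_eps => e e0; have := h (e / s n); rewrite divr_gt0// => /(_ isT).
  by rewrite mulrDr mulrCA mulfV ?mulr1// gt_eqF.
move=> e0; have be0 : 0 < b + e by rewrite ltr_wpDl.
have bS m : bmeas (k *+ m) (fun u => \sum_(j < m) Y j u).
  have := bmeas_sum (index_enum 'I_m) (F := fun j => Y j) (k := fun=> k) (fun j => bY j).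
  by rewrite sumr_const card_ord.
elim: n => [|n IH].
  have -> : (fun u => \sum_(j < 0) Y j u) = (fun=> 0 : R).
    by apply/funext => u; rewrite big_ord0.
  apply: mom_le (mom_cst mu 0 q0); rewrite normr0 mulr_ge0// ltW//.
have -> : (fun u => \sum_(j < n.+1) Y j u) = fun u => \sum_(j < n) Y j u + Y n u.
  by apply/funext => u; rewrite big_ord_recr.
have -> : s n.+1 * (b + e) = Num.sqrt ((s n * (b + e)) ^+ 2 + rio_cst q * (b + e) ^+ 2).
  have e1 : (s n * (b + e)) ^+ 2 + rio_cst q * (b + e) ^+ 2 =
      rio_cst q * n.+2%:R * (b + e) ^+ 2.
    rewrite exprMn sqr_sqrtr; last by rewrite mulr_ge0// ltW.
    by rewrite -(natr1 n.+1); clear; ring.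
  rewrite e1 sqrtrM; last by rewrite mulr_ge0// ltW.
  by rewrite sqrtr_sqr gtr0_norm.
apply: (@mom_mart_step _ _ _ _ _ _ _ _ _ _ (k *+ n) k) => //.
- by rewrite mulr_gt0.
- by move=> w; case: (bS n).
- by move=> w; case: (bY n).
(* Time runs backwards along j: the summands before n live on the coordinates from c - n + 1 on, and
   [Y n] is orthogonal to all functions of these. *)
- apply: (oY n (fun u => spow (q - 1) (\sum_(j < n) Y j u)) ((k *+ n) `^ (q - 1))).
    split; first by apply: measurable_spow; case: (bS n).
    move=> u; rewrite norm_spow//; apply: ler_powR2 => //; first exact: ltW.
    by case: (bS n).
  move=> u v uv; congr spow; apply: eq_bigr => j _; apply: dY => i ij; apply: uv.
  apply: ge_coord_sub ij; have := ltn_ord j; clear; lia.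
- exact: mY.
Qed.

(** For a difference D bounded by 2k, |D|^q <= (2k + 1)^(q - 1) |D|, so closeness in L^1 is
    closeness in L^q. *)
Lemma mom_L1_limit q (k c : R) (X : E -> R) : 2 < q -> bmeas k X ->
  (forall e, 0 < e -> exists X', [/\ bmeas k X', mom mu q X' c &
     Ex mu (fun u => `|X u - X' u|) <= e]) -> mom mu q X c.
Proof.
move=> q2 bX h; have q0 : 0 < q by lraw q2.
have q1 : 1 <= q by lraw q2.
have q10 : 0 <= q - 1 by lraw q2.
have k0 := bmeas_ge0 bX.
apply: mom_eps => e e0.
pose B := (k + k + 1) `^ (q - 1).
have kk0 : 0 < k + k + 1 by rewrite ltr_wpDl// addr_ge0.
have B0 : 0 < B by rewrite powR_gt0.
have [X' [bX' mX' hX']] := h (e `^ q / B) (divr_gt0 (powR_gt0 _ e0) B0).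
have bD := bmeasB bX bX'.
have -> : X = fun u => X' u + (X u - X' u).
  by apply/funext => u; rewrite addrC subrK.
apply: (momD q1 mX'); apply: mom_Ex => //; first by case: bD.
- exact: ltW.
- by apply: (bmeas_itg_pow mu (ltW q0) bD).
apply: (@le_trans _ _ (Ex mu (fun u => B * `|X u - X' u|))).
  apply: le_Ex; [exact: (bmeas_itg_pow mu (ltW q0) bD)|
    by apply: itgZ; apply: itg_norm; exact: bmeas_itg bD|].
  move=> u; rewrite -(mulr_powRB1 (normr_ge0 _) q0) mulrC ler_wpM2r//.
  apply: ler_powR2 => //; apply: (@le_trans _ _ (k + k)); last by rewrite lerDl.
  by case: bD.
rewrite ExZ; last by apply: itg_norm; exact: bmeas_itg bD.
by rewrite -ler_pdivlMl// mulrC.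
Qed.

(* The increments of the reversed filtration generated by the coordinates >= a. *)
Definition rinc F a : E -> R :=
  fun u => cE mu (ge_coord a) F u - cE mu (ge_coord (a + 1)) F u.

(* F t - E[F t | coordinates >= t + 1 - L] is the sum over i >= L of the
   increments at t - i; for fixed i these are reversed martingale differences
   in t, and each has L^q norm at most dl i. *)
Lemma mom_truncation_error q k tl (F : int -> E -> R) (dl : nat -> R) (T0 : int) (L n : nat) :
  2 < q -> (forall t, bmeas k (F t)) ->
  (forall t (i : nat), mom (pprod mu mu) q
    (fun z : E * E => F t z.1 - F t (set_coord (t - i%:Z) z.1 (z.2 (t - i%:Z)))) (dl i)) ->
  (forall N, \sum_(i < N) dl (L + i)%N <= tl) ->
  mom mu q (fun u => \sum_(j < n) (F (T0 - j%:Z) u - cE mu (ge_coord (T0 - j%:Z + 1 - L%:Z)) (F (T0 - j%:Z)) u))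
    (Num.sqrt (rio_cst q * n.+1%:R) * tl).
Proof.
move=> q2 bF dF htl.
have q1 : 1 < q by apply: lt_trans q2; rewrite ltr1n.
have k0 := bmeas_ge0 (bF 0).
set s := Num.sqrt _.
have s0 : 0 <= s by exact: sqrtr_ge0.
pose D (N : nat) (j : nat) u := cE mu (ge_coord (T0 - j%:Z + 1 - (L + N)%:Z)) (F (T0 - j%:Z)) u
  - cE mu (ge_coord (T0 - j%:Z + 1 - L%:Z)) (F (T0 - j%:Z)) u.
have bc a t : bmeas k (cE mu (ge_coord a) (F t)) by exact: cE_bmeas.
have step (i : nat) : mom mu q (fun u => \sum_(j < n) rinc (F (T0 - j%:Z)) (T0 - j%:Z - i%:Z) u) (s * dl i).
  apply: (@mom_mart_sum q (fun j => rinc (F (T0 - j%:Z)) (T0 - j%:Z - i%:Z)) (k + k) (dl i) (T0 - i%:Z)) => //.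
  - exact: mom_ge0 (dF 0 i).
  - by move=> j; exact: bmeasB.
  - move=> j; have e : T0 - i%:Z - j%:Z = T0 - j%:Z - i%:Z by rewrite addrAC.
    rewrite e /rinc => u v uv.
    have dT : dep (xpredT : pred int) (F (T0 - j%:Z)).
      by move=> x y xy; congr F; apply/funext => l; exact: xy.
    congr (_ - _).
      by apply: (dep_cE mu (A := ge_coord _) dT) => l /andP[hl _]; exact: uv.
    apply: (dep_cE mu (A := ge_coord _) dT) => l /andP[hl _]; apply: uv.
    by apply: ge_coord_sub hl; clear; lia.
  - move=> j G k' bG dG; rewrite /rinc.
    have e1 : T0 - i%:Z - j%:Z + 1 = T0 - j%:Z - i%:Z + 1 by rewrite [T0 - _ - _]addrAC.
    rewrite e1 in dG; set a := T0 - j%:Z - i%:Z in dG *.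
    have dG' : dep (ge_coord a) G.
      by apply: dep_sub dG; apply: ge_coord_sub; clear; lia.
    have h1 := Ex_cEM imu (bF (T0 - j%:Z)) bG dG'.
    have h2 := Ex_cEM imu (bF (T0 - j%:Z)) bG dG.
    have bM b : bmeas (k' * k) (fun u => G u * cE mu (ge_coord b) (F (T0 - j%:Z)) u).
      have [mG Gk] := bG; have [mC Ck] := bc b (T0 - j%:Z); split; first exact: measurable_funM.
      by move=> u; rewrite normrM ler_pM.
    have e2 : (fun u => G u * (cE mu (ge_coord a) (F (T0 - j%:Z)) u - cE mu (ge_coord (a + 1)) (F (T0 - j%:Z)) u))
       = fun u => G u * cE mu (ge_coord a) (F (T0 - j%:Z)) u - G u * cE mu (ge_coord (a + 1)) (F (T0 - j%:Z)) u.
      by apply/funext => u; rewrite mulrBr.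
    rewrite e2 ExB; [|exact: bmeas_itg (bM _)|exact: bmeas_itg (bM _)].
    have e3 b : Ex mu (fun u => G u * cE mu (ge_coord b) (F (T0 - j%:Z)) u) =
        Ex mu (fun u => cE mu (ge_coord b) (F (T0 - j%:Z)) u * G u).
      by congr Ex; apply/funext => u; rewrite mulrC.
    by rewrite !e3 -h1 -h2 subrr.
  - move=> j; apply: (mom_cE_step imu (k0 := T0 - j%:Z - i%:Z) q1 (bF _) _ _ (dF _ i)).
      by move=> l; rewrite /ge_coord; apply/idP/andP; clear; lia.
    by rewrite /ge_coord.
have mD N : mom mu q (fun u => \sum_(j < n) D N j u) (s * tl).
  have -> : (fun u => \sum_(j < n) D N j u) =
      fun u => \sum_(i < N) \sum_(j < n) rinc (F (T0 - j%:Z)) (T0 - j%:Z - (L + i)%:Z) u.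
    apply/funext => u; rewrite exchange_big /=; apply: eq_bigr => j _.
    rewrite /D; elim: N => [|N IH]; first by rewrite big_ord0 addn0 subrr.
    rewrite big_ord_recr /= -IH /rinc.
    have -> : T0 - j%:Z + 1 - (L + N.+1)%:Z = T0 - j%:Z - (L + N)%:Z by clear; lia.
    have -> : T0 - j%:Z - (L + N)%:Z + 1 = T0 - j%:Z + 1 - (L + N)%:Z by clear; lia.
    set x := cE _ _ _ u; set y := cE _ _ _ u; set z := cE _ _ _ u.
    by move: x y z => x y z; clear; lra.
  apply: (@mom_le _ _ _ _ _ _ (\sum_(i < N) s * dl (L + i)%N)).
    by rewrite -mulr_sumr ler_wpM2l.
  by apply: mom_sum => [|i _]; [exact: ltW|exact: step].
(* So far finitely many lags are covered. The remaining ones vanish in L^1, and the largest of the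
   depths needed by the n summands serves all of them. *)
apply: (@mom_L1_limit q ((k + k) *+ n)) => //.
  have := bmeas_sum (index_enum 'I_n) (F := fun (j : 'I_n) u => F (T0 - j%:Z) u -
    cE mu (ge_coord (T0 - j%:Z + 1 - L%:Z)) (F (T0 - j%:Z)) u) (k := fun=> k + k).
  by rewrite sumr_const card_ord; apply => j; exact: bmeasB.
move=> e e0; have en0 : 0 < e / n.+1%:R by rewrite divr_gt0.
have /choice[N hN] : forall j : 'I_n, exists N : nat, forall N' : nat, (N <= N')%N ->
    Ex mu (fun u => `|cE mu (ge_coord (T0 - j%:Z + 1 - (L + N')%:Z)) (F (T0 - j%:Z)) u - F (T0 - j%:Z) u|) <= e / n.+1%:R.
  move=> j; have [a0 ha0] := cE_cvg imu (bF (T0 - j%:Z)) en0.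
  exists (absz (T0 - j%:Z + 1 - a0)%R) => N' hN'; apply: ha0.
  by move: hN'; clear; lia.
pose M := \max_(j < n) N j.
exists (fun u => \sum_(j < n) D M j u); split => //.
  have := bmeas_sum (index_enum 'I_n) (F := fun (j : 'I_n) u => D M j u) (k := fun=> k + k).
  by rewrite sumr_const card_ord; apply => j; exact: bmeasB.
pose Z (j : 'I_n) u := `|cE mu (ge_coord (T0 - j%:Z + 1 - (L + M)%:Z)) (F (T0 - j%:Z)) u - F (T0 - j%:Z) u|.
have iZ j : itg mu (Z j) by apply: itg_norm; exact: bmeas_itg (bmeasB (bc _ _) (bF _)).
apply: (@le_trans _ _ (Ex mu (fun u => \sum_(j < n) Z j u))).
  apply: le_Ex.
  - apply: itg_norm; apply: itgB; apply: itg_sum => j _.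
      exact: bmeas_itg (bmeasB (bF _) (bc _ _)).
    exact: bmeas_itg (bmeasB (bc _ _) (bc _ _)).
  - exact: itg_sum.
  - move=> u; rewrite -sumrB; apply: le_trans (ler_norm_sum _ _ _) _.
    apply: ler_sum => j _; rewrite /D /Z distrC.
    set x := cE _ _ _ u; set y := cE _ _ _ u; set z := F _ u; move: x y z => x y z.
    by rewrite (_ : x - y - (z - y) = x - z)//; clear; lra.
rewrite Ex_sum//; apply: (@le_trans _ _ (\sum_(j < n) e / n.+1%:R)).
  by apply: ler_sum => j _; apply: hN; exact: leq_bigmax.
rewrite sumr_const card_ord -[_ *+ n]mulr_natr -mulrA ler_piMr ?(ltW e0)//.
by rewrite mulrC ler_pdivrMr ?ltr0n// mul1r ler_nat.
Qed.

(** Truncation at level K. It is 1-Lipschitz and does not increase absolute values, so neither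
    moments nor dependence coefficients grow. *)
Definition clip (K x : R) : R := Num.max (- K) (Num.min x K).

Lemma clip_bnd K x : 0 <= K -> `|clip K x| <= K.
Proof.
move=> K0; rewrite /clip ler_norml le_max lexx /= ge_max ge_min lexx orbT andbT.
by rewrite (le_trans _ K0)// oppr_le0.
Qed.

Lemma clip_id K x : `|x| <= K -> clip K x = x.
Proof. by rewrite ler_norml => /andP[h1 h2]; rewrite /clip min_l// max_r. Qed.

Lemma clip_lip K x y : `|clip K x - clip K y| <= `|x - y|.
Proof.
have h (a b c : R) : `|Num.max a b - Num.max a c| <= `|b - c|.
  rewrite !ler_norml; have [] := ltP a b; have [] := ltP a c;
  have := ler_norm (b - c); have := ler_norm (c - b); rewrite distrC;
  by move=> *; apply/andP; split; lra.
have h' (a b c : R) : `|Num.min b a - Num.min c a| <= `|b - c|.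
  rewrite !ler_norml; have [] := ltP b a; have [] := ltP c a;
  have := ler_norm (b - c); have := ler_norm (c - b); rewrite distrC;
  by move=> *; apply/andP; split; lra.
exact: le_trans (h _ _ _) (h' _ _ _).
Qed.

Lemma clip_norm K x : 0 <= K -> `|clip K x| <= `|x|.
Proof.
move=> K0; have := clip_lip K x 0.
have -> : clip K 0 = 0 by apply: clip_id; rewrite normr0.
by rewrite !subr0.
Qed.

Lemma measurable_clip d (T : measurableType d) K (X : T -> R) :
  measurable_fun setT X -> measurable_fun setT (fun w => clip K (X w)).
Proof. by move=> mX; apply: measurable_maxr => //; exact: measurable_minr. Qed.

Lemma mom_clip_cvg q (X : E -> R) (c e : R) : 1 <= q -> mom mu q X c -> 0 < e ->
  exists N : nat, forall n, (N <= n)%N -> mom mu q (fun u => X u - clip n%:R (X u)) e.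
Proof.
move=> q1 mX e0; have q0 : 0 < q by exact: lt_le_trans ltr01 q1.
have mmX := mom_meas mX; have [iX hX] := mom_itg_pow q0 mX.
have mD n : measurable_fun setT (fun u => X u - clip n%:R (X u)).
  by apply: measurable_funB => //; exact: measurable_clip.
have Dle n u : `|X u - clip n%:R (X u)| <= `|X u|.
  rewrite /clip; have n0 : 0 <= n%:R :> R by [].
  move: (X u) => x; have [xn|xn] := leP x n%:R.
    have [h|h] := leP (- n%:R) x; first by rewrite subrr normr0.
    by rewrite !ltr0_norm//; move: h n0; clear; lra.
  have [h|h] := leP (- n%:R : R) n%:R; last by move: h n0; clear; lra.
  by rewrite !gtr0_norm//; move: xn n0; clear; lra.
have iD n : itg mu (fun u => `|X u - clip n%:R (X u)| `^ q).
  apply: (itg_le _ iX); first exact: measurable_norm_powR.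
  by move=> u; rewrite ger0_norm ?powR_ge0//; apply: ler_powR2 => //; exact: ltW.
have : Ex mu (fun u => `|X u - clip n%:R (X u)| `^ q) @[n --> \oo] --> Ex mu (fun=> 0 : R).
  apply: (@Ex_cvg _ _ _ _ _ _ (fun u => `|X u| `^ q)) => //.
  - by move=> n; exact: measurable_norm_powR.
  - by move=> n u; rewrite ger0_norm ?powR_ge0//; apply: ler_powR2 => //; exact: ltW.
  move=> u; apply: cvg_near_cst; exists (Num.truncn `|X u|).+1 => // n /= hn.
  rewrite clip_id ?subrr ?normr0 ?powR0 ?gt_eqF//.
  by apply: le_trans (ltW (truncnS_gt _)) _; rewrite ler_nat.
rewrite Ex_cst => /cvgrPdist_le/(_ _ (powR_gt0 q e0))[N _ hN].
exists N => n /hN; rewrite sub0r normrN ger0_norm; last by apply: Ex_ge0 => u; exact: powR_ge0.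
by move=> h; apply: mom_Ex => //; exact: ltW.
Qed.

(** Truncation makes the summands bounded, conditioning on the coordinates of the last L times
    produces the window, and subtracting the mean restores centring. The truncation level depends on
    n and e, but it enters the sup bound [k] only. *)
Lemma dependent_sum_approx q M tl (x : int -> E -> R) (dl : nat -> R) (T0 : int) (L n : nat) (e : R) :
  2 < q -> 0 < e ->
  (forall t, mom mu q (x t) M) -> (forall t, dep (le_coord t) (x t)) ->
  (forall t (i : nat), mom (pprod mu mu) q
    (fun z : E * E => x t z.1 - x t (set_coord (t - i%:Z) z.1 (z.2 (t - i%:Z)))) (dl i)) ->
  (forall t, Ex mu (x t) = 0) ->
  (forall N, \sum_(i < N) dl (L + i)%N <= tl) ->
  exists k (V : int -> E -> R), [/\ forall t, bmeas k (V t),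
    forall t, dep (fun k => (t + 1 - L%:Z <= k <= t)%R) (V t),
    forall t, Ex mu (V t) = 0, forall t, mom mu q (V t) (M + M) &
    mom mu q (fun u => \sum_(j < n) (x (T0 - j%:Z) u - V (T0 - j%:Z) u))
      (Num.sqrt (rio_cst q * n.+1%:R) * tl + e)].
Proof.
move=> q2 e0 mx dx Dx x0 htl.
have q1 : 1 < q by lraw q2.
have q0 : 0 < q by lraw q1.
(* Each of the n summands loses e' by truncation and at most e' by the mean of the truncated
   variable. *)
pose e' := e / (2 * n.+1%:R).
have n0 : 0 < n.+1%:R :> R by rewrite ltr0n.
have e'0 : 0 < e' by rewrite divr_gt0// mulr_gt0.
have /choice[N hN] : forall j : 'I_n, exists N : nat, forall m, (N <= m)%N ->
    mom mu q (fun u => x (T0 - j%:Z) u - clip m%:R (x (T0 - j%:Z) u)) e'.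
  by move=> j; apply: mom_clip_cvg (mx _) e'0; exact: ltW.
pose K : R := (\max_(j < n) N j)%:R.
have K0 : 0 <= K by [].
pose y t u := clip K (x t u).
have bY t : bmeas K (y t).
  split; first by apply: measurable_clip; exact: mom_meas (mx t).
  by move=> u; exact: clip_bnd.
have mY t : mom mu q (y t) M.
  by apply: mom_dom (mx t) => //; [case: (bY t)|move=> u; exact: clip_norm].
have DY t (i : nat) : mom (pprod mu mu) q
    (fun z : E * E => y t z.1 - y t (set_coord (t - i%:Z) z.1 (z.2 (t - i%:Z)))) (dl i).
  apply: mom_dom (Dx t i) => //; last by move=> z; exact: clip_lip.
  have [my _] := bY t; apply: measurable_funB.
    exact: (measurableT_comp my measurable_fst).
  exact: (measurableT_comp my (measurable_set_coord _)).
have hEy t : `|Ex mu (y t)| <= M.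
  have [iy hy] := mom_itg (ltW q1) (mY t).
  exact: le_trans (norm_Ex iy) hy.
have bC t := cE_bmeas mu (ge_coord (t + 1 - L%:Z)) (bY t).
pose V t u := cE mu (ge_coord (t + 1 - L%:Z)) (y t) u - Ex mu (y t).
exists (K + M), V; split.
- move=> t; split.
    by apply: measurable_funB => //; case: (bC t).
  by move=> u; rewrite (le_trans (ler_normB _ _))// lerD//; case: (bC t).
- move=> t u v uv; congr (_ - _).
  have dy : dep (le_coord t) (y t) by move=> a b ab; rewrite /y (dx t a b ab).
  apply: (dep_cE mu (A := ge_coord (t + 1 - L%:Z)) dy) => l /andP[h1 h2].
  by apply: uv; apply/andP; split.
- move=> t; rewrite /V ExB; [|exact: bmeas_itg (bC t)|exact: itg_cst].
  by rewrite (Ex_cE imu _ (bY t)) Ex_cst subrr.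
- move=> t; apply: momB; first exact: ltW.
    exact: (mom_cE imu _ q1 (bY t) (mY t)).
  exact: mom_le (hEy t) (mom_cst mu _ q0).
have -> : (fun u => \sum_(j < n) (x (T0 - j%:Z) u - V (T0 - j%:Z) u)) =
  fun u => \sum_(j < n) (y (T0 - j%:Z) u -
      cE mu (ge_coord (T0 - j%:Z + 1 - L%:Z)) (y (T0 - j%:Z)) u) +
    \sum_(j < n) ((x (T0 - j%:Z) u - y (T0 - j%:Z) u) + Ex mu (y (T0 - j%:Z))).
  apply/funext => u; rewrite -big_split; apply: eq_bigr => j _ /=; rewrite /V.
  set a := x _ u; set b := cE _ _ _ u; set c := Ex _ _; set d := y _ u.
  by move: a b c d => a b c d; clear; lra.
apply: momD; first exact: ltW.
  exact: (mom_truncation_error T0 n q2 bY DY htl).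
apply: (@mom_le _ _ _ _ _ _ (\sum_(j < n) (e' + e'))).
  rewrite sumr_const card_ord -[_ *+ n]mulr_natr /e'.
  have -> : (e / (2 * n.+1%:R) + e / (2 * n.+1%:R)) * n%:R = e * (n%:R / n.+1%:R).
    by move: n0; clear; move=> n0; field; rewrite addrC natr1 gt_eqF.
  by rewrite ler_piMr ?(ltW e0)// ler_pdivrMr// mul1r ler_nat.
apply: mom_sum => [|j _]; first exact: ltW.
have hj := hN j _ (leq_bigmax j).
apply: momD => //; first exact: ltW.
have [ij hij] := mom_itg (ltW q1) hj.
have iy := bmeas_itg mu (bY (T0 - j%:Z)).
have [ix _] := mom_itg (ltW q1) (mx (T0 - j%:Z)).
apply: mom_le (mom_cst mu _ q0); apply: le_trans hij; apply: le_trans _ (norm_Ex ij).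
by rewrite ExB// x0 sub0r normrN.
Qed.

(** The case L = 0 of [dependent_sum_approx]: the window is empty, so [V] is constant and equal to
    its mean 0. *)
Lemma dependent_sum_mom q M tl (x : int -> E -> R) (dl : nat -> R) (T0 : int) (n : nat) :
  2 < q ->
  (forall t, mom mu q (x t) M) -> (forall t, dep (le_coord t) (x t)) ->
  (forall t (i : nat), mom (pprod mu mu) q
    (fun z : E * E => x t z.1 - x t (set_coord (t - i%:Z) z.1 (z.2 (t - i%:Z)))) (dl i)) ->
  (forall t, Ex mu (x t) = 0) ->
  (forall N, \sum_(i < N) dl i <= tl) ->
  mom mu q (fun u => \sum_(j < n) x (T0 - j%:Z) u) (Num.sqrt (rio_cst q * n.+1%:R) * tl).
Proof.
move=> q2 mx dx Dx x0 htl; apply: mom_eps => e e0.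
have [|k [V [bV dV V0 _]]] := @dependent_sum_approx q M tl x dl T0 0 n e q2 e0 mx dx Dx x0.
  by move=> N; under eq_bigr do rewrite add0n; exact: htl.
congr (mom mu q _ _); apply/funext => u; apply: eq_bigr => j _.
have -> : V (T0 - j%:Z) u = 0; last by rewrite subr0.
rewrite -(V0 (T0 - j%:Z)) -[LHS](Ex_cst mu); congr Ex; apply/funext => v.
by apply: dV => i /andP[h1 h2]; exfalso; move: h1 h2; clear; lia.
Qed.

End DependentSums.

(** * Smoothed maximum *)

Section LineDerivatives.
Context (R : realType).
Implicit Types (f g : R -> R) (t a b : R).

Lemma drvM f g t a b : is_derive t 1 f a -> is_derive t 1 g b ->
  is_derive t 1 (fun t => f t * g t) (a * g t + f t * b).
Proof.
move=> df dg; apply: (is_derive_eq (is_deriveM df dg)).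
by rewrite addrC /GRing.scale /= [g t * a]mulrC.
Qed.

Lemma drvD f g t a b : is_derive t 1 f a -> is_derive t 1 g b ->
  is_derive t 1 (fun t => f t + g t) (a + b).
Proof. by move=> df dg; exact: (is_deriveD df dg). Qed.

Lemma drvB f g t a b : is_derive t 1 f a -> is_derive t 1 g b ->
  is_derive t 1 (fun t => f t - g t) (a - b).
Proof. by move=> df dg; exact: (is_deriveB df dg). Qed.

Lemma drvN f t a : is_derive t 1 f a -> is_derive t 1 (fun t => - f t) (- a).
Proof. by move=> df; exact: (is_deriveN df). Qed.

Lemma drv_sum I (r : seq I) (f : I -> R -> R) (a : I -> R) t :
  (forall i, is_derive t 1 (f i) (a i)) ->
  is_derive t 1 (fun t => \sum_(i <- r) f i t) (\sum_(i <- r) a i).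
Proof.
move=> df; elim: r => [|i r IH].
  rewrite big_nil; have -> : (fun t => \sum_(i <- [::]) f i t) = cst 0.
    by apply/funext => s; rewrite big_nil.
  exact: is_derive_cst.
rewrite big_cons; have -> : (fun t => \sum_(j <- i :: r) f j t) =
    fun t => f i t + \sum_(j <- r) f j t by apply/funext => s; rewrite big_cons.
exact: drvD.
Qed.

Lemma drvV f t a : f t != 0 -> is_derive t 1 f a ->
  is_derive t 1 (fun t => (f t)^-1) (- a / f t ^+ 2).
Proof.
move=> f0 df; apply: (is_derive_eq (is_deriveV f0 df)).
by rewrite [_ *: _](_ : _ = (- f t ^- 2) * a)// mulNr mulrC -mulNr.
Qed.

Lemma drv_le (f df : R -> R) (B : R) : (forall t, is_derive t 1 f (df t)) ->
  (forall t, `|df t| <= B) -> `|f 1 - f 0| <= B.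
Proof.
move=> dF hB; have cf : {within `[0, 1], continuous f}.
  apply/continuous_subspaceT => r.
  by apply/differentiable_continuous/derivable1_diffP; case: (dF r).
have [c _ ->] := MVT_segment ler01 (fun x _ => dF x) cf.
by rewrite subr0 mulr1.
Qed.

(** Two applications of the mean value theorem; the factor 1/2 of Taylor's formula is given away. *)
Lemma drv2_le (f df ddf : R -> R) (B : R) : (forall t, is_derive t 1 f (df t)) ->
  (forall t, is_derive t 1 df (ddf t)) ->
  (forall t, `|ddf t| <= B) -> `|f 1 - f 0 - df 0| <= B.
Proof.
move=> dF ddF hB; have cf : {within `[0, 1], continuous f}.
  apply/continuous_subspaceT => r.
  by apply/differentiable_continuous/derivable1_diffP; case: (dF r).
have [c + ->] := MVT_segment ler01 (fun x _ => dF x) cf.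
rewrite in_itv/= => /andP[c0 c1]; rewrite subr0 mulr1.
have B0 : 0 <= B by exact: le_trans (normr_ge0 _) (hB 0).
have cdf : {within `[0, c], continuous df}.
  apply/continuous_subspaceT => r.
  by apply/differentiable_continuous/derivable1_diffP; case: (ddF r).
have [e _ ->] := MVT_segment c0 (fun x _ => ddF x) cdf.
rewrite subr0 normrM (ger0_norm c0) -[leRHS]mulr1.
by apply: ler_pM => //.
Qed.

End LineDerivatives.

Section SoftMax.
Context (R : realType) (I : finType).
Implicit Types (x u v w h : I -> R) (t : R).

(* With y_i = b (z_i - c), [lgs y] is a smooth version of the indicator of
   max_i z_i <= c, and [gbs y] is the Gibbs measure, whose mass at i is
   exp(y_i) / (1 + sum_j exp(y_j)). *)
Definition lgs x : R := (1 + \sum_i expR (x i))^-1.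
Definition gbs x u : R := (\sum_i expR (x i) * u i) * lgs x.

(** [lgs1], [lgs2] and, below, [lgs3] are the successive directional derivatives of [lgs]; [gbs1]
    and [gbs2] are those of [gbs] in x. [gbs1] is a covariance once the missing Gibbs mass [lgs x]
    is put on an extra point where u and v vanish. *)
Definition lgs1 x u : R := - (gbs x u * lgs x).
Definition lgs2 x u v : R :=
  lgs x * (2 * (gbs x u * gbs x v) - gbs x (fun i => u i * v i)).
Definition gbs1 x u v : R := gbs x (fun i => u i * v i) - gbs x u * gbs x v.

Lemma sum_expR_ge0 x : 0 <= \sum_i expR (x i).
Proof. by apply: sumr_ge0 => i _; exact: expR_ge0. Qed.

Lemma lgs_den_gt0 x : 0 < 1 + \sum_i expR (x i).
Proof. by rewrite ltr_pwDl// sum_expR_ge0. Qed.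

Lemma lgs_gt0 x : 0 < lgs x.
Proof. by rewrite invr_gt0 lgs_den_gt0. Qed.

Lemma lgs_le1 x : lgs x <= 1.
Proof. by rewrite invf_le1 ?lgs_den_gt0// lerDl sum_expR_ge0. Qed.

(** The Gibbs weights add up to 1 - lgs x. Hence the derivatives of [lgs] and [gbs] are bounded by
    the sup norms of their directions, with constants free of the cardinality of [I]. *)
Lemma gbs_bnd x u (a : R) : (forall i, `|u i| <= a) -> `|gbs x u| <= a * (1 - lgs x).
Proof.
move=> ua; rewrite /gbs normrM (gtr0_norm (lgs_gt0 x)).
have -> : 1 - lgs x = (\sum_i expR (x i)) * lgs x.
  have := lgs_den_gt0 x; rewrite /lgs; move: (\sum_i _) => s s0.
  by field; rewrite gt_eqF.
rewrite mulrA ler_pM2r ?lgs_gt0// mulr_sumr.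
apply: le_trans (ler_norm_sum _ _ _) _; apply: ler_sum => i _.
by rewrite normrM (gtr0_norm (expR_gt0 _)) mulrC ler_pM2r ?expR_gt0.
Qed.

Lemma gbs_le x u (a : R) : 0 <= a -> (forall i, `|u i| <= a) -> `|gbs x u| <= a.
Proof.
move=> a0 ua; apply: (le_trans (gbs_bnd x ua)).
by rewrite ler_piMr// gerBl ltW// lgs_gt0.
Qed.

Lemma gbs_sum x (f : I -> I -> R) (c : I -> R) :
  gbs x (fun i => \sum_k c k * f k i) = \sum_k c k * gbs x (f k).
Proof.
rewrite /gbs (eq_bigr (fun i => \sum_k c k * (expR (x i) * f k i))) => [|i _]; last first.
  by rewrite mulr_sumr; apply: eq_bigr => k _; rewrite mulrCA.
rewrite exchange_big mulr_suml; apply: eq_bigr => k _.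
by rewrite -mulr_sumr mulrA.
Qed.

Definition line x h t : I -> R := fun i => x i + t * h i.

Lemma drv_expR_sum x h u t :
  is_derive t 1 (fun t => \sum_i expR (line x h t i) * u i)
    (\sum_i expR (line x h t i) * (u i * h i)).
Proof.
apply: drv_sum => i; rewrite /line.
have d1 : is_derive t 1 (fun t : R => x i + t * h i) (h i).
  have d0 : is_derive t 1 (fun t : R => t) (1 : R) by exact: is_derive_id.
  have dc k : is_derive t 1 (fun _ : R => k) (0 : R) by exact: is_derive_cst.
  by apply: (is_derive_eq (drvD (dc (x i)) (drvM d0 (dc (h i))))); rewrite mulr0 !addr0 add0r mul1r.
have d2 := @is_derive1_comp _ expR (fun t : R => x i + t * h i) t _ _
    (is_derive_expR (x i + t * h i)) d1.
have d3 := drvM d2 (is_derive_cst (u i) t 1).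
by apply: (is_derive_eq d3); rewrite /= mulr0 addr0; ring.
Qed.

Lemma drv_lgs x h t :
  is_derive t 1 (fun t => lgs (line x h t)) (- (gbs (line x h t) h * lgs (line x h t))).
Proof.
have d1 : is_derive t 1 (fun t => 1 + \sum_i expR (line x h t i)) (\sum_i expR (line x h t i) * h i).
  have d0 := drvD (is_derive_cst (1 : R) t 1) (drv_expR_sum x h (fun=> 1) t).
  apply: (is_derive_eq (_ : is_derive t 1 _ (0 + \sum_i expR (line x h t i) * (1 * h i)))).
    move: d0; rewrite (_ : (fun t => cst 1 t + _) = fun t => 1 + \sum_i expR (line x h t i))//.
    by apply/funext => s; congr (_ + _); apply: eq_bigr => i _; rewrite mulr1.
  by rewrite add0r; apply: eq_bigr => i _; rewrite mul1r.
have D0 := lgs_den_gt0 (line x h t).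
have dV := @drvV _ (fun t => 1 + \sum_i expR (line x h t i)) _ _ (lt0r_neq0 D0) d1.
apply: (is_derive_eq dV); rewrite /gbs /lgs; field; exact: lt0r_neq0.
Qed.

Lemma drv_gbs x h u t :
  is_derive t 1 (fun t => gbs (line x h t) u) (gbs1 (line x h t) u h).
Proof.
apply: (is_derive_eq (drvM (drv_expR_sum x h u t) (drv_lgs x h t))).
by rewrite /gbs1 /gbs; ring.
Qed.

Lemma drv_lgs1 x h u t :
  is_derive t 1 (fun t => lgs1 (line x h t) u) (lgs2 (line x h t) u h).
Proof.
apply: (is_derive_eq (drvN (drvM (drv_gbs x h u t) (drv_lgs x h t)))).
by rewrite /lgs2 /gbs1; ring.
Qed.

Definition lgs3 x u v h : R :=
  - (gbs x h * lgs x) * (2 * (gbs x u * gbs x v) - gbs x (fun i => u i * v i)) +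
  lgs x * (2 * (gbs1 x u h * gbs x v + gbs x u * gbs1 x v h) - gbs1 x (fun i => u i * v i) h).

Lemma drv_lgs2 x h u v t :
  is_derive t 1 (fun t => lgs2 (line x h t) u v) (lgs3 (line x h t) u v h).
Proof.
have dc : is_derive t 1 (fun _ : R => 2 : R) (0 : R) by exact: is_derive_cst.
have d := drvM (drv_lgs x h t) (drvB (drvM dc (drvM (drv_gbs x h u t) (drv_gbs x h v t)))
  (drv_gbs x h (fun i => u i * v i) t)).
by apply: (is_derive_eq d); rewrite /lgs3; ring.
Qed.

Definition gbs2 x u v : R :=
  gbs1 x (fun i => u i * v i) v - (gbs1 x u v * gbs x v + gbs x u * gbs1 x v v).

Lemma drv_gbs1 x h u t :
  is_derive t 1 (fun t => gbs1 (line x h t) u h) (gbs2 (line x h t) u h).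
Proof.
exact: (drvB (drv_gbs x h (fun i => u i * h i) t) (drvM (drv_gbs x h u t) (drv_gbs x h h t))).
Qed.

Lemma line0 x h : line x h 0 = x.
Proof. by apply/funext => i; rewrite /line mul0r addr0. Qed.

Lemma line1 x h : line x h 1 = fun i => x i + h i.
Proof. by apply/funext => i; rewrite /line mul1r. Qed.

Section Bounds.
Variables (a b c : R) (u v h : I -> R).
Hypotheses (ua : forall i, `|u i| <= a) (vb : forall i, `|v i| <= b) (hc : forall i, `|h i| <= c).
Hypotheses (a0 : 0 <= a) (b0 : 0 <= b) (c0 : 0 <= c).

Lemma gbs_prod_le x (u' v' : I -> R) (a' b' : R) : 0 <= a' -> 0 <= b' -> (forall i, `|u' i| <= a') -> (forall i, `|v' i| <= b') ->
  `|gbs x (fun i => u' i * v' i)| <= a' * b'.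
Proof. by move=> p1 p2 h1 h2; apply: gbs_le => [|i]; rewrite ?mulr_ge0// normrM ler_pM. Qed.

Lemma gbs1_le x (u' v' : I -> R) (a' b' : R) : 0 <= a' -> 0 <= b' -> (forall i, `|u' i| <= a') -> (forall i, `|v' i| <= b') ->
  `|gbs1 x u' v'| <= 2 * (a' * b').
Proof.
move=> p1 p2 h1 h2; rewrite /gbs1 (le_trans (ler_normB _ _))// [leRHS](_ : _ = a' * b' + a' * b') ?lerD//; last lra.
  exact: gbs_prod_le.
by rewrite normrM ler_pM// gbs_le.
Qed.

Lemma lgs1_le x : `|lgs1 x u| <= a.
Proof.
rewrite /lgs1 normrN normrM -[leRHS]mulr1 ler_pM ?gbs_le//.
by rewrite gtr0_norm ?lgs_gt0 ?lgs_le1.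
Qed.

Lemma lgs2_le x : `|lgs2 x u v| <= 3 * (a * b).
Proof.
rewrite /lgs2 normrM -[leRHS]mul1r ler_pM//.
  by rewrite gtr0_norm ?lgs_gt0 ?lgs_le1.
rewrite (le_trans (ler_normB _ _))// normrM (ger0_norm (ler0n _ 2)).
have h1 := gbs_prod_le x a0 b0 ua vb.
have h2 : `|gbs x u * gbs x v| <= a * b by rewrite normrM ler_pM// gbs_le.
by move: h1 h2; lra.
Qed.

Lemma lgs3_le x : `|lgs3 x u v h| <= 13 * (a * b * c).
Proof.
have l1 : `|lgs x| <= 1 by rewrite gtr0_norm ?lgs_gt0 ?lgs_le1.
have ab0 : 0 <= a * b by rewrite mulr_ge0.
have hu : `|gbs x u| <= a by exact: gbs_le.
have hv : `|gbs x v| <= b by exact: gbs_le.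
have hh : `|gbs x h| <= c by exact: gbs_le.
have huv : `|gbs x (fun i => u i * v i)| <= a * b by exact: gbs_prod_le.
have h1 : `|2 * (gbs x u * gbs x v) - gbs x (fun i => u i * v i)| <= 3 * (a * b).
  rewrite (le_trans (ler_normB _ _))// normrM (ger0_norm (ler0n _ 2)).
  have h2 : `|gbs x u * gbs x v| <= a * b by rewrite normrM ler_pM.
  by move: huv h2; lra.
have h2 : `|gbs x h * lgs x| <= c by rewrite normrM -[leRHS]mulr1 ler_pM.
have h3 : `|gbs1 x u h * gbs x v| <= 2 * (a * c) * b by rewrite normrM ler_pM// gbs1_le.
have h4 : `|gbs x u * gbs1 x v h| <= a * (2 * (b * c)) by rewrite normrM ler_pM// gbs1_le.
have h5 : `|gbs1 x (fun i => u i * v i) h| <= 2 * (a * b * c).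
  by apply: gbs1_le => // i; rewrite normrM ler_pM.
have h6 : `|- (gbs x h * lgs x) * (2 * (gbs x u * gbs x v) - gbs x (fun i => u i * v i))| <= c * (3 * (a * b)).
  by rewrite normrM normrN ler_pM.
set A := gbs1 x u h * gbs x v in h3 *; set B := gbs x u * gbs1 x v h in h4 *.
set C := gbs1 x _ h in h5 *.
have h7 : `|2 * (A + B) - C| <= 10 * (a * b * c).
  rewrite (le_trans (ler_normB _ _))// normrM (ger0_norm (ler0n _ 2)).
  by have := ler_normD A B; move: h3 h4 h5; lra.
rewrite /lgs3 (le_trans (ler_normD _ _))//.
have h8 : `|lgs x * (2 * (A + B) - C)| <= 1 * (10 * (a * b * c)) by rewrite normrM ler_pM.
by move: h6 h8; lra.
Qed.

Lemma gbs2_le x : `|gbs2 x u h| <= 10 * (a * c * c).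
Proof.
have hu : `|gbs x u| <= a by exact: gbs_le.
have hh : `|gbs x h| <= c by exact: gbs_le.
have h1 : `|gbs1 x (fun i => u i * h i) h| <= 2 * (a * c * c).
  by apply: gbs1_le => // [|i]; rewrite ?mulr_ge0// normrM ler_pM.
have h2 : `|gbs1 x u h * gbs x h| <= 2 * (a * c) * c by rewrite normrM ler_pM// gbs1_le.
have h3 : `|gbs x u * gbs1 x h h| <= a * (2 * (c * c)) by rewrite normrM ler_pM// gbs1_le.
have ac0 : 0 <= a * c * c by rewrite !mulr_ge0.
rewrite /gbs2 (le_trans (ler_normB _ _))//.
have := ler_normD (gbs1 x u h * gbs x h) (gbs x u * gbs1 x h h).
by move: h1 h2 h3 ac0; lra.
Qed.

End Bounds.

Lemma lgs_taylor x h (c : R) : 0 <= c -> (forall i, `|h i| <= c) ->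
  `|lgs (fun i => x i + h i) - lgs x - lgs1 x h| <= 3 * (c * c).
Proof.
move=> c0 hc; rewrite -line1 -[in X in `|_ - X - _|](line0 x h) -[in lgs1 _ _](line0 x h).
apply: (drv2_le (f := fun t => lgs (line x h t)) (df := fun t => lgs1 (line x h t) h) (ddf := fun t => lgs2 (line x h t) h h)).
- by move=> t; exact: drv_lgs.
- by move=> t; exact: drv_lgs1.
- by move=> t; exact: lgs2_le.
Qed.

Lemma lgs1_taylor x u h (a c : R) : 0 <= a -> 0 <= c ->
  (forall i, `|u i| <= a) -> (forall i, `|h i| <= c) ->
  `|lgs1 (fun i => x i + h i) u - lgs1 x u - lgs2 x u h| <= 13 * (a * c * c).
Proof.
move=> a0 c0 ua hc; rewrite -line1 -[in X in `|_ - X - _|](line0 x h) -[in lgs2 _ _ _](line0 x h).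
apply: (drv2_le (f := fun t => lgs1 (line x h t) u) (df := fun t => lgs2 (line x h t) u h) (ddf := fun t => lgs3 (line x h t) u h h)).
- by move=> t; exact: drv_lgs1.
- by move=> t; exact: drv_lgs2.
- by move=> t; exact: lgs3_le.
Qed.

Lemma lgs2_lip x u v h (a b c : R) : 0 <= a -> 0 <= b -> 0 <= c ->
  (forall i, `|u i| <= a) -> (forall i, `|v i| <= b) -> (forall i, `|h i| <= c) ->
  `|lgs2 (fun i => x i + h i) u v - lgs2 x u v| <= 13 * (a * b * c).
Proof.
move=> a0 b0 c0 ua vb hc; rewrite -line1 -[in X in `|_ - X|](line0 x h).
apply: (drv_le (f := fun t => lgs2 (line x h t) u v) (df := fun t => lgs3 (line x h t) u v h)).
- by move=> t; exact: drv_lgs2.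
- by move=> t; exact: lgs3_le.
Qed.

Lemma gbs_taylor x u h (a c : R) : 0 <= a -> 0 <= c ->
  (forall i, `|u i| <= a) -> (forall i, `|h i| <= c) ->
  `|gbs (fun i => x i + h i) u - gbs x u - gbs1 x u h| <= 10 * (a * c * c).
Proof.
move=> a0 c0 ua hc; rewrite -line1 -[in X in `|_ - X - _|](line0 x h) -[in gbs1 _ _ _](line0 x h).
apply: (drv2_le (f := fun t => gbs (line x h t) u) (df := fun t => gbs1 (line x h t) u h) (ddf := fun t => gbs2 (line x h t) u h)).
- by move=> t; exact: drv_gbs.
- by move=> t; exact: drv_gbs1.
- by move=> t; exact: gbs2_le.
Qed.

End SoftMax.

(** * Gaussian vectors *)

Section NormalDensity.
Context (R : realType).
Local Notation leb := (@lebesgue_measure R).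
Local Notation TR := (measurableTypeR R).
Variables (m s : R).
Local Notation gam := (normal_prob m s).
Local Notation pdf := (normal_pdf m s).

Let mpdf : measurable_fun setT (fun x : TR => (pdf x)%:E).
Proof. by apply/measurable_EFinP; exact: measurable_normal_pdf. Qed.

Let pdf0 x : (0 <= (pdf x)%:E)%E.
Proof. by rewrite lee_fin normal_pdf_ge0. Qed.

Let density_indic (A : set TR) : measurable A ->
  (\int[gam]_x (\1_A x)%:E = \int[leb]_x ((\1_A x)%:E * (pdf x)%:E))%E.
Proof.
move=> mA; rewrite integral_indic//= setIT /normal_prob integral_mkcond.
by apply: eq_integral => x _; rewrite patchE indicE; case: ifP => _; rewrite ?mul1e ?mul0e.
Qed.

Import HBNNSimple.

Let density_nnsfun (f : {nnsfun TR >-> R}) :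
  (\int[gam]_x (f x)%:E = \int[leb]_x ((f x)%:E * (pdf x)%:E))%E.
Proof.
under [LHS]eq_integral do rewrite fimfunE -fsumEFin//.
rewrite [LHS]ge0_integral_fsum//; last 2 first.
  - by move=> r; exact/measurable_EFinP/measurableT_comp.
  - by move=> n x _; rewrite EFinM nnfun_muleindic_ge0.
under [RHS]eq_integral.
  move=> x xD; rewrite fimfunE -fsumEFin// ge0_mule_fsuml; last first.
    by move=> r; rewrite EFinM nnfun_muleindic_ge0.
  over.
rewrite [RHS]ge0_integral_fsum//; last 2 first.
  - move=> r; apply: emeasurable_funM => //.
    by apply/measurable_EFinP; do 2 apply/measurableT_comp => //.
  - by move=> n x _; rewrite EFinM mule_ge0//; rewrite nnfun_muleindic_ge0.
apply: eq_fsbigr => r _.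
have [r0|r0] := leP 0 r.
  rewrite integralZl_indic_nnsfun//= density_indic//.
  rewrite -ge0_integralZl//=.
  - by apply: eq_integral => x _; rewrite EFinM muleA.
  - by apply: emeasurable_funM => //; apply/measurable_EFinP.
  - by move=> x _; rewrite mule_ge0// lee_fin indicE.
have e x : \1_(f @^-1` [set r]) x = 0 :> R.
  rewrite indicE memNset// => /= fr.
  have : 0 <= f x by [].
  by rewrite fr leNgt r0.
rewrite !integral0_eq// => x _; by rewrite e mulr0 ?mul0e.
Qed.

(** Indicators, simple functions, monotone convergence. Expectations under a normal law become
    Lebesgue integrals, to which calculus applies. *)
Lemma ge0_integral_normal_prob (f : TR -> \bar R) :
  measurable_fun setT f -> (forall x, 0 <= f x)%E ->
  (\int[gam]_x f x = \int[leb]_x (f x * (pdf x)%:E))%E.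
Proof.
move=> mf f0; pose f_ := nnsfun_approx measurableT mf.
transitivity (lim (\int[gam]_x (f_ n x)%:E @[n --> \oo])%E).
  rewrite -monotone_convergence//=.
  - apply: eq_integral => ? /[!inE] xD; apply/esym/cvg_lim => //=.
    exact: cvg_nnsfun_approx.
  - by move=> n; exact/measurable_EFinP/measurable_funTS.
  - by move=> n ? _; rewrite lee_fin.
  - by move=> ? _ ? ? mn; rewrite lee_fin; exact/lefP/nd_nnsfun_approx.
transitivity (lim (\int[leb]_x ((f_ n x)%:E * (pdf x)%:E) @[n --> \oo])%E).
  by apply: congr_lim; apply/funext => n /=; exact: density_nnsfun.
rewrite -monotone_convergence//=.
- apply: eq_integral => x _; apply/cvg_lim => //=.
  by apply: cvgeMr => //; exact: cvg_nnsfun_approx.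
- by move=> n; apply: emeasurable_funM => //; exact/measurable_EFinP/measurable_funTS.
- by move=> n x _; rewrite mule_ge0// lee_fin.
- move=> x _ a b ab; rewrite lee_wpmul2r// lee_fin; exact/lefP/nd_nnsfun_approx.
Qed.

Lemma normal_itgP (h : TR -> R) : measurable_fun setT h ->
  itg gam h <-> leb.-integrable setT (fun x => (h x * pdf x)%:E).
Proof.
move=> mh.
have e : (\int[gam]_x `|(h x)%:E| = \int[leb]_x `|(h x * pdf x)%:E|)%E.
  rewrite ge0_integral_normal_prob//; last first.
    by apply: measurableT_comp => //; exact/measurable_EFinP.
  apply: eq_integral => x _; rewrite -EFinM; congr EFin.
  by rewrite normrM (ger0_norm (normal_pdf_ge0 _ _ _)).
split=> /integrableP[_ hi]; apply/integrableP; split.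
- by apply/measurable_EFinP; apply: measurable_funM => //; exact: measurable_normal_pdf.
- by rewrite -e.
- exact/measurable_EFinP.
- by rewrite [ltLHS]e.
Qed.

Lemma normal_Ex (h : TR -> R) : itg gam h -> Ex gam h = \int[leb]_x (h x * pdf x).
Proof.
move=> ih; have mh := itg_meas ih.
have ge0E (g : TR -> R) : itg gam g -> (forall x, 0 <= g x) ->
    Ex gam g = \int[leb]_x (g x * pdf x).
  move=> ig g0; rewrite /Ex /Rintegral; congr fine.
  rewrite ge0_integral_normal_prob//; last by apply/measurable_EFinP; exact: itg_meas ig.
have iN := itg_norm ih; have iP := itgD iN ih.
have P0 x : 0 <= `|h x| + h x by rewrite -lerBlDr sub0r -normrN ler_norm.
have hE : h = fun x => (`|h x| + h x) - `|h x| by apply/funext => x; rewrite addrAC subrr add0r.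
rewrite {1}hE ExB// (ge0E _ iP P0) (ge0E _ iN (fun x => normr_ge0 _)).
rewrite -RintegralB//.
- by apply: eq_Rintegral => x _; rewrite -mulrBl addrAC subrr add0r.
- by apply/(normal_itgP (itg_meas iP)).
- by apply/(normal_itgP (itg_meas iN)).
Qed.

End NormalDensity.

Section StandardNormal.
Context (R : realType).
Local Notation leb := (@lebesgue_measure R).
Local Notation TR := (measurableTypeR R).
Local Notation gam := (normal_prob (0 : R) 1).
Local Notation pdf := (normal_pdf (0 : R) 1).

Lemma std_pdfE (x : R) : pdf x = normal_peak 1 * expR (- (x ^+ 2 / 2)).
Proof.
rewrite normal_pdfE ?oner_neq0// /normal_fun subr0 expr1n.
by rewrite mulNr.
Qed.

(** The exponential changes the variance from 1 to s^2, so exponential moments of the square reduce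
    to the integrability of a normal density. *)
Lemma normal_tail_dom (s : R) : 1 < s -> exists2 c : R, 0 <= c & forall (x : R) , expR ((1 - s ^- 2) / 2 * x ^+ 2) * pdf x = c * normal_pdf 0 s x.
Proof.
move=> s1; have s0 : s != 0 by rewrite gt_eqF// (lt_trans ltr01).
exists (normal_peak 1 / normal_peak s); first by rewrite divr_ge0 ?normal_peak_ge0.
move=> x; rewrite std_pdfE normal_pdfE// /normal_fun subr0.
rewrite mulrCA -expRD [RHS]mulrA divfK ?gt_eqF ?normal_peak_gt0//.
by congr (_ * expR _); field.
Qed.

Lemma itg_std_exp2 : itg gam (fun x : TR => expR (x ^+ 2 / 4)).
Proof.
have m1 : measurable_fun setT (fun x : TR => expR (x ^+ 2 / 4)).
  by apply: measurableT_comp => //; apply: measurable_funM => //; exact: measurable_funX.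
apply: (normal_itgP 0 1 m1).2.
(* Variance 2 corresponds to the exponent (1 - 1/2) / 2 = 1/4. *)
have s2 : Num.sqrt 2 ^+ 2 = 2 :> R by rewrite sqr_sqrtr.
have s1 : 1 < Num.sqrt 2 :> R by rewrite -[ltLHS]sqrtr1 ltr_sqrt// ltr1n.
have [c c0 hc] := normal_tail_dom s1.
rewrite (_ : (fun x : TR => _) = fun x => (c%:E * (normal_pdf 0 (Num.sqrt 2) x)%:E)%E); last first.
  apply/funext => x; rewrite -EFinM -hc s2; congr (_%:E); congr (expR _ * _).
  by field.
by apply: integrableZl => //; exact: integrable_normal_pdf.
Qed.

Lemma itg_std_pow (k : nat) : itg gam (fun x : TR => x ^+ (2 * k)).
Proof.
have mX j : measurable_fun setT (fun x : TR => x ^+ j) by exact: measurable_funX.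
case: k => [|k]; first by rewrite muln0; under eq_fun do rewrite expr0; exact: itg_cst.
apply: (itg_le (mX _) (itgZ (4 ^+ k.+1 * k.+1`!%:R) itg_std_exp2)) => x.
have y0 : 0 <= x ^+ 2 / 4 by rewrite divr_ge0 ?sqr_ge0.
have h : (x ^+ 2 / 4) ^+ k.+1 <= k.+1`!%:R * expR (x ^+ 2 / 4).
  have f0 : 0 < k.+1`!%:R :> R by rewrite ltr0n fact_gt0.
  rewrite -ler_pdivrMl// mulrC; apply: le_trans (expR_ge1Dxn k y0).
  by rewrite lerDr.
rewrite ger0_norm; last by rewrite exprM exprn_ge0// sqr_ge0.
have -> : x ^+ (2 * k.+1) = 4 ^+ k.+1 * (x ^+ 2 / 4) ^+ k.+1.
  by rewrite exprM -exprMn; congr (_ ^+ _); field.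
by rewrite -mulrA ler_pM2l// exprn_gt0.
Qed.

Lemma itg_std_quad (h : R -> R) (c : R) : measurable_fun setT (h : TR -> R) ->
  (forall x, `|h x| <= c * (1 + x ^+ 2)) -> itg gam (h : TR -> R).
Proof.
move=> mh hc; apply: (itg_le mh (itgZ c (itgD (itg_cst _ 1) (itg_std_pow 1)))) => x.
by rewrite muln1.
Qed.

Lemma integral_deriv_eq0 (F f : R -> R) : (forall x : R, is_derive x (1 : R) F (f x)) ->
  continuous f -> leb.-integrable setT (fun x : TR => (f x)%:E) ->
  (F n%:R : R) @[n --> \oo] --> (0 : R) -> (F (- n%:R) : R) @[n --> \oo] --> (0 : R) ->
  \int[leb]_x (f x) = 0.
Proof.
move=> dF cf if_ F1 F2.
pose I n : set TR := `[- n.+1%:R, n.+1%:R]%classic.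
have mI n : measurable (I n) by exact: measurable_itv.
have cF : continuous F.
  by move=> x; apply/differentiable_continuous/derivable1_diffP; case: (dF x).
have FTC n : (\int[leb]_(x in I n) (f x)%:E = (F n.+1%:R)%:E - (F (- n.+1%:R))%:E)%E.
  apply: continuous_FTC2.
  - by rewrite (@lt_trans _ _ 0)// ?oppr_lt0 ltr0Sn.
  - exact: continuous_subspaceT.
  - split.
    + by move=> x _; case: (dF x).
    + by apply: cvg_at_right_filter; exact: cF.
    + by apply: cvg_at_left_filter; exact: cF.
  - by move=> x _; rewrite derive1E; exact: derive_val.
have cv : (\int[leb]_x ((f \_ (I n)) x)%:E @[n --> \oo] --> \int[leb]_x (f x)%:E)%E.
  have mf : measurable_fun setT (f : TR -> R) by have /integrableP[/measurable_EFinP] := if_.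
  have [] // := @dominated_convergence _ _ _ leb setT measurableT
    (fun n (x : TR) => ((f \_ (I n)) x)%:E) (fun x : TR => (f x)%:E) (fun x : TR => `|(f x)%:E|)%E.
  - move=> n; apply/measurable_EFinP.
    by apply/(measurable_restrictT _ (mI n)); exact: measurable_funTS.
  - exact/measurable_EFinP.
  - apply: aeW => x _; apply: cvg_near_cst.
    exists (Num.truncn `|x|) => // n /= hn.
    rewrite patchE mem_set// /I /= in_itv /= -ler_norml.
    by rewrite (le_trans (ltW (truncnS_gt _)))// ler_nat.
  - exact: integrable_abse.
  - apply: aeW => x n _; rewrite patchE; case: ifP => // _.
    by rewrite [X in (X <= _)%E](_ : _ = 0%E) ?abse_ge0//= normr0.
have cv0 : (\int[leb]_x ((f \_ (I n)) x)%:E @[n --> \oo] --> (0 : R)%:E)%E.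
  have -> : (fun n => \int[leb]_x ((f \_ (I n)) x)%:E)%E =
      fun n => (F n.+1%:R - F (- n.+1%:R))%:E.
    apply/funext => n; rewrite EFinB -FTC [RHS]integral_mkcond.
    by congr integral; apply/funext => x; rewrite !patchE; case: ifP.
  apply: cvg_EFin; first exact: nearW.
  rewrite -[X in _ --> X](subr0 (0 : R)); apply: cvgB.
    by move: F1; rewrite -(cvg_shiftS (fun n => F n%:R)).
  by move: F2; rewrite -(cvg_shiftS (fun n => F (- n%:R))).
by rewrite /Rintegral (cvg_unique _ cv cv0).
Qed.

Lemma is_derive_std_pdf (x : R) : is_derive x 1 (pdf : R -> R) (- (x * pdf x)).
Proof.
have -> : pdf = fun x => normal_peak 1 * expR (- (x ^+ 2 / 2)).
  by apply/funext => y; exact: std_pdfE.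
have dc (k : R) : is_derive x 1 (fun _ : R => k) (0 : R) by exact: is_derive_cst.
have d1 : is_derive x 1 (fun x : R => - (x ^+ 2 / 2)) (- x).
  have d0 : is_derive x 1 (fun x : R => x) (1 : R) by exact: is_derive_id.
  have -> : (fun x : R => - (x ^+ 2 / 2)) = fun x => - ((x * x) * 2^-1) by apply/funext => y; rewrite expr2.
  apply: (is_derive_eq (drvN (drvM (drvM d0 d0) (dc 2^-1)))).
  by field.
have d2 := @is_derive1_comp _ expR (fun x : R => - (x ^+ 2 / 2)) x _ _ (is_derive_expR _) d1.
apply: (is_derive_eq (drvM (dc (normal_peak 1)) d2)).
by rewrite mul0r add0r /=; ring.
Qed.

Lemma std_pdf_decay (n : nat) (x : R) : `|x| = n%:R -> (1 + `|x|) * pdf x <= 4 * normal_peak 1 * n.+1%:R^-1.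
Proof.
move=> xn; rewrite std_pdfE.
rewrite [leLHS]mulrCA (_ : 4 * normal_peak 1 * _ = normal_peak 1 * (4 * n.+1%:R^-1)); last by rewrite mulrA [4 * _]mulrC.
rewrite ler_wpM2l ?normal_peak_ge0//.
rewrite expRN ler_pdivrMr ?expR_gt0//.
have x2 : x ^+ 2 = n%:R ^+ 2 by rewrite -xn real_normK// num_real.
have h := expR_ge1Dx (x ^+ 2 / 2).
rewrite mulrAC ler_pdivlMr// -natr1.
apply: (@le_trans _ _ (4 * (1 + x ^+ 2 / 2))); last by rewrite ler_pM2l.
rewrite x2 xn; move: (n%:R) (ler0n R n) => y y0; clear -y0; nra.
Qed.

Lemma squeeze0 (v u : nat -> R) : (forall n, `|u n| <= v n) ->
  v n @[n --> \oo] --> 0 -> u n @[n --> \oo] --> 0.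
Proof.
move=> uv v0; apply/norm_cvg0P; apply: (squeeze_cvgr (f := fun=> 0)) v0 => //.
- by apply: nearW => n; rewrite normr_ge0 uv.
- exact: cvg_cst.
Qed.

(** Gaussian integration by parts: h times the density has derivative (h' - x h) times the density,
    and the linear growth of h makes it vanish at infinity. *)
Lemma std_ibp (h dh : R -> R) (c : R) : (forall x : R, is_derive x (1 : R) h (dh x)) -> continuous dh ->
  (forall x, `|h x| <= c * (1 + `|x|)) -> (forall x, `|dh x| <= c * (1 + x ^+ 2)) ->
  [/\ itg gam (dh : TR -> R), itg gam (fun x : TR => x * h x) &
     Ex gam (fun x : TR => x * h x) = Ex gam (dh : TR -> R)].
Proof.
move=> dH cdh hc dhc.
have c0 : 0 <= c.
  by have := hc 0; rewrite normr0 addr0 mulr1; exact: le_trans (normr_ge0 _).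
have ch : continuous h.
  by move=> x; apply/differentiable_continuous/derivable1_diffP; case: (dH x).
have mh : measurable_fun setT (h : TR -> R) by exact: continuous_measurable_fun.
have mdh : measurable_fun setT (dh : TR -> R) by exact: continuous_measurable_fun.
have idh : itg gam (dh : TR -> R) by exact: (itg_std_quad mdh dhc).
have ixh : itg gam (fun x : TR => x * h x).
  apply: (@itg_std_quad _ (2 * c)); first exact: measurable_funM.
  move=> x; rewrite normrM; apply: (@le_trans _ _ (`|x| * (c * (1 + `|x|)))).
    by rewrite ler_wpM2l.
  have -> : x ^+ 2 = `|x| ^+ 2 by rewrite real_normK// num_real.
  move: (`|x|) (normr_ge0 x) => y y0; rewrite mulrCA -mulrA [2 * _]mulrCA ler_wpM2l//.
  by clear -y0; nra.
split=> //; apply/eqP; rewrite eq_sym -subr_eq0 -ExB//; apply/eqP.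
rewrite normal_Ex; last exact: itgB.
have hz : c * (4 * normal_peak 1 * n.+1%:R^-1) @[n --> \oo] --> (0 : R).
  rewrite -[X in _ --> X](mulr0 (c * (4 * normal_peak 1))).
  under eq_fun do rewrite mulrA.
  by apply: cvgMr; exact: cvg_harmonic.
have hd (n : nat) (x : R) : `|x| = n%:R ->
    `|h x * pdf x| <= c * (4 * normal_peak 1 * n.+1%:R^-1).
  move=> xn; rewrite normrM (ger0_norm (normal_pdf_ge0 _ _ _)).
  apply: (@le_trans _ _ (c * (1 + `|x|) * pdf x)).
    by rewrite ler_wpM2r// normal_pdf_ge0.
  by rewrite -mulrA ler_wpM2l//; exact: std_pdf_decay.
apply: (@integral_deriv_eq0 (fun x => h x * pdf x)).
- move=> x; apply: (is_derive_eq (drvM (dH x) (is_derive_std_pdf x))).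
  by ring.
- have cp : continuous (pdf : R -> R).
    by apply: continuous_normal_pdf; exact: oner_neq0.
  move=> x; apply: (@cvgM _ _ _ _ _ _ _ _ _ (cp x)); apply: cvgB; first exact: cdh.
  by apply: cvgM; [exact: cvg_id|exact: ch].
- exact: (normal_itgP 0 1 (itg_meas (itgB idh ixh))).1 (itgB idh ixh).
- apply: (squeeze0 (v := fun n => c * (4 * normal_peak 1 * n.+1%:R^-1))) => [n|]; last exact: hz.
  exact: hd (normr_nat _ _).
- apply: (squeeze0 (v := fun n => c * (4 * normal_peak 1 * n.+1%:R^-1))) => [n|]; last exact: hz.
  by apply: hd; rewrite normrN normr_nat.
Qed.

Lemma std_mean : Ex gam (fun x : TR => x) = 0.
Proof.
have [|||_ _] := @std_ibp (fun=> 1) (fun=> 0) 1.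
- exact: cst_continuous.
- by move=> x; rewrite normr1 mul1r lerDl.
- by move=> x; rewrite normr0 mul1r addr_ge0 ?sqr_ge0.
have -> : (fun x : TR => x * 1) = (fun x : TR => x) by apply/funext => x; rewrite mulr1.
by move=> ->; rewrite Ex_cst.
Qed.

Lemma std_var : itg gam (fun x : TR => x * x) /\ Ex gam (fun x : TR => x * x) = 1.
Proof.
have [|||_ h ->] := @std_ibp (fun x => x) (fun=> 1) 1.
- exact: cst_continuous.
- by move=> x; rewrite mul1r lerDr.
- by move=> x; rewrite normr1 mul1r lerDl sqr_ge0.
by rewrite Ex_cst.
Qed.

(** Used to differentiate an expectation: a pointwise quadratic remainder is integrated, in place of
    an exchange of limit and expectation. *)
Lemma drv_quad (f : R -> R) (s a C : R) :
  (forall h, `|f (s + h) - f s - h * a| <= C * h ^+ 2) -> is_derive s (1 : R) f a.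
Proof.
move=> fC.
have C0 : 0 <= C by have := fC 1; rewrite expr1n mulr1; exact: le_trans (normr_ge0 _).
have cv : h^-1 *: (f (h *: (1 : R) + s) - f s) @[h --> 0^'] --> a.
  apply/cvgrPdist_le => e e0; near=> h.
  have h0 : h != 0 by near: h; exact: nbhs_dnbhs_neq.
  have e1 : h^-1 *: (f (h *: (1 : R) + s) - f s) - a = h^-1 * (f (s + h) - f s - h * a).
    by rewrite /GRing.scale /= mulr1 [h + s]addrC; field.
  rewrite distrC e1 normrM normfV ler_pdivrMl ?normr_gt0//.
  apply: (le_trans (fC h)); rewrite -real_normK ?num_real// expr2 mulrCA ler_wpM2l//.
  have : `|h| < e / (C + 1).
    by near: h; apply: dnbhs0_lt; rewrite divr_gt0// ltr_wpDl.
  rewrite ltr_pdivlMr ?ltr_wpDl// => /ltW; apply: le_trans.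
  by rewrite mulrC ler_wpM2l// lerDl.
apply: DeriveDef; first by apply/cvg_ex; exists a.
exact/cvg_lim.
Unshelve. all: by end_near.
Qed.

Lemma cos_taylor (a b : R) : `|cos (a + b) - cos a + b * sin a| <= b ^+ 2.
Proof.
have d0 t : is_derive t (1 : R) (fun t : R => a + t * b) b.
  have d1 : is_derive t (1 : R) (fun t : R => t) (1 : R) by exact: is_derive_id.
  apply: (is_derive_eq (drvD (is_derive_cst a t (1 : R)) (drvM d1 (is_derive_cst b t (1 : R))))).
  by rewrite /= mulr0 addr0 mul1r add0r.
have dc t : is_derive t (1 : R) (fun t : R => cos (a + t * b)) (- (b * sin (a + t * b))).
  by apply: (is_derive_eq (is_derive1_comp (is_derive_cos _) (d0 t))); rewrite mulNr mulrC.
have ds t : is_derive t (1 : R) (fun t : R => - (b * sin (a + t * b))) (- (b * (b * cos (a + t * b)))).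
  have d2 := drvM (is_derive_cst b t (1 : R)) (is_derive1_comp (is_derive_sin _) (d0 t)).
  apply: (is_derive_eq (drvN d2)).
  by rewrite mul0r add0r [b * cos _]mulrC.
have := @drv2_le _ _ _ _ (b ^+ 2) dc ds _.
rewrite mul1r mul0r addr0 opprK; apply => t.
rewrite normrN !normrM mulrA -expr2 real_normK ?num_real// ler_piMr ?sqr_ge0//.
by rewrite ler_norml cos_geN1 cos_le1.
Qed.

Let mcos (s k : R) : measurable_fun setT (fun x : TR => cos (s * x + k)).
Proof.
apply: (measurableT_comp (f := cos)).
  by apply: continuous_measurable_fun; exact: continuous_cos.
by apply: measurable_funD => //; exact: measurable_funM.
Qed.

Lemma cos_abs_le1 (y : R) : `|cos y| <= 1.
Proof. by rewrite ler_norml cos_geN1 cos_le1. Qed.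

Lemma sin_abs_le1 (y : R) : `|sin y| <= 1.
Proof. by rewrite ler_norml sin_geN1 sin_le1. Qed.

Let i_cos (s k : R) : itg gam (fun x : TR => cos (s * x + k)).
Proof. by apply: (@itg_bnd _ _ _ _ _ 1) => // x; exact: cos_abs_le1. Qed.

Let i_xsin (s k : R) : itg gam (fun x : TR => x * sin (s * x + k)) /\
  Ex gam (fun x : TR => x * sin (s * x + k)) = s * Ex gam (fun x : TR => cos (s * x + k)).
Proof.
have d0 t : is_derive t (1 : R) (fun t : R => s * t + k) s.
  have d1 : is_derive t (1 : R) (fun t : R => t) (1 : R) by exact: is_derive_id.
  apply: (is_derive_eq (drvD (drvM (is_derive_cst s t (1 : R)) d1) (is_derive_cst k t (1 : R)))).
  by rewrite /= mul0r mulr1 add0r addr0.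
have [||||_ h1 h2] := @std_ibp (fun x => sin (s * x + k)) (fun x => s * cos (s * x + k)) (1 + `|s|).
- by move=> x; apply: (is_derive_eq (is_derive1_comp (is_derive_sin _) (d0 x))); rewrite mulrC.
- move=> x; apply: cvgMr; apply: (@continuous_comp _ _ _ (fun x => s * x + k) cos); last exact: continuous_cos.
  by apply: cvgD; [apply: cvgMr; exact: cvg_id|exact: cvg_cst].
- move=> x; apply: (le_trans (sin_abs_le1 _)).
  by rewrite -[leLHS]mulr1 ler_pM// lerDl.
- move=> x; rewrite normrM ler_pM//; first by rewrite lerDr.
  by apply: (le_trans (cos_abs_le1 _)); rewrite lerDl sqr_ge0.
split; first exact: h1.
by rewrite h2 (ExZ s (i_cos s k)).
Qed.

(** For the left side psi(s), integration by parts gives psi' = - s psi; hence psi(s) exp(s^2 / 2)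
    is constant, equal to cos k at s = 0. *)
Lemma std_cos (s k : R) : Ex gam (fun x : TR => cos (s * x + k)) = expR (- (s ^+ 2 / 2)) * cos k.
Proof.
pose psi s := Ex gam (fun x : TR => cos (s * x + k)).
have [v1 v2] := std_var.
have dpsi t : is_derive t (1 : R) psi (- (t * psi t)).
  apply: (@drv_quad _ _ _ 1) => h; have [k1 k2] := i_xsin t k.
  have iB : itg gam (fun x : TR => cos ((t + h) * x + k) - cos (t * x + k)) by apply: itgB; exact: i_cos.
  have -> : psi (t + h) - psi t - h * - (t * psi t) =
      Ex gam (fun x : TR => cos ((t + h) * x + k) - cos (t * x + k) + h * (x * sin (t * x + k))).
    rewrite (ExD iB (itgZ h k1)) (ExB (i_cos _ _) (i_cos _ _)) (ExZ h k1).
    by rewrite k2 -/(psi t) mulrN opprK.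
  apply: (le_trans (norm_Ex_le (itg_meas (itgD iB (itgZ h k1))) (itgZ (h ^+ 2) v1) _)).
  - move=> x; have := cos_taylor (t * x + k) (h * x).
    have -> : (t + h) * x + k = t * x + k + h * x by ring.
    by rewrite -mulrA exprMn [x ^+ 2]expr2.
  - by rewrite ExZ// v2 mulr1 mul1r.
have de t : is_derive t (1 : R) (fun t : R => expR (t ^+ 2 / 2)) (t * expR (t ^+ 2 / 2)).
  have d1 : is_derive t (1 : R) (fun t : R => t) (1 : R) by exact: is_derive_id.
  have -> : (fun t : R => expR (t ^+ 2 / 2)) = fun t => expR ((t * t) * 2^-1) by apply/funext => y; rewrite expr2.
  apply: (is_derive_eq (is_derive1_comp (is_derive_expR _) (drvM (drvM d1 d1) (is_derive_cst (2^-1 : R) t (1 : R))))).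
  by rewrite /= expr2; field.
have dz t : is_derive t (1 : R) (fun t => psi t * expR (t ^+ 2 / 2)) 0.
  by apply: (is_derive_eq (drvM (dpsi t) (de t))); ring.
have := @is_derive_0_is_cst _ _ s 0 dz.
rewrite expr0n/= mul0r expR0 mulr1 {2}/psi.
have -> : (fun x : TR => cos (0 * x + k)) = fun=> cos k by apply/funext => x; rewrite mul0r add0r.
by rewrite Ex_cst expRN => <-; rewrite -/(psi s) mulrC mulfK// gt_eqF ?expR_gt0.
Qed.

End StandardNormal.

(** * Smoothing by narrow normal laws *)

Section NormalSmoothing.
Context (R : realType).
Local Notation leb := (@lebesgue_measure R).
Local Notation TR := (measurableTypeR R).
Local Notation gam := (normal_prob (0 : R) 1).

(** [std_cos] read backwards: the Gaussian function is its own Fourier transform up to scaling,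
    which serves as an inversion formula. *)
Lemma normal_pdf_cos (m s x : R) : s != 0 ->
  normal_pdf m s x = normal_peak s * Ex gam (fun b : TR => cos ((x - m) / s * b + 0)).
Proof.
move=> s0; rewrite std_cos cos0 mulr1 normal_pdfE// /normal_fun; congr (_ * expR _).
by field.
Qed.

(** Domination by a normal density of variance 2 s^2. The order s^2 is what matters; the constant 8
    is crude. *)
Lemma normal_second_moment (m s : R) : 0 < s ->
  itg (normal_prob m s) (fun x : TR => (x - m) ^+ 2) /\
  Ex (normal_prob m s) (fun x : TR => (x - m) ^+ 2) <= 8 * s ^+ 2.
Proof.
move=> s0; pose t := Num.sqrt 2 * s.
have t0 : t != 0 by rewrite mulf_neq0 ?gt_eqF ?sqrtr_gt0.
have t2 : t ^+ 2 = 2 * s ^+ 2 by rewrite exprMn sqr_sqrtr.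
have pk : normal_peak s <= 2 * normal_peak t.
  rewrite /normal_peak t2.
  have -> : 2 * s ^+ 2 * pi *+ 2 = 2 * (s ^+ 2 * pi *+ 2) by rewrite -mulrA mulrnAr.
  have a0 : 0 < s ^+ 2 * pi *+ 2 by rewrite pmulrn_rgt0// mulr_gt0 ?exprn_gt0 ?pi_gt0.
  move: (_ *+ 2) a0 => a a0.
  rewrite ler_pdivlMr ?sqrtr_gt0 ?mulr_gt0// mulrC ler_pdivrMr ?sqrtr_gt0//.
  rewrite -ler_sqr ?nnegrE ?mulr_ge0 ?sqrtr_ge0// exprMn !sqr_sqrtr ?mulr_ge0 ?(ltW a0)//.
  by rewrite ler_pM2r// expr2 -natrM ler_nat.
have hb (x : R) : (x - m) ^+ 2 * normal_pdf m s x <= 8 * s ^+ 2 * normal_pdf m t x.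
  rewrite !normal_pdfE ?(gt_eqF s0)// /normal_fun t2.
  set u := (x - m) ^+ 2; have u0 : 0 <= u by rewrite sqr_ge0.
  have s2 : 0 < s ^+ 2 by rewrite exprn_gt0.
  set q := u / (4 * s ^+ 2); have q0 : 0 <= q by rewrite divr_ge0// mulr_ge0// ltW.
  have -> : - u / (s ^+ 2 *+ 2) = - q + - q by rewrite /q; field; rewrite gt_eqF.
  have -> : - u / (2 * s ^+ 2 *+ 2) = - q by rewrite /q; field; rewrite gt_eqF.
  have -> : u = 4 * s ^+ 2 * q by rewrite /q; field; rewrite gt_eqF.
  rewrite expRD.
  have h : q * expR (- q) <= 1.
    rewrite expRN ler_pdivrMr ?expR_gt0// mul1r; apply: le_trans (expR_ge1Dx q).
    by rewrite lerDr.
  apply: (@le_trans _ _ (4 * s ^+ 2 * (normal_peak s * expR (- q)))).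
    rewrite -[X in X <= _]mulrA ler_wpM2l//; first by rewrite mulr_ge0// ltW.
    rewrite mulrCA ler_wpM2l ?normal_peak_ge0// mulrA.
    by rewrite -[leRHS]mul1r ler_wpM2r// expR_ge0.
  have -> : 8 * s ^+ 2 * (normal_peak t * expR (- q)) = 4 * s ^+ 2 * (2 * normal_peak t * expR (- q)) by ring.
  apply: ler_wpM2l; first by rewrite mulr_ge0// ltW.
  by apply: ler_wpM2r => //; exact: expR_ge0.
have mq : measurable_fun setT (fun x : TR => (x - m) ^+ 2).
  by apply: measurable_funX; exact: measurable_funB.
have i2 : leb.-integrable setT (fun x : TR => (8 * s ^+ 2 * normal_pdf m t x)%:E).
  have -> : (fun x : TR => (8 * s ^+ 2 * normal_pdf m t x)%:E) =
    (fun x => (8 * s ^+ 2)%:E * (normal_pdf m t x)%:E)%E by apply/funext => x; rewrite EFinM.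
  by apply: integrableZl => //; exact: integrable_normal_pdf.
have i1 : leb.-integrable setT (fun x : TR => ((x - m) ^+ 2 * normal_pdf m s x)%:E).
  apply: le_integrable i2 => //.
    by apply/measurable_EFinP; apply: measurable_funM => //; exact: measurable_normal_pdf.
  move=> x _; rewrite lee_fin !ger0_norm ?hb// mulr_ge0 ?sqr_ge0 ?normal_pdf_ge0//.
  by rewrite mulr_ge0// sqr_ge0.
have iq := (normal_itgP m s mq).2 i1.
split=> //; rewrite normal_Ex//.
apply: (le_trans (le_Rintegral _ i1 i2 _)) => //.
rewrite RintegralZl//; last exact: integrable_normal_pdf.
by rewrite /Rintegral integral_normal_pdf mulr1.
Qed.

(** Near x the oscillation of G is at most e / 2; at distance at least d it is at most 2 M <= 2 M (y
    - x)^2 / d^2, which has small mean. *)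
Lemma normal_approx_id (G : R -> R) (M x : R) : measurable_fun setT (G : TR -> R) ->
  (forall y, `|G y| <= M) -> {for x, continuous G} ->
  Ex (normal_prob x n.+1%:R^-1) (G : TR -> R) @[n --> \oo] --> G x.
Proof.
move=> mG GM cG; have M0 : 0 <= M by exact: le_trans (normr_ge0 _) (GM 0).
apply/cvgrPdist_le => e e0.
have e2 : 0 < e / 2 by rewrite divr_gt0.
have [d /= d0 hd] : \forall y \near x, `|G x - G y| <= e / 2.
  by move/cvgrPdist_le : cG; exact.
pose C := 2 * M / d ^+ 2; have C0 : 0 <= C by rewrite divr_ge0 ?sqr_ge0// mulr_ge0.
have hG y : `|G y - G x| <= e / 2 + C * (y - x) ^+ 2.
  have [yd|yd] := ltP `|x - y| d.
    by rewrite distrC (le_trans (hd _ yd))// lerDl mulr_ge0// sqr_ge0.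
  apply: (@le_trans _ _ (2 * M)).
    by rewrite (le_trans (ler_normB _ _))// mulrDl mul1r lerD.
  rewrite -[leLHS]add0r lerD ?(ltW e2)// /C mulrAC ler_pdivlMr ?exprn_gt0//.
  rewrite ler_wpM2l ?mulr_ge0// -[leRHS]real_normK ?num_real// distrC.
  by rewrite ler_sqr ?nnegrE// ltW.
have key n : `|G x - Ex (normal_prob x n.+1%:R^-1) (G : TR -> R)| <= e / 2 + 8 * C * n.+1%:R^-1.
  have s0 : 0 < n.+1%:R^-1 :> R by rewrite invr_gt0.
  have [i2 h2] := normal_second_moment x s0.
  have iG : itg (normal_prob x n.+1%:R^-1) (G : TR -> R) by exact: (@itg_bnd _ _ _ _ _ M mG GM).
  rewrite distrC -[X in _ - X](Ex_cst (normal_prob x n.+1%:R^-1)) -ExB//; last exact: itg_cst.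
  apply: (le_trans (norm_Ex_le _ (itgD (itg_cst _ (e / 2)) (itgZ C i2)) hG)).
    exact: itg_meas (itgB iG (itg_cst _ _)).
  rewrite (ExD (itg_cst _ _) (itgZ C i2)) Ex_cst (ExZ C i2).
  rewrite lerD2l [8 * C]mulrC -[C * 8 * _]mulrA ler_wpM2l//.
  apply: (le_trans h2); rewrite ler_pM2l// expr2 ler_piMr ?(ltW s0)//.
  by rewrite invf_le1 ?ltr0n// ler1n.
have : (8 * C) * n.+1%:R^-1 @[n --> \oo] --> (8 * C * 0 : R) by apply: cvgMr; exact: cvg_harmonic.
rewrite mulr0 => /cvgrPdist_le /(_ _ e2) [N _ hN].
exists N => // n /= Nn; apply: (le_trans (key n)); rewrite [leRHS]splitr lerD//.
apply: le_trans (hN _ Nn); rewrite sub0r normrN; exact: ler_norm.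
Qed.

Section OneCoordinate.
Context (d : measure_display) (T : measurableType d) (P : probability T R).
Variables (V : T * TR -> R) (X : T -> R) (M : R).
Hypotheses (mV : measurable_fun setT V) (VM : forall z, `|V z| <= M).
Hypotheses (mX : measurable_fun setT X).

Let M0 : 0 <= M. Proof. by have := VM point; exact: le_trans. Qed.

Local Notation s n := (n.+1%:R^-1 : R).

Let mshift : measurable_fun setT (fun z : T * TR => z.2 - X z.1).
Proof. by apply: measurable_funB; [exact: measurable_snd|exact: (measurableT_comp mX measurable_fst)]. Qed.

Let mH (n : nat) : measurable_fun setT (fun z : T * TR => V z * normal_pdf (X z.1) (s n) z.2).
Proof.
apply: measurable_funM => //.
have -> : (fun z : T * TR => normal_pdf (X z.1) (s n) z.2) = fun z => normal_pdf 0 (s n) (z.2 - X z.1).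
  by apply/funext => z; rewrite !normal_pdfE// /normal_fun subr0.
apply: (measurableT_comp (f := normal_pdf 0 (s n))) => //; exact: measurable_normal_pdf.
Qed.

Let iH (n : nat) : (P \x leb)%E.-integrable setT (fun z : T * TR => (V z * normal_pdf (X z.1) (s n) z.2)%:E).
Proof.
apply/(integrable12ltyP P leb); first by apply/measurable_EFinP; exact: mH.
apply: (@le_lt_trans _ _ (\int[P]_w (M%:E))%E); last by rewrite integral_cst//= probability_setT mule1 ltry.
apply: ge0_le_integral => //.
- by move=> w _; apply: integral_ge0 => y _; exact: abse_ge0.
- apply: (measurable_fun_fubini_tonelli_F (m2 := leb) (fun z => `|(V z * normal_pdf (X z.1) (s n) z.2)%:E|%E)) => //.
  by apply: measurableT_comp => //; apply/measurable_EFinP; exact: mH.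
move=> w _; apply: (@le_trans _ _ (\int[leb]_y (M%:E * (normal_pdf (X w) (s n) y)%:E))%E).
  apply: ge0_le_integral => //.
  - by apply: measurableT_comp => //; apply/measurable_EFinP; exact: (measurable_sec1 w (mH n)).
  - by apply: emeasurable_funM => //; apply/measurable_EFinP; exact: measurable_normal_pdf.
  move=> y _; rewrite -EFinM lee_fin normrM (ger0_norm (normal_pdf_ge0 _ _ _)).
  by rewrite ler_wpM2r ?normal_pdf_ge0.
rewrite ge0_integralZl//.
- by rewrite integral_normal_pdf// mule1.
- by apply/measurable_EFinP; exact: measurable_normal_pdf.
- by move=> y _; rewrite lee_fin normal_pdf_ge0.
Qed.

Local Notation J n := (fun w => Ex (normal_prob (X w) (s n)) (fun y : TR => V (w, y))).

Let JE (n : nat) w : J n w = \int[leb]_y (V (w, y) * normal_pdf (X w) (s n) y).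
Proof.
by rewrite /= normal_Ex//; apply: (@itg_bnd _ _ _ _ _ M) => //; exact: (measurable_sec1 w mV).
Qed.

Let mJ (n : nat) : measurable_fun setT (J n).
Proof.
have -> : J n = fine \o (fun w => \int[leb]_y (V (w, y) * normal_pdf (X w) (s n) y)%:E)%E.
  by apply/funext => w; rewrite JE.
apply: (measurableT_comp (@fine_measurable _ _ measurableT)).
exact: (measurable_fubini_F (iH n)).
Qed.

(** The density is expanded into cosines and the integrals are exchanged, so that X enters only
    through expectations of V (w, y) times a cosine of an affine function of X w. *)
Lemma Ex_coord_smooth (n : nat) : Ex P (J n) = \int[leb]_y
  (normal_peak (s n) * Ex gam (fun b : TR => Ex P (fun w => V (w, y) * cos (b * - (s n)^-1 * X w + b * y / s n)))).
Proof.
have := Fubini (iH n).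
have -> : (\int[P]_w \int[leb]_y (V (w, y) * normal_pdf (X w) (s n) y)%:E = \int[P]_w (J n w)%:E)%E.
  apply: ae_eq_integral => //.
  - exact: (measurable_fubini_F (iH n)).
  - exact/measurable_EFinP.
  - have := ae_integrable1 (iH n).
    by apply: filterS => w hw _; rewrite JE /Rintegral fineK// integrable_fin_num.
move=> e; rewrite /Ex /Rintegral e; congr fine; apply: eq_integral => y _ /=.
have iVc (b : R) : itg P (fun w => V (w, y) * cos (b * - (s n)^-1 * X w + b * y / s n)).
  apply: (@itg_bnd _ _ _ _ _ M).
    apply: measurable_funM; first exact: (measurable_sec2 y mV).
    apply: (measurableT_comp (f := cos)); first by apply: continuous_measurable_fun; exact: continuous_cos.
    by apply: measurable_funD => //; exact: measurable_funM.
  by move=> w; rewrite normrM -[leRHS]mulr1 ler_pM// cos_abs_le1.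
pose F (z : T * TR) := V (z.1, y) * cos (z.2 * - (s n)^-1 * X z.1 + z.2 * y / s n).
have iF : itg (pprod P gam) F.
  apply: (@itg_bnd _ _ _ _ _ M).
    apply: measurable_funM.
      apply: (measurableT_comp mV); apply: measurable_fun_pair => //; exact: measurable_fst.
    apply: (measurableT_comp (f := cos)); first by apply: continuous_measurable_fun; exact: continuous_cos.
    apply: measurable_funD; apply: measurable_funM => //.
    - by apply: measurable_funM => //; exact: measurable_snd.
    - exact: (measurableT_comp mX measurable_fst).
    - by apply: measurable_funM => //; exact: measurable_snd.
  by move=> z; rewrite normrM -[leRHS]mulr1 ler_pM// cos_abs_le1.
have e1 w : V (w, y) * normal_pdf (X w) (s n) y = normal_peak (s n) * Ex gam (fun b : TR => F (w, b)).
  rewrite normal_pdf_cos// mulrCA; congr (_ * _); rewrite -ExZ.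
    apply: congr1; apply/funext => b; rewrite /F /=; congr (_ * cos _).
    by move: (_^-1)^-1 => k; ring.
  apply: (@itg_bnd _ _ _ _ _ 1); last by move=> b; exact: cos_abs_le1.
  apply: (measurableT_comp (f := cos)); first by apply: continuous_measurable_fun; exact: continuous_cos.
  by apply: measurable_funD => //; exact: measurable_funM.
have iG : itg P (fun w => Ex gam (fun b : TR => F (w, b))).
  apply: (@itg_bnd _ _ _ _ _ M); first exact: measurable_Ex_sec1 iF.
  move=> w; rewrite -[leRHS](Ex_cst gam); apply: norm_Ex_le.
  - exact: (measurable_sec1 w (itg_meas iF)).
  - exact: itg_cst.
  - by move=> b; rewrite /F normrM -[leRHS]mulr1 ler_pM// cos_abs_le1.
under eq_integral do rewrite e1.
by rewrite (ExE (itgZ _ iG)) ExZ// (Ex_swap iF).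
Qed.

Lemma Ex_coord_cvg : (forall w, continuous (fun y : R => V (w, y))) ->
  Ex P (J n) @[n --> \oo] --> Ex P (fun w => V (w, X w)).
Proof.
move=> cV; apply: (@Ex_cvg _ _ _ P (fun n => J n) (fun w => V (w, X w)) (fun=> M)) => //.
- by apply: (measurableT_comp mV); exact: measurable_fun_pair.
- move=> n w; rewrite -[leRHS](Ex_cst (normal_prob (X w) (s n))).
  apply: norm_Ex_le => //; [exact: (measurable_sec1 w mV)|exact: itg_cst].
- exact: itg_cst.
- move=> w; apply: (normal_approx_id (G := fun y => V (w, y)) (M := M)) => //.
  + exact: (measurable_sec1 w mV).
  + exact: cV.
Qed.

End OneCoordinate.

(* A coordinate is smoothed by a narrow normal law, whose density is a mixture
   of cosines. *)
Lemma Ex_coord_uniq d d' (T : measurableType d) (T' : measurableType d')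
    (P : probability T R) (P' : probability T' R) (V : T * TR -> R) (V' : T' * TR -> R)
    (X : T -> R) (X' : T' -> R) (M : R) :
  measurable_fun setT V -> measurable_fun setT V' -> measurable_fun setT X -> measurable_fun setT X' ->
  (forall z, `|V z| <= M) -> (forall z, `|V' z| <= M) ->
  (forall w, continuous (fun y : R => V (w, y))) -> (forall w, continuous (fun y : R => V' (w, y))) ->
  (forall y b c, Ex P (fun w => V (w, y) * cos (b * X w + c)) = Ex P' (fun w => V' (w, y) * cos (b * X' w + c))) ->
  Ex P (fun w => V (w, X w)) = Ex P' (fun w => V' (w, X' w)).
Proof.
move=> mV mV' mX mX' VM VM' cV cV' h.
have c1 := @Ex_coord_cvg _ _ P V X M mV VM mX cV; have c2 := @Ex_coord_cvg _ _ P' V' X' M mV' VM' mX' cV'.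
have e n : Ex P (fun w => Ex (normal_prob (X w) n.+1%:R^-1) (fun y : TR => V (w, y))) =
    Ex P' (fun w => Ex (normal_prob (X' w) n.+1%:R^-1) (fun y : TR => V' (w, y))).
  rewrite [LHS](@Ex_coord_smooth _ _ P V X M mV VM mX n) [RHS](@Ex_coord_smooth _ _ P' V' X' M mV' VM' mX' n).
  by apply: eq_Rintegral => y _; congr (_ * Ex _ _); apply/funext => b; exact: h.
by move: c1; under eq_fun do rewrite e; move=> c1; exact: cvg_unique _ c1 c2.
Qed.

End NormalSmoothing.

(** * The Cramer-Wold device *)

Section CramerWold.
Context (R : realType) (K : finType).
Local Notation TR := (measurableTypeR R).
Local Notation E := (prodR K R).

(** Continuity in each coordinate separately is enough, since coordinates are brought in one at a
    time. *)
Definition sep_continuous (f : E -> R) : Prop :=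
  forall u k, continuous (fun y : R => f (set_coord k u y)).

Section TwoVectors.
Context (d d' : measure_display) (T : measurableType d) (T' : measurableType d').
Variables (P : probability T R) (P' : probability T' R) (X : T -> E) (X' : T' -> E).
Hypotheses (mX : measurable_fun setT X) (mX' : measurable_fun setT X').
Hypothesis XX' : forall (a : K -> R) c,
  Ex P (fun w => cos (\sum_k a k * X w k + c)) = Ex P' (fun w => cos (\sum_k a k * X' w k + c)).

Let Z (l : seq K) (u : E) : E := merge (mem l) u (fun=> 0).

Let m_lin d0 (T0 : measurableType d0) (Y : T0 -> E) (a : K -> R) c : measurable_fun setT Y ->
  measurable_fun setT (fun w => cos (\sum_k a k * Y w k + c)).
Proof.
move=> mY; apply: (measurableT_comp (f := cos)); first by apply: continuous_measurable_fun; exact: continuous_cos.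
apply: measurable_funD => //; apply: measurable_sum => k.
by apply: measurable_funM => //; exact: (measurableT_comp (measurable_coord k) mY).
Qed.

Let m_set k (y : R) : measurable_fun setT (fun u : E => set_coord k u y).
Proof.
apply: measurable_to_prodR => j; rewrite /set_coord; case: eqP => // _; exact: measurable_coord.
Qed.

(** Induction on the list of coordinates that f already sees, the others being set to 0, while the
    cosine factor keeps the joint information. [Ex_coord_uniq] freezes a new coordinate at the price
    of one more cosine. *)
Let hybrid (l : seq K) : forall (f : E -> R) (M : R), measurable_fun setT f -> (forall u, `|f u| <= M) ->
  sep_continuous f -> forall a c,
  Ex P (fun w => f (Z l (X w)) * cos (\sum_k a k * X w k + c)) =
  Ex P' (fun w => f (Z l (X' w)) * cos (\sum_k a k * X' w k + c)).
Proof.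
elim: l => [|k l IH] f M mf fM cf a c.
  have Z0 u : Z [::] u = fun=> 0 by apply/funext => j.
  under eq_fun do rewrite Z0; under [in RHS]eq_fun do rewrite Z0.
  have icos d0 (T0 : measurableType d0) (P0 : probability T0 R) (Y : T0 -> E) : measurable_fun setT Y ->
    itg P0 (fun w => cos (\sum_k a k * Y w k + c)).
    by move=> mY; apply: (@itg_bnd _ _ _ _ _ 1); [exact: m_lin|move=> w; exact: cos_abs_le1].
  by rewrite !ExZ ?XX'//; exact: icos.
pose V d0 (T0 : measurableType d0) (Y : T0 -> E) (z : T0 * TR) :=
  f (set_coord k (Z l (Y z.1)) z.2) * cos (\sum_k a k * Y z.1 k + c).
have ZE u : set_coord k (Z l u) (u k) = Z (k :: l) u.
  apply/funext => j; rewrite /set_coord /Z /merge /= inE.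
  by case: eqVneq => [->|].
have mV d0 (T0 : measurableType d0) (Y : T0 -> E) : measurable_fun setT Y -> measurable_fun setT (V d0 T0 Y).
  move=> mY; have mY1 := measurableT_comp mY (measurable_fst (T1 := T0) (T2 := TR)).
  apply: measurable_funM; last exact: (m_lin _ _ mY1).
  apply: (measurableT_comp mf); apply: measurable_to_prodR => j; rewrite /set_coord /Z /merge.
  case: eqP => _; first exact: measurable_snd.
  case: (mem l j) => //; exact: (measurableT_comp (measurable_coord j) mY1).
have VM d0 (T0 : measurableType d0) (Y : T0 -> E) z : `|V d0 T0 Y z| <= M.
  by rewrite normrM -[leRHS]mulr1 ler_pM// cos_abs_le1.
have cV d0 (T0 : measurableType d0) (Y : T0 -> E) w : continuous (fun y : R => V d0 T0 Y (w, y)).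
  rewrite /V /=; move: (cos _) => c1 y.
  have h := cf (Z l (Y w)) k y.
  have h1 : c1 @[_ --> y] --> c1 by exact: cvg_cst.
  exact: (cvgM h h1).
have := @Ex_coord_uniq R d d' T T' P P' (V _ _ X) (V _ _ X') (X ^~ k) (X' ^~ k) M
  (mV _ _ _ mX) (mV _ _ _ mX') (measurableT_comp (measurable_coord k) mX) (measurableT_comp (measurable_coord k) mX')
  (VM _ _ _) (VM _ _ _) (cV _ _ _) (cV _ _ _) _.
have VE d0 (T0 : measurableType d0) (Y : T0 -> E) : (fun w => V d0 T0 Y (w, Y w k)) =
    fun w => f (Z (k :: l) (Y w)) * cos (\sum_k a k * Y w k + c).
  by apply/funext => w; rewrite /V /= ZE.
rewrite !VE; apply=> y b c0; rewrite /V /=; pose g u := f (set_coord k u y).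
have mg : measurable_fun setT g by exact: (measurableT_comp mf (m_set k y)).
have cg : sep_continuous g.
  move=> u j; rewrite /g; have [->|jk] := eqVneq j k.
    have -> : (fun y0 : R => f (set_coord k (set_coord k u y0) y)) = fun=> f (set_coord k u y).
      apply/funext => y0; congr f; apply/funext => i; rewrite /set_coord.
      by case: eqP.
    by move=> y0; exact: cvg_cst.
  have -> : (fun y0 : R => f (set_coord k (set_coord j u y0) y)) = fun y0 => f (set_coord j (set_coord k u y) y0).
    apply/funext => y0; congr f; apply/funext => i; rewrite /set_coord.
    by case: eqVneq => [->|_]; case: eqVneq => [e|] //; rewrite e eqxx in jk.
  exact: cf.
(* A product of two cosines is half the sum of the cosines of the sum and of the difference of the
   arguments, to which the induction hypothesis applies again. *)
pose a1 e j : R := a j + (if j == k then e * b else 0).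
have lin d0 (T0 : measurableType d0) (P0 : probability T0 R) (Y : T0 -> E) : measurable_fun setT Y ->
    Ex P0 (fun w => f (set_coord k (Z l (Y w)) y) * cos (\sum_k a k * Y w k + c) * cos (b * Y w k + c0)) =
    2^-1 * (Ex P0 (fun w => g (Z l (Y w)) * cos (\sum_k a1 1 k * Y w k + (c + c0)))
      + Ex P0 (fun w => g (Z l (Y w)) * cos (\sum_k a1 (-1) k * Y w k + (c - c0)))).
  move=> mY.
  have i1 e c1 : itg P0 (fun w => g (Z l (Y w)) * cos (\sum_k a1 e k * Y w k + c1)).
    apply: (@itg_bnd _ _ _ _ _ M).
      apply: measurable_funM; last exact: m_lin.
      apply: (measurableT_comp mg); apply: measurable_merge => //.
    by move=> w; rewrite normrM -[leRHS]mulr1 ler_pM ?cos_abs_le1//; exact: fM.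
  rewrite -ExD// -ExZ; last exact: itgD.
  congr Ex; apply/funext => w; rewrite -/(g _).
  have sE e : \sum_k a1 e k * Y w k = \sum_k a k * Y w k + e * (b * Y w k).
    under eq_bigr do rewrite /a1 mulrDl.
    rewrite big_split /=; congr (_ + _).
    rewrite (bigD1 k)//= eqxx big1 ?addr0 ?mulrA// => j /negbTE ->.
    by rewrite mul0r.
  rewrite !sE; set s := \sum_k _; set t := b * _.
  have -> : s + 1 * t + (c + c0) = (s + c) + (t + c0) by ring.
  have -> : s + -1 * t + (c - c0) = (s + c) - (t + c0) by ring.
  move: (s + c) (t + c0) => A B; move: (g _) => G0.
  by rewrite cosD cosB; field.
rewrite !lin//; congr (_ * _).
have gM u : `|g u| <= M by exact: fM.
by congr (_ + _); exact: (IH g M mg gM cg).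
Qed.

Lemma cramer_wold_bounded (f : E -> R) (M : R) : measurable_fun setT f -> (forall u, `|f u| <= M) ->
  sep_continuous f -> Ex P (fun w => f (X w)) = Ex P' (fun w => f (X' w)).
Proof.
move=> mf fM cf; have := @hybrid (enum K) f M mf fM cf (fun=> 0) 0.
have ZE u : Z (enum K) u = u by apply/funext => j; rewrite /Z /merge /= mem_enum.
have e d0 (T0 : measurableType d0) (Y : T0 -> E) :
  (fun w => f (Z (enum K) (Y w)) * cos (\sum_k 0 * Y w k + 0)) = fun w => f (Y w).
  apply/funext => w; rewrite ZE big1 ?addr0 ?cos0 ?mulr1// => k _; by rewrite mul0r.
by rewrite !e.
Qed.

Lemma cramer_wold (f : E -> R) : measurable_fun setT f -> sep_continuous f ->
  itg P (fun w => f (X w)) -> itg P' (fun w => f (X' w)) ->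
  Ex P (fun w => f (X w)) = Ex P' (fun w => f (X' w)).
Proof.
move=> mf cf i1 i2.
have cvc d0 (T0 : measurableType d0) (P0 : probability T0 R) (Y : T0 -> E) : itg P0 (fun w => f (Y w)) ->
    Ex P0 (fun w => clip n%:R (f (Y w))) @[n --> \oo] --> Ex P0 (fun w => f (Y w)).
  move=> iY; apply: (Ex_cvg (Y := fun w => `|f (Y w)|)) => [n||n w||w].
  - by apply: measurable_clip; exact: itg_meas iY.
  - exact: itg_meas iY.
  - exact: clip_norm.
  - exact: itg_norm.
  apply: cvg_near_cst; exists (Num.truncn `|f (Y w)|).+1 => // n /= hn.
  by rewrite clip_id// (le_trans (ltW (truncnS_gt _)))// ler_nat.
have c1 := cvc _ _ _ _ i1; have c2 := cvc _ _ _ _ i2.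
have e n : Ex P (fun w => clip n%:R (f (X w))) = Ex P' (fun w => clip n%:R (f (X' w))); last first.
  by move: c1; under eq_fun do rewrite e; move=> c1; exact: cvg_unique _ c1 c2.
apply: (@cramer_wold_bounded (fun u => clip n%:R (f u)) n%:R).
- exact: measurable_clip.
- by move=> u; exact: clip_bnd.
- move=> u k y; apply/cvgrPdist_le => e e0.
  have := cf u k y => /cvgrPdist_le /(_ e e0); apply: filterS => z.
  exact: le_trans (clip_lip _ _ _).
Qed.

End TwoVectors.
End CramerWold.

Section SameLaw.
Context (R : realType) d d' d0 (T : measurableType d) (T' : measurableType d') (T0 : measurableType d0).
Variables (P : probability T R) (P' : probability T' R) (X : T -> T0) (X' : T' -> T0).
Hypotheses (mX : measurable_fun setT X) (mX' : measurable_fun setT X').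
Hypothesis XX' : forall B, measurable B -> P (X @^-1` B) = P' (X' @^-1` B).

Lemma same_law (h : T0 -> R) : measurable_fun setT h -> itg P (fun w => h (X w)) ->
  itg P' (fun w => h (X' w)) /\ Ex P (fun w => h (X w)) = Ex P' (fun w => h (X' w)).
Proof.
move=> mh ih; pose phi : {mfun _ >-> _} := mfun_Sub (mem_set mX).
pose phi' : {mfun _ >-> _} := mfun_Sub (mem_set mX').
have mEh : measurable_fun setT (EFin \o h) by exact/measurable_EFinP.
have e (f : T0 -> \bar R) :
    (\int[pushforward P phi]_z f z = \int[pushforward P' phi']_z f z)%E.
  by apply: eq_measure_integral => C mC _; rewrite /pushforward; exact: XX'.
have ih' : itg P' (fun w => h (X' w)).
  apply/integrableP; split; first by apply/measurable_EFinP; exact: measurableT_comp.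
  have /integrableP[_] := ih; apply: le_lt_trans.
  have ma : measurable_fun setT (fun z => `|(EFin \o h) z|%E) by exact: measurableT_comp.
  have p1 := @ge0_integral_pushforward _ _ _ _ _ phi mX P setT (fun z => `|(EFin \o h) z|%E) measurableT
    ma (fun _ _ => abse_ge0 _).
  have p2 := @ge0_integral_pushforward _ _ _ _ _ phi' mX' P' setT (fun z => `|(EFin \o h) z|%E) measurableT
    ma (fun _ _ => abse_ge0 _).
  rewrite preimage_setT in p1; rewrite preimage_setT in p2.
  by rewrite -[leLHS]p2 -[leRHS]p1 e.
split=> //; rewrite /Ex /Rintegral; congr fine.
have p1 := integral_pushforward mX mEh ih measurableT.
have p2 := integral_pushforward mX' mEh ih' measurableT.
rewrite preimage_setT in p1; rewrite preimage_setT in p2.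
by rewrite -[LHS]p1 -[RHS]p2; exact: e.
Qed.

End SameLaw.

Lemma itg_std_id (R : realType) : itg (normal_prob (0 : R) 1) (fun u : measurableTypeR R => u).
Proof.
apply: (@itg_std_quad _ (fun u => u) 1) => // u.
rewrite mul1r -[u ^+ 2]real_normK ?num_real//.
move: (`|u|) (normr_ge0 u) => y y0; nra.
Qed.

(** * Laws and moments of Gaussian vectors *)

Section GaussianVector.
Context (R : realType) (K : finType) (d : measure_display) (T : measurableType d).
Variables (Q : probability T R) (G : K -> T -> R) (Lam : K -> K -> R).
Local Notation TR := (measurableTypeR R).
Local Notation gam := (normal_prob (0 : R) 1).
Hypotheses (mG : forall i, measurable_fun setT (G i)) (nG : jointly_normal Q G).
Hypothesis mean0 : forall i, expectation Q (G i) = 0%E.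
Hypothesis covG : forall i j, covariance Q (G i) (G j) = (Lam i j)%:E.

Definition lin (a : K -> R) (w : T) : R := \sum_i a i * G i w.
Definition dlt (i : K) : K -> R := fun j => (j == i)%:R.
Definition qf (a : K -> R) : R := \sum_i \sum_j a i * a j * Lam i j.

Lemma sum_dlt (f : K -> R) i : \sum_j dlt i j * f j = f i.
Proof.
rewrite (bigD1 i)//= /dlt eqxx mul1r big1 ?addr0// => j /negbTE ->.
by rewrite mul0r.
Qed.

Lemma sum_dltr (f : K -> R) i : \sum_j f j * dlt j i = f i.
Proof. by rewrite -[RHS]sum_dlt; apply: eq_bigr => j _; rewrite mulrC /dlt eq_sym. Qed.

Lemma lin_dlt i : lin (dlt i) = G i.
Proof. by apply/funext => w; exact: sum_dlt. Qed.

Lemma measurable_lin a : measurable_fun setT (lin a).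
Proof. by apply: measurable_sum => i; exact: measurable_funM. Qed.

Let lin_law a : exists m s : R, forall h : TR -> R, measurable_fun setT h ->
  itg gam (fun u : TR => h (m + s * u)) ->
  itg Q (fun w => h (lin a w)) /\ Ex Q (fun w => h (lin a w)) = Ex gam (fun u : TR => h (m + s * u)).
Proof.
have [m [s ms]] := nG a; exists m, s => h mh ih.
have maf : measurable_fun setT (fun u : TR => (m + s * u) : TR).
  by apply: measurable_funD => //; exact: measurable_funM.
have mlin : measurable_fun setT (lin a : T -> TR) by exact: measurable_lin.
have ms' B : measurable B -> gam ((fun u : TR => (m + s * u) : TR) @^-1` B) = Q ((lin a : T -> TR) @^-1` B).
  by move=> mB; exact: esym (ms B mB).
by have [h1 h2] := @same_law R _ _ _ _ _ TR gam Q _ _ maf mlin ms' h mh ih.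
Qed.

Let itg_pow8 (m s : R) (k : nat) : itg gam (fun u : TR => `|m + s * u| ^+ (2 * k)).
Proof.
have i1 := itg_std_pow R k.
have mu1 : measurable_fun setT (fun u : TR => `|m + s * u| ^+ (2 * k)).
  apply: measurable_funX; apply: measurableT_comp => //.
  by apply: measurable_funD => //; exact: measurable_funM.
apply: (itg_le mu1 (itgZ ((`|m| + `|s|) ^+ (2 * k)) (itgD (itg_cst _ 1) i1))) => u.
rewrite ger0_norm ?exprn_ge0//.
have h1 : `|m + s * u| <= (`|m| + `|s|) * Num.max 1 `|u|.
  rewrite (le_trans (ler_normD _ _))// normrM mulrDl lerD//.
    by rewrite ler_peMr// le_max lexx.
  by rewrite ler_wpM2l// le_max lexx orbT.
apply: (le_trans (lerXn2r _ _ _ h1)); rewrite ?nnegrE// ?mulr_ge0 ?addr_ge0 ?le_max ?ler01//.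
rewrite exprMn ler_wpM2l ?exprn_ge0 ?addr_ge0//.
have u2 : u ^+ (2 * k) = `|u| ^+ (2 * k) by rewrite !exprM real_normK ?num_real.
rewrite u2; have [_|_] := leP 1 `|u|; first by rewrite lerDr.
by rewrite expr1n lerDl exprn_ge0.
Qed.

Lemma gauss_mom8 i : exists c, mom Q 8 (G i) c.
Proof.
have [m [s ms]] := lin_law (dlt i).
have m8 : measurable_fun setT (fun x : TR => `|x| ^+ 8) by apply: measurable_funX; exact: normr_measurable.
have [i8 _] := ms (fun x => `|x| ^+ 8) m8 (@itg_pow8 m s 4).
rewrite lin_dlt in i8.
exists (1 + Ex Q (fun w => `|G i w| ^+ 8)).
have e : (fun w => `|G i w| `^ 8) = fun w => `|G i w| ^+ 8.
  by apply/funext => w; rewrite -powR_mulrn.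
have E0 : 0 <= Ex Q (fun w => `|G i w| ^+ 8) by apply: Ex_ge0 => w; exact: exprn_ge0.
apply: mom_Ex => //; [by rewrite addr_ge0|by rewrite e|rewrite e].
apply: (@le_trans _ _ (1 + Ex Q (fun w => `|G i w| ^+ 8))); first by rewrite lerDr.
rewrite powR_mulrn ?addr_ge0//.
by rewrite -[leLHS]expr1 ler_weXn2l// lerDl.
Qed.

Lemma gauss_itg i : itg Q (G i).
Proof. by have [c hc] := gauss_mom8 i; have [] := mom_itg (ler1n _ 8) hc. Qed.

Lemma gauss_Ex0 i : Ex Q (G i) = 0.
Proof. by have := mean0 i; rewrite unlock (ExE (gauss_itg i)) => -[]. Qed.

Lemma gauss_itgM i j : itg Q (fun w => G i w * G j w).
Proof.
have [c hc] := gauss_mom8 i; have [c' hc'] := gauss_mom8 j.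
have h : mom Q 4 (fun w => G i w * G j w) (c * c').
  by apply: momM; rewrite ?ler1n// -natrM.
by have [] := mom_itg (ler1n _ 4) h.
Qed.

Lemma gauss_Ex2 i j : Ex Q (fun w => G i w * G j w) = Lam i j.
Proof.
have := covG i j; rewrite unlock !mean0 /= unlock.
have -> : (fun w => (((G i \- cst 0) * (G j \- cst 0)) w)%:E) = fun w => (G i w * G j w)%:E.
  by apply/funext => w; congr EFin; rewrite -[LHS]/((G i w - 0) * (G j w - 0)) !subr0.
by rewrite (ExE (gauss_itgM i j)) => -[].
Qed.

Lemma lin_Ex0 a : Ex Q (lin a) = 0.
Proof.
rewrite Ex_sum => [|i _]; last exact: itgZ (gauss_itg i).
by rewrite big1// => i _; rewrite ExZ ?gauss_Ex0 ?mulr0//; exact: gauss_itg.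
Qed.

Lemma lin_Ex2 a : itg Q (fun w => lin a w * lin a w) /\ Ex Q (fun w => lin a w * lin a w) = qf a.
Proof.
have e : (fun w => lin a w * lin a w) = fun w => \sum_i \sum_j a i * a j * (G i w * G j w).
  apply/funext => w; rewrite /lin mulr_suml; apply: eq_bigr => i _.
  by rewrite mulr_sumr; apply: eq_bigr => j _; ring.
rewrite e; split.
  by apply: itg_sum => i _; apply: itg_sum => j _; apply: itgZ; exact: gauss_itgM.
rewrite Ex_sum => [|i _]; last by apply: itg_sum => j _; apply: itgZ; exact: gauss_itgM.
apply: eq_bigr => i _; rewrite Ex_sum => [|j _]; last by apply: itgZ; exact: gauss_itgM.
by apply: eq_bigr => j _; rewrite ExZ ?gauss_Ex2//; exact: gauss_itgM.
Qed.

(** [jointly_normal] only provides some m and s; the first moment of [lin a] forces m = 0, and the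
    second forces s^2 = qf a. *)
Lemma gauss_law a : exists2 s : R, s ^+ 2 = qf a & forall h : TR -> R, measurable_fun setT h ->
  itg gam (fun u : TR => h (s * u)) ->
  itg Q (fun w => h (lin a w)) /\ Ex Q (fun w => h (lin a w)) = Ex gam (fun u : TR => h (s * u)).
Proof.
have [m [s ms]] := lin_law a.
have iu := itg_std_id R.
have [v1 v2] := std_var R.
have i1 : itg gam (fun u : TR => m + s * u) by apply: itgD; [exact: itg_cst|exact: itgZ].
have [_ e1] := ms (fun x => x) (@measurable_id _ _ _) i1.
have m0 : m = 0.
  have : Ex Q (lin a) = m by rewrite [LHS]e1 (ExD (itg_cst _ m) (itgZ s iu)) Ex_cst (ExZ s iu) std_mean mulr0 addr0.
  by rewrite lin_Ex0.
have ms0 h : measurable_fun setT h -> itg gam (fun u : TR => h (s * u)) ->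
    itg Q (fun w => h (lin a w)) /\ Ex Q (fun w => h (lin a w)) = Ex gam (fun u : TR => h (s * u)).
  by have := ms h; rewrite m0; under eq_fun do rewrite add0r.
exists s => //.
have e u : s * u * (s * u) = s ^+ 2 * (u * u) by ring.
have i2 : itg gam (fun u : TR => s * u * (s * u)) by under eq_fun do rewrite e; exact: itgZ.
have [_] := ms0 (fun x => x * x) (measurable_funM (@measurable_id _ _ _) (@measurable_id _ _ _)) i2.
rewrite (lin_Ex2 a).2 => ->; under eq_fun do rewrite e.
by rewrite ExZ// v2 mulr1.
Qed.

Lemma gauss_cos a c : Ex Q (fun w => cos (lin a w + c)) = expR (- (qf a / 2)) * cos c.
Proof.
have [s <- hs] := gauss_law a; rewrite -std_cos.
have mc : measurable_fun setT (fun x : TR => cos (x + c)).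
  apply: (measurableT_comp (f := cos)); first by apply: continuous_measurable_fun; exact: continuous_cos.
  exact: measurable_funD.
have [|_ ->//] := hs (fun x => cos (x + c)) mc.
apply: (@itg_bnd _ _ _ _ _ 1); last by move=> u; exact: cos_abs_le1.
by apply: (measurableT_comp mc); exact: measurable_funM.
Qed.

Lemma gauss_even i k : itg Q (fun w => G i w ^+ (2 * k)) /\
  Ex Q (fun w => G i w ^+ (2 * k)) = Lam i i ^+ k * Ex gam (fun u : TR => u ^+ (2 * k)).
Proof.
have [s s2 hs] := gauss_law (dlt i); rewrite lin_dlt in hs.
have q1 : qf (dlt i) = Lam i i.
  rewrite /qf; under eq_bigr do under eq_bigr do rewrite -mulrA.
  by under eq_bigr do rewrite -mulr_sumr sum_dlt; rewrite sum_dlt.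
have i1 := itg_std_pow R k.
have e u : (s * u) ^+ (2 * k) = s ^+ (2 * k) * u ^+ (2 * k) by rewrite exprMn.
have i2 : itg gam (fun u : TR => (s * u) ^+ (2 * k)) by under eq_fun do rewrite e; exact: itgZ.
have m2 : measurable_fun setT (fun u : TR => u ^+ (2 * k)) by exact: measurable_funX.
have [h1 ->] := hs (fun x => x ^+ (2 * k)) m2 i2.
split=> //; under eq_fun do rewrite e.
by rewrite ExZ// exprM s2 q1.
Qed.

Section Rotation.
Variables (c s : R).
Hypothesis cs1 : c ^+ 2 + s ^+ 2 = 1.

(** Both pairs have the same cosine transform, since rotating the coefficients preserves qf a1 + qf
    a2 when c^2 + s^2 = 1. The Cramer-Wold device on [K + K] passes from cosines to F. *)
Lemma gauss_rotation (F : (K -> R) -> (K -> R) -> R) :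
  measurable_fun setT (fun u : prodR (K + K)%type R => F (u \o inl) (u \o inr)) ->
  sep_continuous (fun u : prodR (K + K)%type R => F (u \o inl) (u \o inr)) ->
  itg (pprod Q Q) (fun z => F (G ^~ z.1) (G ^~ z.2)) ->
  itg (pprod Q Q) (fun z => F (fun i => c * G i z.1 + s * G i z.2) (fun i => - s * G i z.1 + c * G i z.2)) ->
  Ex (pprod Q Q) (fun z => F (G ^~ z.1) (G ^~ z.2)) =
  Ex (pprod Q Q) (fun z => F (fun i => c * G i z.1 + s * G i z.2) (fun i => - s * G i z.1 + c * G i z.2)).
Proof.
move=> mF cF i1 i2.
have m1 i : measurable_fun setT (fun z : T * T => G i z.1) by exact: (measurableT_comp (mG i) measurable_fst).
have m2 i : measurable_fun setT (fun z : T * T => G i z.2) by exact: (measurableT_comp (mG i) measurable_snd).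
pose X (z : T * T) : prodR (K + K)%type R := fun k => match k with inl i => G i z.1 | inr i => G i z.2 end.
pose X' (z : T * T) : prodR (K + K)%type R := fun k => match k with
  inl i => c * G i z.1 + s * G i z.2 | inr i => - s * G i z.1 + c * G i z.2 end.
apply: (@cramer_wold R (K + K)%type _ _ _ _ (pprod Q Q) (pprod Q Q) X X' _ _ _ _ mF cF i1 i2).
- by apply: measurable_to_prodR => -[i|i] /=; [exact: m1|exact: m2].
- by apply: measurable_to_prodR => -[i|i] /=; apply: measurable_funD; exact: measurable_funM.
have key (a1 a2 : K -> R) k : Ex (pprod Q Q) (fun z => cos (lin a1 z.1 + lin a2 z.2 + k)) =
    expR (- ((qf a1 + qf a2) / 2)) * cos k.
  have l1 := measurableT_comp (measurable_lin a1) (measurable_fst (T1 := T) (T2 := T)).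
  have l2 := measurableT_comp (measurable_lin a2) (measurable_snd (T1 := T) (T2 := T)).
  rewrite Ex_pprod1; last first.
    apply: (@itg_bnd _ _ _ _ _ 1); last by move=> u; exact: cos_abs_le1.
    apply: (measurableT_comp (f := cos)); first by apply: continuous_measurable_fun; exact: continuous_cos.
    by apply: measurable_funD => //; apply: measurable_funD.
  have e w : Ex Q (fun v => cos (lin a1 w + lin a2 v + k)) = expR (- (qf a2 / 2)) * cos (lin a1 w + k).
    rewrite -gauss_cos; congr Ex; apply/funext => v; congr cos; ring.
  under eq_fun do rewrite e /=.
  rewrite ExZ ?gauss_cos; last first.
    apply: (@itg_bnd _ _ _ _ _ 1); last by move=> u; exact: cos_abs_le1.
    apply: (measurableT_comp (f := cos)); first by apply: continuous_measurable_fun; exact: continuous_cos.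
    by apply: measurable_funD => //; exact: measurable_lin.
  by rewrite mulrA -expRD; congr (expR _ * _); field.
move=> a k; pose a1 i := a (inl i); pose a2 i := a (inr i).
pose b1 i := c * a1 i - s * a2 i; pose b2 i := s * a1 i + c * a2 i.
transitivity (Ex (pprod Q Q) (fun z => cos (lin a1 z.1 + lin a2 z.2 + k))).
  by congr Ex; apply/funext => z; rewrite big_sumType.
transitivity (Ex (pprod Q Q) (fun z => cos (lin b1 z.1 + lin b2 z.2 + k))).
  rewrite !key; congr (expR (- (_ / 2)) * _).
  rewrite /qf -!big_split /=; apply: eq_bigr => i _; rewrite -!big_split /=; apply: eq_bigr => j _.
  rewrite -!mulrDl; congr (_ * _); rewrite /b1 /b2.
  rewrite -[LHS]mul1r -cs1; ring.
congr Ex; apply/funext => z; rewrite big_sumType /lin -!big_split /=; congr cos; congr (_ + _).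
by rewrite -!big_split /=; apply: eq_bigr => i _; rewrite /b1 /b2 -/(a1 i) -/(a2 i); ring.
Qed.

End Rotation.
End GaussianVector.

Lemma cvg_lip2 (R : realType) (D : R) (f : R -> R) (y : R) : 0 <= D ->
  (forall y', `|f y' - f y| <= D * (`|y' - y| + `|y' - y| * `|y' - y|)) ->
  f y' @[y' --> y] --> f y.
Proof.
move=> D0 hf; apply/cvgrPdist_le => e e0.
have e2 : 0 < e / (2 * D + 1) by rewrite divr_gt0// ltr_wpDl// mulr_ge0.
near=> y'.
have r1 : `|y' - y| <= 1 by rewrite distrC; near: y'; apply: cvgr_dist_le; [exact: cvg_id|exact: ltr01].
have r2 : `|y' - y| <= e / (2 * D + 1) by rewrite distrC; near: y'; apply: cvgr_dist_le; [exact: cvg_id|exact: e2].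
rewrite distrC (le_trans (hf y'))//; move: r2; rewrite ler_pdivlMr ?ltr_wpDl ?mulr_ge0//.
move=> h; apply: le_trans h; move: (`|y' - y|) r1 (normr_ge0 (y' - y)) => r r1 r0.
have h1 : 0 <= D * r * (1 - r) by rewrite !mulr_ge0// subr_ge0.
by clear - r0 h1; nra.
Unshelve. all: by end_near.
Qed.

(** * Stein's identity by rotation *)

Section Stein.
Context (R : realType) (K : finType) (d : measure_display) (T : measurableType d).
Variables (Q : probability T R) (G : K -> T -> R) (Lam : K -> K -> R).
Hypotheses (mG : forall i, measurable_fun setT (G i)) (nG : jointly_normal Q G).
Hypothesis mean0 : forall i, expectation Q (G i) = 0%E.
Hypothesis covG : forall i j, covariance Q (G i) (G j) = (Lam i j)%:E.
Local Notation dlt := (@dlt R K).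
Local Notation E2 := (Ex (pprod Q Q)).

(** [phi x u] is linear in u, and [dphi x u] is its derivative in x, with a quadratic remainder. The
    pair is abstract because it stands for [gbs] and [gbs1] as well as for [lgs1] and [lgs2]. *)
Variables (phi : (K -> R) -> (K -> R) -> R) (dphi : (K -> R) -> (K -> R) -> (K -> R) -> R) (C : R).
Hypothesis C0 : 0 <= C.
Hypothesis philin : forall x u, phi x u = \sum_i u i * phi x (dlt i).
Hypothesis dphilin : forall x u v, dphi x u v = \sum_i v i * dphi x u (dlt i).
Hypothesis phib : forall x u a, 0 <= a -> (forall i, `|u i| <= a) -> `|phi x u| <= C * a.
Hypothesis dphib : forall x u v a b, 0 <= a -> 0 <= b -> (forall i, `|u i| <= a) ->
  (forall i, `|v i| <= b) -> `|dphi x u v| <= C * (a * b).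
Hypothesis phit : forall x u h a c, 0 <= a -> 0 <= c -> (forall i, `|u i| <= a) ->
  (forall i, `|h i| <= c) -> `|phi (fun i => x i + h i) u - phi x u - dphi x u h| <= C * (a * c * c).
Hypothesis phim : forall d (T : measurableType d) (y u : K -> T -> R),
  (forall i, measurable_fun setT (y i)) -> (forall i, measurable_fun setT (u i)) ->
  measurable_fun setT (fun w => phi (y ^~ w) (u ^~ w)).
Hypothesis dphim : forall d (T : measurableType d) (y u v : K -> T -> R),
  (forall i, measurable_fun setT (y i)) -> (forall i, measurable_fun setT (u i)) ->
  (forall i, measurable_fun setT (v i)) -> measurable_fun setT (fun w => dphi (y ^~ w) (u ^~ w) (v ^~ w)).
Variables (sg : R) (z : K -> R).

Let phiD x u v a b : phi x (fun i => a * u i + b * v i) = a * phi x u + b * phi x v.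
Proof.
rewrite philin (philin x u) (philin x v) !mulr_sumr -big_split /=.
by apply: eq_bigr => i _; ring.
Qed.

Let dphiD x u v w a b : dphi x u (fun i => a * v i + b * w i) = a * dphi x u v + b * dphi x u w.
Proof.
rewrite dphilin (dphilin x u v) (dphilin x u w) !mulr_sumr -big_split /=.
by apply: eq_bigr => i _; ring.
Qed.

Let phi_lip x u h a c : 0 <= a -> 0 <= c -> (forall i, `|u i| <= a) ->
  (forall i, `|h i| <= c) -> `|phi (fun i => x i + h i) u - phi x u| <= C * (a * (c + c * c)).
Proof.
move=> a0 c0 ua hc; have h1 := phit x a0 c0 ua hc; have h2 := dphib x a0 c0 ua hc.
rewrite -[X in `|X|](subrK (dphi x u h)) (le_trans (ler_normD _ _))//.
by rewrite !mulrDr addrC lerD// mulrA.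
Qed.

Let A w : R := \sum_i `|G i w|.

Let A0 w : 0 <= A w. Proof. exact: sumr_ge0. Qed.

Let GA i w : `|G i w| <= A w.
Proof. by rewrite /A (bigD1 i)//= lerDl sumr_ge0. Qed.

Let F (u v : K -> R) := phi (fun i => sg * u i + z i) v.

Let x w : K -> R := fun i => sg * G i w + z i.

Let m1 i : measurable_fun setT (fun z : T * T => G i z.1).
Proof. exact: (measurableT_comp (mG i) measurable_fst). Qed.

Let m2 i : measurable_fun setT (fun z : T * T => G i z.2).
Proof. exact: (measurableT_comp (mG i) measurable_snd). Qed.

Let A_mom8 : exists c, mom Q 8 A c.
Proof.
have [c hc] := choice (fun i => gauss_mom8 mG nG i).
exists (\sum_i c i); apply: mom_sum; first by rewrite ler1n.
move=> i _; apply: mom_dom (hc i) => //; first exact: measurableT_comp.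
by move=> w; rewrite normr_id.
Qed.

Let itg_poly (p q : nat) : (p + q <= 4)%N -> itg (pprod Q Q) (fun z => A z.1 ^+ p * A z.2 ^+ q).
Proof.
move=> pq; have [c hc] := A_mom8; have c0 := mom_ge0 hc; have mA := mom_meas hc.
have iX k : (k <= 4)%N -> itg Q (fun w => A w ^+ k).
  move=> k4; have [i8 _] := mom_itg_pow (ltr0Sn R 7) hc.
  apply: (itg_le _ (itgD (itg_cst _ 1) i8)); first exact: measurable_funX.
  move=> w; rewrite normrX (ger0_norm (A0 w)) powR_mulrn//.
  have [a1|a1] := leP (A w) 1; first by rewrite (le_trans (exprn_ile1 k (A0 w) a1))// lerDl exprn_ge0.
  have k8 : (k <= 8)%N by rewrite (leq_trans k4).
  by rewrite (le_trans (ler_weXn2l (ltW a1) k8))// lerDr.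
have p4 := leq_trans (leq_addr q p) pq; have q4 := leq_trans (leq_addl p q) pq.
exact: (itg_tensor (iX p p4) (iX q q4)).
Qed.

Let Ex_F0 : E2 (fun z => F (G ^~ z.1) (G ^~ z.2)) = 0.
Proof.
have e : (fun z : T * T => F (G ^~ z.1) (G ^~ z.2)) =
    fun z => \sum_i phi (x z.1) (dlt i) * G i z.2.
  by apply/funext => w; rewrite /F philin; apply: eq_bigr => i _; rewrite mulrC.
have ip i : itg Q (fun w => phi (x w) (dlt i)).
  apply: (@itg_bnd _ _ _ _ _ (C * 1)).
    apply: (@phim _ _ (fun i w => sg * G i w + z i) (fun j w => dlt i j)) => // j.
    by apply: measurable_funD => //; exact: measurable_funM.
  move=> w; apply: phib => // j; rewrite /dlt; case: (_ == _); by rewrite ?normr1 ?normr0.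
rewrite e Ex_sum => [|i _]; last exact: (itg_tensor (ip i) (gauss_itg mG nG i)).
rewrite big1// => i _; rewrite (@Ex_tensor _ _ _ _ _ Q Q (fun w => phi (x w) (dlt i)) (G i))//.
  by rewrite (gauss_Ex0 mG nG mean0) mulr0.
exact: (gauss_itg mG nG).
Qed.

Let mF (c1 s1 c2 s2 : R) : measurable_fun setT (fun z : T * T =>
  F (fun i => c1 * G i z.1 + s1 * G i z.2) (fun i => c2 * G i z.1 + s2 * G i z.2)).
Proof.
apply: (@phim _ _ (fun i (w : T * T) => sg * (c1 * G i w.1 + s1 * G i w.2) + z i)
  (fun i (w : T * T) => c2 * G i w.1 + s2 * G i w.2)) => i.
- by apply: measurable_funD => //; apply: measurable_funM => //; apply: measurable_funD; exact: measurable_funM.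
- by apply: measurable_funD; exact: measurable_funM.
Qed.

Let iF (c1 s1 c2 s2 : R) : itg (pprod Q Q) (fun z : T * T =>
  F (fun i => c1 * G i z.1 + s1 * G i z.2) (fun i => c2 * G i z.1 + s2 * G i z.2)).
Proof.
have p1 := @itg_poly 1 0 isT; have p2 := @itg_poly 0 1 isT.
apply: (itg_le (@mF c1 s1 c2 s2) (itgZ C (itgD (itgZ `|c2| p1) (itgZ `|s2| p2)))) => w.
apply: phib.
  by rewrite addr_ge0// mulr_ge0// ?mulr_ge0// ?exprn_ge0.
move=> i; rewrite expr0 mulr1 mul1r !expr1 (le_trans (ler_normD _ _))// !normrM.
by rewrite lerD// ler_wpM2l.
Qed.

Let F_sep : sep_continuous (fun u : prodR (K + K)%type R => F (u \o inl) (u \o inr)).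
Proof.
move=> u k y; pose a := \sum_i `|u (inr i)|.
have a0 : 0 <= a by exact: sumr_ge0.
have ua i : `|u (inr i)| <= a by rewrite /a (bigD1 i)//= lerDl sumr_ge0.
case: k => k.
  apply: (@cvg_lip2 _ (C * (a * (`|sg| + `|sg| * `|sg|)))); first by rewrite !mulr_ge0// addr_ge0// mulr_ge0.
  move=> y'; set r := `|y' - y|; have r0 : 0 <= r by exact: normr_ge0.
  pose h i := sg * ((y' - y) * dlt k i).
  have hr i : `|h i| <= `|sg| * r.
    rewrite !normrM ler_wpM2l// ler_piMr// /dlt; case: (_ == _); by rewrite ?normr1 ?normr0.
  have eu (y0 : R) : set_coord (inl k) u y0 \o inr = u \o inr by apply/funext => i; rewrite /set_coord /=.
  rewrite !eu /F.
  have -> : (fun i => sg * (set_coord (inl k) u y' \o inl) i + z i) =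
      fun i => (sg * (set_coord (inl k) u y \o inl) i + z i) + h i.
    apply/funext => i; rewrite /h /set_coord /dlt /= (inj_eq (@inl_inj _ _)).
    by case: (i == k); rewrite ?mulr1 ?mulr0 ?addr0//; ring.
  apply: (le_trans (phi_lip _ a0 (mulr_ge0 (normr_ge0 sg) r0) ua hr)).
  rewrite -!mulrA ler_wpM2l// ler_wpM2l//.
  have g0 := normr_ge0 sg; rewrite -/r.
  have h1 : 0 <= `|sg| * (r * r) by rewrite !mulr_ge0.
  have h2 : 0 <= `|sg| * `|sg| * r by rewrite !mulr_ge0.
  rewrite -subr_ge0; have -> : (`|sg| + `|sg| * `|sg|) * (r + r * r) - (`|sg| * r + `|sg| * (r * (`|sg| * r))) =
    `|sg| * (r * r) + `|sg| * `|sg| * r by ring.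
  exact: addr_ge0.
apply: (@cvg_lip2 _ C) => // y'; set r := `|y' - y|; have r0 : 0 <= r by exact: normr_ge0.
have eu (y0 : R) : set_coord (inr k) u y0 \o inl = u \o inl by apply/funext => i; rewrite /set_coord /=.
rewrite !eu /F; move: (fun i => sg * _ + _) => x0.
have -> : phi x0 (set_coord (inr k) u y' \o inr) - phi x0 (set_coord (inr k) u y \o inr) =
    phi x0 (fun i => (y' - y) * dlt k i).
  rewrite philin [X in _ - X]philin [RHS]philin -sumrB; apply: eq_bigr => i _.
  rewrite -mulrBl; congr (_ * _); rewrite /set_coord /dlt /= (inj_eq (@inr_inj _ _)).
  by case: (i == k); rewrite ?mulr1 ?mulr0 ?subrr.
apply: (@le_trans _ _ (C * r)); last by rewrite ler_wpM2l// lerDl mulr_ge0.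
apply: phib => // i; rewrite normrM -[leRHS]mulr1 ler_wpM2l// /dlt; case: (_ == _); by rewrite ?normr1 ?normr0.
Qed.

Let B w : R := `|sg| * (A w.1 + A w.2).
Let Y (w : T * T) : R := C * (A w.1 * (B w + B w * B w) + A w.2 + A w.2 * B w * B w + `|sg| * (A w.2 * A w.1)).

Let iY : itg (pprod Q Q) Y.
Proof.
have p p1 q1 := @itg_poly p1 q1.
have -> : Y = fun w => C * (`|sg| * (A w.1 ^+ 2 * A w.2 ^+ 0 + A w.1 ^+ 1 * A w.2 ^+ 1)
   + `|sg| ^+ 2 * (A w.1 ^+ 3 * A w.2 ^+ 0 + 2 * (A w.1 ^+ 2 * A w.2 ^+ 1) + A w.1 ^+ 1 * A w.2 ^+ 2)
   + A w.1 ^+ 0 * A w.2 ^+ 1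
   + `|sg| ^+ 2 * (A w.1 ^+ 2 * A w.2 ^+ 1 + 2 * (A w.1 ^+ 1 * A w.2 ^+ 2) + A w.1 ^+ 0 * A w.2 ^+ 3)
   + `|sg| * (A w.1 ^+ 1 * A w.2 ^+ 1)).
  by apply/funext => w; rewrite /Y /B; ring.
by repeat first [exact: p | apply: itgD | apply: itgZ].
Qed.

(** Expansion to first order in the sine s of the angle. The cosine c may be replaced by 1 since 1 -
    c <= s^2, and the remainder is s^2 times the integrable polynomial [Y] in the sizes of the two
    copies. *)
Let pt (c s : R) (w : T * T) : 0 <= s -> s <= 1 -> 0 <= c -> c <= 1 -> 1 - c <= s ^+ 2 ->
  `|F (fun i => c * G i w.1 + s * G i w.2) (fun i => - s * G i w.1 + c * G i w.2)
    - (- s * F (G ^~ w.1) (G ^~ w.1) + F (G ^~ w.1) (G ^~ w.2)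
       + s * (sg * dphi (x w.1) (G ^~ w.2) (G ^~ w.2)))| <= s ^+ 2 * Y w.
Proof.
move=> s0 s1 c0 c1 cs.
pose h i := sg * s * G i w.2 + sg * (c - 1) * G i w.1.
pose y := fun i => x w.1 i + h i.
have s2 : s ^+ 2 <= s by rewrite expr2 ler_piMr.
have cs' : `|c - 1| <= s ^+ 2 by rewrite distrC ger0_norm// subr_ge0.
have hB i : `|h i| <= s * B w.
  rewrite (le_trans (ler_normD _ _))// !normrM (ger0_norm s0) /B mulrDr mulrDr addrC lerD//.
    rewrite [leRHS]mulrCA -mulrA ler_wpM2l// ler_pM// (le_trans cs')//.
  by rewrite [leRHS]mulrCA -mulrA ler_wpM2l// ler_wpM2l.
have B0 : 0 <= B w by rewrite mulr_ge0// addr_ge0.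
have sB0 : 0 <= s * B w by rewrite mulr_ge0.
have yE : (fun i => sg * (c * G i w.1 + s * G i w.2) + z i) = y.
  by apply/funext => i; rewrite /y /h /x; ring.
rewrite /F yE phiD -/(x w.1).
have t1 := @phi_lip (x w.1) (G ^~ w.1) h _ _ (A0 w.1) sB0 (fun i => GA i w.1) hB.
have t2 := @phib y (G ^~ w.2) _ (A0 w.2) (fun i => GA i w.2).
have t3 := @phit (x w.1) (G ^~ w.2) h _ _ (A0 w.2) sB0 (fun i => GA i w.2) hB.
have t4 := @dphib (x w.1) (G ^~ w.2) (G ^~ w.1) _ _ (A0 w.2) (A0 w.1) (fun i => GA i w.2) (fun i => GA i w.1).
have dE : dphi (x w.1) (G ^~ w.2) h = sg * s * dphi (x w.1) (G ^~ w.2) (G ^~ w.2) + sg * (c - 1) * dphi (x w.1) (G ^~ w.2) (G ^~ w.1).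
  by rewrite -dphiD.
rewrite -/y dE in t1 t3.
have u1 : `|- s * (phi y (G ^~ w.1) - phi (x w.1) (G ^~ w.1))| <= s ^+ 2 * (C * (A w.1 * (B w + B w * B w))).
  rewrite normrM normrN (ger0_norm s0) expr2 -mulrA ler_wpM2l//.
  apply: (le_trans t1); rewrite [leRHS]mulrCA ler_wpM2l// [leRHS]mulrCA ler_wpM2l// mulrDr lerD2l.
  by rewrite -mulrA ler_wpM2l// [leRHS]mulrC -[leRHS]mulr1 -mulrA ler_wpM2l// [leLHS]mulrC ler_wpM2l.
have u2 : `|(c - 1) * phi y (G ^~ w.2)| <= s ^+ 2 * (C * A w.2) by rewrite normrM ler_pM.
have u3 : `|phi y (G ^~ w.2) - phi (x w.1) (G ^~ w.2) - (sg * s * dphi (x w.1) (G ^~ w.2) (G ^~ w.2) +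
    sg * (c - 1) * dphi (x w.1) (G ^~ w.2) (G ^~ w.1))| <= s ^+ 2 * (C * (A w.2 * B w * B w)).
  have -> : s ^+ 2 * (C * (A w.2 * B w * B w)) = C * (A w.2 * (s * B w) * (s * B w)) by ring.
  exact: t3.
have u4 : `|sg * (c - 1) * dphi (x w.1) (G ^~ w.2) (G ^~ w.1)| <= s ^+ 2 * (C * (`|sg| * (A w.2 * A w.1))).
  have -> : s ^+ 2 * (C * (`|sg| * (A w.2 * A w.1))) = s ^+ 2 * (`|sg| * (C * (A w.2 * A w.1))) by ring.
  move: (dphi _ _ _) t4 => dd t4; have -> : `|sg * (c - 1) * dd| = `|c - 1| * (`|sg| * `|dd|) by rewrite !normrM; ring.
  apply: ler_pM; rewrite ?mulr_ge0//; exact: ler_wpM2l.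
have eq : - s * phi y (G ^~ w.1) + c * phi y (G ^~ w.2) -
    (- s * phi (x w.1) (G ^~ w.1) + phi (x w.1) (G ^~ w.2) + s * (sg * dphi (x w.1) (G ^~ w.2) (G ^~ w.2))) =
   - s * (phi y (G ^~ w.1) - phi (x w.1) (G ^~ w.1)) + (c - 1) * phi y (G ^~ w.2)
   + (phi y (G ^~ w.2) - phi (x w.1) (G ^~ w.2) - (sg * s * dphi (x w.1) (G ^~ w.2) (G ^~ w.2) +
    sg * (c - 1) * dphi (x w.1) (G ^~ w.2) (G ^~ w.1)))
   + sg * (c - 1) * dphi (x w.1) (G ^~ w.2) (G ^~ w.1) by ring.
rewrite eq /Y (le_trans (ler_normD _ _))//.
apply: (@le_trans _ _ (s ^+ 2 * (C * (A w.1 * (B w + B w * B w))) + s ^+ 2 * (C * A w.2) +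
  s ^+ 2 * (C * (A w.2 * B w * B w)) + s ^+ 2 * (C * (`|sg| * (A w.2 * A w.1))))).
  rewrite lerD// (le_trans (ler_normD _ _))// lerD// (le_trans (ler_normD _ _))// lerD//.
by rewrite -!mulrDr.
Qed.

(* First-order expansion in the angle of the rotation invariance of a pair of
   independent copies of G. *)
Lemma stein_identity :
  [/\ itg Q (fun w => F (G ^~ w) (G ^~ w)),
      itg (pprod Q Q) (fun w => dphi (x w.1) (G ^~ w.2) (G ^~ w.2)) &
  Ex Q (fun w => F (G ^~ w) (G ^~ w)) = sg * E2 (fun w => dphi (x w.1) (G ^~ w.2) (G ^~ w.2))].
Proof.
have p20 := @itg_poly 0 2 isT.
have i1 : itg (pprod Q Q) (fun w => F (G ^~ w.1) (G ^~ w.1)).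
  have -> : (fun w => F (G ^~ w.1) (G ^~ w.1)) = (fun w : T * T =>
      F (fun i => 1 * G i w.1 + 0 * G i w.2) (fun i => 1 * G i w.1 + 0 * G i w.2)).
    by apply/funext => w; congr F; apply/funext => i; ring.
  exact: iF.
have i2 : itg (pprod Q Q) (fun w => F (G ^~ w.1) (G ^~ w.2)).
  have -> : (fun w => F (G ^~ w.1) (G ^~ w.2)) = (fun w : T * T =>
      F (fun i => 1 * G i w.1 + 0 * G i w.2) (fun i => 0 * G i w.1 + 1 * G i w.2)).
    by apply/funext => w; congr F; apply/funext => i; ring.
  exact: iF.
have i3 : itg (pprod Q Q) (fun w => dphi (x w.1) (G ^~ w.2) (G ^~ w.2)).
  apply: (itg_le _ (itgZ C p20)).
    apply: (@dphim _ _ (fun i (w : T * T) => sg * G i w.1 + z i) (fun i (w : T * T) => G i w.2) (fun i (w : T * T) => G i w.2)) => // i.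
    by apply: measurable_funD => //; exact: measurable_funM.
  by move=> w; rewrite expr0 mul1r expr2; exact: dphib.
have iQ : itg Q (fun w => F (G ^~ w) (G ^~ w)).
  have [cA hA] := A_mom8; have [iA _] := mom_itg (ler1n _ 8) hA.
  apply: (itg_le _ (itgZ C iA)).
    apply: (@phim _ _ (fun i w => sg * G i w + z i) G) => // i.
    by apply: measurable_funD => //; exact: measurable_funM.
  by move=> w; exact: phib.
split=> //.
have -> : Ex Q (fun w => F (G ^~ w) (G ^~ w)) = E2 (fun w => F (G ^~ w.1) (G ^~ w.1)).
  by rewrite (Ex_fst Q iQ).
(* D is the coefficient of s in the expansion of the rotated expectation, which is 0 for every s. *)
pose D := sg * E2 (fun w => dphi (x w.1) (G ^~ w.2) (G ^~ w.2)) - E2 (fun w => F (G ^~ w.1) (G ^~ w.1)).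
have key (s : R) : 0 < s -> s <= 1 -> `|D| <= s * E2 Y.
  move=> s0 s1; pose c := Num.sqrt (1 - s ^+ 2).
  have s2 : s ^+ 2 <= 1 by rewrite exprn_ile1// ltW.
  have c0 : 0 <= c by exact: sqrtr_ge0.
  have c2 : c ^+ 2 = 1 - s ^+ 2 by rewrite sqr_sqrtr// subr_ge0.
  have c1 : c <= 1 by rewrite -sqrtr1 ler_wsqrtr// gerBl sqr_ge0.
  have cs : 1 - c <= s ^+ 2 by nra.
  have iR := iF c s (- s) c.
  have rot := @gauss_rotation R K d T Q G Lam mG nG mean0 covG c s _ F _ F_sep i2 iR.
  have mR : measurable_fun setT (fun u : prodR (K + K)%type R => F (u \o inl) (u \o inr)).
    apply: (@phim _ _ (fun i (u : prodR (K + K)%type R) => sg * u (inl i) + z i)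
      (fun i (u : prodR (K + K)%type R) => u (inr i))) => i; last exact: measurable_coord.
    by apply: measurable_funD => //; apply: measurable_funM => //; exact: measurable_coord.
  have {}rot : E2 (fun z => F (fun i => c * G i z.1 + s * G i z.2) (fun i => - s * G i z.1 + c * G i z.2)) = 0.
    by rewrite -rot ?Ex_F0// c2 subrK.
  have iL : itg (pprod Q Q) (fun w => - s * F (G ^~ w.1) (G ^~ w.1) + F (G ^~ w.1) (G ^~ w.2)
      + s * (sg * dphi (x w.1) (G ^~ w.2) (G ^~ w.2))).
    by apply: itgD; [apply: itgD => //; exact: itgZ|do 2 apply: itgZ].
  have := norm_Ex_le (itg_meas (itgB iR iL)) (itgZ (s ^+ 2) iY)
    (fun w => pt w (ltW s0) s1 c0 c1 cs).
  rewrite (ExB iR iL) rot ExZ// (ExD (itgD (itgZ (- s) i1) i2) (itgZ s (itgZ sg i3))).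
  rewrite (ExD (itgZ (- s) i1) i2) (ExZ _ i1) (ExZ _ (itgZ sg i3)) (ExZ _ i3) Ex_F0.
  have -> : 0 - (- s * E2 (fun w => F (G ^~ w.1) (G ^~ w.1)) + 0 +
     s * (sg * E2 (fun w => dphi (x w.1) (G ^~ w.2) (G ^~ w.2)))) = - s * D by rewrite /D; ring.
  by rewrite normrM normrN (ger0_norm (ltW s0)) expr2 -mulrA ler_pM2l.
have D0 : D = 0.
  apply/eqP/contraT => Dn; have D0 : 0 < `|D| by rewrite normr_gt0.
  have h1 := key 1 ltr01 (lexx _); rewrite mul1r in h1.
  have y0 : 0 < E2 Y by exact: lt_le_trans h1.
  (* At s = |D| / (2 E Y) the bound |D| <= s E Y would read |D| <= |D| / 2. *)
  have t0 : 0 < `|D| / (2 * E2 Y) by rewrite divr_gt0// mulr_gt0.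
  have := key _ t0 _; rewrite ler_pdivrMr ?mulr_gt0//.
  move=> /(_ _)/wrap[].
    by rewrite mul1r (le_trans h1)// ler_peMl ?(ltW y0)// ler1n.
  have -> : `|D| / (2 * E2 Y) * E2 Y = `|D| / 2 by field; rewrite gt_eqF.
  by rewrite leNgt ltr_pdivrMr// ltr_pMr// ltr1n.
by apply/esym/eqP; rewrite -subr_eq0 -/D D0.
Qed.

End Stein.

Section SoftMaxMeasurability.
Context (R : realType) (K : finType).
Implicit Types (x u v h : K -> R).
Local Notation dlt := (@dlt R K).

Lemma gbs_lin x u : gbs x u = \sum_i u i * gbs x (dlt i).
Proof.
rewrite -gbs_sum; congr gbs; apply/funext => j.
by rewrite -[LHS](sum_dltr u).
Qed.

Lemma gbs1_lin x u v : gbs1 x u v = \sum_i v i * gbs1 x u (dlt i).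
Proof.
rewrite /gbs1 (gbs_lin x v) mulr_sumr.
have -> : gbs x (fun i => u i * v i) = \sum_i v i * gbs x (fun j => u j * dlt i j).
  rewrite -gbs_sum; congr gbs; apply/funext => j.
  under [RHS]eq_bigr do rewrite mulrCA.
  by rewrite -mulr_sumr sum_dltr.
by rewrite -sumrB; apply: eq_bigr => i _; rewrite mulrBr; congr (_ - _); ring.
Qed.

Lemma lgs1_lin x u : lgs1 x u = \sum_i u i * lgs1 x (dlt i).
Proof.
rewrite /lgs1 (gbs_lin x u) mulr_suml -sumrN.
by apply: eq_bigr => i _; ring.
Qed.

Lemma lgs2E x u v : lgs2 x u v = lgs x * (gbs x u * gbs x v - gbs1 x u v).
Proof. by rewrite /lgs2 /gbs1; ring. Qed.

Lemma lgs2_lin x u v : lgs2 x u v = \sum_i v i * lgs2 x u (dlt i).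
Proof.
rewrite lgs2E (gbs_lin x v) (gbs1_lin x u v) mulr_sumr -sumrB mulr_sumr.
by apply: eq_bigr => i _; rewrite lgs2E; ring.
Qed.

Section Measurability.
Context d (T : measurableType d) (y : K -> T -> R).
Hypothesis my : forall i, measurable_fun setT (y i).

Lemma measurable_lgs : measurable_fun setT (fun w => lgs (y ^~ w)).
Proof.
have -> : (fun w => lgs (y ^~ w)) = fun w => (1 + \sum_i expR (y i w)) `^ (- 1).
  by apply/funext => w; rewrite powR_inv1// ltW// lgs_den_gt0.
apply: (measurableT_comp (@measurable_powR R (-1))).
by apply: measurable_funD => //; apply: measurable_sum => i; exact: measurableT_comp.
Qed.

Lemma measurable_gbs (u : K -> T -> R) : (forall i, measurable_fun setT (u i)) ->
  measurable_fun setT (fun w => gbs (y ^~ w) (u ^~ w)).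
Proof.
move=> mu; apply: measurable_funM; last exact: measurable_lgs.
apply: measurable_sum => i; apply: measurable_funM => //; exact: measurableT_comp.
Qed.

Lemma measurable_lgs1 (u : K -> T -> R) : (forall i, measurable_fun setT (u i)) ->
  measurable_fun setT (fun w => lgs1 (y ^~ w) (u ^~ w)).
Proof.
move=> mu; apply: measurable_funN; apply: measurable_funM; last exact: measurable_lgs.
exact: measurable_gbs.
Qed.

Lemma measurable_gbs1 (u v : K -> T -> R) : (forall i, measurable_fun setT (u i)) ->
  (forall i, measurable_fun setT (v i)) ->
  measurable_fun setT (fun w => gbs1 (y ^~ w) (u ^~ w) (v ^~ w)).
Proof.
move=> mu mv; apply: measurable_funB; last by apply: measurable_funM; exact: measurable_gbs.
by apply: (measurable_gbs (u := fun i w => u i w * v i w)) => i; exact: measurable_funM.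
Qed.

Lemma measurable_lgs2 (u v : K -> T -> R) : (forall i, measurable_fun setT (u i)) ->
  (forall i, measurable_fun setT (v i)) ->
  measurable_fun setT (fun w => lgs2 (y ^~ w) (u ^~ w) (v ^~ w)).
Proof.
move=> mu mv; under eq_fun do rewrite lgs2E.
apply: measurable_funM; first exact: measurable_lgs.
apply: measurable_funB; last exact: measurable_gbs1.
by apply: measurable_funM; exact: measurable_gbs.
Qed.

End Measurability.

(** The Cauchy-Schwarz inequality for the Gibbs weights, of total mass 1 - lgs x, through Lagrange's
    identity. *)
Lemma gbs1_ge x u : lgs x * gbs x (fun i => u i * u i) <= gbs1 x u u.
Proof.
have l0 := lgs_gt0 x; have l1 := lgs_le1 x.
suff h : gbs x u * gbs x u <= (1 - lgs x) * gbs x (fun i => u i * u i).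
  rewrite /gbs1 lerBrDr; move: h; rewrite mulrBl mul1r lerBrDl addrC.
  by [].
have q1 : 1 - lgs x = \sum_i expR (x i) * lgs x.
  have := lgs_den_gt0 x; rewrite -mulr_suml /lgs; move: (\sum_i _) => s s0.
  by field; rewrite gt_eqF.
have gE (v : K -> R) : gbs x v = \sum_i expR (x i) * lgs x * v i.
  by rewrite /gbs mulr_suml; apply: eq_bigr => i _; ring.
rewrite q1 !gE; set p := fun i => expR (x i) * lgs x.
have p0 i : 0 <= p i by rewrite mulr_ge0 ?expR_ge0// ltW.
rewrite -subr_ge0.
have -> : (\sum_i p i) * (\sum_i p i * (u i * u i)) - (\sum_i p i * u i) * (\sum_i p i * u i) =
    2^-1 * \sum_i \sum_j p i * p j * (u i - u j) ^+ 2.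
  have e1 : (\sum_i p i) * (\sum_i p i * (u i * u i)) = \sum_i \sum_j p i * p j * (u i * u i).
    rewrite mulr_sumr; apply: eq_bigr => i _; rewrite mulr_suml; apply: eq_bigr => j _; ring.
  have e2 : (\sum_i p i) * (\sum_i p i * (u i * u i)) = \sum_i \sum_j p i * p j * (u j * u j).
    rewrite mulr_suml; apply: eq_bigr => i _; rewrite mulr_sumr; apply: eq_bigr => j _; ring.
  have e3 : (\sum_i p i * u i) * (\sum_i p i * u i) = \sum_i \sum_j p i * p j * (u i * u j).
    rewrite mulr_suml; apply: eq_bigr => i _; rewrite mulr_sumr; apply: eq_bigr => j _; ring.
  have -> : forall a b : R, a - b = 2^-1 * (a + a - (b + b)) by move=> a b; field.
  rewrite {1}e1 e2 e3 -!big_split /= -sumrB; congr (_ * _); apply: eq_bigr => i _.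
  by rewrite -!big_split /= -sumrB; apply: eq_bigr => j _; ring.
rewrite mulr_ge0// sumr_ge0// => i _; rewrite sumr_ge0// => j _.
by apply: mulr_ge0; [exact: mulr_ge0|exact: sqr_ge0].
Qed.

Lemma gbs_cst x (k : R) : gbs x (fun=> k) = k * (1 - lgs x).
Proof.
have := lgs_den_gt0 x; rewrite /gbs -mulr_suml /lgs; move: (\sum_i _) => s s0.
by field; rewrite gt_eqF.
Qed.

End SoftMaxMeasurability.

(** Cut h into n + 1 equal steps: the quadratic errors add up to C h^2 / (n + 1). It replaces the
    mean value theorem for functions known through a one-step estimate. *)
Lemma lipschitz_of_quadratic (R : realType) (g : R -> R) (L C : R) : 0 <= C ->
  (forall x h, `|g (x + h) - g x| <= L * `|h| + C * h ^+ 2) ->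
  forall x h, `|g (x + h) - g x| <= L * `|h|.
Proof.
move=> C0 gC x h.
have key n : `|g (x + h) - g x| <= L * `|h| + C * h ^+ 2 * n.+1%:R^-1.
  pose s : R := h / n.+1%:R.
  have tel k : `|g (x + k%:R * s) - g x| <= k%:R * (L * `|s| + C * s ^+ 2).
    elim: k => [|k IH]; first by rewrite !mul0r addr0 subrr normr0.
    rewrite -natr1 mulrDl mul1r addrA.
    have -> : g (x + k%:R * s + s) - g x = (g (x + k%:R * s + s) - g (x + k%:R * s)) + (g (x + k%:R * s) - g x) by ring.
    by rewrite (le_trans (ler_normD _ _))// mulrDl mul1r addrC lerD.
  have n0 : n.+1%:R != 0 :> R by rewrite pnatr_eq0.
  have := tel n.+1; rewrite [n.+1%:R * s]mulrC divfK// => /le_trans; apply.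
  rewrite le_eqVlt; apply/orP; left; apply/eqP.
  rewrite /s normrM normfV normr_nat; move: (n.+1%:R) n0 => N N0; by field.
have hz : L * `|h| + C * h ^+ 2 * n.+1%:R^-1 @[n --> \oo] --> L * `|h| + C * h ^+ 2 * 0.
  by apply: cvgD; [exact: cvg_cst|apply: cvgMr; exact: cvg_harmonic].
rewrite mulr0 addr0 in hz.
by apply: (ler_cvg_to (cvg_cst _) hz); apply: nearW => n; exact: key.
Qed.

Section SteinSoftMax.
Context (R : realType) (K : finType) (d : measure_display) (T : measurableType d).
Variables (Q : probability T R) (G : K -> T -> R) (Lam : K -> K -> R).
Hypotheses (mG : forall i, measurable_fun setT (G i)) (nG : jointly_normal Q G).
Hypothesis mean0 : forall i, expectation Q (G i) = 0%E.
Hypothesis covG : forall i j, covariance Q (G i) (G j) = (Lam i j)%:E.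
Variables (s : R) (z : K -> R).

Lemma stein_gbs :
  [/\ itg Q (fun w => gbs (fun i => s * G i w + z i) (G ^~ w)),
      itg (pprod Q Q) (fun w => gbs1 (fun i => s * G i w.1 + z i) (G ^~ w.2) (G ^~ w.2)) &
  Ex Q (fun w => gbs (fun i => s * G i w + z i) (G ^~ w)) =
  s * Ex (pprod Q Q) (fun w => gbs1 (fun i => s * G i w.1 + z i) (G ^~ w.2) (G ^~ w.2))].
Proof.
apply: (@stein_identity R K d T Q G Lam mG nG mean0 covG (@gbs R K) (@gbs1 R K) 10) => //.
- exact: gbs_lin.
- exact: gbs1_lin.
- by move=> y u a a0 ua; rewrite (le_trans (gbs_le _ a0 ua))// ler_peMl// ler1n.
- move=> y u v a a' a0 a'0 ua va; apply: (le_trans (gbs1_le _ a0 a'0 ua va)).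
  by rewrite ler_wpM2r ?mulr_ge0// ler_nat.
- by move=> y u h a c a0 c0 ua hc; exact: gbs_taylor.
- by move=> *; exact: measurable_gbs.
- by move=> *; exact: measurable_gbs1.
Qed.

Lemma stein_lgs1 :
  [/\ itg Q (fun w => lgs1 (fun i => s * G i w + z i) (G ^~ w)),
      itg (pprod Q Q) (fun w => lgs2 (fun i => s * G i w.1 + z i) (G ^~ w.2) (G ^~ w.2)) &
  Ex Q (fun w => lgs1 (fun i => s * G i w + z i) (G ^~ w)) =
  s * Ex (pprod Q Q) (fun w => lgs2 (fun i => s * G i w.1 + z i) (G ^~ w.2) (G ^~ w.2))].
Proof.
apply: (@stein_identity R K d T Q G Lam mG nG mean0 covG (@lgs1 R K) (@lgs2 R K) 13) => //.
- exact: lgs1_lin.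
- exact: lgs2_lin.
- move=> y u a a0 ua; by rewrite (le_trans (lgs1_le ua a0 _))// ler_peMl// ler1n.
- move=> y u v a a' a0 a'0 ua va; apply: (le_trans (lgs2_le ua va a0 a'0 _)).
  by rewrite ler_wpM2r ?mulr_ge0// ler_nat.
- by move=> y u h a c a0 c0 ua hc; exact: lgs1_taylor.
- by move=> *; exact: measurable_lgs1.
- by move=> *; exact: measurable_lgs2.
Qed.

End SteinSoftMax.

(** * Anti-concentration of the Gaussian maximum *)

Section AntiConcentration.
Context (R : realType) (K : finType) (d : measure_display) (T : measurableType d).
Variables (Q : probability T R) (G : K -> T -> R) (Lam : K -> K -> R).
Hypotheses (mG : forall i, measurable_fun setT (G i)) (nG : jointly_normal Q G).
Hypothesis mean0 : forall i, expectation Q (G i) = 0%E.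
Hypothesis covG : forall i j, covariance Q (G i) (G j) = (Lam i j)%:E.
Variables (U : T -> R) (c' kap b : R).
Hypotheses (b0 : 0 < b) (c'0 : 0 < c') (Lc' : forall i, c' <= Lam i i).
Hypotheses (U0 : forall w, 0 <= U w) (UG : forall i w, `|G i w| <= U w) (iU : itg Q U) (Ukap : Ex Q U <= kap).

Local Notation f x w := (lgs (fun i => b * (G i w - x))).

Let mf x : measurable_fun setT (fun w => f x w).
Proof.
by apply: (@measurable_lgs _ _ _ _ (fun i w => b * (G i w - x))) => i; apply: measurable_funM => //; exact: measurable_funB.
Qed.

Let fb x w : `|f x w| <= 1. Proof. by rewrite gtr0_norm ?lgs_gt0 ?lgs_le1. Qed.

Let iff x : itg Q (fun w => f x w). Proof. exact: (@itg_bnd _ _ _ _ _ 1). Qed.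

(* Stein's identity for [gbs]: E gbs(b (G - x), G) is at most kap, and equals b
   times an expectation that is at least c' E f (1 - f). *)
Lemma gauss_slope x : itg Q (fun w => f x w * (1 - f x w)) /\
  b * Ex Q (fun w => f x w * (1 - f x w)) <= kap / c'.
Proof.
have iv : itg Q (fun w => f x w * (1 - f x w)).
  apply: (@itg_bnd _ _ _ _ _ 1).
    by apply: measurable_funM => //; exact: measurable_funB.
  move=> w; rewrite normrM -[leRHS]mulr1 ler_pM//.
  by rewrite ger0_norm ?subr_ge0 ?lgs_le1// gerBl ltW// lgs_gt0.
split=> //.
pose y (w : T) : K -> R := fun i => b * G i w + - (b * x).
have yE w : y w = fun i => b * (G i w - x) by apply/funext => i; rewrite /y; ring.
have [i1 i3 st] := @stein_gbs R K d T Q G Lam mG nG mean0 covG b (fun=> - (b * x)).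
have my i : measurable_fun setT (fun w => y w i) by apply: measurable_funD => //; exact: measurable_funM.
have ig i : itg Q (fun w => lgs (y w) * gbs (y w) (dlt R i)).
  apply: (@itg_bnd _ _ _ _ _ 1).
    apply: measurable_funM; first exact: (@measurable_lgs _ _ _ _ (fun i w => y w i)).
    exact: (@measurable_gbs _ _ _ _ (fun i w => y w i) my (fun j w => dlt R i j)).
  move=> w; rewrite normrM -[leRHS]mulr1 ler_pM//; first by rewrite gtr0_norm ?lgs_gt0 ?lgs_le1.
  by apply: gbs_le => // j; rewrite /dlt; case: (_ == _); rewrite ?normr1 ?normr0.
rewrite ler_pdivlMr// (le_trans _ Ukap)// -mulrA.
apply: (@le_trans _ _ (b * Ex (pprod Q Q) (fun w => gbs1 (y w.1) (G ^~ w.2) (G ^~ w.2)))); last first.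
  by rewrite -st; apply: le_Ex => // w; apply: (le_trans (ler_norm _)); apply: gbs_le.
rewrite ler_wpM2l ?(ltW b0)//.
have iG i : itg Q (fun w => G i w * G i w) by exact: (gauss_itgM mG nG).
have iT i : itg (pprod Q Q) (fun w => lgs (y w.1) * gbs (y w.1) (dlt R i) * (G i w.2 * G i w.2)).
  exact: (itg_tensor (ig i) (iG i)).
(* The directions in Stein's identity are an independent copy of G. After [gbs1_ge] each expectation
   factorizes, with a variance [Lam i i], at least c', as one factor. *)
apply: (@le_trans _ _ (Ex (pprod Q Q) (fun w => \sum_i lgs (y w.1) * gbs (y w.1) (dlt R i) * (G i w.2 * G i w.2)))); last first.
  apply: le_Ex => //; first exact: itg_sum.
  move=> w; apply: le_trans (gbs1_ge _ _); rewrite [X in _ <= _ * X]gbs_lin mulr_sumr.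
  by apply: ler_sum => i _; rewrite le_eqVlt; apply/orP; left; apply/eqP; ring.
rewrite Ex_sum//.
have -> : (fun w => f x w * (1 - f x w)) = fun w => \sum_i lgs (y w) * gbs (y w) (dlt R i).
  apply/funext => w; rewrite -yE -mulr_sumr; congr (_ * _).
  rewrite -[LHS]mul1r -gbs_cst gbs_lin; by apply: eq_bigr => i _; rewrite mul1r.
rewrite Ex_sum// mulr_suml; apply: ler_sum => i _.
rewrite (@Ex_tensor _ _ _ _ _ Q Q (fun w => lgs (y w) * gbs (y w) (dlt R i)) (fun w => G i w * G i w))//.
rewrite (gauss_Ex2 mG nG mean0 covG) ler_wpM2l//.
apply: Ex_ge0 => w; rewrite mulr_ge0 ?(ltW (lgs_gt0 _))//.
rewrite /gbs mulr_ge0 ?(ltW (lgs_gt0 _))// sumr_ge0// => j _.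
by rewrite mulr_ge0 ?expR_ge0// ler0n.
Qed.

(** The derivative in x is b E f (1 - f), bounded by [gauss_slope]; [lipschitz_of_quadratic] removes
    the Taylor remainder. The resulting constant is independent of the inverse temperature b. *)
Lemma gauss_anticoncentration x h : `|Ex Q (fun w => f (x + h) w) - Ex Q (fun w => f x w)| <= kap / c' * `|h|.
Proof.
apply: (@lipschitz_of_quadratic _ (fun x => Ex Q (fun w => f x w)) _ (3 * b ^+ 2)) => [|{}x {}h].
  by rewrite mulr_ge0// sqr_ge0.
have [iv sl] := gauss_slope x.
rewrite -ExB//.
have key w : `|f (x + h) w - f x w| <= b * `|h| * (f x w * (1 - f x w)) + 3 * b ^+ 2 * h ^+ 2.
  have := @lgs_taylor R K (fun i => b * (G i w - x)) (fun=> - (b * h)) (`|b * h|) (normr_ge0 _).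
  have -> : (fun i => b * (G i w - x) + - (b * h)) = fun i => b * (G i w - (x + h)) by apply/funext => i; ring.
  rewrite /lgs1 gbs_cst => /(_ (fun i => _)) t.
  have f1 : 0 <= 1 - f x w by rewrite subr_ge0 lgs_le1.
  have bh : `|- (b * h)| <= `|b * h| by rewrite normrN.
  have {}t := t bh.
  rewrite -[X in `|X|](subrK (- (- (b * h) * (1 - f x w) * f x w))) (le_trans (ler_normD _ _))// addrC lerD//.
    rewrite normrN !normrM normrN normrM (gtr0_norm b0) (gtr0_norm (lgs_gt0 _)) (ger0_norm f1).
    by rewrite -mulrA [_ * f x w]mulrC.
  apply: (le_trans t); rewrite normrM (gtr0_norm b0) -[h ^+ 2]real_normK ?num_real// le_eqVlt.
  by apply/orP; left; apply/eqP; ring.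
have i1 := itgZ (b * `|h|) iv.
apply: (le_trans (norm_Ex_le _ (itgD i1 (itg_cst _ (3 * b ^+ 2 * h ^+ 2))) key)).
  by apply: measurable_funB.
rewrite (ExD i1 (itg_cst _ _)) Ex_cst lerD2r ExZ// mulrAC ler_wpM2r//.
Qed.

End AntiConcentration.

(** * Gaussian approximation under local dependence *)

Section HessianForm.
Context (R : realType) (K : finType).
Implicit Types (x u v h : K -> R) (M : K -> K -> R).
Local Notation dlt := (@dlt R K).

(** The Hessian form of [lgs] with a matrix in place of the products u_i v_j, so that covariance
    matrices can be inserted; see [lgs2ME] and [lgs2M_Ex]. *)
Definition lgs2M x M : R :=
  lgs x * (2 * (\sum_i \sum_j gbs x (dlt i) * gbs x (dlt j) * M i j) - \sum_i gbs x (dlt i) * M i i).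

Lemma lgs2ME x u v : lgs2 x u v = lgs2M x (fun i j => u i * v j).
Proof.
rewrite /lgs2 /lgs2M (gbs_lin x u) (gbs_lin x v) (gbs_lin x (fun i => u i * v i)).
congr (_ * (2 * _ - _)); last by apply: eq_bigr => i _; rewrite mulrC.
rewrite mulr_suml; apply: eq_bigr => i _; rewrite mulr_sumr; apply: eq_bigr => j _; ring.
Qed.

Lemma lgs2M_sum x I (r : seq I) (p : pred I) (M : I -> K -> K -> R) :
  lgs2M x (fun i j => \sum_(k <- r | p k) M k i j) = \sum_(k <- r | p k) lgs2M x (M k).
Proof.
elim: r => [|k r IH].
  rewrite big_nil /lgs2M.
  under eq_bigr do under eq_bigr do rewrite big_nil mulr0.
  under [X in _ - X]eq_bigr do rewrite big_nil mulr0.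
  by rewrite !big1 ?mulr0 ?subrr ?mulr0// => i _; rewrite big1.
rewrite big_cons; case: ifP => pk; last first.
  by rewrite -IH; congr lgs2M; apply/funext => i; apply/funext => j; rewrite big_cons pk.
rewrite -IH /lgs2M -mulrDr; congr (_ * _).
under eq_bigr do under eq_bigr do rewrite big_cons pk mulrDr.
under eq_bigr do rewrite big_split.
under [X in _ - X = _]eq_bigr do rewrite big_cons pk mulrDr.
by rewrite !big_split /=; ring.
Qed.

Lemma lgs2MZ x c M : lgs2M x (fun i j => c * M i j) = c * lgs2M x M.
Proof.
rewrite /lgs2M; under eq_bigr do under eq_bigr do rewrite mulrCA.
under eq_bigr do rewrite -mulr_sumr.
have -> : \sum_i gbs x (dlt i) * (c * M i i) = c * \sum_i gbs x (dlt i) * M i i.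
  by rewrite mulr_sumr; apply: eq_bigr => i _; rewrite mulrCA.
by rewrite -!mulr_sumr; ring.
Qed.

Lemma lgs2MB x M M' : lgs2M x (fun i j => M i j - M' i j) = lgs2M x M - lgs2M x M'.
Proof.
rewrite /lgs2M -mulrBr; congr (_ * _).
under eq_bigr do under eq_bigr do rewrite mulrBr.
under eq_bigr do rewrite sumrB.
under [X in _ - X = _]eq_bigr do rewrite mulrBr.
by rewrite !sumrB; ring.
Qed.

Lemma gbs_ge0 x u : (forall i, 0 <= u i) -> 0 <= gbs x u.
Proof.
move=> u0; rewrite /gbs mulr_ge0 ?(ltW (lgs_gt0 x))// sumr_ge0// => i _.
by rewrite mulr_ge0// expR_ge0.
Qed.

Lemma gbs_dlt_ge0 x i : 0 <= gbs x (dlt i).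
Proof. by apply: gbs_ge0 => j; exact: ler0n. Qed.

Lemma sum_gbs_dlt x : \sum_i gbs x (dlt i) = 1 - lgs x.
Proof.
by rewrite -[RHS]mul1r -gbs_cst gbs_lin; apply: eq_bigr => i _; rewrite mul1r.
Qed.

Lemma lgs2M_le x M c : 0 <= c -> (forall i j, `|M i j| <= c) -> `|lgs2M x M| <= 3 * c.
Proof.
move=> c0 hM; have l0 := lgs_gt0 x; have l1 := lgs_le1 x.
have q1 : \sum_i gbs x (dlt i) <= 1 by rewrite sum_gbs_dlt gerBl ltW.
have q0 : 0 <= \sum_i gbs x (dlt i) by apply: sumr_ge0 => i _; exact: gbs_dlt_ge0.
have h1 : `|\sum_i gbs x (dlt i) * M i i| <= c.
  rewrite (le_trans (ler_norm_sum _ _ _))// (@le_trans _ _ (\sum_i gbs x (dlt i) * c))//.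
    by apply: ler_sum => i _; rewrite normrM ger0_norm ?gbs_dlt_ge0// ler_wpM2l// gbs_dlt_ge0.
  by rewrite -mulr_suml ler_piMl.
have h2 : `|\sum_i \sum_j gbs x (dlt i) * gbs x (dlt j) * M i j| <= c.
  rewrite (le_trans (ler_norm_sum _ _ _))// (@le_trans _ _ (\sum_i gbs x (dlt i) * c))//; last first.
    by rewrite -mulr_suml ler_piMl.
  apply: ler_sum => i _; rewrite (le_trans (ler_norm_sum _ _ _))//.
  apply: (@le_trans _ _ (\sum_j gbs x (dlt i) * (gbs x (dlt j) * c))).
    apply: ler_sum => j _; rewrite -mulrA normrM ger0_norm ?gbs_dlt_ge0// ler_wpM2l ?gbs_dlt_ge0//.
    by rewrite normrM ger0_norm ?gbs_dlt_ge0// ler_wpM2l// gbs_dlt_ge0.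
  by rewrite -mulr_sumr ler_wpM2l ?gbs_dlt_ge0// -mulr_suml ler_piMl.
rewrite /lgs2M normrM (gtr0_norm l0) (@le_trans _ _ (1 * (2 * c + c)))//; last lra.
rewrite ler_pM ?(ltW l0)// (le_trans (ler_normB _ _))// normrM ger0_norm// lerD// ler_wpM2l//.
Qed.

Lemma lgs2M_dlt x M : lgs2M x M = \sum_i \sum_j lgs2 x (dlt i) (dlt j) * M i j.
Proof.
have {1}-> : M = fun i' j' => \sum_i \sum_j M i j * (dlt i i' * dlt j j').
  apply/funext => i'; apply/funext => j'; rewrite -[LHS](sum_dltr (M ^~ j')).
  apply: eq_bigr => i _; rewrite -(sum_dltr (M i) j') mulr_suml.
  by apply: eq_bigr => j _; ring.
rewrite lgs2M_sum; apply: eq_bigr => i _; rewrite lgs2M_sum; apply: eq_bigr => j _.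
by rewrite lgs2MZ -lgs2ME mulrC.
Qed.

Lemma lgs2_sumr x u a I (r : seq I) (p : pred I) (v : I -> K -> R) :
  lgs2 x u (fun i => a * \sum_(k <- r | p k) v k i) = a * \sum_(k <- r | p k) lgs2 x u (v k).
Proof.
rewrite lgs2ME; under [in RHS]eq_bigr do rewrite lgs2ME.
rewrite -lgs2M_sum -lgs2MZ; congr lgs2M; apply/funext => i; apply/funext => j.
by rewrite mulr_sumr !mulr_sumr; apply: eq_bigr => k _; ring.
Qed.

Lemma lgs1_suml x I (r : seq I) (p : pred I) (v : I -> K -> R) :
  lgs1 x (fun i => \sum_(k <- r | p k) v k i) = \sum_(k <- r | p k) lgs1 x (v k).
Proof.
rewrite lgs1_lin; under eq_bigr do rewrite mulr_suml.
by rewrite exchange_big /=; apply: eq_bigr => k _; rewrite [RHS]lgs1_lin.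
Qed.

Lemma lgs2M_Ex d (T : measurableType d) (P : probability T R) x (u v : K -> T -> R) :
  (forall i j, itg P (fun w => u i w * v j w)) ->
  itg P (fun w => lgs2 x (u ^~ w) (v ^~ w)) /\
  Ex P (fun w => lgs2 x (u ^~ w) (v ^~ w)) = lgs2M x (fun i j => Ex P (fun w => u i w * v j w)).
Proof.
move=> iuv.
have e : (fun w => lgs2 x (u ^~ w) (v ^~ w)) = fun w =>
    lgs x * (2 * (\sum_i \sum_j gbs x (dlt i) * gbs x (dlt j) * (u i w * v j w))
      - \sum_i gbs x (dlt i) * (u i w * v i w)).
  by apply/funext => w; rewrite lgs2ME.
have i1 : itg P (fun w => \sum_i \sum_j gbs x (dlt i) * gbs x (dlt j) * (u i w * v j w)).
  by apply: itg_sum => i _; apply: itg_sum => j _; exact: itgZ.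
have i2 : itg P (fun w => \sum_i gbs x (dlt i) * (u i w * v i w)).
  by apply: itg_sum => i _; exact: itgZ.
rewrite e; split; first by apply: itgZ; apply: itgB => //; exact: itgZ.
rewrite ExZ; last by apply: itgB => //; exact: itgZ.
rewrite /lgs2M ExB ?ExZ//; last exact: itgZ.
congr (_ * (2 * _ - _)).
  rewrite Ex_sum => [|i _]; last by apply: itg_sum => j _; exact: itgZ.
  apply: eq_bigr => i _; rewrite Ex_sum => [|j _]; last exact: itgZ.
  by apply: eq_bigr => j _; rewrite ExZ.
rewrite Ex_sum => [|i _]; last exact: itgZ.
by apply: eq_bigr => i _; rewrite ExZ.
Qed.

Lemma measurable_lgs2M d (T : measurableType d) (y : K -> T -> R) M : (forall i, measurable_fun setT (y i)) ->
  measurable_fun setT (fun w => lgs2M (y ^~ w) M).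
Proof.
move=> my; have mg i : measurable_fun setT (fun w => gbs (y ^~ w) (dlt i)).
  by apply: (@measurable_gbs _ _ _ _ y my (fun j w => dlt i j)) => j.
apply: measurable_funM; first exact: measurable_lgs.
apply: measurable_funB; last by apply: measurable_sum => i; exact: measurable_funM.
apply: measurable_funM => //; apply: measurable_sum => i; apply: measurable_sum => j.
by apply: measurable_funM => //; exact: measurable_funM.
Qed.

End HessianForm.

Lemma mom_Ex3 d (T : measurableType d) (R : realType) (P : probability T R) (A B C : T -> R) (a b c : R) :
  mom P 4 A a -> mom P 4 B b -> mom P 4 C c ->
  itg P (fun w => A w * (B w * C w)) /\ Ex P (fun w => `|A w * (B w * C w)|) <= a * (b * c).
Proof.
move=> hA hB hC; have two : 1 <= 2 :> R by rewrite ler1n.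
have e4 : 2 * 2 = 4 :> R by rewrite -natrM.
have hBC : mom P 2 (fun w => B w * C w) (b * c) by apply: momM; rewrite ?e4.
have hA2 : mom P 2 A a by apply: mom_expo hA => //; rewrite ler_nat.
apply: mom_itg (lexx 1) _; by apply: momM; rewrite ?mulr1.
Qed.

(** * Stein's method for locally dependent sums *)

Section LocalDependence.
Context (R : realType) (K : finType) (mu : probability (prodR int R) R).
Hypothesis imu : indep_coord mu.
Local Notation E := (prodR int R).
Local Notation dlt := (@dlt R K).
(** The t-th summand depends on the coordinates in [W t], and windows can meet only when [nr t s].
    [U t] dominates all components of the t-th summand, so the index set [K] enters the bounds only
    through a fourth moment of [U]. *)
Variables (n : nat) (V : 'I_n -> K -> E -> R) (W : 'I_n -> pred int) (nr : rel 'I_n).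
Variables (U : 'I_n -> E -> R) (k H : R) (Ln : nat).
Hypotheses (nrW : forall t s a, ~~ nr t s -> W t a -> ~~ W s a).
Hypotheses (bV : forall t i, bmeas k (V t i)) (dV : forall t i, dep (W t) (V t i)).
Hypotheses (EV : forall t i, Ex mu (V t i) = 0).
Hypotheses (VU : forall t i w, `|V t i w| <= U t w) (hU : forall t, mom mu 4 (U t) H).
Hypotheses (nrL : forall t, (#|[pred s | nr t s]| <= Ln)%N).
Hypotheses (H0 : 0 <= H) (U0 : forall t w, 0 <= U t w).
Variables (a : R) (z : K -> R).

Let S i w : R := \sum_t V t i w.
Let D t w : R := \sum_(s | nr t s) U s w.
Let y w : K -> R := fun i => a * S i w + z i.
(** [y1 t] omits the neighbours of t, and [y2 t s] those of t and of s. The latter is independent of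
    the pair of summands t and s, whose covariances can therefore be factored out in [step3]. *)
Let y1 t w : K -> R := fun i => a * (\sum_(r | ~~ nr t r) V r i w) + z i.
Let y2 t s w : K -> R := fun i => a * (\sum_(r | ~~ nr t r && ~~ nr s r) V r i w) + z i.
Let cov t s i j : R := Ex mu (fun w => V t i w * V s j w).

Let mV t i : measurable_fun setT (V t i). Proof. by case: (bV t i). Qed.

Let hD t : mom mu 4 (D t) (Ln%:R * H).
Proof.
have h : mom mu 4 (D t) (\sum_(s | nr t s) H) by apply: mom_sum => //; rewrite ler1n.
apply: mom_le h; rewrite sumr_const -(mulr_natl H).
by apply: ler_wpM2r => //; rewrite ler_nat; exact: nrL.
Qed.

Let mlin (p : pred 'I_n) i : measurable_fun setT (fun w => a * (\sum_(r | p r) V r i w) + z i).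
Proof.
apply: measurable_funD => //; apply: measurable_funM => //.
have -> : (fun w => \sum_(r | p r) V r i w) = fun w => \sum_r (if p r then V r i w else 0).
  by apply/funext => w; rewrite big_mkcond.
by apply: measurable_sum => r; case: (p r).
Qed.

Let bmeasM (F G : E -> R) c c' : bmeas c F -> bmeas c' G -> bmeas (c * c') (fun w => F w * G w).
Proof.
move=> [mF Fc] [mG Gc]; split; first exact: measurable_funM.
by move=> w; rewrite normrM ler_pM.
Qed.

Let dep_lin (p : pred 'I_n) i (A : pred int) : (forall r, p r -> forall c, W r c -> A c) ->
  dep A (fun w => a * (\sum_(r | p r) V r i w) + z i).
Proof.
move=> pA u v uv; congr (_ * _ + _); apply: eq_bigr => r pr.
by apply: (@dV r i) => j Wj; apply: uv; exact: pA pr j Wj.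
Qed.

Let dep_fun A (f : (K -> R) -> R) (Y : E -> K -> R) : (forall i, dep A (fun w => Y w i)) ->
  dep A (fun w => f (Y w)).
Proof. by move=> dY u v uv; congr f; apply/funext => i; exact: dY. Qed.

Let dlt1 i j : `|dlt i j| <= 1.
Proof. by rewrite /dlt; case: (_ == _); rewrite ?normr1 ?normr0. Qed.

(* V t is centred and independent of [y1 t]. *)
Let step1 t : Ex mu (fun w => lgs1 (y1 t w) (V t ^~ w)) = 0.
Proof.
have bl i : bmeas 1 (fun w => lgs1 (y1 t w) (dlt i)).
  split; last by move=> w; apply: lgs1_le => //.
  exact: (@measurable_lgs1 _ _ _ _ (fun i w => y1 t w i) (mlin _) (fun j w => dlt i j)).
have -> : (fun w => lgs1 (y1 t w) (V t ^~ w)) = fun w => \sum_i lgs1 (y1 t w) (dlt i) * V t i w.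
  by apply/funext => w; rewrite lgs1_lin; apply: eq_bigr => i _; rewrite mulrC.
rewrite Ex_sum => [|i _]; last exact: (bmeas_itg mu (bmeasM (bl i) (bV t i))).
rewrite big1// => i _; rewrite -[RHS](mulr0 (Ex mu (fun w => lgs1 (y1 t w) (dlt i)))) -(EV t i).
apply: (Ex_indep imu (bl i) (bV t i) _ (@dV t i)).
apply: (dep_fun (fun x => lgs1 x (dlt i))) => j; apply: dep_lin => r nr1 c Wc.
by apply/negP => Wt; have := nrW nr1 Wt; rewrite Wc.
Qed.

Let step3 t s : itg mu (fun w => lgs2 (y2 t s w) (V t ^~ w) (V s ^~ w)) /\
  Ex mu (fun w => lgs2 (y2 t s w) (V t ^~ w) (V s ^~ w)) = Ex mu (fun w => lgs2M (y2 t s w) (cov t s)).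
Proof.
pose M i j : E -> R := fun w => lgs2 (y2 t s w) (dlt i) (dlt j).
have bl i j : bmeas 3 (M i j).
  split; last by move=> w; rewrite -[leRHS]mulr1 -[X in _ <= _ * X]mulr1; exact: lgs2_le.
  exact: (@measurable_lgs2 _ _ _ _ (fun i w => y2 t s w i) (mlin _) (fun c w => dlt i c) (fun c w => dlt j c)).
have e w (c : K -> K -> R) : lgs2M (y2 t s w) c = \sum_i \sum_j M i j w * c i j by exact: lgs2M_dlt.
have bVV i j := bmeasM (bV t i) (bV s j).
have bMV i j := bmeasM (bl i j) (bVV i j).
have -> : (fun w => lgs2 (y2 t s w) (V t ^~ w) (V s ^~ w)) =
    fun w => \sum_i \sum_j M i j w * (V t i w * V s j w).
  by apply/funext => w; rewrite lgs2ME e.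
have -> : (fun w => lgs2M (y2 t s w) (cov t s)) = fun w => \sum_i \sum_j cov t s i j * M i j w.
  by apply/funext => w; rewrite e; apply: eq_bigr => i _; apply: eq_bigr => j _; rewrite mulrC.
have iMV i j : itg mu (fun w => M i j w * (V t i w * V s j w)) := bmeas_itg mu (bMV i j).
have iM i j := bmeas_itg mu (bl i j).
split; first by apply: itg_sum => i _; apply: itg_sum => j _.
rewrite !Ex_sum => [|i _|i _]; last 2 first.
- by apply: itg_sum => j _; exact: itgZ.
- by apply: itg_sum => j _.
apply: eq_bigr => i _; rewrite !Ex_sum => [|j _|j _] //; last exact: itgZ.
apply: eq_bigr => j _; rewrite ExZ// mulrC.
have dV2 : dep (predU (W t) (W s)) (fun w => V t i w * V s j w).
  move=> u v uv; congr (_ * _); first by apply: (@dV t i) => c Wc; apply: uv; rewrite /= Wc.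
  by apply: (@dV s j) => c Wc; apply: uv; rewrite /= Wc orbT.
apply: (Ex_indep imu (bl i j) (bVV i j) _ dV2).
apply: (dep_fun (fun x => lgs2 x (dlt i) (dlt j))) => c; apply: dep_lin => r /andP[nt ns] c' Wc'.
apply/negP => /orP[Wt|Ws].
  by have := nrW nt Wt; rewrite Wc'.
by have := nrW ns Ws; rewrite Wc'.
Qed.

Let my i : measurable_fun setT (fun w => y w i).
Proof. exact: (mlin predT i). Qed.

Let absV (p q : pred 'I_n) i w : {subset p <= q} -> `|a * \sum_(r | p r) V r i w| <= `|a| * \sum_(r | q r) U r w.
Proof.
move=> pq; rewrite normrM ler_wpM2l// (le_trans (ler_norm_sum _ _ _))//.
rewrite [leRHS]big_mkcond /= big_mkcond /=; apply: ler_sum => r _.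
case: ifP => pr; first by rewrite (pq r pr : q r).
by case: ifP.
Qed.

Let D0 t w : 0 <= D t w. Proof. exact: sumr_ge0. Qed.

Let P1 t w : `|lgs1 (y w) (V t ^~ w) - lgs1 (y1 t w) (V t ^~ w)
    - a * \sum_(s | nr t s) lgs2 (y1 t w) (V t ^~ w) (V s ^~ w)| <= 13 * a ^+ 2 * (U t w * (D t w * D t w)).
Proof.
pose h i := a * \sum_(s | nr t s) V s i w.
have yE : y w = fun i => y1 t w i + h i.
  apply/funext => i; rewrite /y /y1 /h /S (bigID (nr t)) /=; ring.
have hc i : `|h i| <= `|a| * D t w by exact: (absV (p := nr t) (q := nr t)).
have aD0 : 0 <= `|a| * D t w by rewrite mulr_ge0.
have := lgs1_taylor (y1 t w) (U0 t w) aD0 (fun i => VU t i w) hc.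
rewrite -yE /h lgs2_sumr => /le_trans; apply.
by rewrite -[a ^+ 2]real_normK ?num_real// le_eqVlt; apply/orP; left; apply/eqP; ring.
Qed.

Let P2 t s w : `|lgs2 (y1 t w) (V t ^~ w) (V s ^~ w) - lgs2 (y2 t s w) (V t ^~ w) (V s ^~ w)|
  <= 13 * `|a| * (U t w * (U s w * D s w)).
Proof.
pose h i := a * \sum_(r | ~~ nr t r && nr s r) V r i w.
have yE : y1 t w = fun i => y2 t s w i + h i.
  apply/funext => i; rewrite /y1 /y2 /h (bigID (nr s)) /=; ring.
have hc i : `|h i| <= `|a| * D s w.
  by apply: (absV (p := [pred r | ~~ nr t r && nr s r]) (q := nr s)) => r /andP[].
have aD0 : 0 <= `|a| * D s w by rewrite mulr_ge0.
have := lgs2_lip (y2 t s w) (U0 t w) (U0 s w) aD0 (fun i => VU t i w) (fun i => VU s i w) hc.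
rewrite -yE => /le_trans; apply.
by rewrite le_eqVlt; apply/orP; left; apply/eqP; ring.
Qed.

Let hUU t s : itg mu (fun w => U t w * U s w) /\ Ex mu (fun w => U t w * U s w) <= H * H.
Proof.
have h2 r : mom mu 2 (U r) H by apply: mom_expo (hU r) => //; rewrite ler_nat.
have h : mom mu 1 (fun w => U t w * U s w) (H * H) by apply: momM; rewrite ?mulr1.
have [i1 h1] := mom_itg (lexx 1) h; split => //; apply: le_trans h1; apply: le_Ex => //.
  exact: itg_norm.
by move=> w; exact: ler_norm.
Qed.

Let iVV t s i j : itg mu (fun w => V t i w * V s j w).
Proof. exact: bmeas_itg (bmeasM (bV t i) (bV s j)). Qed.

Let P3 t s w : `|lgs2M (y2 t s w) (cov t s) - lgs2M (y w) (cov t s)|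
  <= 13 * `|a| * (H * H) * (D t w + D s w).
Proof.
pose h i := a * \sum_(r | nr t r || nr s r) V r i w.
have yE : y w = fun i => y2 t s w i + h i.
  apply/funext => i; rewrite /y /S /y2 /h (bigID (fun r => nr t r || nr s r)) /=.
  have -> : \sum_(r | ~~ (nr t r || nr s r)) V r i w = \sum_(r | ~~ nr t r && ~~ nr s r) V r i w.
    by apply: eq_bigl => r; rewrite negb_or.
  ring.
have hc i : `|h i| <= `|a| * (D t w + D s w).
  apply: (le_trans (absV (q := [pred r | nr t r || nr s r]) i w _)) => //.
  rewrite ler_wpM2l// /D big_mkcond [X in _ <= X + _]big_mkcond [X in _ <= _ + X]big_mkcond /=.
  rewrite -big_split /=; apply: ler_sum => r _.
  by case: (nr t r); case: (nr s r); rewrite /= ?addr0 ?add0r// lerDl.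
have aD0 : 0 <= `|a| * (D t w + D s w) by rewrite mulr_ge0// addr_ge0.
have [i1 e1] := lgs2M_Ex (y2 t s w) (iVV t s); have [i2 e2] := lgs2M_Ex (y w) (iVV t s).
rewrite /cov -e1 -e2 -ExB//.
have [i3 h3] := hUU t s.
apply: (le_trans (norm_Ex_le _ (itgZ (13 * (`|a| * (D t w + D s w))) i3) _)).
- exact: itg_meas (itgB i1 i2).
- move=> w'; have := lgs2_lip (y2 t s w) (U0 t w') (U0 s w') aD0 (fun i => VU t i w') (fun i => VU s i w') hc.
  rewrite -yE distrC => /le_trans; apply.
  by rewrite le_eqVlt; apply/orP; left; apply/eqP; ring.
rewrite ExZ//; apply: (@le_trans _ _ (13 * (`|a| * (D t w + D s w)) * (H * H))).
  by rewrite ler_wpM2l// mulr_ge0.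
by rewrite le_eqVlt; apply/orP; left; apply/eqP; ring.
Qed.

Let cov0 t s : ~~ nr t s -> cov t s = fun _ _ => 0.
Proof.
move=> nts; apply/funext => i; apply/funext => j; rewrite /cov.
have dt : dep (predC (W s)) (V t i) by apply: dep_sub (@dV t i) => c Wc; exact: nrW nts Wc.
by rewrite (Ex_indep imu (bV t i) (bV s j) dt (@dV s j)) EV mul0r.
Qed.

Let covS i j : Ex mu (fun w => S i w * S j w) = \sum_t \sum_(s | nr t s) cov t s i j.
Proof.
have -> : (fun w => S i w * S j w) = fun w => \sum_t \sum_s V t i w * V s j w.
  by apply/funext => w; rewrite /S mulr_suml; apply: eq_bigr => t _; rewrite mulr_sumr.
rewrite Ex_sum => [|t _]; last by apply: itg_sum => s _; exact: iVV.
apply: eq_bigr => t _; rewrite Ex_sum => [|s _]; last exact: iVV.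
rewrite [RHS]big_mkcond /=; apply: eq_bigr => s _; case: ifPn => // /cov0 e.
by rewrite -[LHS]/(cov t s i j) e.
Qed.

Let bl1 t : itg mu (fun w => lgs1 (y w) (V t ^~ w)) /\ itg mu (fun w => lgs1 (y1 t w) (V t ^~ w)).
Proof.
have [iU _] := mom_itg (ler1n _ 4) (hU t).
split.
  apply: (itg_le _ iU) => [|w]; last exact: (lgs1_le (fun i => VU t i w) (U0 t w)).
  exact: (@measurable_lgs1 _ _ _ _ (fun i w => y w i) my (V t)).
apply: (itg_le _ iU) => [|w]; last exact: (lgs1_le (fun i => VU t i w) (U0 t w)).
exact: (@measurable_lgs1 _ _ _ _ (fun i w => y1 t w i) (mlin _) (V t)).
Qed.

Let bl2 t s : itg mu (fun w => lgs2 (y1 t w) (V t ^~ w) (V s ^~ w)).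
Proof.
have [iU _] := hUU t s; apply: (itg_le _ (itgZ 3 iU)).
  exact: (@measurable_lgs2 _ _ _ _ (fun i w => y1 t w i) (mlin _) (V t) (V s)).
by move=> w; exact: (lgs2_le (fun i => VU t i w) (fun i => VU s i w) (U0 t w) (U0 s w)).
Qed.

Let cov_le t s i j : `|cov t s i j| <= H * H.
Proof.
have [i1 h1] := hUU t s; apply: le_trans h1; apply: norm_Ex_le => //.
  exact: measurable_funM.
by move=> w; rewrite normrM ler_pM.
Qed.

Let bM (M : K -> K -> R) c (Y : E -> K -> R) : (forall i, measurable_fun setT (fun w => Y w i)) ->
  0 <= c -> (forall i j, `|M i j| <= c) -> itg mu (fun w => lgs2M (Y w) M).
Proof.
move=> mY c0 hM; apply: (@itg_bnd _ _ _ _ _ (3 * c)); last by move=> w; exact: lgs2M_le.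
exact: (@measurable_lgs2M _ _ _ _ (fun i w => Y w i)).
Qed.

(** Three exchanges. The function is expanded at [y1 t], where the leading term vanishes by [step1]
    (A1, cost 13); then [y1 t] becomes [y2 t s], so that covariances factor out (A2, cost 13);
    finally [y2 t s] becomes [y] again (A3, cost 26). Their sum is 52. *)
Let one t : `|Ex mu (fun w => lgs1 (y w) (V t ^~ w)) - a * \sum_(s | nr t s) Ex mu (fun w => lgs2M (y w) (cov t s))|
  <= 52 * (a ^+ 2 * (Ln%:R ^+ 2 * H ^+ 3)).
Proof.
have [i1 i2] := bl1 t.
have HH0 : 0 <= H * H by rewrite mulr_ge0.
have i3 : itg mu (fun w => a * \sum_(s | nr t s) lgs2 (y1 t w) (V t ^~ w) (V s ^~ w)).
  by apply: itgZ; apply: itg_sum => s _.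
have i4 s : itg mu (fun w => lgs2 (y2 t s w) (V t ^~ w) (V s ^~ w)) by case: (step3 t s).
have i5 s : itg mu (fun w => lgs2M (y w) (cov t s)) by apply: (bM my HH0); exact: cov_le.
have i6 s : itg mu (fun w => lgs2M (y2 t s w) (cov t s)) by apply: (bM (mlin _) HH0); exact: cov_le.
have L0 : 0 <= Ln%:R :> R by [].
have a2 : `|a| * `|a| = a ^+ 2 by rewrite -expr2 real_normK ?num_real.
pose A1 := Ex mu (fun w => lgs1 (y w) (V t ^~ w) - lgs1 (y1 t w) (V t ^~ w)
    - a * \sum_(s | nr t s) lgs2 (y1 t w) (V t ^~ w) (V s ^~ w)).
pose A2 s := Ex mu (fun w => lgs2 (y1 t w) (V t ^~ w) (V s ^~ w) - lgs2 (y2 t s w) (V t ^~ w) (V s ^~ w)).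
pose A3 s := Ex mu (fun w => lgs2M (y2 t s w) (cov t s) - lgs2M (y w) (cov t s)).
have -> : Ex mu (fun w => lgs1 (y w) (V t ^~ w)) - a * \sum_(s | nr t s) Ex mu (fun w => lgs2M (y w) (cov t s)) =
    A1 + \sum_(s | nr t s) a * (A2 s + A3 s).
  rewrite /A1 ExB//; last exact: itgB.
  rewrite ExB// step1 subr0 ExZ; last by apply: itg_sum.
  rewrite Ex_sum//.
  have -> : \sum_(s | nr t s) a * (A2 s + A3 s) = a * \sum_(s | nr t s) Ex mu (fun w => lgs2 (y1 t w) (V t ^~ w) (V s ^~ w))
      - a * \sum_(s | nr t s) Ex mu (fun w => lgs2M (y w) (cov t s)).
    rewrite -mulrBr -sumrB mulr_sumr; apply: eq_bigr => s _; congr (_ * _).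
    rewrite /A2 /A3 !ExB//; have [_ ->] := step3 t s; ring.
  ring.
have h1 : `|A1| <= 13 * (a ^+ 2 * (Ln%:R ^+ 2 * H ^+ 3)).
  have [j1 k1] := mom_Ex3 (hU t) (hD t) (hD t).
  apply: (le_trans (norm_Ex_le _ (itgZ (13 * a ^+ 2) (itg_norm j1)) _)).
  - exact: (itg_meas (itgB (itgB i1 i2) i3)).
  - move=> w; apply: (le_trans (P1 t w)); apply: ler_wpM2l (ler_norm _); by rewrite mulr_ge0// sqr_ge0.
  rewrite ExZ; last exact: itg_norm.
  apply: (@le_trans _ _ (13 * a ^+ 2 * (H * (Ln%:R * H * (Ln%:R * H))))).
    by apply: ler_wpM2l => //; rewrite mulr_ge0// sqr_ge0.
  by rewrite le_eqVlt; apply/orP; left; apply/eqP; ring.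
have h2 s : `|A2 s| <= 13 * `|a| * (Ln%:R * H ^+ 3).
  have [j1 k1] := mom_Ex3 (hU t) (hU s) (hD s).
  apply: (le_trans (norm_Ex_le _ (itgZ (13 * `|a|) (itg_norm j1)) _)).
  - exact: (itg_meas (itgB (bl2 t s) (i4 s))).
  - move=> w; apply: (le_trans (P2 t s w)); apply: ler_wpM2l (ler_norm _); by rewrite mulr_ge0.
  rewrite ExZ; last exact: itg_norm.
  apply: (@le_trans _ _ (13 * `|a| * (H * (H * (Ln%:R * H))))).
    by rewrite ler_wpM2l ?mulr_ge0.
  by rewrite le_eqVlt; apply/orP; left; apply/eqP; ring.
have h3 s : `|A3 s| <= 26 * `|a| * (Ln%:R * H ^+ 3).
  have kD r : itg mu (D r) /\ Ex mu (D r) <= Ln%:R * H.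
    have [j1 k1] := mom_itg (ler1n _ 4) (hD r); split=> //; apply: le_trans k1.
    by apply: le_Ex => // [|w]; [exact: itg_norm|exact: ler_norm].
  have [j1 k1] := kD t; have [j2 k2] := kD s.
  apply: (le_trans (norm_Ex_le _ (itgZ (13 * `|a| * (H * H)) (itgD j1 j2)) _)).
  - exact: (itg_meas (itgB (i6 s) (i5 s))).
  - by move=> w; exact: P3.
  rewrite ExZ ?ExD//; last exact: itgD.
  apply: (@le_trans _ _ (13 * `|a| * (H * H) * (Ln%:R * H + Ln%:R * H))).
    by rewrite ler_wpM2l ?mulr_ge0// lerD.
  by rewrite le_eqVlt; apply/orP; left; apply/eqP; ring.
rewrite (le_trans (ler_normD _ _))//.
have h4 : `|\sum_(s | nr t s) a * (A2 s + A3 s)| <= 39 * (a ^+ 2 * (Ln%:R ^+ 2 * H ^+ 3)).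
  rewrite (le_trans (ler_norm_sum _ _ _))//.
  apply: (@le_trans _ _ (\sum_(s | nr t s) 39 * (a ^+ 2 * (Ln%:R * H ^+ 3)))).
    apply: ler_sum => s _; rewrite normrM.
    have h5 : `|A2 s + A3 s| <= 39 * `|a| * (Ln%:R * H ^+ 3).
      rewrite (le_trans (ler_normD _ _))// (_ : 39 = 13 + 26 :> R); last by rewrite -natrD.
      by rewrite 2!mulrDl lerD.
    apply: (le_trans (ler_wpM2l (normr_ge0 a) h5)); rewrite -a2.
    by rewrite le_eqVlt; apply/orP; left; apply/eqP; ring.
  rewrite sumr_const -[leLHS]mulr_natl.
  apply: (@le_trans _ _ (Ln%:R * (39 * (a ^+ 2 * (Ln%:R * H ^+ 3))))).
    apply: ler_wpM2r; last by rewrite ler_nat; exact: nrL.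
    by rewrite mulr_ge0// mulr_ge0 ?sqr_ge0// mulr_ge0// exprn_ge0.
  by rewrite le_eqVlt; apply/orP; left; apply/eqP; ring.
have -> : 52 = 13 + 39 :> R by rewrite -natrD.
by rewrite mulrDl lerD.
Qed.

Lemma local_dependence_stein :
  `|Ex mu (fun w => lgs1 (y w) (S ^~ w)) - a * Ex mu (fun w => lgs2M (y w) (fun i j => Ex mu (fun w => S i w * S j w)))|
  <= 52 * (a ^+ 2 * (n%:R * (Ln%:R ^+ 2 * H ^+ 3))).
Proof.
have HH0 : 0 <= H * H by rewrite mulr_ge0.
have i5 t s : itg mu (fun w => lgs2M (y w) (cov t s)) by apply: (bM my HH0); exact: cov_le.
have -> : (fun w => lgs1 (y w) (S ^~ w)) = fun w => \sum_t lgs1 (y w) (V t ^~ w).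
  by apply/funext => w; exact: lgs1_suml.
rewrite Ex_sum => [|t _]; last by case: (bl1 t).
have -> : (fun w => lgs2M (y w) (fun i j => Ex mu (fun w => S i w * S j w))) =
    fun w => \sum_t \sum_(s | nr t s) lgs2M (y w) (cov t s).
  apply/funext => w; rewrite -[RHS](eq_bigr _ (fun t _ => lgs2M_sum (y w) _ (nr t) (cov t))) -lgs2M_sum.
  congr lgs2M; apply/funext => i; apply/funext => j; exact: covS.
rewrite Ex_sum => [|t _]; last by apply: itg_sum => s _.
rewrite mulr_sumr -sumrB (le_trans (ler_norm_sum _ _ _))//.
apply: (@le_trans _ _ (\sum_(t < n) 52 * (a ^+ 2 * (Ln%:R ^+ 2 * H ^+ 3)))).
  by apply: ler_sum => t _; rewrite Ex_sum//; exact: one.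
rewrite sumr_const card_ord -[leLHS]mulr_natl.
by rewrite le_eqVlt; apply/orP; left; apply/eqP; ring.
Qed.

End LocalDependence.

Section TrigIncrements.
Context (R : realType).

Lemma cos_lip (a b : R) : `|cos (a + b) - cos a| <= `|b|.
Proof.
have d0 t : is_derive t (1 : R) (fun t : R => a + t * b) b.
  have d1 : is_derive t (1 : R) (fun t : R => t) (1 : R) by exact: is_derive_id.
  apply: (is_derive_eq (drvD (is_derive_cst a t (1 : R)) (drvM d1 (is_derive_cst b t (1 : R))))).
  by rewrite /= mulr0 addr0 mul1r add0r.
have dc t : is_derive t (1 : R) (fun t : R => cos (a + t * b)) (- (b * sin (a + t * b))).
  by apply: (is_derive_eq (is_derive1_comp (is_derive_cos _) (d0 t))); rewrite mulNr mulrC.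
have := @drv_le _ _ _ `|b| dc _.
rewrite mul1r mul0r addr0; apply => t.
by rewrite normrN normrM ler_piMr// sin_abs_le1.
Qed.

Lemma sin_cos_shift (a : R) : sin a = cos (a + - (pi / 2)).
Proof. by rewrite cosB cos_pihalf sin_pihalf mulr0 add0r mulr1. Qed.

Lemma cos_sin_shift (a : R) : - cos a = sin (a + - (pi / 2)).
Proof. by rewrite sinB cos_pihalf sin_pihalf mulr0 mulr1 sub0r. Qed.

Lemma sin_lip (a b : R) : `|sin (a + b) - sin a| <= `|b|.
Proof. by rewrite !sin_cos_shift addrAC; exact: cos_lip. Qed.

Lemma sin_taylor (a b : R) : `|sin (a + b) - sin a - b * cos a| <= b ^+ 2.
Proof.
have := cos_taylor (a + - (pi / 2)) b.
have -> : cos (a + - (pi / 2) + b) = sin (a + b) by rewrite addrAC -sin_cos_shift.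
by rewrite -cos_sin_shift -sin_cos_shift mulrN.
Qed.

End TrigIncrements.

(** * Interpolation between the sum and the Gaussian vector *)

Section GaussianApproximation.
Context (R : realType) (K : finType) (mu : probability (prodR int R) R).
Context (d : measure_display) (T : measurableType d).
Variables (Q : probability T R) (G : K -> T -> R) (Lam : K -> K -> R).
Hypotheses (mG : forall i, measurable_fun setT (G i)) (nG : jointly_normal Q G).
Hypothesis mean0 : forall i, expectation Q (G i) = 0%E.
Hypothesis covG : forall i j, covariance Q (G i) (G j) = (Lam i j)%:E.
Hypothesis imu : indep_coord mu.
Local Notation E := (prodR int R).
Variables (n : nat) (V : 'I_n -> K -> E -> R) (W : 'I_n -> pred int) (nr : rel 'I_n).
Variables (U : 'I_n -> E -> R) (k H : R) (Ln : nat).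
Hypotheses (nrW : forall t s a, ~~ nr t s -> W t a -> ~~ W s a).
Hypotheses (bV : forall t i, bmeas k (V t i)) (dV : forall t i, dep (W t) (V t i)).
Hypotheses (EV : forall t i, Ex mu (V t i) = 0).
Hypotheses (VU : forall t i w, `|V t i w| <= U t w) (hU : forall t, mom mu 4 (U t) H).
Hypotheses (nrL : forall t, (#|[pred s | nr t s]| <= Ln)%N).
Hypotheses (H0 : 0 <= H) (U0 : forall t w, 0 <= U t w).
Variables (b x Del : R).
Hypotheses (b0 : 0 <= b) (Del0 : 0 <= Del).

Local Notation S := (fun i w => \sum_t V t i w).
Hypothesis covDel : forall i j, `|Lam i j - Ex mu (fun w => S i w * S j w)| <= Del.

Local Notation PQ := (pprod mu Q).
Let Y th (z : E * T) : K -> R := fun i => b * (cos th * S i z.1 + sin th * G i z.2 - x).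
Let v th (z : E * T) : K -> R := fun i => b * (- sin th * S i z.1 + cos th * G i z.2).
Let Psi th := Ex PQ (fun z => lgs (Y th z)).
Let Psi1 th := Ex PQ (fun z => lgs1 (Y th z) (v th z)).
Let A (z : E * T) := \sum_i `|S i z.1| + \sum_i `|G i z.2|.
Let A0 z : 0 <= A z. Proof. by rewrite addr_ge0// sumr_ge0. Qed.

Let mS i : measurable_fun setT (S i).
Proof. by apply: measurable_sum => t; case: (bV t i). Qed.

Let mS1 i : measurable_fun setT (fun z : E * T => S i z.1).
Proof. exact: (measurableT_comp (mS i) measurable_fst). Qed.

Let mG2 i : measurable_fun setT (fun z : E * T => G i z.2).
Proof. exact: (measurableT_comp (mG i) measurable_snd). Qed.

Let mlin c1 c2 c3 i : measurable_fun setT (fun z => b * (c1 * S i z.1 + c2 * G i z.2 - c3)).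
Proof.
apply: measurable_funM => //; apply: measurable_funB => //.
by apply: measurable_funD; apply: measurable_funM.
Qed.

Let mY th i : measurable_fun setT (fun z => Y th z i). Proof. exact: mlin. Qed.

Let mv th i : measurable_fun setT (fun z => v th z i).
Proof.
have -> : (fun z => v th z i) = fun z => b * (- sin th * S i z.1 + cos th * G i z.2 - 0).
  by apply/funext => z; rewrite subr0.
exact: mlin.
Qed.

Let mSmom i : exists c, mom mu 8 (S i) c.
Proof.
exists (\sum_(t < n) k); apply: mom_sum => [|t _]; first by rewrite ler1n.
by case: (bV t i) => m1 m2; apply: mom_bnd => //; exact: bmeas_ge0 (bV t i).
Qed.

Let SA i z : `|S i z.1| <= A z.
Proof. by rewrite /A (bigD1 i)//= -addrA lerDl addr_ge0// sumr_ge0. Qed.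

Let GA i z : `|G i z.2| <= A z.
Proof. by rewrite /A addrC (bigD1 i)//= -addrA lerDl addr_ge0// sumr_ge0. Qed.

Let iA : itg PQ A /\ itg PQ (fun z => A z * A z).
Proof.
have [cS hS] := choice mSmom; have [cG hG] := choice (fun i => gauss_mom8 mG nG i).
have mnorm d0 (T0 : measurableType d0) (P0 : probability T0 R) (X : K -> T0 -> R) (c : K -> R) :
    (forall i, mom P0 8 (X i) (c i)) -> mom P0 8 (fun w => \sum_i `|X i w|) (\sum_i c i).
  move=> hX; apply: mom_sum => [|i _]; first by rewrite ler1n.
  apply: mom_dom (hX i) => //; last by move=> w; rewrite normr_id.
  by apply: measurableT_comp => //; exact: mom_meas (hX i).
have h1 := mnorm _ _ _ _ _ hS; have h2 := mnorm _ _ _ _ _ hG.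
have [i1 _] := mom_itg (ler1n _ 8) h1; have [i2 _] := mom_itg (ler1n _ 8) h2.
have sq d0 (T0 : measurableType d0) (P0 : probability T0 R) X c : mom P0 8 X c -> itg P0 (fun w => X w * X w).
  move=> hX; have h : mom P0 4 (fun w => X w * X w) (c * c) by apply: momM; rewrite -?natrM ?ler1n.
  by have [] := mom_itg (ler1n _ 4) h.
have iA1 : itg PQ A by apply: itgD; [exact: (itg_fst Q i1)|exact: (itg_snd mu i2)].
split => //; apply: (itg_le _ (itgZ 2 (itgD (itg_fst Q (sq _ _ _ _ _ h1)) (itg_snd mu (sq _ _ _ _ _ h2))))).
  by apply: measurable_funM; exact: itg_meas iA1.
move=> z; rewrite ger0_norm ?mulr_ge0// /A; move: (\sum_i `|S i _|) (\sum_i `|G i _|) => p q.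
rewrite -subr_ge0; have -> : 2 * (p * p + q * q) - (p + q) * (p + q) = (p - q) ^+ 2 by ring.
exact: sqr_ge0.
Qed.

Let ilgs th : itg PQ (fun z => lgs (Y th z)).
Proof.
apply: (@itg_bnd _ _ _ _ _ 1); first exact: (@measurable_lgs _ _ _ _ (fun i z => Y th z i)).
by move=> z; rewrite gtr0_norm ?lgs_gt0 ?lgs_le1.
Qed.

Let vA th z i : `|v th z i| <= b * (2 * A z).
Proof.
rewrite /v normrM (ger0_norm b0) ler_wpM2l// mulrDl mul1r (le_trans (ler_normD _ _))// !normrM normrN.
by rewrite lerD// (le_trans _ (ler_piMl _ (_ : 1 <= 1)))//; rewrite ler_pM ?sin_abs_le1 ?cos_abs_le1.
Qed.

Let ilgs1 th (u : E * T -> K -> R) (c : R) : (forall i, measurable_fun setT (fun z => u z i)) -> 0 <= c ->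
  (forall z i, `|u z i| <= c * A z) -> itg PQ (fun z => lgs1 (Y th z) (u z)).
Proof.
move=> mu1 c0 uA; have [iA1 _] := iA; apply: (itg_le _ (itgZ c iA1)).
  exact: (@measurable_lgs1 _ _ _ _ (fun i z => Y th z i) (mY th) (fun i z => u z i)).
by move=> z; apply: lgs1_le => //; rewrite mulr_ge0.
Qed.

(** A first-order expansion in the angle with quadratic remainder, the form that
    [lipschitz_of_quadratic] takes. *)
Let Psi_quad th h : `|Psi (th + h) - Psi th - h * Psi1 th| <= Ex PQ (fun z => 12 * b ^+ 2 * (A z * A z) + 2 * b * A z) * h ^+ 2.
Proof.
have [iA1 iA2] := iA.
have iv : itg PQ (fun z => lgs1 (Y th z) (v th z)).
  by apply: (@ilgs1 _ _ (b * 2)) => //; [rewrite mulr_ge0|move=> z i; rewrite -mulrA; exact: vA].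
have iB : itg PQ (fun z => 12 * b ^+ 2 * (A z * A z) + 2 * b * A z) by apply: itgD; exact: itgZ.
rewrite /Psi /Psi1 -ExB// -ExZ// -ExB//; [|exact: itgB|exact: itgZ].
rewrite mulrC -ExZ//; apply: norm_Ex_le; [|exact: itgZ|].
  by apply: (itg_meas (itgB (itgB (ilgs _) (ilgs _)) (itgZ h iv))).
move=> z; pose dd i := b * ((cos (th + h) - cos th) * S i z.1 + (sin (th + h) - sin th) * G i z.2).
have YE : Y (th + h) z = fun i => Y th z i + dd i by apply/funext => i; rewrite /Y /dd; ring.
have ddA i : `|dd i| <= b * (2 * (`|h| * A z)).
  rewrite /dd normrM (ger0_norm b0) ler_wpM2l// (_ : 2 * (`|h| * A z) = `|h| * A z + `|h| * A z); last by ring.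
  rewrite (le_trans (ler_normD _ _))// !normrM.
  apply: lerD.
    by apply: ler_pM; [exact: normr_ge0|exact: normr_ge0|exact: cos_lip|exact: SA].
  by apply: ler_pM; [exact: normr_ge0|exact: normr_ge0|exact: sin_lip|exact: GA].
have bA0 : 0 <= b * (2 * (`|h| * A z)) by rewrite !mulr_ge0.
have t1 := lgs_taylor (Y th z) bA0 ddA.
have e1 : lgs1 (Y th z) dd - h * lgs1 (Y th z) (v th z) = lgs1 (Y th z) (fun i => dd i - h * v th z i).
  rewrite (lgs1_lin _ dd) (lgs1_lin _ (v th z)) (lgs1_lin _ (fun i => _ - _)) mulr_sumr -sumrB.
  by apply: eq_bigr => i _; ring.
have t2 : `|lgs1 (Y th z) (fun i => dd i - h * v th z i)| <= b * (2 * (h ^+ 2 * A z)).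
  have h2A : 0 <= h ^+ 2 * A z by apply: mulr_ge0; [exact: sqr_ge0|exact: A0].
  apply: lgs1_le; last by rewrite mulr_ge0// mulr_ge0.
  move=> i; have -> : dd i - h * v th z i = b * ((cos (th + h) - cos th + h * sin th) * S i z.1 +
      (sin (th + h) - sin th - h * cos th) * G i z.2) by rewrite /dd /v; ring.
  rewrite normrM (ger0_norm b0) ler_wpM2l// (_ : 2 * (h ^+ 2 * A z) = h ^+ 2 * A z + h ^+ 2 * A z); last by ring.
  rewrite (le_trans (ler_normD _ _))// !normrM.
  apply: lerD.
    by apply: ler_pM; [exact: normr_ge0|exact: normr_ge0|exact: cos_taylor|exact: SA].
  by apply: ler_pM; [exact: normr_ge0|exact: normr_ge0|exact: sin_taylor|exact: GA].
rewrite -YE in t1.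
have -> : lgs (Y (th + h) z) - lgs (Y th z) - h * lgs1 (Y th z) (v th z) =
  (lgs (Y (th + h) z) - lgs (Y th z) - lgs1 (Y th z) dd) + (lgs1 (Y th z) dd - h * lgs1 (Y th z) (v th z)) by ring.
rewrite e1 (le_trans (ler_normD _ _))//.
apply: (le_trans (lerD t1 t2)); rewrite -[h ^+ 2]real_normK ?num_real//.
by rewrite le_eqVlt; apply/orP; left; apply/eqP; ring.
Qed.

Let CovS i j := Ex mu (fun w => S i w * S j w).

Let ilgs2M th M : itg PQ (fun z => lgs2M (Y th z) M).
Proof.
pose c := \sum_i \sum_j `|M i j|.
have c0 : 0 <= c by do 2 apply: sumr_ge0 => ? _.
apply: (@itg_bnd _ _ _ _ _ (3 * c)); first exact: (@measurable_lgs2M _ _ _ _ (fun i z => Y th z i)).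
move=> z; apply: lgs2M_le => // i j.
rewrite /c (bigD1 i)//= (bigD1 j)//= -addrA lerDl addr_ge0// sumr_ge0// => i' _.
exact: sumr_ge0.
Qed.

Let E1_le th : `|Ex PQ (fun z => lgs1 (Y th z) (S ^~ z.1)) - b * cos th * Ex PQ (fun z => lgs2M (Y th z) CovS)|
  <= 52 * (b ^+ 2 * (n%:R * (Ln%:R ^+ 2 * H ^+ 3))).
Proof.
have i1 : itg PQ (fun z => lgs1 (Y th z) (S ^~ z.1)).
  by apply: (@ilgs1 _ (fun z i => S i z.1) 1) => // z i; rewrite mul1r.
have i2 := ilgs2M th CovS.
have i3 := itgB i1 (itgZ (b * cos th) i2).
have r0 : 0 <= n%:R * (Ln%:R ^+ 2 * H ^+ 3) by rewrite !mulr_ge0 ?exprn_ge0.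
rewrite -ExZ// -ExB//; last exact: itgZ.
rewrite (Ex_pprod2 i3); set r := 52 * _.
rewrite -[leRHS](Ex_cst Q); apply: norm_Ex_le; [exact: measurable_Ex_sec2 i3|exact: itg_cst|].
move=> w /=; pose z i := b * (sin th * G i w - x).
have YE u : Y th (u, w) = fun i => b * cos th * S i u + z i by apply/funext => i; rewrite /Y /z /=; ring.
have my i : measurable_fun setT (fun u => b * cos th * S i u + z i).
  by apply: measurable_funD => //; exact: measurable_funM.
have j1 : itg mu (fun u => lgs1 (Y th (u, w)) (S ^~ u)).
  have [cS hS] := choice mSmom.
  have iS : itg mu (fun u => \sum_i `|S i u|).
    apply: itg_sum => i _; apply: itg_norm; by have [] := mom_itg (ler1n _ 8) (hS i).
  apply: (itg_le _ iS); first exact: (measurable_sec2 (H := fun z => lgs1 (Y th z) (S ^~ z.1)) w (itg_meas i1)).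
  move=> u; apply: lgs1_le; last exact: sumr_ge0.
  by move=> i; rewrite (bigD1 i)//= lerDl sumr_ge0.
have j2 : itg mu (fun u => lgs2M (Y th (u, w)) CovS).
  pose c := \sum_i \sum_j `|CovS i j|.
  have c0 : 0 <= c by do 2 apply: sumr_ge0 => ? _.
  apply: (@itg_bnd _ _ _ _ _ (3 * c)); first exact: (measurable_sec2 (H := fun z => lgs2M (Y th z) CovS) w (itg_meas i2)).
  move=> u; apply: lgs2M_le => // i j.
  rewrite /c (bigD1 i)//= (bigD1 j)//= -addrA lerDl addr_ge0// sumr_ge0// => i' _.
  exact: sumr_ge0.
rewrite ExB//; last exact: itgZ.
rewrite ExZ//; under eq_fun do rewrite YE; under [X in _ - _ * Ex _ X]eq_fun do rewrite YE.
have := @local_dependence_stein R K mu imu n V W nr U k H Ln nrW bV dV EV VU hU nrL H0 U0 (b * cos th) z.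
move=> /le_trans; apply; rewrite /r ler_wpM2l// ler_wpM2r// exprMn ler_piMr ?sqr_ge0//.
Qed.

Let E2_eq th : Ex PQ (fun z => lgs1 (Y th z) (G ^~ z.2)) = b * sin th * Ex PQ (fun z => lgs2M (Y th z) Lam).
Proof.
have i1 : itg PQ (fun z => lgs1 (Y th z) (G ^~ z.2)).
  by apply: (@ilgs1 _ (fun z i => G i z.2) 1) => // z i; rewrite mul1r.
rewrite (Ex_pprod1 i1) -ExZ; last exact: ilgs2M.
rewrite (Ex_pprod1 (itgZ (b * sin th) (ilgs2M th Lam))); congr Ex; apply/funext => u /=.
pose z i := b * (cos th * S i u - x).
have YE w : Y th (u, w) = fun i => b * sin th * G i w + z i by apply/funext => i; rewrite /Y /z /=; ring.
under eq_fun do rewrite YE; under [X in _ = Ex _ X]eq_fun do rewrite YE.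
have [_ j1 ->] := stein_lgs1 mG nG mean0 covG (b * sin th) z.
rewrite (Ex_pprod1 j1) /=.
have iG i j : itg Q (fun w => G i w * G j w) by exact: (gauss_itgM mG nG).
have LE : (fun i j => Ex Q (fun w => G i w * G j w)) = Lam.
  by apply/funext => i; apply/funext => j; exact: (gauss_Ex2 mG nG mean0 covG).
rewrite ExZ; last first.
  pose c := \sum_i \sum_j `|Lam i j|.
  have c0 : 0 <= c by do 2 apply: sumr_ge0 => ? _.
  apply: (@itg_bnd _ _ _ _ _ (3 * c)).
    apply: (@measurable_lgs2M _ _ _ _ (fun i w => b * sin th * G i w + z i)) => i.
    by apply: measurable_funD => //; exact: measurable_funM.
  move=> w; apply: lgs2M_le => // i j.
  rewrite /c (bigD1 i)//= (bigD1 j)//= -addrA lerDl addr_ge0// sumr_ge0// => i' _.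
  exact: sumr_ge0.
congr (_ * Ex _ _); apply/funext => w.
by have [_ ->] := lgs2M_Ex (fun i => b * sin th * G i w + z i) iG; rewrite LE.
Qed.

(** The two parts carry the Hessian form with the factor b^2 sin th cos th and opposite signs, one
    with the covariances of S and one with [Lam]. What is left is the difference of the covariances
    and the Stein error of S. *)
Let Psi1_le th : `|Psi1 th| <= 52 * (b ^+ 3 * (n%:R * (Ln%:R ^+ 2 * H ^+ 3))) + 3 * (b ^+ 2 * Del).
Proof.
have i1 : itg PQ (fun z => lgs1 (Y th z) (S ^~ z.1)).
  by apply: (@ilgs1 _ (fun z i => S i z.1) 1) => // z i; rewrite mul1r.
have i2 : itg PQ (fun z => lgs1 (Y th z) (G ^~ z.2)).
  by apply: (@ilgs1 _ (fun z i => G i z.2) 1) => // z i; rewrite mul1r.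
have e : Psi1 th = (- (b * sin th)) * Ex PQ (fun z => lgs1 (Y th z) (S ^~ z.1)) + b * cos th * Ex PQ (fun z => lgs1 (Y th z) (G ^~ z.2)).
  rewrite -!ExZ// -ExD//; [|exact: itgZ|exact: itgZ].
  congr Ex; apply/funext => z; rewrite (lgs1_lin _ (v th z)) (lgs1_lin _ (S ^~ z.1)) (lgs1_lin _ (G ^~ z.2)).
  by rewrite !mulr_sumr -big_split /=; apply: eq_bigr => i _; rewrite /v; ring.
have h1 := E1_le th; rewrite e E2_eq.
set e1 := Ex PQ (fun z => lgs1 (Y th z) (S ^~ z.1)) in h1 *.
set eC := Ex PQ (fun z => lgs2M (Y th z) CovS) in h1 *.
set eL := Ex PQ (fun z => lgs2M (Y th z) Lam).
have h2 : `|eL - eC| <= 3 * Del.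
  rewrite /eL /eC -ExB; [|exact: ilgs2M|exact: ilgs2M].
  rewrite -[leRHS](Ex_cst PQ); apply: norm_Ex_le; [|exact: itg_cst|].
    by apply: (itg_meas (itgB (ilgs2M _ _) (ilgs2M _ _))).
  by move=> z; rewrite -lgs2MB; apply: lgs2M_le => // i j; exact: covDel.
have -> : - (b * sin th) * e1 + b * cos th * (b * sin th * eL) =
  - (b * sin th) * (e1 - b * cos th * eC) + b ^+ 2 * (sin th * cos th) * (eL - eC) by ring.
rewrite (le_trans (ler_normD _ _))// lerD//.
  rewrite normrM normrN normrM (ger0_norm b0).
  apply: (@le_trans _ _ (b * 1 * (52 * (b ^+ 2 * (n%:R * (Ln%:R ^+ 2 * H ^+ 3)))))).
    by apply: ler_pM => //; [rewrite mulr_ge0|rewrite ler_wpM2l// sin_abs_le1].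
  by rewrite le_eqVlt; apply/orP; left; apply/eqP; ring.
rewrite 2!normrM (ger0_norm (sqr_ge0 b)) [`|sin th * _|]normrM.
apply: (@le_trans _ _ (b ^+ 2 * (1 * 1) * (3 * Del))).
  apply: ler_pM => //; first by rewrite mulr_ge0 ?sqr_ge0.
  by apply: ler_wpM2l; [exact: sqr_ge0|apply: ler_pM; rewrite ?sin_abs_le1 ?cos_abs_le1].
by rewrite le_eqVlt; apply/orP; left; apply/eqP; ring.
Qed.

(* Interpolation along th |-> cos th S + sin th G on [0, pi / 2]; Stein's
   identities for S (approximate) and for G (exact) cancel in the derivative. *)
Lemma gauss_approx :
  `|Ex mu (fun w => lgs (fun i => b * (S i w - x))) - Ex Q (fun w => lgs (fun i => b * (G i w - x)))|
  <= 2 * (52 * (b ^+ 3 * (n%:R * (Ln%:R ^+ 2 * H ^+ 3))) + 3 * (b ^+ 2 * Del)).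
Proof.
pose M := 52 * (b ^+ 3 * (n%:R * (Ln%:R ^+ 2 * H ^+ 3))) + 3 * (b ^+ 2 * Del); rewrite -/M.
pose C := Ex PQ (fun z => 12 * b ^+ 2 * (A z * A z) + 2 * b * A z).
have C0 : 0 <= C.
  by apply: Ex_ge0 => z; rewrite addr_ge0// !mulr_ge0// sqr_ge0.
have q th h : `|Psi (th + h) - Psi th| <= M * `|h| + C * h ^+ 2.
  have t1 : `|h * Psi1 th| <= M * `|h| by rewrite normrM mulrC ler_wpM2r//; exact: Psi1_le.
  have := lerD (Psi_quad th h) t1; rewrite -/C [X in _ <= X]addrC; apply: le_trans.
  by rewrite -{1}(subrK (h * Psi1 th) (Psi (th + h) - Psi th)) ler_normD.
have M0 : 0 <= M by exact: le_trans (normr_ge0 _) (Psi1_le 0).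
have := lipschitz_of_quadratic C0 q 0 (pi / 2).
have -> : Psi 0 = Ex mu (fun w => lgs (fun i => b * (S i w - x))).
  rewrite -(Ex_fst Q).
    by congr Ex; apply/funext => z; congr lgs; apply/funext => i; rewrite /Y cos0 sin0 mul1r mul0r addr0.
  apply: (@itg_bnd _ _ _ _ _ 1); last by move=> z; rewrite gtr0_norm ?lgs_gt0 ?lgs_le1.
  apply: (@measurable_lgs _ _ _ _ (fun i w => b * (S i w - x))) => i.
  by apply: measurable_funM => //; exact: measurable_funB.
have -> : Psi (0 + pi / 2) = Ex Q (fun w => lgs (fun i => b * (G i w - x))).
  rewrite -(Ex_snd mu).
    by congr Ex; apply/funext => z; congr lgs; apply/funext => i; rewrite /Y add0r cos_pihalf sin_pihalf mul1r mul0r add0r.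
  apply: (@itg_bnd _ _ _ _ _ 1); last by move=> z; rewrite gtr0_norm ?lgs_gt0 ?lgs_le1.
  apply: (@measurable_lgs _ _ _ _ (fun i w => b * (G i w - x))) => i.
  by apply: measurable_funM => //; exact: measurable_funB.
rewrite distrC => /le_trans; apply; rewrite mulrC ler_wpM2r//.
(* The factor 2 of the bound stands for the length pi / 2 of the path. *)
have /andP[p0 p2] := pihalf_02 R.
by rewrite ger0_norm ltW.
Qed.

End GaussianApproximation.

Lemma mul1B1D_le1 (R : realType) (q s : R) : 0 <= s -> s <= q -> (1 - q) * (1 + s) <= 1.
Proof. by move=> s0 sq; nra. Qed.

(** * From smoothed to exact distribution functions *)

Section Sandwich.
Context (R : realType) (K : finType).
Context (d d' : measure_display) (Om : measurableType d) (Om' : measurableType d').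
Variables (P : probability Om R) (Q : probability Om' R).
Variables (X : Om -> R) (Y : Om' -> R) (S : K -> Om -> R) (G : K -> Om' -> R).
Variables (Bad : set Om) (b del rho ga ka : R).
Hypotheses (mX : measurable_fun setT X) (mY : measurable_fun setT Y).
Hypotheses (mS : forall i, measurable_fun setT (S i)) (mG : forall i, measurable_fun setT (G i)).
Hypotheses (mBad : measurable Bad) (b0 : 0 < b) (del0 : 0 <= del) (rho0 : 0 <= rho).
Hypothesis K0 : (0 < #|K|)%N.
Hypothesis YG : forall w x, Y w <= x <-> forall i, G i w <= x.
Hypothesis XS1 : forall w x, ~ Bad w -> X w <= x -> forall i, S i w <= x + rho.
Hypothesis XS2 : forall w x, ~ Bad w -> (forall i, S i w <= x) -> X w <= x + rho.
Local Notation fS x w := (lgs (fun i => b * (S i w - x))).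
Local Notation fG x w := (lgs (fun i => b * (G i w - x))).
Hypothesis hga : forall x, `|Ex P (fun w => fS x w) - Ex Q (fun w => fG x w)| <= ga.
Hypothesis hka : forall x h, `|Ex Q (fun w => fG (x + h) w) - Ex Q (fun w => fG x w)| <= ka * `|h|.

Let e := expR (- (b * del)).
Let N : R := #|K|%:R.

(* [lgs] is close to 1 when all coordinates are below the level by at least
   [del], and close to 0 when some coordinate is above it by at least [del]. *)
Lemma lgs_below (u : K -> R) x : (forall i, u i <= x) -> 1 - N * e <= lgs (fun i => b * (u i - (x + del))).
Proof.
move=> ux; have l0 := lgs_den_gt0 (fun i => b * (u i - (x + del))).
have s1 : \sum_i expR (b * (u i - (x + del))) <= N * e.
  apply: (@le_trans _ _ (\sum_(i : K) e)); last by rewrite sumr_const -(mulr_natl e).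
  apply: ler_sum => i _; rewrite ler_expR -mulrN ler_pM2l//.
  by have := ux i; lra.
rewrite /lgs -(ler_pM2r l0) mulVf ?gt_eqF//.
have s0 : 0 <= \sum_i expR (b * (u i - (x + del))) by apply: sumr_ge0 => i _; exact: expR_ge0.
move: (\sum_i _) s0 s1 {l0} => s s0 s1; move: (N * e) s1 => q s1.
exact: mul1B1D_le1.
Qed.

Lemma lgs_above (u : K -> R) x i : x <= u i -> lgs (fun i => b * (u i - (x - del))) <= e.
Proof.
move=> ux; have l0 := lgs_den_gt0 (fun i => b * (u i - (x - del))).
rewrite /lgs /e expRN lef_pV2 ?posrE ?expR_gt0//.
apply: (@le_trans _ _ (expR (b * (u i - (x - del))))).
  by rewrite ler_expR ler_pM2l//; lra.
rewrite (bigD1 i)//= addrCA lerDl addr_ge0// sumr_ge0// => j _; exact: expR_ge0.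
Qed.

Let mlgs d0 (T0 : measurableType d0) (u : K -> T0 -> R) x : (forall i, measurable_fun setT (u i)) ->
  measurable_fun setT (fun w => lgs (fun i => b * (u i w - x))).
Proof.
move=> mu; apply: (@measurable_lgs _ _ _ _ (fun i w => b * (u i w - x))) => i.
by apply: measurable_funM => //; exact: measurable_funB.
Qed.

Let ilgs d0 (T0 : measurableType d0) (P0 : probability T0 R) (u : K -> T0 -> R) x :
  (forall i, measurable_fun setT (u i)) -> itg P0 (fun w => lgs (fun i => b * (u i w - x))).
Proof.
move=> mu; apply: (@itg_bnd _ _ _ _ _ 1); first exact: mlgs.
by move=> w; rewrite gtr0_norm ?lgs_gt0 ?lgs_le1.
Qed.

Let N1 : 1 <= N. Proof. by rewrite ler1n. Qed.
Let e0 : 0 <= e. Proof. exact: expR_ge0. Qed.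

(** Up to [Bad] and the smoothing tails, the indicator of X <= x lies between the smoothed
    indicators at the levels x - rho - del and x + rho + del, and that of Y <= x between those at x
    - del and x + del. After the comparison [hga] the levels to be matched differ by 2 del + rho,
    which [hka] pays for. *)
Lemma sandwich x : `|fine (P [set w | X w <= x]) - fine (Q [set w | Y w <= x])| <=
  fine (P Bad) + 2 * N * e + ga + (2 * del + rho) * ka.
Proof.
have mA : measurable [set w | X w <= x] by exact: measurable_le_set.
have mB : measurable [set w | Y w <= x] by exact: measurable_le_set.
have r0 : 0 <= 2 * del + rho by rewrite addr_ge0// mulr_ge0.
have Ne : e <= N * e by rewrite ler_peMl.
have Ne0 : 0 <= N * e by exact: le_trans Ne.
have hk y z : `|Ex Q (fun w => fG y w) - Ex Q (fun w => fG z w)| <= ka * `|y - z|.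
  by have := hka z (y - z); rewrite [z + _]addrC subrK.
have iI d0 (T0 : measurableType d0) (P0 : probability T0 R) (A : set T0) := @itg_indic _ _ _ P0 A.
rewrite -(Ex_indic P mA) -(Ex_indic Q mB) ler_norml; apply/andP; split; last first.
  have u1 : Ex P \1_[set w | X w <= x] <= fine (P Bad) + (Ex P (fun w => fS (x + rho + del) w) + N * e).
    rewrite -Ex_indic// -[N * e](Ex_cst P) -ExD; [|exact: ilgs|exact: itg_cst].
    rewrite -ExD; [|exact: iI|by apply: itgD; [exact: ilgs|exact: itg_cst]].
    apply: le_Ex; [exact: iI|by apply: itgD; [exact: iI|apply: itgD; [exact: ilgs|exact: itg_cst]]|].
    move=> w; rewrite !indicE; have lg := lgs_gt0 (fun i => b * (S i w - (x + rho + del))).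
    have [wB|wB] := pselect (Bad w).
      by rewrite [w \in Bad]mem_set//; case: (_ \in _) => /=; move: (N * e) Ne0 (lgs _) lg => q Ne0 l lg; rewrite ?mulr1n ?mulr0n; lra.
    rewrite [w \in Bad]memNset// add0r.
    have [wX|wX] := pselect (X w <= x); last first.
      by rewrite memNset//= addr_ge0 ?(ltW lg).
    rewrite mem_set//= -lerBlDr; exact: (lgs_below (XS1 wB wX)).
  have u2 : Ex Q (fun w => fG (x - del) w) <= Ex Q \1_[set w | Y w <= x] + e.
    rewrite -[X in _ <= _ + X](Ex_cst Q) -ExD; [|exact: iI|exact: itg_cst].
    apply: le_Ex; [exact: ilgs|by apply: itgD; [exact: iI|exact: itg_cst]|].
    move=> w; rewrite indicE; have [wY|wY] := pselect (Y w <= x).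
      by rewrite mem_set//= (le_trans (lgs_le1 _))// lerDl.
    rewrite memNset//= add0r.
    have [i hi] : exists i, x < G i w.
      apply/not_existsP => h; apply: wY; apply/YG => i; rewrite leNgt; apply/negP; exact: h.
    exact: (lgs_above (i := i) (u := fun i => G i w) (ltW hi)).
  have u3 := hga (x + rho + del).
  have u4 := hk (x + rho + del) (x - del).
  have e4 : `|x + rho + del - (x - del)| = 2 * del + rho by rewrite ger0_norm; lra.
  rewrite e4 in u4; move: u3 u4; rewrite !ler_norml => /andP[_ u3] /andP[_ u4].
  have -> : 2 * N * e = 2 * (N * e) by ring.
  move: (N * e) Ne Ne0 u1 => q Ne Ne0 u1.
  move: (Ex Q (fun w => fG (x - del) w)) (Ex Q (fun w => fG (x + rho + del) w)) (Ex P (fun w => fS (x + rho + del) w))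
    (Ex P \1_[set w | X w <= x]) (Ex Q \1_[set w | Y w <= x]) (fine (P Bad)) u1 u2 u3 u4 => q1 q2 q3 q4 q5 q6.
  by move=> *; lra.
have v1 : Ex Q \1_[set w | Y w <= x] <= Ex Q (fun w => fG (x + del) w) + N * e.
  rewrite -[N * e](Ex_cst Q) -ExD; [|exact: ilgs|exact: itg_cst].
  apply: le_Ex; [exact: iI|by apply: itgD; [exact: ilgs|exact: itg_cst]|].
  move=> w; rewrite indicE; have lg := lgs_gt0 (fun i => b * (G i w - (x + del))).
  have [wY|wY] := pselect (Y w <= x); last by rewrite memNset//= addr_ge0 ?(ltW lg).
  rewrite mem_set//= -lerBlDr; exact: (lgs_below ((YG w x).1 wY)).
have v2 : Ex P (fun w => fS (x - rho - del) w) <= fine (P Bad) + (Ex P \1_[set w | X w <= x] + e).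
  rewrite -Ex_indic// -[X in _ <= _ + (_ + X)](Ex_cst P) -ExD; [|exact: iI|exact: itg_cst].
  rewrite -ExD; [|exact: iI|by apply: itgD; [exact: iI|exact: itg_cst]].
  apply: le_Ex; [exact: ilgs|by apply: itgD; [exact: iI|apply: itgD; [exact: iI|exact: itg_cst]]|].
  move=> w; rewrite !indicE; have lg := lgs_le1 (fun i => b * (S i w - (x - rho - del))).
  have [wB|wB] := pselect (Bad w).
    by rewrite [w \in Bad]mem_set// (le_trans lg)// lerDl addr_ge0// ler0n.
  rewrite [w \in Bad]memNset// add0r.
  have [wX|wX] := pselect (X w <= x); first by rewrite mem_set//= (le_trans lg)// lerDl.
  rewrite memNset//= add0r.
  have [i hi] : exists i, x - rho < S i w.
    apply/not_existsP => h; apply: wX; rewrite -(subrK rho x); apply: XS2 => // i.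
    by rewrite leNgt; apply/negP; exact: h.
  exact: (lgs_above (i := i) (u := fun i => S i w) (ltW hi)).
have v3 := hga (x - rho - del).
have v4 := hk (x + del) (x - rho - del).
have e4 : `|x + del - (x - rho - del)| = 2 * del + rho by rewrite ger0_norm; lra.
rewrite e4 in v4; move: v3 v4; rewrite !ler_norml => /andP[v3 _] /andP[_ v4].
have -> : 2 * N * e = 2 * (N * e) by ring.
move: (N * e) Ne Ne0 v1 => q Ne Ne0 v1.
move: (Ex Q (fun w => fG (x + del) w)) (Ex Q (fun w => fG (x - rho - del) w)) (Ex P (fun w => fS (x - rho - del) w))
  (Ex P \1_[set w | X w <= x]) (Ex Q \1_[set w | Y w <= x]) (fine (P Bad)) v1 v2 v3 v4 => q1 q2 q3 q4 q5 q6.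
by move=> *; lra.
Qed.

End Sandwich.

(** * Short-range dependence *)

Section InnovationLaw.
Context (R : realType) (d : measure_display) (Om : measurableType d).
Variables (P : probability Om R) (e : int -> {RV P >-> R}).
Hypothesis ind : mutually_independent e.
Local Notation E := (prodR int R).

(* Moments are computed under the law of e on R^Z, where conditioning on a set
   of coordinates is integration over the others. *)
Definition seq_map (w : Om) : E := fun t => e t w.

Lemma measurable_seq_map : measurable_fun setT seq_map.
Proof. by apply: measurable_to_prodR => t; exact: measurable_funP. Qed.

Definition seq_mfun : {mfun Om >-> E} := mfun_Sub (mem_set measurable_seq_map).

Definition seq_law : probability E R := distribution P seq_mfun.

Lemma indep_coord_seq_law : indep_coord seq_law.
Proof.
move=> s B us mB.
transitivity (P (\big[setI/setT]_(k <- s) (e k @^-1` B k))).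
  congr (P _); apply/seteqP; split => w /=; rewrite -bigcap_seq => h k ks; exact: h.
by rewrite ind.
Qed.

Let lawE (f : E -> \bar R) : measurable_fun setT f -> (forall u, 0 <= f u)%E ->
  (\int[seq_law]_u f u = \int[P]_w f (seq_map w))%E.
Proof.
move=> mf f0; have := @ge0_integral_pushforward _ _ _ _ _ seq_mfun measurable_seq_map P setT f measurableT mf (fun u _ => f0 u).
by rewrite preimage_setT.
Qed.

Lemma law_Ex (h : E -> R) : measurable_fun setT h -> itg P (fun w => h (seq_map w)) ->
  itg seq_law h /\ Ex seq_law h = Ex P (fun w => h (seq_map w)).
Proof.
move=> mh ih.
have [h1 h2] := @same_law R _ _ _ _ _ E P seq_law _ (@id E) measurable_seq_map (@measurable_id _ _ _)
  (fun B mB => erefl) h mh ih.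
by split.
Qed.

Lemma law_itg (h : E -> R) : measurable_fun setT h -> itg seq_law h -> itg P (fun w => h (seq_map w)).
Proof.
move=> mh ih.
by have [h1 h2] := @same_law R _ _ _ _ _ E seq_law P (@id E) _ (@measurable_id _ _ _) measurable_seq_map
  (fun B mB => erefl) h mh ih.
Qed.

Lemma law_mom q (h : E -> R) c : 0 < q -> measurable_fun setT h -> 0 <= c ->
  mom P q (fun w => h (seq_map w)) c <-> mom seq_law q h c.
Proof.
move=> q0 mh c0; have mh' := measurableT_comp mh measurable_seq_map.
rewrite (mom_int _ q0 mh c0) (mom_int _ q0 mh' c0).
by rewrite lawE//; apply/measurable_EFinP; exact: measurable_norm_powR.
Qed.

Let seq_map2 (z : Om * Om) : E * E := (seq_map z.1, seq_map z.2).

Let measurable_seq_map2 : measurable_fun setT seq_map2.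
Proof.
apply: measurable_fun_pair; first exact: (measurableT_comp measurable_seq_map measurable_fst).
exact: (measurableT_comp measurable_seq_map measurable_snd).
Qed.

Lemma law_mom2 q (H : E * E -> R) c : 0 < q -> measurable_fun setT H -> 0 <= c ->
  mom (pprod P P) q (fun z => H (seq_map z.1, seq_map z.2)) c -> mom (pprod seq_law seq_law) q H c.
Proof.
move=> q0 mH c0; have mH' := measurableT_comp mH measurable_seq_map2.
rewrite (mom_int _ q0 mH' c0) (mom_int _ q0 mH c0); apply: le_trans.
pose phi : {mfun _ >-> _} := mfun_Sub (mem_set measurable_seq_map2).
have e1 C : measurable C -> (seq_law \x seq_law)%E C = pushforward (pprod P P) phi C.
  apply: product_measure_unique => A B mA mB.
  transitivity ((P \x P)%E ((seq_map @^-1` A) `*` (seq_map @^-1` B))); first by [].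
  by rewrite product_measure1E//; rewrite -[X in measurable X]setTI; exact: measurable_seq_map.
have mf : measurable_fun setT (fun z => (`|H z| `^ q)%:E).
  by apply/measurable_EFinP; exact: (measurable_norm_powR q mH).
have := @ge0_integral_pushforward _ _ _ _ _ phi measurable_seq_map2 (pprod P P) setT (fun z => (`|H z| `^ q)%:E)
  measurableT mf _.
rewrite preimage_setT => <- //.
rewrite le_eqVlt; apply/orP; left; apply/eqP.
by apply: eq_measure_integral => C mC _; exact: e1.
Qed.

End InnovationLaw.

Section ShortRange.
Context (R : realType) (mu : probability (prodR int R) R).
Local Notation E := (prodR int R).
Implicit Types (y : int -> E -> R) (dl : nat -> R) (q M : R).

Definition resample (t : int) (i : nat) (z : E * E) : E := set_coord (t - i%:Z) z.1 (z.2 (t - i%:Z)).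

Definition srd q M dl y : Prop := [/\ forall t, mom mu q (y t) M,
  forall t, dep (le_coord t) (y t) &
  forall t i, mom (pprod mu mu) q (fun z => y t z.1 - y t (resample t i z)) (dl i)].

(** A delay by j shifts the coefficients: the j most recent innovations have no effect, hence the
    zeros. *)
Definition lagd (j : nat) dl : nat -> R := fun i => if (i < j)%N then 0 else dl (i - j)%N.

Lemma measurable_resample t i : measurable_fun setT (resample t i).
Proof. exact: measurable_set_coord. Qed.

Lemma srd_le q M M' dl dl' y : M <= M' -> (forall i, dl i <= dl' i) -> srd q M dl y -> srd q M' dl' y.
Proof.
move=> MM dd [h1 h2 h3]; split => // t; first exact: mom_le (h1 t).
by move=> i; exact: mom_le (h3 t i).
Qed.

Lemma srd_ge0 q M dl y : srd q M dl y -> 0 <= M /\ forall i, 0 <= dl i.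
Proof. by move=> [h1 _ h3]; split; [exact: mom_ge0 (h1 0)|move=> i; exact: mom_ge0 (h3 0 i)]. Qed.

Lemma srd_lag q M dl y (j : nat) : 0 < q -> srd q M dl y -> srd q M (lagd j dl) (fun t => y (t - j%:Z)).
Proof.
move=> q0 [h1 h2 h3]; split => // t.
  by apply: dep_sub (h2 _) => k; rewrite !unfold_in /le_coord; lia.
move=> i; rewrite /lagd; case: ltnP => ij; last first.
  have e : t - i%:Z = t - j%:Z - (i - j)%N%:Z by lia.
  by have := h3 (t - j%:Z) (i - j)%N; rewrite /resample -e.
have -> : (fun z => y (t - j%:Z) z.1 - y (t - j%:Z) (resample t i z)) = fun=> 0.
  apply/funext => z; apply/eqP; rewrite subr_eq0; apply/eqP; apply: h2 => k.
  rewrite /le_coord /resample /set_coord; case: eqP => // ->; lia.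
by have := mom_cst (pprod mu mu) 0 q0; rewrite normr0.
Qed.

Lemma srdZ q M dl y (c : R) : 0 < q -> srd q M dl y -> srd q (`|c| * M) (fun i => `|c| * dl i) (fun t u => c * y t u).
Proof.
move=> q0 [h1 h2 h3]; split => // t; first exact: momZ.
  by move=> u v uv; congr (_ * _); exact: h2 uv.
move=> i; have -> : (fun z => c * y t z.1 - c * y t (resample t i z)) = fun z => c * (y t z.1 - y t (resample t i z)).
  by apply/funext => z; rewrite mulrBr.
exact: (momZ c q0 (h3 t i)).
Qed.

Lemma srdD q M M' dl dl' y y' : 1 <= q -> srd q M dl y -> srd q M' dl' y' ->
  srd q (M + M') (fun i => dl i + dl' i) (fun t u => y t u + y' t u).
Proof.
move=> q0 [h1 h2 h3] [h1' h2' h3']; split => // t; first exact: momD.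
  by move=> u v uv; congr (_ + _); [exact: h2 uv|exact: h2' uv].
move=> i; have -> : (fun z => y t z.1 + y' t z.1 - (y t (resample t i z) + y' t (resample t i z))) =
    fun z => (y t z.1 - y t (resample t i z)) + (y' t z.1 - y' t (resample t i z)).
  by apply/funext => z; rewrite opprD addrACA.
exact: (momD q0 (h3 t i) (h3' t i)).
Qed.

Hypothesis imu : indep_coord mu.

Let mom_fst q (y0 : E -> R) M : 0 < q -> mom mu q y0 M -> mom (pprod mu mu) q (fun z => y0 z.1) M.
Proof.
move=> q0 h; have M0 := mom_ge0 h; have [i1 h1] := mom_itg_pow q0 h.
apply: mom_Ex => //; first exact: (measurableT_comp (mom_meas h) measurable_fst).
  exact: (itg_fst mu i1).
by rewrite (Ex_fst mu i1).
Qed.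

(** A resampled sequence is the first component of a swap that replaces a single coordinate, so it
    has law [mu]. *)
Let mom_resample q (y0 : E -> R) M t i : 0 < q -> mom mu q y0 M -> mom (pprod mu mu) q (fun z => y0 (resample t i z)) M.
Proof.
move=> q0 h; have M0 := mom_ge0 h; have [i1 h1] := mom_itg_pow q0 h.
have my : measurable_fun setT y0 := mom_meas h.
have mr : measurable_fun setT (fun z => y0 (resample t i z)) by exact: (measurableT_comp my (measurable_resample t i)).
pose A : pred int := fun k => k != t - i%:Z.
have rE z : resample t i z = (swap A z).1.
  by apply/funext => k; rewrite /resample /set_coord /= /merge /A; case: eqP => //= ->.
pose H (z : E * E) := `|y0 z.1| `^ q.
have mH : measurable_fun setT H by exact: (measurableT_comp (measurable_norm_powR q my) measurable_fst).
have sK z : swap A (swap A z) = z.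
  by case: z => u v; congr pair; apply/funext => k; rewrite /= /merge; case: (A k).
have iH : itg (pprod mu mu) (fun z => H (swap A (swap A z))).
  by have -> : (fun z => H (swap A (swap A z))) = H; [apply/funext => z; rewrite sK|exact: (itg_fst mu i1)].
have mHs : measurable_fun setT (fun z => H (swap A z)) by exact: (measurableT_comp mH (measurable_swap A)).
have [i2 e2] := Ex_swapE imu (A := A) mHs iH.
have eH : (fun z => `|y0 (resample t i z)| `^ q) = fun z => H (swap A z) by apply/funext => z; rewrite rE.
apply: (mom_Ex q0 mr M0); rewrite eH; first exact: i2.
rewrite e2.
have -> : (fun z => H (swap A (swap A z))) = H by apply/funext => z; rewrite sK.
by rewrite (Ex_fst mu i1).
Qed.

(** The product rule: the difference of the products splits into two terms with one difference each.
    The Cauchy-Schwarz inequality halves the exponent. *)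
Lemma srdM q M M' dl dl' y y' : 1 <= q -> srd (2 * q) M dl y -> srd (2 * q) M' dl' y' ->
  srd q (M * M') (fun i => M * dl' i + M' * dl i) (fun t u => y t u * y' t u).
Proof.
move=> q1 [h1 h2 h3] [h1' h2' h3']; have q0 : 0 < 2 * q by rewrite mulr_gt0// (lt_le_trans ltr01).
split => t; first exact: momM.
  by move=> u v uv; congr (_ * _); [exact: h2 uv|exact: h2' uv].
move=> i; have -> : (fun z => y t z.1 * y' t z.1 - y t (resample t i z) * y' t (resample t i z)) =
    fun z => y t z.1 * (y' t z.1 - y' t (resample t i z)) + y' t (resample t i z) * (y t z.1 - y t (resample t i z)).
  by apply/funext => z; ring.
exact: (momD q1 (momM q1 (mom_fst q0 (h1 t)) (h3' t i)) (momM q1 (mom_resample t i q0 (h1' t)) (h3 t i))).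
Qed.

(** The subtraction in [tl (L - j)] is truncated: for L < j the tail starts among the zeros and
    meets the whole sequence. *)
Lemma lagd_tail dl (tl : nat -> R) j L N : (forall i, 0 <= dl i) ->
  (forall k N, \sum_(i < N) dl (k + i)%N <= tl k) -> \sum_(i < N) lagd j dl (L + i)%N <= tl (L - j)%N.
Proof.
move=> dl0 htl; case: (leqP j L) => jL.
  rewrite (eq_bigr (fun i : 'I_N => dl ((L - j) + i)%N)) => [|i _]; first exact: htl.
  by rewrite /lagd ltnNge (leq_trans jL (leq_addr _ _))/=; congr dl; lia.
have -> : (L - j)%N = 0%N by lia.
case: (leqP (j - L) N) => jN; last first.
  rewrite big1 => [|i _]; first by have := htl 0%N 0%N; rewrite big_ord0.
  by rewrite /lagd; case: ltnP => //; have := ltn_ord i; lia.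
rewrite -(subnKC jN) big_split_ord /= big1 ?add0r => [|i _]; last first.
  by rewrite /lagd; case: ltnP => //; have := ltn_ord i; lia.
rewrite (eq_bigr (fun i : 'I_(N - (j - L)) => dl (0 + i)%N)) => [|i _]; first exact: htl.
by rewrite /lagd; case: ltnP => h; [lia|congr dl; lia].
Qed.

End ShortRange.

(** * Vector autoregressions *)

Section BackwardOrbits.
Context (R : realType).
Local Notation C := R[i].
Local Notation normc := (@ComplexField.Normc.normc R).
Local Notation rc := (real_complex R).

Let normE (z : C) : `|z| = rc (normc z). Proof. by case: z. Qed.

Let normcD (x y : C) : normc (x + y) <= normc x + normc y.
Proof. by rewrite -lecR rmorphD /= -!normE ler_normD. Qed.

Let normcN (x : C) : normc (- x) = normc x.
Proof. by have := normrN x; rewrite !normE => -[]. Qed.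

Let normc_le0 (z : C) b (r : R) : 0 <= r -> r < 1 -> (forall k, normc z <= r ^+ k * b) -> z = 0.
Proof.
move=> r0 r1 h; apply: ComplexField.Normc.eq0_normc; apply/eqP.
rewrite eq_le; apply/andP; split; last by case: (z) => x y; exact: sqrtr_ge0.
have cv : r ^+ k * b @[k --> \oo] --> 0 * b.
  by apply: cvgMl; apply: cvg_expr; rewrite ger0_norm.
rewrite mul0r in cv.
by apply: (ler_cvg_to (cvg_cst _) cv); apply: nearW => k; exact: h.
Qed.

(** For the first root z, put w k = v k - z v (k + 1): a bounded backward orbit annihilated by the
    remaining factors, hence 0 by induction. So v m = z^k v (m + k), which tends to 0 as k grows. *)
Lemma backward_orbit_roots n (N : 'M[C]_n) (ls : seq C) : (forall z, z \in ls -> `|z| < 1) ->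
  forall (v : nat -> 'rV[C]_n) (b : R), (forall m i, normc (v m 0 i) <= b) ->
  (forall m, v m = v m.+1 *m N) ->
  (forall m, foldl (fun u z => u *m N - z *: u) (v m) ls = 0) -> forall m, v m = 0.
Proof.
elim: ls => [|z ls IH] lt1 v b vb vN vls m; first by have := vls m.
pose w k := v k - z *: v k.+1.
have z1 : normc z < 1 by have := lt1 z (mem_head _ _); rewrite -ltcR.
have z0 : 0 <= normc z by case: (z) => x y; exact: sqrtr_ge0.
have w0 k : w k = 0.
  apply: (IH _ w (b + normc z * b)) => [y yls|k' i|k'|k'].
  - by apply: lt1; rewrite inE yls orbT.
  - rewrite !mxE (le_trans (normcD _ _))// lerD//.
    rewrite normcN ComplexField.Normc.normcM ler_wpM2l//.
  - by rewrite /w mulmxBl -vN -scalemxAl -vN.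
  - by rewrite /w {1}vN; have := vls k'.+1.
have vz k : v k = z *: v k.+1 by apply/eqP; rewrite -subr_eq0; apply/eqP; exact: w0.
apply/rowP => i; rewrite mxE; apply: (normc_le0 (b := b) z0 z1) => k.
have -> : v m 0 i = z ^+ k * v (m + k)%N 0 i.
  elim: k => [|k IHk]; first by rewrite expr0 mul1r addn0.
  by rewrite IHk vz mxE addnS exprSr mulrA.
rewrite ComplexField.Normc.normcM; apply: ler_pM => //.
- by case: (_ ^+ _) => x y; exact: sqrtr_ge0.
- by case: (v _ _ _) => x y; exact: sqrtr_ge0.
- elim: k => [|k IHk]; first by rewrite !expr0 /= expr1n expr0n /= addr0 sqrtr1.
  by rewrite !exprS ComplexField.Normc.normcM ler_wpM2l.
Qed.

(** Over the complex numbers the characteristic polynomial splits, and by the Cayley-Hamilton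
    theorem its factors together annihilate every vector. This replaces estimates of the powers of
    N. *)
Lemma backward_orbit n (N : 'M[R]_n) (v : nat -> 'rV[R]_n) (b : R) :
  (forall z, eigenvalue (map_mx rc N) z -> `|z| < 1) ->
  (forall m i, `|v m 0 i| <= b) -> (forall m, v m = v m.+1 *m N) -> forall m, v m = 0.
Proof.
case: n N v => [|n] N v eig vb vN m; first by apply/rowP => -[].
pose NC := map_mx rc N; pose vC k := map_mx rc (v k).
have [ls hls] := closed_field_poly_normal (char_poly NC).
have mon : lead_coef (char_poly NC) = 1 by apply/eqP; rewrite -[_ == _]/(_ \is monic); exact: char_poly_monic.
rewrite mon scale1r in hls.
suff h : vC m = 0.
  apply/rowP => i; have := congr1 (fun u : 'rV[C]_n.+1 => u 0 i) h; rewrite !mxE => -[].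
  by move=> ->.
apply: (@backward_orbit_roots _ NC ls _ vC b) => [z zls|k i|k|k].
- apply: eig; rewrite eigenvalue_root_char -/NC hls root_prod_XsubC//.
- by rewrite mxE /= expr0n /= addr0 sqrtr_sqr.
- by rewrite /vC {1}vN map_mxM.
have e (u : 'rV[C]_n.+1) (l : seq C) : foldl (fun u z => u *m NC - z *: u) u l =
    u *m horner_mx NC (\prod_(z <- l) ('X - z%:P)).
  elim: l u => [|z l IH] u; first by rewrite big_nil rmorph1 mulmx1.
  rewrite /= IH big_cons rmorphM /= -mulmxE mulmxA; congr (_ *m _).
  by rewrite rmorphB /= horner_mx_X horner_mx_C mulmxBr mul_mx_scalar.
by rewrite e -hls Cayley_Hamilton mulmx0.
Qed.

End BackwardOrbits.

(** * Second moments of a vector autoregression *)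

Section VARCovariance.
Context (R : realType) (n d : nat) (dsp : measure_display) (T : measurableType dsp) (P : probability T R).
Variables (N : 'M[R]_n) (J : 'I_n -> 'I_d -> R) (Sig : 'I_d -> 'I_d -> R).
Variables (z : int -> 'I_n -> T -> R) (eps : int -> 'I_d -> T -> R) (b : R).
Hypothesis eig : forall c, eigenvalue (map_mx (real_complex R) N) c -> `|c| < 1.
Hypothesis zE : forall t k w, z t k w = \sum_k' z (t - 1) k' w * N k' k + \sum_l J k l * eps t l w.
Hypothesis izz : forall t s k k', itg P (fun w => z t k w * z s k' w) /\ `|Ex P (fun w => z t k w * z s k' w)| <= b.
Hypothesis ize : forall t s k l, itg P (fun w => z t k w * eps s l w) /\ `|Ex P (fun w => z t k w * eps s l w)| <= b.
Hypothesis iee : forall t s l l', itg P (fun w => eps t l w * eps s l' w).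
Hypothesis wn0 : forall t s l l', t != s -> Ex P (fun w => eps t l w * eps s l' w) = 0.
Hypothesis wn1 : forall t l l', Ex P (fun w => eps t l w * eps t l' w) = Sig l l'.

Let CC t s k k' := Ex P (fun w => z t k w * z s k' w).
Let DD t s k l := Ex P (fun w => z t k w * eps s l w).

Let DDrec t s k l : DD t s k l = \sum_k' DD (t - 1) s k' l * N k' k + \sum_l' J k l' * Ex P (fun w => eps t l' w * eps s l w).
Proof.
rewrite /DD.
have -> : (fun w => z t k w * eps s l w) = fun w =>
    \sum_k' N k' k * (z (t - 1) k' w * eps s l w) + \sum_l' J k l' * (eps t l' w * eps s l w).
  apply/funext => w; rewrite zE mulrDl !mulr_suml; congr (_ + _); apply: eq_bigr => i _; ring.
have h1 k' := (ize (t - 1) s k' l).1; have h2 l' := iee t s l' l.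
rewrite ExD; last 2 first.
- by apply: itg_sum => k' _; exact: itgZ.
- by apply: itg_sum => k' _; exact: itgZ.
rewrite !Ex_sum => [|k' _|k' _]; last 2 first.
- exact: itgZ.
- exact: itgZ.
congr (_ + _); first by apply: eq_bigr => k' _; rewrite ExZ// mulrC.
by apply: eq_bigr => l' _; rewrite ExZ.
Qed.

(* The vectors E z_(t-m) eps_s, m >= 0, form a bounded backward orbit of N. *)
Lemma state_innovation_uncorrelated t s k l : t < s -> Ex P (fun w => z t k w * eps s l w) = 0.
Proof.
move=> ts; pose v (m : nat) : 'rV[R]_n := \row_k DD (t - m%:Z) s k l.
have := @backward_orbit R n N v b eig _ _ 0%N; rewrite /v subr0 => h.
have {}h : \row_k DD t s k l = 0 :> 'rV[R]_n.
  apply: h => [m i|m]; first by rewrite mxE; exact: (ize _ _ _ _).2.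
  apply/rowP => i; rewrite !mxE DDrec [X in _ + X]big1 ?addr0 => [|l' _]; last first.
    by rewrite wn0 ?mulr0//; lia.
  by apply: eq_bigr => k' _; rewrite mxE; congr (DD _ _ _ _ * _); lia.
by have := congr1 (fun u : 'rV[R]_n => u 0 k) h; rewrite !mxE.
Qed.

(** For t < s both sides vanish. At t = s the white noise covariance enters, the same at all times,
    and the recursion propagates the equality to t > s. *)
Let DDstat t s k l : DD (t + 1) (s + 1) k l = DD t s k l.
Proof.
have [ts|st] := ltP t s.
  by rewrite /DD !state_innovation_uncorrelated//; lia.
have [m tm] : exists m : nat, t = s + m%:Z by exists `|t - s|%N; lia.
rewrite tm {t tm st} in k l *; elim: m k l => [|m IH] k l.
  rewrite addr0 (DDrec (s + 1)) (DDrec s); congr (_ + _).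
    apply: eq_bigr => k' _; congr (_ * _); rewrite /DD !state_innovation_uncorrelated//; lia.
  by apply: eq_bigr => l' _; rewrite !wn1.
rewrite DDrec [RHS]DDrec; congr (_ + _); last first.
  by rewrite !big1// => l' _; rewrite wn0 ?mulr0//; lia.
apply: eq_bigr => k' _; congr (_ * _).
have -> : s + m.+1%:Z + 1 - 1 = s + m%:Z + 1 by lia.
have -> : s + m.+1%:Z - 1 = s + m%:Z by lia.
exact: IH.
Qed.

Let CCrec t s k k0 : CC t s k k0 = \sum_k' CC (t - 1) s k' k0 * N k' k + \sum_l J k l * DD s t k0 l.
Proof.
rewrite /CC.
have -> : (fun w => z t k w * z s k0 w) = fun w =>
    \sum_k' N k' k * (z (t - 1) k' w * z s k0 w) + \sum_l J k l * (z s k0 w * eps t l w).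
  apply/funext => w; rewrite zE mulrDl !mulr_suml; congr (_ + _); apply: eq_bigr => i _; ring.
have h1 k' := (izz (t - 1) s k' k0).1; have h2 l := (ize s t k0 l).1.
rewrite ExD; last 2 first.
- by apply: itg_sum => k' _; exact: itgZ.
- by apply: itg_sum => k' _; exact: itgZ.
rewrite !Ex_sum => [|k' _|k' _]; last 2 first.
- exact: itgZ.
- exact: itgZ.
congr (_ + _); first by apply: eq_bigr => k' _; rewrite ExZ// mulrC.
by apply: eq_bigr => l' _; rewrite ExZ.
Qed.

Let CCstat1 t s k k0 : CC (t + 1) (s + 1) k k0 = CC t s k k0.
Proof.
pose v (m : nat) : 'rV[R]_n := \row_k (CC (t - m%:Z + 1) (s + 1) k k0 - CC (t - m%:Z) s k k0).
have := @backward_orbit R n N v (b + b) eig _ _ 0%N; rewrite /v subr0 => h.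
have {}h : \row_k (CC (t + 1) (s + 1) k k0 - CC t s k k0) = 0 :> 'rV[R]_n.
  apply: h => [m i|m]; first by rewrite mxE (le_trans (ler_normB _ _))// lerD//; exact: (izz _ _ _ _).2.
  apply/rowP => i; rewrite !mxE (CCrec (_ + 1)) (CCrec (t - m%:Z)).
  have -> : \sum_l J i l * DD (s + 1) (t - m%:Z + 1) k0 l = \sum_l J i l * DD s (t - m%:Z) k0 l.
    by apply: eq_bigr => l _; rewrite DDstat.
  rewrite opprD addrACA subrr addr0 -sumrB; apply: eq_bigr => k' _; rewrite mxE mulrBl.
  congr (CC _ _ _ _ * _ - CC _ _ _ _ * _); lia.
have := congr1 (fun u : 'rV[R]_n => u 0 k) h; rewrite !mxE => /eqP.
by rewrite subr_eq0 => /eqP.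
Qed.

(** The covariances and their shifts by one time unit satisfy the same recursion with the same
    innovation terms. Their difference is a bounded backward orbit, hence 0: this is [CCstat1],
    which is iterated here. *)
Lemma state_covariance_stationary t s k k' :
  Ex P (fun w => z t k w * z t k' w) = Ex P (fun w => z s k w * z s k' w).
Proof.
have h (m : nat) u : CC (u + m%:Z) (u + m%:Z) k k' = CC u u k k'.
  elim: m => [|m IH]; first by rewrite addr0.
  rewrite -IH -(CCstat1 (u + m%:Z)); have -> : u + m.+1%:Z = u + m%:Z + 1 by lia.
  by [].
have [ts|st] := leP t s.
  have -> : s = t + `|s - t|%N%:Z by lia.
  by have := h `|s - t|%N t.
have -> : t = s + `|t - s|%N%:Z by lia.
by have := h `|t - s|%N s.
Qed.

End VARCovariance.

Section MxvecIndex.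

Lemma index_allpairs_pair (S T : eqType) (s : seq S) (t : seq T) x y : x \in s -> y \in t ->
  index (x, y) [seq (a, b) | a <- s, b <- t] = (index x s * size t + index y t)%N.
Proof.
elim: s => // a s IH; rewrite inE => xs yt; rewrite /= index_cat /=.
have [ax|ax] := eqVneq a x.
  by rewrite ax map_f//= index_map// => u v [].
have -> : ((x, y) \in [seq (a, b) | b <- t]) = false.
  by apply/negbTE/mapP => -[b _ [e _]]; rewrite e eqxx in ax.
rewrite eq_sym (negbTE ax) /= in xs.
by rewrite size_map IH// mulSn addnA.
Qed.

Lemma index_enum_rank (T : finType) (x : T) : index x (enum T) = enum_rank x.
Proof.
rewrite -{1}(enum_rankK x) (enum_val_nth x) index_uniq ?enum_uniq//.
by rewrite -cardE ltn_ord.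
Qed.

(** The companion matrix is given by numerical indices, the lagged vector by pairs of a lag and a
    coordinate; this connects the two. *)
Lemma val_mxvec_index m n (i : 'I_m) (j : 'I_n) : mxvec_index i j = (i * n + j)%N :> nat.
Proof.
rewrite /mxvec_index /= -index_enum_rank enumT unlock /= /prod_enum.
by rewrite index_allpairs_pair ?mem_enum// !index_enum_ord size_enum_ord.
Qed.

End MxvecIndex.

Section StateSpace.
Context (R : realType) (p d : nat).
Implicit Types (x eps : int -> 'cV[R]_d) (A : 'I_p -> 'M[R]_d).

Lemma laggedE x t j i : lagged p x t (mxvec_index j i) 0 = x (t - j%:Z) i 0.
Proof. by rewrite /lagged mxE mxvecE mxE. Qed.

Lemma coef_mxE A j i l : coef_mx A (mxvec_index j i) l = A j l i.
Proof. by rewrite /coef_mx mxE mxvecE mxE. Qed.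

Lemma sum_mxvec_index (f : 'I_(p * d) -> R) : \sum_k f k = \sum_j \sum_i f (mxvec_index j i).
Proof.
rewrite (reindex _ (curry_mxvec_bij p d)) pair_bigA /=.
by apply: eq_bigr => -[].
Qed.

Lemma lagged_rec x eps A t k : x t = \sum_(j < p) A j *m x (t - j.+1%:Z) + eps t ->
  lagged p x t k 0 = \sum_k' lagged p x (t - 1) k' 0 * companion_tr (coef_mx A) k' k
    + \sum_(l < d) (k == l :> nat)%:R * eps t l 0.
Proof.
move=> xt.
case/mxvec_indexP: k => j i; rewrite laggedE.
have d0 : (0 < d)%N by exact: leq_ltn_trans (leq0n _) (ltn_ord i).
(* The block of lag 0 is the autoregression itself; the block of lag j > 0 is the block of lag j - 1
   one time unit earlier. *)
have [j0|j0] := posnP j.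
  have vi : mxvec_index j i = i :> nat by rewrite val_mxvec_index j0.
  have cE k' : companion_tr (coef_mx A) k' (mxvec_index j i) = coef_mx A k' i.
    rewrite mxE mxE -[val _]/(nat_of_ord _) vi (insubT (fun k => k < d)%N (ltn_ord i)).
    by congr (coef_mx A k' _); apply: val_inj; rewrite SubK.
  rewrite vi j0 subr0 xt mxE (bigD1 i)//= eqxx mul1r.
  rewrite [X in _ = _ + (_ + X)]big1 ?addr0 => [|l li]; last first.
    by rewrite (_ : (_ == _) = false) ?mul0r//; apply/negbTE; rewrite eq_sym.
  congr (_ + _); rewrite summxE sum_mxvec_index; apply: eq_bigr => j' _.
  rewrite mxE; apply: eq_bigr => i' _; rewrite laggedE cE coef_mxE mulrC; congr (x _ _ _ * _).
  by rewrite -addrA -opprD; congr (_ - _); lia.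
have vi := val_mxvec_index j i.
have jd : (mxvec_index j i < d)%N = false.
  by apply/negbTE; rewrite vi -leqNgt (leq_trans _ (leq_addr _ _))// leq_pmull.
have cE k' : companion_tr (coef_mx A) k' (mxvec_index j i) = (k' + d == mxvec_index j i)%N%:R.
  by rewrite mxE mxE insubF.
rewrite [X in _ = _ + X]big1 ?addr0 => [|l _]; last first.
  by rewrite (_ : (_ == _) = false) ?mul0r//; apply/eqP => e; have := ltn_ord l; rewrite -e jd.
have jp : (j.-1 < p)%N by rewrite (leq_ltn_trans (leq_pred _)).
have vp := val_mxvec_index (Ordinal jp) i.
have ej : (j.-1 * d + i + d = j * d + i)%N by case: (nat_of_ord j) j0 => // n _; rewrite mulSn /=; lia.
rewrite (bigD1 (mxvec_index (Ordinal jp) i))//= laggedE cE vp vi /= ej eqxx mulr1.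
rewrite big1 ?addr0 => [|k' kk]; first by congr (x _ _ _); rewrite -addrA -opprD; congr (_ - _); lia.
rewrite cE (_ : (_ == _) = false) ?mulr0//; apply/eqP => e; case/eqP: kk; apply: ord_inj.
by rewrite vp /=; apply/eqP; rewrite -(eqn_add2r d) e vi ej.
Qed.

End StateSpace.

(** * The smallest eigenvalue and the quadratic form *)

Section Rayleigh.
Context (R : realType).
Local Notation C := R[i].
Local Notation rc := (real_complex R).
Local Open Scope sesquilinear_scope.

Lemma real_complexC_real (x : R) : rc x \is Num.real.
Proof. by rewrite realE -[0]/(rc 0) !lecR -realE num_real. Qed.

(** The spectral theorem for the complexified matrix, which is hermitian. Its diagonal entries are
    real and are eigenvalues of A through the characteristic polynomial, and the unitary change of
    basis preserves the sum of squares. *)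
Lemma symmetric_eig_min n (A : 'M[R]_n) (c : R) (v : 'I_n -> R) : A^T = A ->
  (forall a, eigenvalue A a -> c < a) -> c * (\sum_i v i ^+ 2) <= \sum_i \sum_j v i * A i j * v j.
Proof.
move=> As eigA; set B : 'M[C]_n := map_mx rc A; set u : 'rV[C]_n := \row_i rc (v i).
have rcB : B \is a realmx by apply/mxOverP => i j; rewrite mxE real_complexC_real.
have Bh : B \is hermsymmx.
  by apply: realsym_hermsym => //; apply/is_hermitianmxP; rewrite expr0 scale1r map_mx_id// /B map_trmx As.
set Q := spectralmx B; set D := spectral_diag B.
have QU : Q \is unitarymx := spectral_unitarymx B.
have BE : B = Q^t* *m diag_mx D *m Q.
  by rewrite -(invmx_unitary QU); exact/orthomx_spectralP/hermitian_normalmx.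
have Dreal k : exists2 a : R, D 0 k = rc a & c < a.
  have /mxOverP/(_ 0 k) := hermitian_spectral_diag_real Bh; rewrite -/D.
  case De : (D 0 k) => [a b]; rewrite realE !lecE /= => /orP b0.
  have {}b0 : b = 0 by apply/eqP; case: b0 => /andP[]// ; rewrite eq_sym.
  exists a; first by rewrite b0.
  apply: eigA; rewrite eigenvalue_root_char -(fmorph_root rc) map_char_poly -eigenvalue_root_char.
  apply/eigenvalueP; exists (row k Q).
    rewrite -[map_mx _ A]/B -row_mul BE !mulmxA (unitarymxP QU) mul1mx; apply/rowP => l.
    by rewrite mul_diag_mx !mxE De b0.
  apply/eqP => Q0; have := spectral_unit B; rewrite -row_free_unit => /row_freeP[Z QZ].
  by have /(congr1 (row k))/rowP/(_ k) := QZ; rewrite row_mul Q0 mul0mx !mxE eqxx => /esym/eqP; rewrite oner_eq0.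
set w := u *m Q^t*.
have uu : u *m u^t* = w *m w^t*.
  rewrite /w trmx_mul map_mxM mulmxA map_trmx trmxK -map_mx_comp (map_mx_id (@conjCK _)).
  by rewrite mulmxKtV.
have uBu : u *m B *m u^t* = w *m diag_mx D *m w^t*.
  rewrite BE /w [(u *m _)^T]trmx_mul map_mxM !mulmxA; congr (_ *m _).
  by rewrite map_trmx trmxK -map_mx_comp (map_mx_id (@conjCK _)).
have ww k : 0 <= w 0 k * (w 0 k)^*%C by exact: mul_conjC_ge0.
have uu0 : rc (\sum_i v i ^+ 2) = \sum_k w 0 k * (w 0 k)^*%C.
  have /rowP/(_ 0) := uu; rewrite !mxE.
  under eq_bigr => i _ do rewrite !mxE /= conj_Creal ?real_complexC_real// -rmorphM -expr2.
  by rewrite -rmorph_sum => ->; apply: eq_bigr => k _; rewrite !mxE.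
have uBu0 : rc (\sum_i \sum_j v i * A i j * v j) = \sum_k D 0 k * (w 0 k * (w 0 k)^*%C).
  have /rowP/(_ 0) := uBu; rewrite !mxE => e; transitivity ((u *m B *m u^t*) 0 0).
    rewrite mxE exchange_big rmorph_sum; apply: eq_bigr => j _.
    rewrite !mxE conj_Creal ?real_complexC_real// rmorph_sum mulr_suml; apply: eq_bigr => i _.
    by rewrite !mxE !rmorphM.
  by rewrite mxE e; apply: eq_bigr => k _; rewrite mul_mx_diag !mxE mulrCA mulrA.
rewrite -lecR uBu0 rmorphM /= uu0 mulr_sumr; apply: ler_sum => k _.
by apply: ler_wpM2r => //; have [a -> ca] := Dreal k; rewrite lecR ltW.
Qed.

End Rayleigh.

(** * Partial inverses and the Lasso *)

Section PartialInverse.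
Context (R : realType) (n : nat).
Implicit Types (A : 'M[R]_n) (B : {set 'I_n}) (v : 'I_n -> R).

Definition qform A v : R := \sum_i \sum_j v i * A i j * v j.

Lemma pinv_unit k (M : 'M[R]_k) : M \in unitmx -> Defs.pinv M = invmx M.
Proof.
move=> uM; apply: (is_pinv_inj (pinvP M)).
by split; rewrite ?mulmxV ?mulVmx ?mul1mx ?trmx1.
Qed.

Lemma pinv_tr k l (M : 'M[R]_(k, l)) : Defs.pinv M^T = (Defs.pinv M)^T.
Proof.
apply: (is_pinv_inj (pinvP _)); have [a b c d] := pinvP M.
by split; rewrite -?trmx_mul ?mulmxA ?a ?b ?c ?d ?trmxK // mulmxA ?a ?b.
Qed.

Lemma partial_inv_offl B A i j : i \notin B -> partial_inv B A i j = 0.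
Proof.
move=> iB; rewrite mxE big1// => s /eqP si.
by have := enum_valP s; rewrite si (negbTE iB).
Qed.

Lemma partial_inv_offr B A i j : j \notin B -> partial_inv B A i j = 0.
Proof.
move=> jB; rewrite mxE big1// => s _; rewrite big1// => t /eqP tj.
by have := enum_valP t; rewrite tj (negbTE jB).
Qed.

Lemma partial_inv_enum B A s t : partial_inv B A (enum_val s) (enum_val t) =
  Defs.pinv (\matrix_(s < #|B|, t < #|B|) A (enum_val s) (enum_val t)) s t.
Proof.
rewrite mxE (eq_bigl (pred1 s)) => [|s']; last by rewrite (inj_eq enum_val_inj).
rewrite big_pred1_eq (eq_bigl (pred1 t)) ?big_pred1_eq// => t'.
by rewrite (inj_eq enum_val_inj).
Qed.

Lemma partial_inv_tr B A : partial_inv B A^T = (partial_inv B A)^T.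
Proof.
apply/matrixP => i j; rewrite [RHS]mxE.
have [iB|iB] := boolP (i \in B); last by rewrite partial_inv_offl// partial_inv_offr.
have [jB|jB] := boolP (j \in B); last by rewrite partial_inv_offr// partial_inv_offl.
rewrite -(enum_rankK_in iB iB) -(enum_rankK_in jB jB) !partial_inv_enum.
have -> : (\matrix_(s < #|B|, t < #|B|) A^T (enum_val s) (enum_val t)) =
  (\matrix_(s < #|B|, t < #|B|) A (enum_val s) (enum_val t))^T.
  by apply/matrixP => a b; rewrite !mxE.
by rewrite pinv_tr mxE.
Qed.

Section Coercive.
Context (A : 'M[R]_n) (B : {set 'I_n}) (c : R).
Hypotheses (c0 : 0 < c)
  (Ac : forall v, (forall i, i \notin B -> v i = 0) -> c * (\sum_i v i ^+ 2) <= qform A v).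

Local Notation AB := (\matrix_(s < #|B|, t < #|B|) A (enum_val s) (enum_val t)).

Lemma sum_enum_val (f : 'I_n -> R) : (forall i, i \notin B -> f i = 0) ->
  \sum_i f i = \sum_(s < #|B|) f (enum_val s).
Proof.
move=> f0; rewrite -big_enum_val [RHS]big_mkcond/=.
by apply: eq_bigr => i _; case: ifP => // /negbT /f0.
Qed.

(** A kernel vector of the submatrix, extended by 0 outside [B], has vanishing form and so is 0 by
    coercivity. *)
Lemma coercive_submx_unit : AB \in unitmx.
Proof.
rewrite -row_free_unit -kermx_eq0; apply/eqP/row_matrixP => r; rewrite row0.
set w := row r _; have w0 : w *m AB = 0 by rewrite -row_mul mulmx_ker row0.
clearbody w.
pose v i : R := \sum_(s | enum_val s == i) w 0 s.
have vs s : v (enum_val s) = w 0 s.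
  rewrite /v (eq_bigl (pred1 s)) ?big_pred1_eq// => s'.
  by rewrite (inj_eq enum_val_inj).
have vB i : i \notin B -> v i = 0.
  by move=> iB; rewrite /v big1// => s /eqP si; have := enum_valP s; rewrite si (negbTE iB).
have q0 : qform A v = 0.
  rewrite /qform exchange_big sum_enum_val => [|j /vB v0]; last first.
    by rewrite big1// => i _; rewrite v0 mulr0.
  rewrite big1// => t _; rewrite sum_enum_val => [|i /vB ->]; last by rewrite !mul0r.
  rewrite -mulr_suml; have /rowP/(_ t) := w0; rewrite !mxE.
  under eq_bigr => s _ do rewrite mxE.
  by move=> w1; under eq_bigr => s _ do rewrite vs; rewrite w1 mul0r.
have := Ac vB; rewrite q0 pmulr_rle0// => s0.
apply/rowP => s; rewrite [RHS]mxE -vs; apply/eqP; rewrite -sqrf_eq0 eq_le sqr_ge0 andbT.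
by apply: le_trans s0; rewrite (bigD1 (enum_val s))//= lerDl sumr_ge0// => *; exact: sqr_ge0.
Qed.

Lemma partial_inv_mulr a k : a \in B ->
  \sum_b A a b * partial_inv B A b k = (a == k)%:R.
Proof.
move=> aB; have [kB|kB] := boolP (k \in B); last first.
  rewrite big1 => [|b _]; last by rewrite partial_inv_offr ?mulr0.
  by rewrite (_ : (_ == _) = false)//; apply: contraNF kB => /eqP <-.
rewrite sum_enum_val => [|b /(partial_inv_offl A k) ->]; last by rewrite mulr0.
rewrite -(enum_rankK_in aB aB) -(enum_rankK_in kB kB) (inj_eq enum_val_inj).
have := coercive_submx_unit => /mulmxV /matrixP /(_ (enum_rank_in aB a) (enum_rank_in kB k)).
rewrite !mxE => <-; apply: eq_bigr => s _.
by rewrite partial_inv_enum (pinv_unit coercive_submx_unit) !mxE.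
Qed.

Lemma partial_inv_mull i k : k \in B ->
  \sum_a partial_inv B A i a * A a k = (i == k)%:R.
Proof.
move=> kB; have [iB|iB] := boolP (i \in B); last first.
  rewrite big1 => [|b _]; last by rewrite partial_inv_offl ?mul0r.
  by rewrite (_ : (_ == _) = false)//; apply: contraNF iB => /eqP ->.
rewrite sum_enum_val => [|b /(partial_inv_offr A i) ->]; last by rewrite mul0r.
rewrite -(enum_rankK_in iB iB) -(enum_rankK_in kB kB) (inj_eq enum_val_inj).
have := coercive_submx_unit => /mulVmx /matrixP /(_ (enum_rank_in iB i) (enum_rank_in kB k)).
rewrite !mxE => <-; apply: eq_bigr => s _.
by rewrite partial_inv_enum (pinv_unit coercive_submx_unit) !mxE.
Qed.

(** The column v of index j solves A v = e_j on [B] and vanishes outside, so qform A v = v_j.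
    Coercivity gives c v_i^2 <= v_j for every i; with i = j this yields v_j <= 1 / c. *)
Lemma partial_inv_bound i j : `|partial_inv B A i j| <= c^-1.
Proof.
have ci : 0 <= c^-1 by rewrite invr_ge0 ltW.
have [jB|jB] := boolP (j \in B); last by rewrite partial_inv_offr// normr0.
pose v i := partial_inv B A i j.
have := Ac (v := v) (fun i iB => partial_inv_offl A j iB).
have -> : qform A v = v j.
  rewrite /qform (bigD1 j)//= [X in _ + X]big1 ?addr0 => [|a aj].
    under eq_bigr do rewrite -mulrA; rewrite -mulr_sumr partial_inv_mulr// eqxx.
    by rewrite mulr1.
  under eq_bigr do rewrite -mulrA; rewrite -mulr_sumr.
  have [aB|aB] := boolP (a \in B); last by rewrite /v partial_inv_offl// mul0r.
  by rewrite partial_inv_mulr// (negbTE aj) mulr0.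
move=> cv.
have vi k : v k ^+ 2 <= c^-1 * v j.
  rewrite -(ler_pM2l c0) mulVKf ?gt_eqF//; apply: le_trans cv; apply: ler_wpM2l; first exact: ltW.
  by rewrite (bigD1 k)//= lerDl sumr_ge0// => *; exact: sqr_ge0.
have vj0 : 0 <= v j.
  have := le_trans (sqr_ge0 _) (vi j); rewrite pmulr_rge0 ?invr_gt0//.
have vj : v j <= c^-1.
  have := vi j; rewrite expr2; have [->//|v0] := eqVneq (v j) 0.
  by rewrite ler_pM2r// lt_def v0.
rewrite -(ler_pXn2r (_ : (0 < 2)%N))// ?nnegrE// real_normK ?num_real//.
by apply: le_trans (vi i) _; rewrite expr2; apply: ler_wpM2l.
Qed.

End Coercive.

(** The resolvent identity F' - F = F' (A - A') F, with sums over [B] only. *)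
Lemma partial_inv_perturb A A' B c c1 r i k : 0 < c -> 0 < c1 ->
  (forall v, (forall i, i \notin B -> v i = 0) -> c * (\sum_i v i ^+ 2) <= qform A v) ->
  (forall v, (forall i, i \notin B -> v i = 0) -> c1 * (\sum_i v i ^+ 2) <= qform A' v) ->
  (forall i j, `|A' i j - A i j| <= r) ->
  `|partial_inv B A' i k - partial_inv B A i k| <= c1^-1 * r * c^-1 * #|B|%:R ^+ 2.
Proof.
move=> c0 c10 hA hA' hr; set F := partial_inv B A; set F' := partial_inv B A'.
have F'0 a : a \notin B -> F' i a = 0 by exact: partial_inv_offr.
have F0 b : b \notin B -> F b k = 0 by exact: partial_inv_offl.
have e1 : F' i k = \sum_(a in B) \sum_(b in B) F' i a * A a b * F b k.
  have e0 : F' i k = \sum_(a in B) F' i a * (a == k)%:R.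
    have [kB|kB] := boolP (k \in B).
      rewrite (bigD1 k)//= eqxx mulr1 big1 ?addr0// => a /andP[_ /negbTE ->].
      by rewrite mulr0.
    by rewrite F'0// big1// => a aB; rewrite (_ : (_ == _) = false) ?mulr0//; apply: contraNF kB => /eqP <-.
  rewrite e0; apply: eq_bigr => a aB; rewrite -(partial_inv_mulr c0 hA k aB) mulr_sumr.
  rewrite [RHS]big_mkcond; apply: eq_bigr => b _; rewrite mulrA.
  by case: ifP => // /negbT /F0; rewrite /F => ->; rewrite mulr0.
have e2 : F i k = \sum_(b in B) \sum_(a in B) F' i a * A' a b * F b k.
  have e0 : F i k = \sum_(b in B) (i == b)%:R * F b k.
    have [iB|iB] := boolP (i \in B).
      rewrite (bigD1 i)//= eqxx mul1r big1 ?addr0// => a /andP[_ ai].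
      by rewrite eq_sym (negbTE ai) mul0r.
    by rewrite F0// big1// => a aB; rewrite (_ : (_ == _) = false) ?mul0r//; apply: contraNF iB => /eqP ->.
  rewrite e0; apply: eq_bigr => b bB; rewrite -(partial_inv_mull c10 hA' i bB) mulr_suml.
  rewrite [RHS]big_mkcond; apply: eq_bigr => a _.
  by case: ifP => // /negbT /F'0; rewrite /F' => ->; rewrite !mul0r.
rewrite e1 e2 [X in _ - X]exchange_big -sumrB.
apply: le_trans (ler_norm_sum _ _ _) _.
apply: le_trans (_ : _ <= \sum_(a in B) \sum_(b in B) (c1^-1 * r * c^-1)) _.
  apply: ler_sum => a aB; rewrite -sumrB; apply: le_trans (ler_norm_sum _ _ _) _.
  apply: ler_sum => b bB; rewrite -mulrBl -mulrBr !normrM.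
  apply: ler_pM; [exact: mulr_ge0|exact: normr_ge0| |exact: (partial_inv_bound c0 hA)].
  apply: ler_pM; [exact: normr_ge0|exact: normr_ge0|exact: (partial_inv_bound c10 hA')|].
  by rewrite distrC.
by rewrite !sumr_const -mulrnA -[X in X <= _]mulr_natr natrM expr2.
Qed.

Lemma sum_sqr_supp v B : (\sum_(i in B) `|v i|) ^+ 2 <= #|B|%:R * \sum_i v i ^+ 2.
Proof.
rewrite expr2 mulr_suml.
apply: le_trans (_ : _ <= \sum_(i in B) \sum_(j in B) 2^-1 * (v i ^+ 2 + v j ^+ 2)) _.
  apply: ler_sum => i _; rewrite mulr_sumr; apply: ler_sum => j _.
  rewrite -(real_normK (num_real (v i))) -(real_normK (num_real (v j))).
  by have := sqr_ge0 (`|v i| - `|v j|); nra.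
have sB : \sum_(i in B) v i ^+ 2 <= \sum_i v i ^+ 2.
  by rewrite [X in X <= _]big_mkcond; apply: ler_sum => i _; case: ifP => // _; exact: sqr_ge0.
have -> : \sum_(i in B) \sum_(j in B) 2^-1 * (v i ^+ 2 + v j ^+ 2) = #|B|%:R * \sum_(i in B) v i ^+ 2.
  under eq_bigr => i _ do rewrite -mulr_sumr big_split /= sumr_const.
  rewrite -mulr_sumr big_split /= sumr_const -mulr_natl sumrMnl -mulr_natl; lra.
by apply: ler_wpM2l.
Qed.

Lemma qform_perturb A A' v r : (forall i j, `|A' i j - A i j| <= r) ->
  qform A v - r * (\sum_i `|v i|) ^+ 2 <= qform A' v.
Proof.
move=> hr; rewrite lerBlDr -lerBlDl; apply: le_trans (ler_norm _) _.
rewrite /qform -sumrB; apply: le_trans (ler_norm_sum _ _ _) _.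
rewrite expr2 mulr_suml mulr_sumr; apply: ler_sum => i _.
rewrite -sumrB; apply: le_trans (ler_norm_sum _ _ _) _.
rewrite !mulr_sumr; apply: ler_sum => j _.
rewrite -mulrBl -mulrBr !normrM mulrA [X in _ <= X * _]mulrC.
by apply: ler_wpM2r => //; apply: ler_wpM2l => //; rewrite distrC.
Qed.

End PartialInverse.

Lemma qform_gram (R : realType) n N (W : 'M[R]_(n, N)) (h : 'cV[R]_N) t :
  qform (t *: (W^T *m W)) (fun i => h i 0) = t * \sum_i (W *m h) i 0 ^+ 2.
Proof.
have -> : \sum_i (W *m h) i 0 ^+ 2 = (h^T *m ((W^T *m W) *m h)) 0 0.
  rewrite mulmxA mulmxA -mulmxA -trmx_mul mxE.
  by apply: eq_bigr => i _; rewrite [_^T _ _]mxE expr2.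
rewrite mxE mulr_sumr; apply: eq_bigr => i _.
rewrite [(_ *m h) i 0]mxE !mulr_sumr; apply: eq_bigr => j _.
by rewrite !mxE; ring.
Qed.

(** * The Lasso under a perturbed Gram matrix *)

Section Lasso.
Context (R : realType) (n N : nat).
Variables (W : 'M[R]_(n, N)) (y eta : 'cV[R]_n) (s h : 'cV[R]_N) (t lam c r : R).
Variables (A : 'M[R]_N) (B : {set 'I_N}).

Local Notation A' := (t^-1 *: (W^T *m W)).
Local Notation u := (t^-1 *: (W^T *m eta)).
Hypotheses (t0 : 0 < t) (c0 : 0 < c) (l0 : 0 < lam) (r0 : 0 <= r)
  (yE : y = W *m s + eta)
  (lasso : (2 * t)^-1 * l2norm (y - W *m (s + h)) ^+ 2 + lam * l1norm (s + h) <=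
     (2 * t)^-1 * l2norm (y - W *m s) ^+ 2 + lam * l1norm s)
  (Ac : forall v : 'I_N -> R, c * (\sum_i v i ^+ 2) <= qform A v)
  (hr : forall i j, `|A' i j - A i j| <= r)
  (hu : forall i, `|u i 0| <= lam / 2)
  (sB : forall i, i \notin B -> s i 0 = 0)
  (rB : 16 * r * #|B|%:R <= c / 2).

Lemma l2norm_sqr k (v : 'cV[R]_k) : l2norm v ^+ 2 = \sum_i v i 0 ^+ 2.
Proof. by rewrite sqr_sqrtr// sumr_ge0// => i _; exact: sqr_ge0. Qed.

Lemma lasso_basic : 2^-1 * qform A' (fun i => h i 0) <=
  \sum_i u i 0 * h i 0 + lam * (l1norm s - l1norm (s + h)).
Proof.
move: lasso; rewrite yE mulmxDr !l2norm_sqr.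
have -> : \sum_i (W *m s + eta - W *m s) i 0 ^+ 2 = \sum_i eta i 0 ^+ 2.
  by apply: eq_bigr => i _; rewrite !mxE addrAC subrr add0r.
have -> : \sum_i (W *m s + eta - (W *m s + W *m h)) i 0 ^+ 2 =
    \sum_i eta i 0 ^+ 2 - 2 * \sum_i eta i 0 * (W *m h) i 0 + \sum_i (W *m h) i 0 ^+ 2.
  rewrite mulr_sumr -sumrB -big_split; apply: eq_bigr => i _; rewrite !mxE /=; ring.
rewrite qform_gram.
have -> : \sum_i u i 0 * h i 0 = t^-1 * \sum_i eta i 0 * (W *m h) i 0.
  have -> : \sum_i eta i 0 * (W *m h) i 0 = (eta^T *m (W *m h)) 0 0.
    by rewrite mxE; apply: eq_bigr => i _; rewrite !mxE.
  rewrite mulmxA mxE mulr_sumr; apply: eq_bigr => i _; rewrite !mxE mulrA; congr (_ * _ * _).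
  by apply: eq_bigr => j _; rewrite !mxE mulrC.
rewrite invfM; move: (\sum_i eta i 0 ^+ 2) (\sum_i (W *m h) i 0 ^+ 2) (\sum_i eta i 0 * (W *m h) i 0).
move: (l1norm s) (l1norm (s + h)) t^-1 => a b ti e w f; lra.
Qed.

(** Let D and D' be the l1 norms of the error on and off [B]. The basic inequality gives the cone D'
    <= 3 D, where (D + D')^2 is at most 16 |B| times the sum of squares, so that the perturbation of
    A costs at most half of c. Then D <= 6 |B| lam / c, and D' <= 3 D leads to 18. *)
Lemma lasso_bound i : `|h i 0| <= 18 * #|B|%:R * lam / c.
Proof.
pose D := \sum_(i in B) `|h i 0|; pose D' := \sum_(i in ~: B) `|h i 0|.
have D0 : 0 <= D by apply: sumr_ge0.
have D'0 : 0 <= D' by apply: sumr_ge0.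
have DD : \sum_i `|h i 0| = D + D'.
  by rewrite (bigID (mem B)) /=; congr (_ + _); apply: eq_bigl => j; rewrite inE.
have l1 : l1norm s - l1norm (s + h) <= D - D'.
  rewrite /l1norm -sumrB (bigID (mem B)) /=; apply: lerD.
    by apply: ler_sum => j _; have := ler_normB (s j 0 + h j 0) (h j 0); rewrite addrK mxE; lra.
  rewrite /D' -sumrN [X in _ <= X](eq_bigl (fun j => j \notin B)) => [|j]; last by rewrite inE.
  by apply: ler_sum => j jB; rewrite mxE sB// normr0 !add0r.
have uh : \sum_i u i 0 * h i 0 <= lam / 2 * (D + D').
  rewrite -DD mulr_sumr; apply: ler_sum => j _; apply: le_trans (ler_norm _) _.
  by rewrite normrM; apply: ler_wpM2r.
have qf := qform_perturb (fun i => h i 0) hr; rewrite DD in qf.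
have cq := Ac (fun i => h i 0).
have hB := sum_sqr_supp (fun i => h i 0) B; rewrite -/D in hB.
have bas := lasso_basic; have rB' := rB.
set q := qform A' _ in bas qf; set H := \sum_i h i 0 ^+ 2 in cq hB; set b := #|B|%:R in hB rB' *.
have H0 : 0 <= H by apply: sumr_ge0 => *; exact: sqr_ge0.
have lq : q <= lam * (3 * D - D').
  have := ler_wpM2l (ltW l0) l1; lra.
have q0 : 0 <= q.
  rewrite /q qform_gram.
  by rewrite mulr_ge0 ?invr_ge0 ?(ltW t0)// sumr_ge0// => *; exact: sqr_ge0.
have D3 : D' <= 3 * D.
  by have := le_trans q0 lq; rewrite pmulr_rge0// subr_ge0.
have q1 : c / 2 * H <= 3 * lam * D.
  have e1 : (D + D') ^+ 2 <= 16 * (b * H) by nra.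
  have e2 : r * (D + D') ^+ 2 <= c / 2 * H.
    apply: le_trans (ler_wpM2l r0 e1) _.
    rewrite (_ : r * _ = 16 * r * b * H); last by ring.
    exact: ler_wpM2r.
  have e3 : 0 <= lam * D' by exact: mulr_ge0 (ltW l0) D'0.
  lra.
have b0 : 0 <= b by exact: ler0n.
have Db : D <= 6 * b * lam / c.
  rewrite ler_pdivlMr//; have [D00|D00] := eqVneq D 0.
    by rewrite D00 mul0r; apply: mulr_ge0 (ltW l0); exact: mulr_ge0.
  have Dp : 0 < D by rewrite lt_def D00.
  rewrite -(ler_pM2l Dp) (_ : D * (D * c) = D ^+ 2 * c); last by ring.
  have := ler_wpM2r (ltW c0) hB; have := ler_wpM2l b0 q1; lra.
have iD : `|h i 0| <= D + D'.
  by rewrite -DD (bigD1 i)//= lerDl sumr_ge0.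
have Dp : D + D' <= 4 * D by lra.
have [iB|iB] := boolP (i \in B).
  have i1 : `|h i 0| <= D by rewrite /D (bigD1 i)//= lerDl sumr_ge0.
  apply: le_trans i1 _; apply: le_trans Db _.
  rewrite ler_pM2r ?invr_gt0// ler_pM2r// ler_wpM2r// ler_nat//.
have i1 : `|h i 0| <= D' by rewrite /D' (bigD1 i) ?inE//= lerDl sumr_ge0.
apply: le_trans i1 _; apply: le_trans D3 _.
rewrite (_ : 18 * _ * _ / _ = 3 * (6 * b * lam / c)); last by ring.
by rewrite ler_pM2l.
Qed.

End Lasso.

(** * The post-selection estimator when the deviations are small *)

Section PostSelection.
Context (R : realType) (p d T : nat).
Variables (x eps : int -> 'cV[R]_d) (S St : 'M[R]_(p * d, d)) (b lam c r : R) (A : 'M[R]_(p * d)).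
Local Notation W := (design p T x).
Local Notation eta l := (response p T eps l).
Local Notation A' := (T%:R^-1 *: (W^T *m W)).
Local Notation u l := (T%:R^-1 *: (W^T *m eta l)).
Variable s : nat.
Hypotheses (T0 : (0 < T)%N) (c0 : 0 < c) (l0 : 0 < lam)
  (yE : forall l, response p T x l = W *m col l S + eta l)
  (lasso : is_lasso T lam x St)
  (Ac : forall v : 'I_(p * d) -> R, c * (\sum_i v i ^+ 2) <= qform A v)
  (hr : forall i j, `|A' i j - A i j| <= r)
  (hu : forall l i, `|u l i 0| <= r) (rlam : r <= lam / 2)
  (Ss : forall l, (#|supp S l| <= s)%N)
  (rs : 16 * r * s%:R <= c / 2) (lb : 18 * s%:R * lam / c < b)
  (Sb : forall l k, k \in supp S l -> 2 * b < `|S k l|).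

Lemma post_selection_r0 (k : 'I_(p * d)) : 0 <= r.
Proof. exact: le_trans (normr_ge0 _) (hr k k). Qed.

Lemma threshold_supp_exact l : threshold_supp b St l = supp S l.
Proof.
have hh k : `|St k l - S k l| < b.
  have r0 := post_selection_r0 k.
  have := @lasso_bound R (T - p) (p * d) W (response p T x l) (eta l) (col l S) (col l St - col l S)
    T%:R lam c r A (supp S l).
  rewrite (_ : col l S + (col l St - col l S) = col l St); last by rewrite addrC subrK.
  move=> /(_ _ c0 l0 r0 (yE l) (lasso l (col l S)) Ac hr _ _ _ k); rewrite !mxE => lb0.
  apply: le_lt_trans (lb0 _ _ _ _) _.
  - by rewrite ltr0n.
  - by move=> i; apply: le_trans (hu l i) rlam.
  - by move=> i; rewrite inE negbK mxE => /eqP.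
  - by apply: le_trans rs; rewrite ler_wpM2l ?mulr_ge0// ler_nat.
  - apply: le_lt_trans lb; rewrite ler_pM2r ?invr_gt0// ler_pM2r// ler_wpM2l// ler_nat//.
apply/setP => k; have := hh k; rewrite !inE; have [->|S0] := eqVneq (S k l) 0.
  by rewrite subr0 => ?; apply/negbTE; rewrite -leNgt ltW.
move=> h1; have := Sb (l := l) (k := k); rewrite inE S0 => /(_ isT) h2.
have := ler_normD (S k l - St k l) (St k l); rewrite subrK distrC => h3.
by lra.
Qed.

Lemma gram_coercive (v : 'I_(p * d) -> R) l : (forall i, i \notin supp S l -> v i = 0) ->
  c / 2 * (\sum_i v i ^+ 2) <= qform A' v.
Proof.
move=> vB; have := qform_perturb v hr; have := Ac v; have := sum_sqr_supp v (supp S l).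
rewrite -(_ : \sum_i `|v i| = \sum_(i in supp S l) `|v i|); last first.
  by rewrite [RHS]big_mkcond; apply: eq_bigr => i _; case: ifPn => // /vB ->; rewrite normr0.
set H := \sum_i v i ^+ 2; set D := (\sum_i `|v i|) ^+ 2 => h1 h2 h3.
have H0 : 0 <= H by apply: sumr_ge0 => *; exact: sqr_ge0.
have [k _|N0] := pickP (fun _ : 'I_(p * d) => true); last first.
  by rewrite /H /qform !big_pred0 ?mulr0.
have r0 := post_selection_r0 k.
apply: le_trans h3; rewrite lerBrDr; apply: le_trans h2.
have e1 : r * D <= r * (s%:R * H).
  by apply: ler_wpM2l => //; apply: le_trans h1 _; rewrite ler_wpM2r// ler_nat.
have e2 : 16 * (r * (s%:R * H)) <= c / 2 * H.
  by rewrite (_ : 16 * _ = 16 * r * s%:R * H); [exact: ler_wpM2r|ring].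
have e3 : 0 <= r * (s%:R * H) by rewrite !mulr_ge0.
lra.
Qed.

Lemma post_selectionE k l : post_selection T b x St k l =
  S k l + \sum_j partial_inv (supp S l) A' k j * u l j 0.
Proof.
rewrite mxE threshold_supp_exact yE mulmxDr scalerDr mulmxDr mxE.
congr (_ + _); last by rewrite mxE.
have -> : T%:R^-1 *: (W^T *m (W *m col l S)) = A' *m col l S by rewrite -scalemxAl -mulmxA.
rewrite mulmxA mxE.
have SB i : i \notin supp S l -> S i l = 0 by rewrite inE negbK => /eqP.
transitivity (\sum_(j in supp S l) (k == j)%:R * S j l).
  rewrite [RHS]big_mkcond; apply: eq_bigr => j _.
  case: ifPn => [jB|/SB jB]; last by rewrite [col l S j 0]mxE jB mulr0.
  rewrite [col l S j 0]mxE; congr (_ * _); rewrite mxE.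
  have c20 : 0 < c / 2 by rewrite divr_gt0.
  exact: (partial_inv_mull c20 (fun v => @gram_coercive v l)).
rewrite big_mkcond (bigD1 k)//= eqxx mul1r big1 ?addr0 => [|j jk]; last first.
  by case: ifP => // _; rewrite eq_sym (negbTE jk) mul0r.
by case: ifPn => // /SB.
Qed.

(** The remainder is a deviation of the partial inverse times a deviation of the score, hence
    quadratic in r. Times sqrt T it must vanish, which is why the exponent of r exceeds 1/4 in
    [rate_exponents]. *)
Lemma post_selection_linear k l :
  `|post_selection T b x St k l - S k l - \sum_j partial_inv (supp S l) A k j * u l j 0|
  <= 2 * s%:R ^+ 3 * r ^+ 2 / c ^+ 2.
Proof.
rewrite post_selectionE [S k l + _]addrC addrK -sumrB; apply: le_trans (ler_norm_sum _ _ _) _.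
have r0 := post_selection_r0 k; have c20 : 0 < c / 2 by rewrite divr_gt0.
have sl : #|supp S l|%:R <= s%:R :> R by rewrite ler_nat.
have H j : `|partial_inv (supp S l) A' k j - partial_inv (supp S l) A k j| <= 2 * r / c ^+ 2 * s%:R ^+ 2.
  apply: le_trans (@partial_inv_perturb _ _ _ _ (supp S l) c (c / 2) r k j c0 c20 _ _ hr) _.
  - by move=> v _; exact: Ac.
  - by move=> v; exact: gram_coercive.
  rewrite (_ : (c / 2)^-1 * r * c^-1 = 2 * r / c ^+ 2); last by field; rewrite gt_eqF.
  apply: ler_wpM2l; last by rewrite ler_pXn2r ?nnegrE.
  by rewrite divr_ge0 ?sqr_ge0// mulr_ge0.
apply: le_trans (_ : _ <= \sum_(j in supp S l) 2 * r / c ^+ 2 * s%:R ^+ 2 * r) _.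
  rewrite [X in _ <= X]big_mkcond; apply: ler_sum => j _; case: ifPn => jB.
    by rewrite -mulrBl normrM; apply: ler_pM.
  by rewrite !partial_inv_offr// !mul0r subr0 normr0.
rewrite sumr_const -[X in X <= _]mulr_natr (_ : 2 * s%:R ^+ 3 * r ^+ 2 / c ^+ 2 = 2 * r / c ^+ 2 * s%:R ^+ 2 * r * s%:R).
  by apply: ler_wpM2l => //; rewrite !mulr_ge0 ?invr_ge0 ?sqr_ge0.
by field; rewrite gt_eqF.
Qed.

Lemma post_selection_off k l : k \notin supp S l -> post_selection T b x St k l = S k l.
Proof.
move=> kB; rewrite post_selectionE big1 ?addr0// => j _.
by rewrite partial_inv_offl ?mul0r.
Qed.

End PostSelection.

Lemma coercive_unit (R : realType) n (M : 'M[R]_n) e : 0 < e ->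
  (forall v : 'I_n -> R, e * (\sum_i v i ^+ 2) <= qform M v) ->
  M \in unitmx /\ forall i j, `|invmx M i j| <= e^-1.
Proof.
move=> e0 hM; pose F := partial_inv [set: 'I_n]%SET M.
have hM' v : (forall i, i \notin ([set: 'I_n])%SET -> v i = 0) -> e * (\sum_i v i ^+ 2) <= qform M v by move=> _; exact: hM.
have FM : F *m M = 1%:M.
  by apply/matrixP => i k; rewrite !mxE (partial_inv_mull e0 hM')// in_setT.
have [_ uM] := mulmx1_unit FM; split => // i j.
rewrite -[invmx M]mul1mx -FM mulmxK//; exact: (partial_inv_bound e0 hM').
Qed.

(** * Regularized pseudo-inverses and measurability of the estimator *)

Section Tikhonov.
Context (R : realType) (m n : nat).
Implicit Types A : 'M[R]_(m, n).

(* A continuous approximation of [pinv A], which is discontinuous in A, as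
   e tends to 0; it makes [pinv] measurable. *)
Definition tikhonov A (e : R) : 'M[R]_(n, m) := invmx (A^T *m A + e%:M) *m A^T.

Lemma tikhonov_coercive A e v : e * (\sum_i v i ^+ 2) <= qform (A^T *m A + e%:M) v.
Proof.
have -> : qform (A^T *m A + e%:M) v = qform (1 *: (A^T *m A)) (fun i => (\col_k v k) i 0) + e * (\sum_i v i ^+ 2).
  rewrite scale1r mulr_sumr -big_split; apply: eq_bigr => i _ /=.
  have -> : e * v i ^+ 2 = \sum_j v i * (e%:M : 'M[R]_n) i j * v j.
    rewrite (bigD1 i)//= big1 ?addr0 => [|j ji]; rewrite !mxE ?eqxx ?mulr1n; first by ring.
    by rewrite eq_sym (negbTE ji) mulr0n mulr0 mul0r.
  by rewrite -big_split; apply: eq_bigr => j _ /=; rewrite !mxE mulrDr mulrDl.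
by rewrite qform_gram mul1r lerDr sumr_ge0// => i _; exact: sqr_ge0.
Qed.

(** The Penrose equations give Z = A^T A Y with Y = Z Z^T Z, so the difference is e (Y - e (A^T A +
    e)^-1 Y). The entries of the inverse are at most 1 / e, and the bracket stays bounded. *)
Lemma tikhonov_cvg A i j : exists2 K, 0 <= K & forall e, 0 < e ->
  `|Defs.pinv A i j - tikhonov A e i j| <= e * K.
Proof.
set Z := Defs.pinv A; have [a b c d] := pinvP A.
have AZ : A^T *m A *m Z = A^T by rewrite -mulmxA -c -trmx_mul a.
pose Y := Z *m Z^T *m Z.
have ZY : Z = A^T *m A *m Y.
  by rewrite /Y !mulmxA AZ -trmx_mul d b.
exists (\sum_k `|Y k j| + `|Y i j|) => [|e e0].
  by rewrite addr_ge0// sumr_ge0.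
set G := A^T *m A + e%:M.
have [uG iG] := coercive_unit e0 (tikhonov_coercive A e).
have GE (X : 'M[R]_(n, m)) : A^T *m A *m X = G *m X - e *: X.
  by rewrite /G mulmxDl mul_scalar_mx addrK.
have ZE : Z - tikhonov A e = e *: (Y - e *: (invmx G *m Y)).
  rewrite /tikhonov -/G -AZ GE mulmxBr mulmxA mulVmx// mul1mx opprB addrCA subrr addr0.
  by rewrite -scalemxAr ZY GE mulmxBr mulmxA mulVmx// mul1mx -scalemxAr.
have -> : Z i j - tikhonov A e i j = e * (Y i j - e * \sum_k invmx G i k * Y k j).
  by have /matrixP/(_ i j) := ZE; rewrite !mxE.
rewrite normrM gtr0_norm//; apply: ler_wpM2l; first exact: ltW.
rewrite [leRHS]addrC; apply: le_trans (ler_normB _ _) _; apply: lerD => //.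
rewrite normrM gtr0_norm// -ler_pdivlMl//; apply: le_trans (ler_norm_sum _ _ _) _.
by rewrite mulr_sumr; apply: ler_sum => k _; rewrite normrM; apply: ler_wpM2r.
Qed.

End Tikhonov.

Section MeasurableMatrix.
Context (R : realType) d (T : measurableType d).

Lemma measurable_inv (f : T -> R) : measurable_fun setT f -> (forall w, f w != 0) ->
  measurable_fun setT (fun w => (f w)^-1).
Proof.
move=> mf f0.
have -> : (fun w => (f w)^-1) = fun w => f w * (f w ^+ 2) `^ (- 1).
  by apply/funext => w; rewrite powR_inv1 ?sqr_ge0// expr2 invfM mulrA divff// mul1r.
apply: measurable_funM => //; apply: (measurableT_comp (@measurable_powR R (-1))).
exact: measurable_funX.
Qed.

Lemma measurable_mulmx m n k (M : T -> 'M[R]_(m, n)) (N : T -> 'M[R]_(n, k)) :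
  measurable_mx M -> measurable_mx N -> measurable_mx (fun w => M w *m N w).
Proof.
move=> mM mN i j; have -> : (fun w => (M w *m N w) i j) = fun w => \sum_k M w i k * N w k j.
  by apply/funext => w; rewrite mxE.
by apply: measurable_sum => l; exact: measurable_funM.
Qed.

Lemma measurable_trmx m n (M : T -> 'M[R]_(m, n)) :
  measurable_mx M -> measurable_mx (fun w => (M w)^T).
Proof.
move=> mM i j; have -> : (fun w => (M w)^T i j) = fun w => M w j i by apply/funext => w; rewrite mxE.
exact: mM.
Qed.

Lemma measurable_addmx m n (M N : T -> 'M[R]_(m, n)) :
  measurable_mx M -> measurable_mx N -> measurable_mx (fun w => M w + N w).
Proof.
move=> mM mN i j; have -> : (fun w => (M w + N w) i j) = fun w => M w i j + N w i j by apply/funext => w; rewrite mxE.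
exact: measurable_funD.
Qed.

Lemma measurable_scalemx m n (M : T -> 'M[R]_(m, n)) (c : R) :
  measurable_mx M -> measurable_mx (fun w => c *: M w).
Proof.
move=> mM i j; have -> : (fun w => (c *: M w) i j) = fun w => c * M w i j by apply/funext => w; rewrite mxE.
exact: measurable_funM.
Qed.

Lemma measurable_det n (M : T -> 'M[R]_n) : measurable_mx M -> measurable_fun setT (fun w => \det (M w)).
Proof.
move=> mM; apply: measurable_sum => s; apply: measurable_funM => //.
by apply: measurable_prod => i _.
Qed.

Lemma measurable_invmx n (M : T -> 'M[R]_n) : measurable_mx M -> (forall w, M w \in unitmx) ->
  measurable_mx (fun w => invmx (M w)).
Proof.
move=> mM uM i j.
have -> : (fun w => invmx (M w) i j) = fun w => (\det (M w))^-1 * cofactor (M w) j i.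
  by apply/funext => w; rewrite /invmx uM !mxE.
apply: measurable_funM; first apply: measurable_inv.
- exact: measurable_det.
- by move=> w; have := uM w; rewrite unitmxE unitfE.
- apply: measurable_funM => //; apply: measurable_det => k l.
  have -> : (fun w => row' j (col' i (M w)) k l) = fun w => M w (lift j k) (lift i l).
    by apply/funext => w; rewrite !mxE.
  exact: mM.
Qed.

Lemma measurable_pinv m n (M : T -> 'M[R]_(m, n)) : measurable_mx M -> measurable_mx (fun w => Defs.pinv (M w)).
Proof.
move=> mM i j; apply: (@measurable_fun_cvg _ _ _ _ (fun k w => tikhonov (M w) (harmonic k) i j)).
  move=> k; have k0 : 0 < harmonic k :> R by rewrite invr_gt0.
  apply: measurable_mulmx => //; last exact: measurable_trmx.
  apply: measurable_invmx => [|w]; last exact: (coercive_unit k0 (tikhonov_coercive _ _)).1.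
  apply: measurable_addmx => //; apply: measurable_mulmx => //; exact: measurable_trmx.
move=> w _; have [K K0 hK] := tikhonov_cvg (M w) i j.
have cK : (fun k => harmonic k * K) @ \oo --> (0 : R).
  by rewrite -(mul0r K); apply: cvgMl; exact: cvg_harmonic.
apply/cvgrPdist_le => e e0; 
have : \forall k \near \oo, `|harmonic k * K| <= e by exact: (@cvgr0_norm_le _ _ _ _ _ (fun k => harmonic k * K) cK).
apply: filterS => k.
have k0 : 0 < harmonic k :> R by rewrite invr_gt0.
by move=> /(le_trans (ler_norm _)); apply: le_trans; exact: hK.
Qed.

Lemma measurable_partial_inv n (B : {set 'I_n}) (M : T -> 'M[R]_n) : measurable_mx M ->
  measurable_mx (fun w => partial_inv B (M w)).
Proof.
move=> mM i j.
have -> : (fun w => partial_inv B (M w) i j) = fun w => \sum_s \sum_t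
   ((enum_val s == i) && (enum_val t == j))%:R *
   Defs.pinv (\matrix_(s < #|B|, t < #|B|) M w (enum_val s) (enum_val t)) s t.
  apply/funext => w; rewrite mxE big_mkcond; apply: eq_bigr => s _.
  case: ifPn => si; last by rewrite big1// => t _; rewrite mul0r.
  by rewrite big_mkcond; apply: eq_bigr => t _; case: ifPn => tj; rewrite /= ?mul1r ?mul0r.
apply: measurable_sum => s; apply: measurable_sum => t; apply: measurable_funM => //.
apply: measurable_pinv => a b.
have -> : (fun w => (\matrix_(s < #|B|, t < #|B|) M w (enum_val s) (enum_val t)) a b) = fun w => M w (enum_val a) (enum_val b).
  by apply/funext => w; rewrite mxE.
exact: mM.
Qed.

Lemma measurable_set_indic n (B : {set 'I_n}) (f : T -> 'I_n -> bool) :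
  (forall k, measurable_fun setT (f ^~ k)) ->
  measurable_fun setT (fun w => (([set k | f w k]%SET == B)%:R : R)).
Proof.
move=> mf.
have -> : (fun w => (([set k | f w k]%SET == B)%:R : R)) = fun w => \prod_k (f w k == (k \in B))%:R.
  apply/funext => w; have [e|/negP e] := boolP (_ == _).
    by rewrite big1// => k _; move/eqP/setP/(_ k) : e; rewrite inE => ->; rewrite eqxx.
  have [k kf] : exists k, f w k != (k \in B).
    apply/existsP; apply: contrapT => /negP; rewrite negb_exists => /forallP h.
    by apply: e; apply/eqP/setP => k; rewrite inE; move: (h k); rewrite negbK => /eqP.
  by rewrite (bigD1 k)//= (negbTE kf) mul0r.
apply: measurable_prod => k _.
have -> : (fun w => (f w k == (k \in B))%:R : R) = fun w => if f w k then (k \in B)%:R else (k \notin B)%:R.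
  by apply/funext => w; case: (f w k); case: (k \in B).
exact: measurable_fun_if.
Qed.

Lemma measurable_design p e N (x : T -> int -> 'cV[R]_e) :
  (forall t, measurable_mx (fun w => x w t)) -> measurable_mx (fun w => design p N (x w)).
Proof.
move=> mx s k'; case/mxvec_indexP: k' => j i.
have -> : (fun w => design p N (x w) s (mxvec_index j i)) = fun w => x w ((p + s)%N%:Z - j%:Z) i 0.
  by apply/funext => w; rewrite /design /lagged !mxE mxvecE mxE.
exact: mx.
Qed.

Lemma measurable_response p e N (x : T -> int -> 'cV[R]_e) l :
  (forall t, measurable_mx (fun w => x w t)) -> measurable_mx (fun w => response p N (x w) l).
Proof.
move=> mx s j; have -> : (fun w => response p N (x w) l s j) = fun w => x w (p + s).+1%:Z l 0.
  by apply/funext => w; rewrite mxE.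
exact: mx.
Qed.

Lemma measurable_post_selection p e N b (x : T -> int -> 'cV[R]_e) (S : T -> 'M[R]_(p * e, e)) :
  (forall t, measurable_mx (fun w => x w t)) -> measurable_mx S ->
  measurable_mx (fun w => post_selection N b (x w) (S w)).
Proof.
move=> mx mS k l.
have mW : measurable_mx (fun w => design p N (x w)) by exact: measurable_design.
have my : measurable_mx (fun w => response p N (x w) l) by exact: measurable_response.
(* The selected set takes finitely many values; the estimator is split along them. *)
have -> : (fun w => post_selection N b (x w) (S w) k l) = fun w => \sum_(B : {set 'I_(p * e)})
   (threshold_supp b (S w) l == B)%:R *
   (partial_inv B (N%:R^-1 *: ((design p N (x w))^T *m design p N (x w)))
     *m (N%:R^-1 *: ((design p N (x w))^T *m response p N (x w) l))) k 0.
  apply/funext => w; rewrite mxE (bigD1 (threshold_supp b (S w) l))//= eqxx mul1r.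
  by rewrite big1 ?addr0// => B; rewrite eq_sym => /negbTE ->; rewrite mul0r.
apply: measurable_sum => B; apply: measurable_funM.
  apply: measurable_set_indic => j; apply: measurable_fun_ltr => //.
  apply: measurableT_comp => //; exact: mS.
apply: measurable_mulmx.
  apply: measurable_partial_inv; apply: measurable_scalemx; apply: measurable_mulmx => //.
  exact: measurable_trmx.
apply: measurable_scalemx; apply: measurable_mulmx => //; exact: measurable_trmx.
Qed.

End MeasurableMatrix.

(** * Gram matrix, score and influence functions *)

Lemma mom2_prod d (T : measurableType d) (R : realType) (P : probability T R) q (X Y : T -> R) a b :
  2 <= q -> mom P q X a -> mom P q Y b ->
  itg P (fun w => X w * Y w) /\ `|Ex P (fun w => X w * Y w)| <= a * b.
Proof.
move=> q2 hX hY.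
have h2 : mom P 1 (fun w => X w * Y w) (a * b).
  by apply: momM => //; rewrite mulr1; apply: mom_expo q2 _.
have [i1 e1] := mom_itg (lexx 1) h2; split => //.
apply: le_trans e1; exact: norm_Ex.
Qed.

(** * Short-range dependence with polynomial tails *)

Section PolynomialDecay.
Context (R : realType) (mu : probability (prodR int R) R) (imu : indep_coord mu) (alpha : R).
Hypothesis alpha0 : 0 <= alpha.
Local Notation E := (prodR int R).
Implicit Types (y : int -> E -> R) (dl : nat -> R) (q M C : R).

Definition decay (k : nat) : R := (1 + k%:R) `^ (- alpha).

(** A class stable under delays, sums and products, in which only the moment bound M and the tail
    constant C have to be tracked. *)
Definition srt q M C y : Prop := exists2 dl, srd mu q M dl y &
  forall k N, \sum_(i < N) dl (k + i)%N <= C * decay k.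

Lemma decay_gt0 k : 0 < decay k. Proof. by rewrite powR_gt0// ltr_pwDl. Qed.

Lemma decay0 : decay 0 = 1. Proof. by rewrite /decay addr0 powR1. Qed.

(** From 1 + L <= (1 + j) (1 + (L - j)): a delay by j costs a factor (1 + j)^alpha. *)
Lemma decay_sub L j : decay (L - j) <= (1 + j%:R) `^ alpha * decay L.
Proof.
have p k : 0 < 1 + k%:R :> R by rewrite ltr_pwDl.
rewrite /decay !powRN ler_pdivlMr ?powR_gt0// mulrC ler_pdivrMr ?powR_gt0// -powRM ?(ltW (p _))//.
apply: ler_powR2 => //.
have : (L.+1 <= j.+1 * (L - j).+1)%N by case: (leqP j L) => jL; [rewrite -(subnKC jL) addKn|]; nia.
by rewrite -(ler_nat R) natrM -!natr1 ![1 + _]addrC.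
Qed.

Lemma srt_mom q M C y t : srt q M C y -> mom mu q (y t) M.
Proof. by case=> dl [h _ _] _. Qed.

Lemma srt_ge0 q M C y : srt q M C y -> 0 <= M /\ 0 <= C.
Proof.
case=> dl h hC; have [M0 dl0] := srd_ge0 h; split => //.
by have := hC 0%N 0%N; rewrite big_ord0 decay0 mulr1.
Qed.

Lemma srt_le q M M' C C' y : M <= M' -> C <= C' -> srt q M C y -> srt q M' C' y.
Proof.
move=> MM CC [dl h hC]; exists dl; first exact: srd_le h.
by move=> k N; apply: le_trans (hC k N) _; apply: ler_wpM2r => //; exact/ltW/decay_gt0.
Qed.

Lemma srt_lag q M C y (j : nat) : 0 < q -> srt q M C y ->
  srt q M (C * (1 + j%:R) `^ alpha) (fun t => y (t - j%:Z)).
Proof.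
move=> q0 [dl h hC]; have [_ dl0] := srd_ge0 h.
have [_ C0] : 0 <= M /\ 0 <= C by apply: (@srt_ge0 q M C y); exists dl.
exists (lagd j dl); first exact: srd_lag.
move=> k N; apply: le_trans (lagd_tail j k N dl0 hC) _.
by rewrite -mulrA; apply: ler_wpM2l => //; exact: decay_sub.
Qed.

Lemma srtZ q M C y (a : R) : 0 < q -> srt q M C y -> srt q (`|a| * M) (`|a| * C) (fun t u => a * y t u).
Proof.
move=> q0 [dl h hC]; exists (fun i => `|a| * dl i); first exact: srdZ.
by move=> k N; rewrite -mulr_sumr -mulrA; apply: ler_wpM2l.
Qed.

Lemma srtD q M M' C C' y y' : 1 <= q -> srt q M C y -> srt q M' C' y' ->
  srt q (M + M') (C + C') (fun t u => y t u + y' t u).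
Proof.
move=> q0 [dl h hC] [dl' h' hC']; exists (fun i => dl i + dl' i); first exact: srdD.
by move=> k N; rewrite big_split mulrDl lerD.
Qed.

Lemma srt_cst q M (a : int -> R) : 0 < q -> (forall t, `|a t| <= M) -> srt q M 0 (fun t _ => a t).
Proof.
move=> q0 aM; exists (fun=> 0); last by move=> k N; rewrite big1// mul0r.
split => // [t|t i]; first exact: mom_le (aM t) (mom_cst mu _ q0).
by rewrite subrr; have := mom_cst (pprod mu mu) 0 q0; rewrite normr0.
Qed.

Lemma srt_sum q I (r : seq I) M C (y : I -> int -> E -> R) : 1 <= q -> 0 <= M -> 0 <= C ->
  (forall k, srt q M C (y k)) ->
  srt q ((size r)%:R * M) ((size r)%:R * C) (fun t u => \sum_(k <- r) y k t u).
Proof.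
move=> q1 M0 C0 h; elim: r => [|k r IH].
  rewrite !mul0r; have -> : (fun t u => \sum_(k <- [::]) y k t u) = fun _ _ => 0.
    by apply/funext => t; apply/funext => u; rewrite big_nil.
  by apply: srt_cst => //; rewrite ?normr0// (lt_le_trans ltr01).
have -> : (fun t u => \sum_(k <- k :: r) y k t u) = fun t u => y k t u + \sum_(k <- r) y k t u.
  by apply/funext => t; apply/funext => u; rewrite big_cons.
by rewrite /= -natr1 !mulrDl !mul1r ![_ * _ + _]addrC; exact: srtD.
Qed.

Lemma srtM q M M' C C' y y' : 1 <= q -> srt (2 * q) M C y -> srt (2 * q) M' C' y' ->
  srt q (M * M') (M * C' + M' * C) (fun t u => y t u * y' t u).
Proof.
move=> q1 h h'; have [M0 _] := srt_ge0 h; have [M'0 _] := srt_ge0 h'.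
case: h h' => dl h hC [dl' h' hC'].
exists (fun i => M * dl' i + M' * dl i); first exact: srdM.
move=> k N; rewrite big_split /= -!mulr_sumr mulrDl -!mulrA.
by apply: lerD; [exact: (ler_wpM2l M0 (hC' k N))|exact: (ler_wpM2l M'0 (hC k N))].
Qed.

Lemma srt_center q M C y : 1 <= q -> srt q M C y ->
  srt q (M + M) C (fun t u => y t u - Ex mu (y t)) /\ forall t, Ex mu (fun u => y t u - Ex mu (y t)) = 0.
Proof.
move=> q1 h; have H t := mom_itg q1 (srt_mom t h); split => [|t].
  rewrite -[C]addr0; apply: srtD => //; apply: srt_cst; first exact: lt_le_trans q1.
  move=> t; rewrite normrN; apply: le_trans (norm_Ex (H t).1) _; exact: (H t).2.
by rewrite ExB ?Ex_cst ?subrr//; [exact: (H t).1|exact: itg_cst].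
Qed.

Lemma srt_sum_mom q M C y (T0 : int) (n : nat) : 2 < q -> srt q M C y ->
  (forall t, Ex mu (y t) = 0) ->
  mom mu q (fun u => \sum_(j < n) y (T0 - j%:Z) u) (Num.sqrt (rio_cst q * n.+1%:R) * C).
Proof.
move=> q2 [dl [h1 h2 h3] hC] y0; apply: (dependent_sum_mom imu T0 n q2 h1 h2 h3 y0) => N.
by have := hC 0%N N; rewrite decay0 mulr1.
Qed.

Lemma srt_sum_approx q M C y (T0 : int) (L n : nat) (e : R) : 2 < q -> 0 < e -> srt q M C y ->
  (forall t, Ex mu (y t) = 0) ->
  exists k (V : int -> E -> R), [/\ forall t, bmeas k (V t),
    forall t, dep (fun k => (t + 1 - L%:Z <= k <= t)%R) (V t),
    forall t, Ex mu (V t) = 0, forall t, mom mu q (V t) (M + M) &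
    mom mu q (fun u => \sum_(j < n) (y (T0 - j%:Z) u - V (T0 - j%:Z) u))
      (Num.sqrt (rio_cst q * n.+1%:R) * (C * decay L) + e)].
Proof.
by move=> q2 e0 [dl [h1 h2 h3] hC] y0; exact: (dependent_sum_approx imu T0 n q2 e0 h1 h2 h3 y0 (hC L)).
Qed.

End PolynomialDecay.

(** The innovation as a function of the path, defined for every path; under the autoregression it
    agrees almost surely with [eps]. *)
Definition innov (R : realType) p d (A : 'I_p -> 'M[R]_d) (x : int -> 'cV[R]_d) (t : int) : 'cV[R]_d :=
  x t - \sum_(j < p) A j *m x (t - j.+1%:Z).

Lemma innovE (R : realType) p d (A : 'I_p -> 'M[R]_d) x t l :
  innov A x t l 0 = x t l 0 - \sum_k coef_mx A k l * lagged p x (t - 1) k 0.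
Proof.
rewrite !mxE summxE sum_mxvec_index; congr (_ - _); apply: eq_bigr => j _.
rewrite mxE; apply: eq_bigr => i _; rewrite coef_mxE laggedE; congr (_ * x _ _ _).
by rewrite -addrA -opprD; congr (_ - _); lia.
Qed.

(** * The autoregression on the space of innovations *)

Section CanonicalVAR.
Context (R : realType) (mu : probability (prodR int R) R) (imu : indep_coord mu) (p d : nat).
Local Notation E := (prodR int R).
Variables (alpha m M C c : R) (s : nat) (X : int -> 'I_d -> E -> R).
Variables (A : 'I_p -> 'M[R]_d) (Sig : 'M[R]_d).
Local Notation S := (coef_mx A).

Definition path_of (u : E) (t : int) : 'cV[R]_d := \col_i X t i u.
Definition state t k (u : E) : R := lagged p (path_of u) t k 0.
Definition innovation t l (u : E) : R := innov A (path_of u) t l 0.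
Local Notation zs := state.
Local Notation et := innovation.
Definition state_cov : 'M[R]_(p * d) := \matrix_(k, k') Ex mu (fun u => zs 0 k u * zs 0 k' u).

Hypotheses (alpha0 : 0 <= alpha) (m8 : 8 < m) (c0 : 0 < c).
Hypothesis hX : forall i, srt mu alpha m M C (fun t => X t i).
Hypothesis eig : forall z : R[i], eigenvalue (map_mx (real_complex R) (companion_tr S)) z -> `|z| < 1.
Hypothesis wn0 : forall t s l l', t != s -> Ex mu (fun u => et t l u * et s l' u) = 0.
Hypothesis wn1 : forall t l l', Ex mu (fun u => et t l u * et t l' u) = Sig l l'.
Hypothesis coerc : forall v : 'I_(p * d) -> R, c * (\sum_k v k ^+ 2) <= qform state_cov v.
Hypothesis sS : forall l, (#|supp S l| <= s)%N.

Let m0 : 0 < m. Proof. by apply: lt_trans m8. Qed.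
Let m1 : 1 <= m. Proof. by apply: ltW; apply: lt_trans m8; rewrite (ltr_nat R 1 8). Qed.
Let m2 : 2 <= m. Proof. by apply: ltW; apply: lt_trans m8; rewrite (ltr_nat R 2 8). Qed.
Let M0 : (0 < d)%N -> 0 <= M /\ 0 <= C.
Proof. by case: d X hX => // d' X' h _; exact: (srt_ge0 (h ord0)). Qed.

(** Bounds the cost of every delay up to p: the lags in a state, and those of the state one time
    unit earlier. *)
Definition lag_cst : R := (1 + p%:R) `^ alpha.
Local Notation Pa := lag_cst.
Local Notation Cz := (C * Pa).

Let lagc (j : nat) : (j <= p)%N -> (1 + j%:R) `^ alpha <= Pa.
Proof. by move=> jp; apply: ler_powR2 => //; rewrite lerD2l ler_nat. Qed.

Lemma srt_state (a : nat) k : (a <= 1)%N -> srt mu alpha m M Cz (fun t => zs (t - a%:Z) k).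
Proof.
move=> a1; case/mxvec_indexP: k => j i.
have [_ C0] := M0 (leq_ltn_trans (leq0n _) (ltn_ord i)).
have -> : (fun t => zs (t - a%:Z) (mxvec_index j i)) = fun t => X (t - (a + j)%N%:Z) i.
  apply/funext => t; apply/funext => u; rewrite /state laggedE mxE; congr (X _ _ _); lia.
apply: srt_le (srt_lag alpha0 (a + j)%N m0 (hX i)) => //.
by apply: ler_wpM2l => //; apply: lagc; have := ltn_ord j; lia.
Qed.

Lemma srt_state0 k : srt mu alpha m M Cz (fun t => zs t k).
Proof.
have := srt_state k (leq0n 1).
by have -> : (fun t => zs (t - 0%N%:Z) k) = fun t => zs t k by apply/funext => t; rewrite subr0.
Qed.

Lemma innovationE t l u : et t l u = X t l u - \sum_k S k l * zs (t - 1) k u.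
Proof. by rewrite /innovation innovE mxE. Qed.

Let momz t k : mom mu m (zs t k) M. Proof. exact: srt_mom (srt_state0 k). Qed.
Let momX t l : mom mu m (X t l) M. Proof. exact: srt_mom (hX l). Qed.

(** This bound may grow with the dimension. Its existence gives integrability and bounds the
    backward orbits; quantitative uses go through [srt_innovation]. *)
Lemma innovation_mom : exists b, forall t l, mom mu m (et t l) b.
Proof.
exists (M + \sum_l \sum_k `|S k l| * M) => t l.
have -> : et t l = fun u => X t l u - \sum_k S k l * zs (t - 1) k u.
  by apply/funext => u; rewrite innovationE.
apply: momB => //.
have h : mom mu m (fun u => \sum_k S k l * zs (t - 1) k u) (\sum_k `|S k l| * M).
  by apply: mom_sum => // k _; exact: momZ.
apply: mom_le h.
rewrite (bigD1 l)//= lerDl; apply: sumr_ge0 => l' _; apply: sumr_ge0 => k _.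
by apply: mulr_ge0 => //; exact: mom_ge0 (momz t k).
Qed.

Lemma state_rec t k u : zs t k u = \sum_k' zs (t - 1) k' u * companion_tr S k' k
  + \sum_(l < d) (k == l :> nat)%:R * et t l u.
Proof.
by rewrite /state /innovation; apply: lagged_rec; rewrite /innov addrC subrK.
Qed.

Lemma state_innovation0 t s' k l : t < s' -> Ex mu (fun u => zs t k u * et s' l u) = 0.
Proof.
have [b hb] := innovation_mom.
apply: (@state_innovation_uncorrelated R _ _ _ _ mu (companion_tr S) (fun k (l : 'I_d) => (k == l :> nat)%:R)
  zs et (M * b) eig state_rec).
- by move=> t' s'' k1 k2; exact: mom2_prod m2 (momz t' k1) (hb s'' k2).
- by move=> t' s'' l1 l2; have [] := mom2_prod m2 (hb t' l1) (hb s'' l2).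
- exact: wn0.
Qed.

Lemma state_covE t k k' : Ex mu (fun u => zs t k u * zs t k' u) = state_cov k k'.
Proof.
have [b hb] := innovation_mom; rewrite mxE.
apply: (@state_covariance_stationary R _ _ _ _ mu (companion_tr S) (fun k (l : 'I_d) => (k == l :> nat)%:R)
  (fun i j => Sig i j) zs et (`|M * M| + `|M * b|) eig state_rec).
- move=> t' s'' k1 k2; have [h1 h2] := mom2_prod m2 (momz t' k1) (momz s'' k2); split => //.
  by apply: le_trans h2 _; apply: le_trans (ler_norm _) _; rewrite lerDl.
- move=> t' s'' k1 k2; have [h1 h2] := mom2_prod m2 (momz t' k1) (hb s'' k2); split => //.
  by apply: le_trans h2 _; apply: le_trans (ler_norm _) _; rewrite lerDr.
- by move=> t' s'' l1 l2; have [] := mom2_prod m2 (hb t' l1) (hb s'' l2).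
- exact: wn0.
- exact: wn1.
Qed.

Lemma qform_state_cov t (v : 'I_(p * d) -> R) :
  itg mu (fun u => (\sum_k v k * zs t k u) * (\sum_k v k * zs t k u)) /\
  Ex mu (fun u => (\sum_k v k * zs t k u) * (\sum_k v k * zs t k u)) = qform state_cov v.
Proof.
have -> : (fun u => (\sum_k v k * zs t k u) * (\sum_k v k * zs t k u)) =
    fun u => \sum_k \sum_k' (v k * v k') * (zs t k u * zs t k' u).
  apply/funext => u; rewrite mulr_suml; apply: eq_bigr => k _; rewrite mulr_sumr.
  by apply: eq_bigr => k' _; rewrite mulrACA.
have iz k k' : itg mu (fun u => zs t k u * zs t k' u) := (mom2_prod m2 (momz t k) (momz t k')).1.
split; first by apply: itg_sum => k _; apply: itg_sum => k' _; exact: itgZ.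
rewrite Ex_sum => [|k _]; last by apply: itg_sum => k' _; exact: itgZ.
apply: eq_bigr => k _; rewrite Ex_sum => [|k' _]; last exact: itgZ.
by apply: eq_bigr => k' _; rewrite ExZ// state_covE mulrAC.
Qed.

Definition coef_bound : R := 1 + M * M / c.
Local Notation Sm := coef_bound.

(** Coordinate l of X at time 0 is the regression part Y plus an orthogonal innovation, so c S_kl^2
    <= E Y^2 <= E X^2 <= M^2. The 1 in [coef_bound] comes from |a| <= 1 + a^2. *)
Lemma coef_le k l : `|S k l| <= Sm.
Proof.
have [b hb] := innovation_mom.
pose Y u := \sum_k S k l * zs (- 1) k u.
have [iY eY] := qform_state_cov (- 1) (S ^~ l).
have hY := coerc (S ^~ l); rewrite -eY in hY.
have momY : mom mu m Y (\sum_k `|S k l| * M) by apply: mom_sum => // k' _; exact: momZ.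
have Ye0 : Ex mu (fun u => Y u * et 0 l u) = 0.
  have -> : (fun u => Y u * et 0 l u) = fun u => \sum_k S k l * (zs (- 1) k u * et 0 l u).
    by apply/funext => u; rewrite /Y mulr_suml; apply: eq_bigr => k' _; rewrite mulrA.
  rewrite Ex_sum => [|k' _]; last by apply: itgZ; exact: (mom2_prod m2 (momz _ k') (hb 0 l)).1.
  rewrite big1// => k' _; rewrite ExZ; last exact: (mom2_prod m2 (momz _ k') (hb 0 l)).1.
  by rewrite state_innovation0 ?mulr0.
have [iYe _] := mom2_prod m2 momY (hb 0 l).
have [iee _] := mom2_prod m2 (hb 0 l) (hb 0 l).
have [iXX XX] := mom2_prod m2 (momX 0 l) (momX 0 l).
have e1 : Ex mu (fun u => Y u * Y u) <= M * M.
  apply: le_trans (le_trans (ler_norm _) XX).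
  rewrite -[X in X <= _]addr0 -[X in _ + X](mulr0 2) -Ye0 -ExZ// -ExD//; last exact: itgZ.
  apply: le_Ex => // [|u]; first by apply: itgD => //; exact: itgZ.
  have -> : X 0 l u = Y u + et 0 l u by rewrite innovationE sub0r addrC subrK.
  by have := sqr_ge0 (et 0 l u); nra.
have e2 : c * S k l ^+ 2 <= M * M.
  apply: le_trans e1; apply: le_trans hY; apply: ler_wpM2l; first exact: ltW.
  by rewrite (bigD1 k)//= lerDl sumr_ge0// => *; exact: sqr_ge0.
have e3 : S k l ^+ 2 <= M * M / c by rewrite ler_pdivlMr// mulrC.
rewrite /coef_bound -(real_normK (num_real (S k l))) in e3 *.
by have := sqr_ge0 (`|S k l| - 1); nra.
Qed.

Definition innov_mom : R := M + s%:R * (Sm * M).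
Definition innov_tail : R := C + s%:R * (Sm * Cz).
Local Notation Me := innov_mom.
Local Notation Ce := innov_tail.

(** At most s coefficients of the column are nonzero, each of absolute value at most [coef_bound];
    this keeps the constants free of the dimension d. *)
Lemma srt_innovation l : srt mu alpha m Me Ce (fun t => et t l).
Proof.
have [M00 C00] := M0 (leq_ltn_trans (leq0n _) (ltn_ord l)).
have Sm0 : 0 <= Sm by rewrite /coef_bound addr_ge0// divr_ge0 ?mulr_ge0// ltW.
have Cz0 : 0 <= Cz by rewrite mulr_ge0// powR_ge0.
have -> : (fun t => et t l) = fun t u => X t l u + (\sum_(k <- enum (supp S l)) (- S k l) * zs (t - 1) k u).
  apply/funext => t; apply/funext => u; rewrite innovationE -sumrN; congr (_ + _).
  rewrite big_enum /= [RHS]big_mkcond; apply: eq_bigr => k _; rewrite inE.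
  by case: eqP => [->|_]; rewrite ?mul0r ?oppr0// mulNr.
apply: srtD => //.
have hk k : srt mu alpha m (Sm * M) (Sm * Cz) (fun t u => - S k l * zs (t - 1) k u).
  apply: srt_le (srtZ (- S k l) m0 (srt_state k (leqnn 1))); rewrite normrN.
    by apply: ler_wpM2r => //; exact: coef_le.
  by apply: ler_wpM2r => //; exact: coef_le.
have h := srt_sum (enum (supp S l)) m1 (mulr_ge0 Sm0 M00) (mulr_ge0 Sm0 Cz0) hk.
have ss : (size (enum (supp S l)))%:R <= s%:R :> R by rewrite ler_nat -cardE.
by apply: srt_le h; apply: ler_wpM2r => //; exact: mulr_ge0.
Qed.

Lemma srt_state_state k k' : srt mu alpha (m / 2) (M * M + M * M) (M * Cz + M * Cz)
    (fun t u => zs t k u * zs t k' u - state_cov k k') /\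
  forall t : int, Ex mu (fun u => zs t k u * zs t k' u - state_cov k k') = 0.
Proof.
have q1 : 1 <= m / 2 by move: m8; lra.
have mm : 2 * (m / 2) = m by rewrite mulrC divfK.
have h := @srtM _ _ imu alpha (m / 2) M M Cz Cz (fun t => zs t k) (fun t => zs t k') q1.
rewrite mm in h; have {h} [h1 h2] := srt_center q1 (h (srt_state0 k) (srt_state0 k')).
have e : (fun (t : int) u => zs t k u * zs t k' u - Ex mu (fun u => zs t k u * zs t k' u)) =
    fun t u => zs t k u * zs t k' u - state_cov k k'.
  by apply/funext => t; apply/funext => u; rewrite state_covE.
split; first by rewrite -e.
by move=> t; have := h2 t; have /(congr1 (@^~ t)) /= -> := e.
Qed.

Lemma srt_state_innovation k l : srt mu alpha (m / 2) (M * Me) (M * Ce + Me * Cz)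
    (fun t u => zs (t - 1) k u * et t l u) /\
  forall t : int, Ex mu (fun u => zs (t - 1) k u * et t l u) = 0.
Proof.
have q1 : 1 <= m / 2 by move: m8; lra.
have mm : 2 * (m / 2) = m by rewrite mulrC divfK.
split; last by move=> t; apply: state_innovation0; lia.
have h := @srtM _ _ imu alpha (m / 2) M Me Cz Ce (fun t => zs (t - 1) k) (fun t => et t l) q1.
by rewrite mm in h; exact: h (srt_state k (leqnn 1)) (srt_innovation l).
Qed.

End CanonicalVAR.

(** * Maxima of finite families *)

Section MaxNorm.
Context (R : realType) (K : finType) d (T : measurableType d) (P : probability T R).
Implicit Types V : K -> T -> R.

Definition maxnorm (v : K -> R) : R := \big[Num.max/0]_i `|v i|.

Lemma maxnorm_ge (v : K -> R) i : `|v i| <= maxnorm v.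
Proof. exact: le_bigmax. Qed.

Lemma maxnorm_ge0 (v : K -> R) : 0 <= maxnorm v.
Proof. exact: bigmax_ge_id. Qed.

Lemma maxnorm_le (v : K -> R) a : 0 <= a -> (forall i, `|v i| <= a) -> maxnorm v <= a.
Proof. by move=> a0 va; apply: bigmax_le. Qed.

Lemma measurable_bigmax I (r : seq I) (f : I -> T -> R) : (forall i, measurable_fun setT (f i)) ->
  measurable_fun setT (fun w => \big[Num.max/0]_(i <- r) f i w).
Proof.
move=> mf; elim: r => [|i r IH].
  by have -> : (fun w => \big[Num.max/0]_(i <- [::]) f i w) = fun=> 0 by apply/funext => w; rewrite big_nil.
have -> : (fun w => \big[Num.max/0]_(i <- i :: r) f i w) = fun w => Num.max (f i w) (\big[Num.max/0]_(i <- r) f i w).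
  by apply/funext => w; rewrite big_cons.
exact: measurable_maxr.
Qed.

Lemma measurable_maxnorm V : (forall i, measurable_fun setT (V i)) ->
  measurable_fun setT (fun w => maxnorm (V ^~ w)).
Proof. by move=> mV; apply: measurable_bigmax => i; exact: measurableT_comp. Qed.

Lemma maxnorm_powR (v : K -> R) q : 0 < q -> maxnorm v `^ q <= \sum_i `|v i| `^ q.
Proof.
move=> q0; rewrite /maxnorm; elim/big_ind: _ => [|a b ha hb|i _].
- by rewrite powR0 ?gt_eqF// sumr_ge0// => i _; exact: powR_ge0.
- by rewrite /Num.max; case: ifP.
- by rewrite (bigD1 i)//= lerDl sumr_ge0// => j _; exact: powR_ge0.
Qed.

(** The q-th power of a maximum is at most the sum of the q-th powers, so the dimension enters as
    its power 1 / q. *)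
Lemma mom_maxnorm V q c : 0 < q -> 0 <= c -> (forall i, mom P q (V i) c) ->
  mom P q (fun w => maxnorm (V ^~ w)) ((#|K|%:R) `^ q^-1 * c).
Proof.
move=> q0 c0 hV; have mV i := mom_meas (hV i).
have hE i := mom_itg_pow q0 (hV i).
have iS : itg P (fun w => \sum_i `|V i w| `^ q) by apply: itg_sum => i _; exact: (hE i).1.
have mm := measurable_maxnorm mV.
have le w : `|maxnorm (V ^~ w)| `^ q <= \sum_i `|V i w| `^ q.
  by rewrite ger0_norm ?maxnorm_ge0//; exact: maxnorm_powR.
have i1 : itg P (fun w => `|maxnorm (V ^~ w)| `^ q).
  apply: (itg_le (measurable_norm_powR q mm) iS) => w.
  by rewrite ger0_norm ?powR_ge0.
apply: (mom_Ex q0 mm) => //; first by rewrite mulr_ge0// powR_ge0.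
apply: le_trans (le_Ex i1 iS le) _; rewrite Ex_sum => [|i _]; last exact: (hE i).1.
rewrite powRM ?powR_ge0// -powRrM mulVf ?gt_eqF// powRr1 ?ler0n//.
by apply: le_trans (ler_sum _ (fun i _ => (hE i).2)) _; rewrite sumr_const mulr_natl.
Qed.

End MaxNorm.

Lemma card_near n (t L : nat) : (#|[pred s : 'I_n | (t < s + L) && (s < t + L)]| <= 2 * L + 1)%N.
Proof.
set A := [pred s : 'I_n | _]; rewrite cardE.
have -> : size (enum A) = size (map (fun s : 'I_n => s + L - t)%N (enum A)) by rewrite size_map.
rewrite -[leqRHS](size_iota 0).
apply: uniq_leq_size.
  rewrite map_inj_in_uniq ?enum_uniq// => x y; rewrite !mem_enum !inE => hx hy e.
  by apply: val_inj => /=; lia.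
by move=> k /mapP[x]; rewrite mem_enum inE => hx ->; rewrite mem_iota; lia.
Qed.

Lemma window_disjoint (T t s L : nat) (a : int) : ~~ ((t < s + L) && (s < t + L))%N ->
  (T%:Z - t%:Z + 1 - L%:Z <= a <= T%:Z - t%:Z)%R -> ~~ (T%:Z - s%:Z + 1 - L%:Z <= a <= T%:Z - s%:Z)%R.
Proof.
move=> hn /andP[h1 h2]; apply/negP => /andP[h3 h4].
by move: hn; rewrite negb_and -!leqNgt => /orP[] h5; lia.
Qed.

Section GaussianMaximum.
Context (R : realType) (K : finType) (d : measure_display) (T : measurableType d).
Variables (Q : probability T R) (G : K -> T -> R) (Lam : K -> K -> R).
Hypotheses (mG : forall i, measurable_fun setT (G i)) (nG : jointly_normal Q G).
Hypothesis mean0 : forall i, expectation Q (G i) = 0%E.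
Hypothesis covG : forall i j, covariance Q (G i) (G j) = (Lam i j)%:E.
Local Notation TR := (measurableTypeR R).
Local Notation gam := (normal_prob (0 : R) 1).

(* max_i |x_i| <= a + sum_i x_i^(2k+2) / a^(2k+1) *)
Lemma gauss_maxnorm (B a : R) (k : nat) : 0 < a -> (forall i, Lam i i <= B) ->
  itg Q (fun w => maxnorm (G ^~ w)) /\
  Ex Q (fun w => maxnorm (G ^~ w)) <= a + #|K|%:R * (B ^+ k.+1 * Ex gam (fun u : TR => u ^+ (2 * k.+1))) / a ^+ (2 * k).+1.
Proof.
move=> a0 LB; have ev i := gauss_even mG nG mean0 covG i k.+1.
pose Y w := a + (\sum_i G i w ^+ (2 * k.+1)) / a ^+ (2 * k).+1.
have e0 (x : R) : 0 <= x ^+ (2 * k.+1) by rewrite exprM exprn_ge0// sqr_ge0.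
have L0 i : 0 <= Lam i i.
  by rewrite -(gauss_Ex2 mG nG mean0 covG); apply: Ex_ge0 => w; rewrite -expr2 sqr_ge0.
have le w : `|maxnorm (G ^~ w)| <= Y w.
  rewrite ger0_norm ?maxnorm_ge0//; apply: maxnorm_le => [|i].
    by rewrite addr_ge0 ?divr_ge0 ?exprn_ge0 ?sumr_ge0// ltW.
  have [ga|ag] := leP `|G i w| a; first by apply: le_trans ga _; rewrite lerDl divr_ge0 ?exprn_ge0 ?sumr_ge0// ltW.
  apply: le_trans (_ : _ <= G i w ^+ (2 * k.+1) / a ^+ (2 * k).+1) _; last first.
    apply: le_trans (_ : _ <= (\sum_i G i w ^+ (2 * k.+1)) / a ^+ (2 * k).+1) _; last by rewrite lerDr ltW.
    rewrite ler_pM2r ?invr_gt0 ?exprn_gt0//.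
    by rewrite (bigD1 i)//= lerDl sumr_ge0.
  rewrite ler_pdivlMr ?exprn_gt0//.
  have -> : G i w ^+ (2 * k.+1) = `|G i w| ^+ (2 * k.+1) by rewrite !exprM real_normK ?num_real.
  rewrite (_ : (2 * k.+1 = (2 * k).+2)%N); last by lia.
  rewrite [leRHS]exprS; apply: ler_wpM2l => //.
  by rewrite ler_pXn2r ?nnegrE// ltW.
have iY : itg Q Y.
  have -> : Y = fun w => a + (a ^+ (2 * k).+1)^-1 * \sum_i G i w ^+ (2 * k.+1).
    by apply/funext => w; rewrite /Y mulrC.
  by apply: itgD; [exact: itg_cst|apply: itgZ; apply: itg_sum => i _; exact: (ev i).1].
have iM := itg_le (measurable_maxnorm mG) iY le; split => //.
apply: le_trans (le_Ex iM iY (fun w => le_trans (ler_norm _) (le w))) _.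
have -> : Y = fun w => a + (a ^+ (2 * k).+1)^-1 * \sum_i G i w ^+ (2 * k.+1).
  by apply/funext => w; rewrite /Y mulrC.
have iS : itg Q (fun w => \sum_i G i w ^+ (2 * k.+1)) by apply: itg_sum => i _; exact: (ev i).1.
rewrite ExD; [|exact: itg_cst|exact: itgZ]; rewrite Ex_cst lerD2l ExZ// [leRHS]mulrC.
apply: ler_wpM2l; first by rewrite invr_ge0 exprn_ge0// ltW.
rewrite Ex_sum => [|i _]; last exact: (ev i).1.
rewrite mulr_natl -sumr_const; apply: ler_sum => i _; rewrite (ev i).2.
apply: ler_wpM2r; first exact: Ex_ge0.
by rewrite lerXn2r ?nnegrE// (le_trans (L0 i)).
Qed.

End GaussianMaximum.

(** * Normalized sums against a Gaussian vector *)

Section SumComparison.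
Context (R : realType) (K : finType) (mu : probability (prodR int R) R) (imu : indep_coord mu).
Local Notation E := (prodR int R).
Variables (alpha q My Cy : R) (y : K -> int -> E -> R) (n L T : nat).
Hypotheses (alpha0 : 0 <= alpha) (q4 : 4 < q) (K0 : (0 < #|K|)%N).
Hypotheses (hy : forall i, srt mu alpha q My Cy (y i)) (y0 : forall i t, Ex mu (y i t) = 0).
Hypotheses (T0 : (0 < T)%N) (nT : (n < T)%N).

Local Notation h := ((Num.sqrt (T%:R : R))^-1).
Local Notation rho0 := (Num.sqrt (rio_cst q)).

Definition normalized_sum i (u : E) : R := h * \sum_(j < n) y i (T%:Z - j%:Z) u.

Definition sum_bound : R := rho0 * Cy.
(** The added 1 pays for the slack [e] of [srt_sum_approx], chosen below to be [decay alpha L] after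
    normalization. *)
Definition approx_error : R := (sum_bound + 1) * decay alpha L.

Let q2 : 2 < q. Proof. by move: q4; lra. Qed.
Let q0 : 0 < q. Proof. by move: q4; lra. Qed.
Let q1 : 1 <= q. Proof. by move: q4; lra. Qed.
Let sT : 0 < Num.sqrt T%:R :> R. Proof. by rewrite sqrtr_gt0 ltr0n. Qed.
Let h0 : 0 < h. Proof. by rewrite invr_gt0. Qed.
Let My0 : 0 <= My /\ 0 <= Cy.
Proof. by move/card_gt0P: K0 => [i _]; exact: srt_ge0 (hy i). Qed.

Let hs : h * Num.sqrt (rio_cst q * n.+1%:R) <= rho0.
Proof.
rewrite mulrC ler_pdivrMr//.
have r0 : 0 <= rio_cst q by rewrite /rio_cst /mart_cst; move: q4 => ?; rewrite addr_ge0// !mulr_ge0 ?powR_ge0//; lra.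
rewrite -sqrtrM//; apply: ler_wsqrtr; apply: ler_wpM2l => //.
by rewrite ler_nat.
Qed.

Lemma mom_normalized_sum i : mom mu q (normalized_sum i) sum_bound.
Proof.
have := momZ h q0 (srt_sum_mom imu T%:Z n q2 (hy i) (y0 i)).
rewrite gtr0_norm// mulrA; apply: mom_le; apply: ler_wpM2r; [exact: My0.2|exact: hs].
Qed.

Let decL := decay_gt0 alpha L.

(** In S each summand is replaced by its window version. The envelope then has fourth moment norm of
    order T^(-1/2) |K|^(1 / q), a window meets at most 2 L + 1 windows, and changing one factor at a
    time moves the covariances by at most approx_error (2 sum_bound + approx_error). *)
Lemma sum_comparison d (Om : measurableType d) (Q : probability Om R) (G : K -> Om -> R) (Lam : K -> K -> R) :
  (forall i, measurable_fun setT (G i)) -> jointly_normal Q G ->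
  (forall i, expectation Q (G i) = 0%E) ->
  (forall i j, covariance Q (G i) (G j) = (Lam i j)%:E) ->
  (forall i j, Lam i j = Ex mu (fun u => normalized_sum i u * normalized_sum j u)) ->
  exists2 S : K -> E -> R, forall i, mom mu q (fun u => normalized_sum i u - S i u) approx_error &
  forall b x, 0 <= b ->
    `|Ex mu (fun u => lgs (fun i => b * (S i u - x))) - Ex Q (fun w => lgs (fun i => b * (G i w - x)))|
    <= 2 * (52 * (b ^+ 3 * (n%:R * ((2 * L + 1)%N%:R ^+ 2 * (h * (#|K|%:R `^ q^-1 * (My + My))) ^+ 3)))
      + 3 * (b ^+ 2 * (approx_error * (2 * sum_bound + approx_error)))).
Proof.
move=> mG nG mean0 covG LamE.
pose e := Num.sqrt T%:R * decay alpha L.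
have e0 : 0 < e by rewrite mulr_gt0.
have /choice[kk /choice[V hV]] := fun i => srt_sum_approx imu T%:Z L n q2 e0 (hy i) (y0 i).
pose k := h * maxnorm kk.
pose V' (t : 'I_n) i u := h * V i (T%:Z - t%:Z) u.
pose S i u := \sum_t V' t i u.
have dS i : mom mu q (fun u => normalized_sum i u - S i u) approx_error.
  have [_ _ _ _ h5] := hV i.
  have -> : (fun u => normalized_sum i u - S i u) =
      fun u => h * \sum_(j < n) (y i (T%:Z - j%:Z) u - V i (T%:Z - j%:Z) u).
    by apply/funext => u; rewrite /normalized_sum /S /V' -mulr_sumr -mulrBr sumrB.
  have := momZ h q0 h5; rewrite gtr0_norm//; apply: mom_le.
  rewrite mulrDr /e [h * (Num.sqrt T%:R * decay _ _)]mulrA mulVf ?gt_eqF// mul1r.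
  rewrite /approx_error [leRHS]mulrDl mul1r; apply: lerD => //.
  rewrite !mulrA; apply: ler_wpM2r; first exact: ltW.
  by apply: ler_wpM2r; [exact: My0.2|exact: hs].
exists S => // b x b0.
have hq : 1 <= q / 2 by move: q4; lra.
pose U (t : 'I_n) u := h * maxnorm (fun i => V i (T%:Z - t%:Z) u).
pose W (t : 'I_n) : pred int := fun a => (T%:Z - t%:Z + 1 - L%:Z <= a <= T%:Z - t%:Z)%R.
pose nr : rel 'I_n := fun t s => ((t < s + L) && (s < t + L))%N.
apply: (@gauss_approx R K mu d Om Q G Lam mG nG mean0 covG imu n V' W nr U k _ (2 * L + 1)%N) => //.
- by move=> t s a; exact: window_disjoint.
- move=> t i; have [h1 _ _ _ _] := hV i; have [mV bV] := h1 (T%:Z - t%:Z); split.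
    exact: measurable_funM.
  move=> u; rewrite /V' normrM gtr0_norm//; apply: ler_wpM2l; first exact: ltW.
  by apply: le_trans (bV u) _; apply: le_trans (ler_norm _) (maxnorm_ge _ i).
- move=> t i u v uv; have [_ h2 _ _ _] := hV i; congr (_ * _); exact: h2.
- move=> t i; have [h1 _ h3 _ _] := hV i.
  by rewrite /V' ExZ ?h3 ?mulr0//; exact: bmeas_itg (h1 _).
- move=> t i w; rewrite /V' normrM gtr0_norm//; apply: ler_wpM2l; first exact: ltW.
  exact: (maxnorm_ge (fun i => V i (T%:Z - t%:Z) w)).
- move=> t; apply: (@mom_expo _ _ _ _ q) => //; first exact: ltW.
  rewrite -[X in X * (_ `^ _ * _)](gtr0_norm h0); apply: momZ => //.
  apply: mom_maxnorm => // [|i]; first by rewrite addr_ge0// My0.1.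
  by have [_ _ _ h4 _] := hV i.
- by move=> t; exact: card_near.
- by rewrite !mulr_ge0 ?powR_ge0 ?addr_ge0 ?My0.1// ltW.
- by move=> t w; rewrite mulr_ge0 ?maxnorm_ge0// ltW.
- have a0 : 0 <= approx_error by rewrite /approx_error /sum_bound mulr_ge0 ?addr_ge0 ?mulr_ge0 ?sqrtr_ge0 ?My0.2// ltW.
  have sb0 : 0 <= sum_bound := mulr_ge0 (sqrtr_ge0 _) My0.2.
  by apply: mulr_ge0 => //; apply: addr_ge0 => //; apply: mulr_ge0.
- move=> i j; rewrite LamE.
  have hSn i' : mom mu q (S i') (sum_bound + approx_error).
    have -> : S i' = fun u => normalized_sum i' u - (normalized_sum i' u - S i' u).
      by apply/funext => u; rewrite subKr.
    exact: momB (mom_normalized_sum i') (dS i').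
  have q2' : 2 <= q by exact: ltW.
  have [i1 b1] := mom2_prod q2' (dS i) (mom_normalized_sum j).
  have [i2 b2] := mom2_prod q2' (hSn i) (dS j).
  have [i3 b3] := mom2_prod q2' (mom_normalized_sum i) (mom_normalized_sum j).
  have [i4 b4] := mom2_prod q2' (hSn i) (hSn j).
  rewrite -[X in _ - X]/(Ex mu (fun u => S i u * S j u)) -ExB//.
  have -> : (fun u => normalized_sum i u * normalized_sum j u - S i u * S j u) = fun u =>
     (normalized_sum i u - S i u) * normalized_sum j u + S i u * (normalized_sum j u - S j u).
    by apply/funext => u; ring.
  rewrite ExD//; apply: le_trans (ler_normD _ _) _.
  by apply: le_trans (lerD b1 b2) _; rewrite le_eqVlt; apply/orP; left; apply/eqP; ring.
Qed.

End SumComparison.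

Lemma sum_rev (R : realType) (p T : nat) (f : int -> R) : (p <= T)%N ->
  \sum_(s < T - p) f (p + s)%N%:Z = \sum_(j < T - p) f (T%:Z - 1 - j%:Z).
Proof.
move=> pT; rewrite (reindex_inj rev_ord_inj) /=; apply: eq_bigr => j _; congr f.
by have := ltn_ord j; lia.
Qed.

Lemma designE (R : realType) p d T (x : int -> 'cV[R]_d) (s : 'I_(T - p)) k :
  design p T x s k = lagged p x (p + s)%N%:Z k 0.
Proof. by rewrite [LHS]mxE [LHS]mxE. Qed.

Lemma response_design (R : realType) p d T (A : 'I_p -> 'M[R]_d) (x eps : int -> 'cV[R]_d) l :
  (forall t, eps t = innov A x t) ->
  response p T x l = design p T x *m col l (coef_mx A) + response p T eps l.
Proof.
move=> he; apply/matrixP => s j; rewrite [LHS]mxE [RHS]mxE [X in _ + X]mxE he innovE.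
have -> : (p + s).+1%:Z - 1 = (p + s)%N%:Z by lia.
rewrite [X in X + _](_ : _ = \sum_k coef_mx A k l * lagged p x (p + s)%N%:Z k 0); first by rewrite addrC subrK.
by rewrite mxE; apply: eq_bigr => k _; rewrite designE [col _ _ _ _]mxE mulrC.
Qed.

Lemma scaled_sum_mom (R : realType) (mu : probability (prodR int R) R) (imu : indep_coord mu)
    alpha q M C y (T0 : int) (n T : nat) :
  2 < q -> (n < T)%N -> srt mu alpha q M C y -> (forall t, Ex mu (y t) = 0) ->
  mom mu q (fun u => T%:R^-1 * \sum_(j < n) y (T0 - j%:Z) u) ((Num.sqrt T%:R)^-1 * (Num.sqrt (rio_cst q) * C)).
Proof.
move=> q2 nT hy y0; have [_ C0] := srt_ge0 hy.
have Tp : 0 < T%:R :> R by rewrite ltr0n; apply: leq_ltn_trans nT.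
have q0 : 0 < q by apply: lt_trans q2.
have r0 : 0 <= rio_cst q by rewrite /rio_cst /mart_cst addr_ge0// !mulr_ge0 ?powR_ge0//; lra.
have := momZ T%:R^-1 q0 (srt_sum_mom imu T0 n q2 hy y0).
rewrite gtr0_norm ?invr_gt0//; apply: mom_le; rewrite !mulrA; apply: ler_wpM2r => //.
have sT : 0 < Num.sqrt T%:R :> R by rewrite sqrtr_gt0.
have {1}<- := sqr_sqrtr (ltW Tp).
rewrite -(ler_pM2l sT) expr2 invfM !mulrA divff ?gt_eqF// mul1r.
rewrite mulrC ler_pdivrMr// mul1r -sqrtrM//; apply: ler_wsqrtr; apply: ler_wpM2l => //.
by rewrite ler_nat.
Qed.

(** * Deviations of the Gram matrix and of the score *)

Section ModelSums.
Context (R : realType) (mu : probability (prodR int R) R) (imu : indep_coord mu) (p d : nat).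
Local Notation E := (prodR int R).
Variables (alpha m M C c : R) (s T : nat) (X : int -> 'I_d -> E -> R).
Variables (A : 'I_p -> 'M[R]_d) (Sig : 'M[R]_d).
Local Notation S := (coef_mx A).
Local Notation zs := (@state R p d X).
Local Notation et := (@innovation R p d X A).
Local Notation cov := (state_cov mu p X).
Local Notation W u := (design p T (path_of X u)).
Local Notation eta u l := (response p T (innov A (path_of X u)) l).

Hypotheses (alpha0 : 0 <= alpha) (m8 : 8 < m) (c0 : 0 < c).
Hypothesis hX : forall i, srt mu alpha m M C (fun t => X t i).
Hypothesis eig : forall z : R[i], eigenvalue (map_mx (real_complex R) (companion_tr S)) z -> `|z| < 1.
Hypothesis wn0 : forall t s l l', t != s -> Ex mu (fun u => et t l u * et s l' u) = 0.
Hypothesis wn1 : forall t l l', Ex mu (fun u => et t l u * et t l' u) = Sig l l'.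
Hypothesis coerc : forall v : 'I_(p * d) -> R, c * (\sum_k v k ^+ 2) <= qform cov v.
Hypothesis sS : forall l, (#|supp S l| <= s)%N.
Hypotheses (p0 : (0 < p)%N) (pT : (p <= T)%N) (d0 : (0 < d)%N).
Let nT : (T - p < T)%N. Proof. by rewrite ltn_subrL p0 (leq_trans p0). Qed.
Let q2 : 2 < m / 2. Proof. by move: m8; lra. Qed.
Let q1 : 1 <= m / 2. Proof. by move: m8; lra. Qed.
Let q0 : 0 < m / 2. Proof. by move: m8; lra. Qed.
Let T0 : 0 < T%:R :> R. Proof. by rewrite ltr0n (leq_trans p0). Qed.
Let ci : 0 <= c^-1. Proof. by rewrite invr_ge0 ltW. Qed.

Local Notation Cz := (C * lag_cst p alpha).
Local Notation Me := (innov_mom M c s).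
Local Notation Ce := (innov_tail p alpha M C c s).

Lemma gramE u k k' : ((W u)^T *m W u) k k' = \sum_(j < T - p) zs (T%:Z - 1 - j%:Z) k u * zs (T%:Z - 1 - j%:Z) k' u.
Proof.
rewrite -(sum_rev (fun t => zs t k u * zs t k' u) pT) mxE.
by apply: eq_bigr => i _; rewrite [_^T _ _]mxE !designE.
Qed.

Lemma scoreE u k l : ((W u)^T *m eta u l) k 0 = \sum_(j < T - p) zs (T%:Z - j%:Z - 1) k u * et (T%:Z - j%:Z) l u.
Proof.
have -> : \sum_(j < T - p) zs (T%:Z - j%:Z - 1) k u * et (T%:Z - j%:Z) l u =
   \sum_(j < T - p) (fun t => zs t k u * et (t + 1) l u) (T%:Z - 1 - j%:Z).
  by apply: eq_bigr => j _ /=; rewrite [T%:Z - 1 - j%:Z]addrAC subrK.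
rewrite -(sum_rev (fun t => zs t k u * et (t + 1) l u) pT) mxE.
apply: eq_bigr => i _; rewrite [_^T _ _]mxE designE [response _ _ _ _ _ _]mxE /innovation.
by have -> : (p + i).+1%:Z = (p + i)%N%:Z + 1 by rewrite -addn1 PoszD.
Qed.

(** The second summand accounts for the centring: T - p terms are divided by T, which shifts the
    mean by p / T times the covariance. *)
Definition gram_cst : R := Num.sqrt (rio_cst (m / 2)) * (M * Cz + M * Cz) + p%:R * (M * M).
Definition score_cst : R := Num.sqrt (rio_cst (m / 2)) * (M * Ce + Me * Cz).

Lemma cov_le k k' : `|cov k k'| <= M * M.
Proof.
have m2 : 2 <= m by apply: ltW; apply: lt_trans m8; rewrite (ltr_nat R 2 8).
have h (k : 'I_(p * d)) := srt_mom 0 (srt_state0 alpha0 m8 c0 hX k).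
by rewrite mxE; exact: (mom2_prod m2 (h k) (h k')).2.
Qed.

Lemma mom_gram k k' : mom mu (m / 2) (fun u => (T%:R^-1 *: ((W u)^T *m W u)) k k' - cov k k')
  ((Num.sqrt T%:R)^-1 * gram_cst).
Proof.
have [h1 h2] := srt_state_state imu alpha0 m8 c0 hX eig wn0 wn1 k k'.
have h := scaled_sum_mom imu (T%:Z - 1) q2 nT h1 h2.
have -> : (fun u => (T%:R^-1 *: ((W u)^T *m W u)) k k' - cov k k') = fun u =>
   T%:R^-1 * (\sum_(j < T - p) (zs (T%:Z - 1 - j%:Z) k u * zs (T%:Z - 1 - j%:Z) k' u - cov k k')) +
     (- (p%:R / T%:R) * cov k k').
  apply/funext => u; rewrite mxE gramE sumrB mulrBr sumr_const card_ord -[cov k k' *+ _]mulr_natl natrB//.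
  by field; rewrite gt_eqF.
have hc := mom_cst mu (- (p%:R / T%:R) * cov k k') q0.
apply: mom_le (momD q1 h hc); rewrite /gram_cst [leRHS]mulrDr; apply: lerD => //.
have -> : `|- (p%:R / T%:R) * cov k k'| = p%:R * `|cov k k'| * T%:R^-1.
  rewrite normrM normrN [`|p%:R / T%:R|]ger0_norm; first by ring.
  by rewrite divr_ge0.
rewrite [leRHS]mulrC.
have sT : 1 <= Num.sqrt T%:R :> R by have := @ler_wsqrtr R 1 T%:R; rewrite sqrtr1; apply; rewrite ler1n (leq_trans p0).
have sT0 : 0 < Num.sqrt T%:R :> R by apply: lt_le_trans sT.
apply: ler_pM; [by rewrite mulr_ge0|by rewrite invr_ge0 ler0n| |].
  by apply: ler_wpM2l => //; exact: cov_le.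
rewrite lef_pV2 ?posrE// -[leRHS](sqr_sqrtr (ltW T0)) expr2.
by rewrite ler_peMr// ltW.
Qed.

Lemma mom_score k l : mom mu (m / 2) (fun u => (T%:R^-1 *: ((W u)^T *m eta u l)) k 0)
  ((Num.sqrt T%:R)^-1 * score_cst).
Proof.
have [h1 h2] := srt_state_innovation imu alpha0 m8 c0 hX eig wn0 wn1 coerc sS k l.
have h := scaled_sum_mom imu T%:Z q2 nT h1 h2.
have -> // : (fun u => (T%:R^-1 *: ((W u)^T *m eta u l)) k 0) = fun u =>
   T%:R^-1 * (\sum_(j < T - p) (zs (T%:Z - j%:Z - 1) k u * et (T%:Z - j%:Z) l u)).
by apply/funext => u; rewrite mxE scoreE.
Qed.

Local Notation F l := (partial_inv (supp S l) cov).

Definition influence (jl : 'I_(p * d) * 'I_d) t u : R :=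
  \sum_k F jl.2 jl.1 k * (zs (t - 1) k u * et t jl.2 u).

Definition influence_mom : R := s%:R * (c^-1 * (M * Me)).
Definition influence_tail : R := s%:R * (c^-1 * (M * Ce + Me * Cz)).

Lemma srt_influence jl : srt mu alpha (m / 2) influence_mom influence_tail (influence jl) /\
  forall t, Ex mu (influence jl t) = 0.
Proof.
have hse k := srt_state_innovation imu alpha0 m8 c0 hX eig wn0 wn1 coerc sS k jl.2.
have [g1 g2] := srt_ge0 (hse (mxvec_index (Ordinal p0) (Ordinal d0))).1.
have Fk k : `|F jl.2 jl.1 k| <= c^-1 by apply: (partial_inv_bound c0) => v _; exact: coerc.
have iE : influence jl = fun t u => \sum_(k <- enum (supp S jl.2)) F jl.2 jl.1 k * (zs (t - 1) k u * et t jl.2 u).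
  apply/funext => t; apply/funext => u; rewrite /influence big_enum [RHS]big_mkcond.
  by apply: eq_bigr => k _; case: ifPn => // kS; rewrite partial_inv_offr// mul0r.
split => [|t].
  rewrite iE.
  have hk k : srt mu alpha (m / 2) (c^-1 * (M * Me)) (c^-1 * (M * Ce + Me * Cz))
      (fun t u => F jl.2 jl.1 k * (zs (t - 1) k u * et t jl.2 u)).
    by apply: srt_le (srtZ (F jl.2 jl.1 k) q0 (hse k).1); apply: ler_wpM2r.
  have ss : (size (enum (supp S jl.2)))%:R <= s%:R :> R by rewrite ler_nat -cardE.
  by apply: srt_le (srt_sum (enum (supp S jl.2)) q1 (mulr_ge0 ci g1) (mulr_ge0 ci g2) hk);
    apply: ler_wpM2r => //; exact: mulr_ge0.
have iz k : itg mu (fun u => zs (t - 1) k u * et t jl.2 u) := (mom_itg q1 (srt_mom t (hse k).1)).1.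
rewrite Ex_sum => [|k _]; last exact: itgZ.
by rewrite big1// => k _; rewrite ExZ// (hse k).2 mulr0.
Qed.

Lemma influence_sum jl u : (Num.sqrt T%:R)^-1 * \sum_(j < T - p) influence jl (T%:Z - j%:Z) u =
  Num.sqrt T%:R * \sum_k F jl.2 jl.1 k * (T%:R^-1 *: ((W u)^T *m eta u jl.2)) k 0.
Proof.
have sT : 0 < Num.sqrt T%:R :> R by rewrite sqrtr_gt0.
rewrite exchange_big !mulr_sumr; apply: eq_bigr => k _ /=.
have -> : (T%:R^-1 *: ((W u)^T *m eta u jl.2)) k 0 = T%:R^-1 * ((W u)^T *m eta u jl.2) k 0 by rewrite mxE.
rewrite scoreE -mulr_sumr.
have -> : T%:R^-1 = (Num.sqrt T%:R)^-1 * (Num.sqrt T%:R)^-1 :> R by rewrite -invfM -expr2 sqr_sqrtr// ltW.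
move: (\sum_(_ < _) _) (F _ _ _) => a b.
by field; rewrite gt_eqF.
Qed.

End ModelSums.

Lemma scalemxE (R : realType) m n (a : R) (M : 'M[R]_(m, n)) i j : (a *: M) i j = a * M i j.
Proof. by rewrite mxE. Qed.

Lemma mom_ae d (T : measurableType d) (R : realType) (P : probability T R) q (X Y : T -> R) c :
  0 < q -> mom P q X c -> measurable_fun setT Y -> {ae P, forall w, X w = Y w} -> mom P q Y c.
Proof.
move=> q0 hX mY XY; have [i1 e1] := mom_itg_pow q0 hX.
have XY' : {ae P, forall w, `|X w| `^ q = `|Y w| `^ q} by apply: filterS XY => w ->.
have mX' := measurable_norm_powR q (mom_meas hX); have mY' := measurable_norm_powR q mY.
apply: (mom_Ex q0 mY (mom_ge0 hX)); first exact: itg_ae i1 mY' XY'.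
by rewrite -(Ex_ae mX' mY' XY').
Qed.

Lemma ae_int d (T : measurableType d) (R : realType) (P : probability T R) (Q : int -> T -> Prop) :
  (forall t, {ae P, forall w, Q t w}) -> {ae P, forall w, forall t, Q t w}.
Proof.
move=> h; have h1 := ae_foralln (fun n : nat => h n%:Z).
have h2 := ae_foralln (fun n : nat => h (- n%:Z)).
apply: filterS2 h1 h2 => w a1 a2 t; case: (intP t) => [|n|n]; [exact: (a1 0%N)|exact: (a1 n.+1)|exact: (a2 n.+1)].
Qed.

(** * Transfer from the given probability space *)

Section Canonical.
Context (R : realType) dsp (Om : measurableType dsp) (P : probability Om R) (e : int -> {RV P >-> R}).
Hypothesis ind : mutually_independent e.
Context (p d T : nat).
Local Notation E := (prodR int R).
Local Notation mu := (seq_law e).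
Local Notation phi := (seq_map e).
Variables (m alpha M C : R) (A : 'I_p -> 'M[R]_d) (Sig : 'M[R]_d).
Variables (x eps : int -> Om -> 'cV[R]_d) (g : int -> 'I_d -> (nat -> R) -> R).
Local Notation S := (coef_mx A).
Hypotheses (m8 : 8 < m) (alpha0 : 0 <= alpha) (d0 : (0 < d)%N).
Hypotheses (x_meas : forall t, measurable_mx (x t)) (eps_meas : forall t, measurable_mx (eps t)).
Hypotheses (x_VAR : is_VAR P A x eps) (eps_wn : white_noise P eps Sig).
Hypothesis mg : forall t i, measurable_seq_fun (g t i).
Hypothesis xg : forall t, {ae P, forall w, forall i, x t w i 0 = g t i (past (fun s => e s w) t)}.
Hypothesis hmom : forall t i, (Lnorm P m%:E (fun w => (x t w i 0)%:E) <= M%:E)%E.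
Hypothesis hdep : forall k : nat, (\sum_(k <= j <oo) dep_coef P m e g j <= (C * decay alpha k)%:E)%E.

Let m0 : 0 < m. Proof. exact: lt_trans m8. Qed.
Let m2 : 2 <= m. Proof. by apply: ltW; apply: lt_trans m8; rewrite (ltr_nat R 2 8). Qed.

Definition canonical (t : int) (i : 'I_d) (u : E) : R := g t i (past u t).
Local Notation X := canonical.

Lemma measurable_canonical t i : measurable_fun setT (X t i).
Proof.
have mp : measurable_fun setT (fun u : E => past u t : prodR nat R).
  by apply: measurable_to_prodR => k; exact: measurable_coord.
exact: (measurableT_comp (mg t i : @measurable_fun _ _ (prodR nat R) R setT (g t i)) mp).
Qed.

Lemma path_canonical : {ae P, forall w, forall t, x t w = path_of X (phi w) t}.
Proof.
apply: ae_int => t; apply: filterS (xg t) => w h.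
by apply/colP => i; rewrite [RHS]mxE h.
Qed.

Lemma innov_canonical : {ae P, forall w, forall t, eps t w = innov A (x ^~ w) t}.
Proof.
apply: ae_int => t; apply: filterS (x_VAR t) => w h.
by rewrite /innov {1}h addrC addKr.
Qed.

Let dcf j := dep_coef P m e g j.
Let i0 : 'I_d := Ordinal d0.

Let dep_ge t i j : (Lnorm (P \x P)%E m%:E (fun ww : Om * Om =>
      (g t i (past (fun t => e t ww.1) t) - g t i (past_subst (fun t => e t ww.1) (fun t => e t ww.2) t j))%:E) <= dcf j)%E.
Proof. by apply: ereal_sup_ubound; exists (t, i). Qed.

Let dep0 j : (0 <= dcf j)%E.
Proof. by apply: le_trans (dep_ge 0 i0 j); exact: Lnorm_ge0. Qed.

Let dep_sum k N : (\sum_(k <= j < k + N) dcf j <= (C * decay alpha k)%:E)%E.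
Proof.
apply: le_trans (hdep k); apply: (@nneseries_lim_ge _ _ xpredT k (k + N)) => n _ _; exact: dep0.
Qed.

Let dep_fin j : dcf j \is a fin_num.
Proof.
rewrite ge0_fin_numE//; apply: le_lt_trans (ltry (C * decay alpha j)).
by have := dep_sum j 1; rewrite addn1 big_nat1.
Qed.

(** The bound on the tails makes each coefficient finite, so [fine] loses nothing, and [past_subst]
    with an independent copy becomes [resample] with a second sequence. *)
Lemma canonical_srt i : srt mu alpha m M C (fun t => X t i).
Proof.
exists (fun j => fine (dcf j)); last first.
  move=> k N; rewrite -lee_fin; apply: le_trans (dep_sum k N).
  have -> : (\sum_(k <= j < k + N) dcf j = \sum_(0 + k <= j < N + k) dcf j)%E by rewrite add0n addnC.
  rewrite big_addn addnK big_mkord -sumEFin.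
  by apply: lee_sum => j _; rewrite fineK// addnC.
have M0 : 0 <= M by rewrite -lee_fin; apply: le_trans (hmom 0 i0); exact: Lnorm_ge0.
split => [t|t u v uv|t j].
- apply/(law_mom e m0 (measurable_canonical t i) M0).
  apply: (@mom_ae _ _ _ _ _ (fun w => x t w i 0)) => //.
  + by split; [exact: x_meas|exact: hmom].
  + exact: (measurableT_comp (measurable_canonical t i) (measurable_seq_map e)).
  + by apply: filterS (xg t) => w; exact.
- congr (g t i); apply/funext => k; apply: uv; rewrite /le_coord; lia.
- have mH : measurable_fun setT (fun z : E * E => X t i z.1 - X t i (resample t j z)).
    apply: measurable_funB; first exact: (measurableT_comp (measurable_canonical t i) measurable_fst).
    exact: (measurableT_comp (measurable_canonical t i) (measurable_resample t j)).
  apply: (law_mom2 (H := fun z : E * E => X t i z.1 - X t i (resample t j z)) m0 mH); first by rewrite fine_ge0.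
  split.
    apply: (measurableT_comp mH); apply/measurable_fun_pairP; split => /=.
      exact: (measurableT_comp (measurable_seq_map e) measurable_fst).
    exact: (measurableT_comp (measurable_seq_map e) measurable_snd).
  rewrite fineK//; apply: le_trans (dep_ge t i j); rewrite le_eqVlt; apply/orP; left; apply/eqP.
  congr (Lnorm _ _ _); apply/funext => -[w1 w2] /=; congr (_%:E); congr (_ - _).
  congr (g t i); apply/funext => k; rewrite /past /past_subst /resample /set_coord /=.
  by rewrite (inj_eq (addrI t)) eqr_opp eqz_nat; case: eqP => // ->.
Qed.

Local Notation et := (@innovation R p d X A).
Local Notation zs := (@state R p d X).

Let E_fin (f : Om -> R) : itg P f -> expectation P f = (Ex P f)%:E.
Proof. by move=> hf; rewrite unlock ExE. Qed.

Lemma law_Ex_ae (h : E -> R) (f : Om -> R) : itg mu h -> measurable_fun setT f ->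
  {ae P, forall w, f w = h (phi w)} -> itg P f /\ Ex P f = Ex mu h.
Proof.
move=> ih mf fh; have mh := itg_meas ih.
have iP := law_itg mh ih; have mhp := measurableT_comp mh (measurable_seq_map e).
have hf : {ae P, forall w, h (phi w) = f w} by apply: filterS fh => w ->.
split; first exact: itg_ae iP mf hf.
by rewrite (Ex_ae mf mhp fh) (law_Ex mh iP).2.
Qed.

Let eps_et : {ae P, forall w, forall t l, eps t w l 0 = et t l (phi w)}.
Proof.
apply: filterS2 path_canonical innov_canonical => w h1 h2 t l.
by rewrite h2 /innovation; congr (innov A _ t l 0); apply/funext => s; rewrite h1.
Qed.

Let z_zs : {ae P, forall w, forall t k, lagged p (x ^~ w) t k 0 = zs t k (phi w)}.
Proof.
apply: filterS path_canonical => w h1 t k.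
by rewrite /state; congr (lagged p _ t k 0); apply/funext => s; rewrite h1.
Qed.

Let et_prod t s l l' : itg mu (fun u => et t l u * et s l' u) /\
  expectation P (fun w => eps t w l 0 * eps s w l' 0) = (Ex mu (fun u => et t l u * et s l' u))%:E.
Proof.
have [b hb] := innovation_mom A alpha0 m8 (ltr01 : 0 < (1 : R)) canonical_srt.
have [i1 _] := mom2_prod m2 (hb t l) (hb s l'); split => //.
have [] := law_Ex_ae (f := fun w => eps t w l 0 * eps s w l' 0) i1.
- by apply: measurable_funM; exact: eps_meas.
- by apply: filterS eps_et => w h; rewrite !h.
by move=> i2 e2; rewrite E_fin// e2.
Qed.

Lemma canonical_wn0 t s l l' : t != s -> Ex mu (fun u => et t l u * et s l' u) = 0.
Proof. by move=> ts; have [_ _ h] := eps_wn; have := (et_prod t s l l').2; rewrite h// => -[]. Qed.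

Lemma canonical_wn1 t l l' : Ex mu (fun u => et t l u * et t l' u) = Sig l l'.
Proof. by have [_ h _] := eps_wn; have := (et_prod t t l l').2; rewrite h// => -[]. Qed.

Variable c : R.
Hypotheses (c0 : 0 < c)
  (eig : forall z : R[i], eigenvalue (map_mx (real_complex R) (companion_tr S)) z -> `|z| < 1)
  (Sigma0_eig : forall a, eigenvalue (Sigma0 P p x) a -> c < a).

Local Notation cov := (state_cov mu p X).

Lemma measurable_lagged t k : measurable_fun setT (fun w => lagged p (x ^~ w) t k 0).
Proof.
case/mxvec_indexP: k => j i.
have -> : (fun w => lagged p (x ^~ w) t (mxvec_index j i) 0) = fun w => x (t - j%:Z) w i 0.
  by apply/funext => w; rewrite laggedE.
exact: x_meas.
Qed.

(** [Sigma0] is taken at time p and [state_cov] at time 0; covariance stationarity identifies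
    them. *)
Lemma Sigma0_canonical : Sigma0 P p x = cov.
Proof.
apply/matrixP => k k'; rewrite [LHS]mxE.
have imu := indep_coord_seq_law ind.
rewrite -(state_covE alpha0 m8 c0 canonical_srt eig canonical_wn0 canonical_wn1 p%:Z).
have hz k := srt_mom p%:Z (srt_state0 alpha0 m8 c0 canonical_srt (k : 'I_(p * d))).
have [i1 _] := mom2_prod m2 (hz k) (hz k').
have -> : (fun w => (lagged p (x^~ w) p *m (lagged p (x^~ w) p)^T) k k') =
    fun w => lagged p (x ^~ w) p k 0 * lagged p (x ^~ w) p k' 0.
  by apply/funext => w; rewrite [LHS]mxE big_ord1; congr (_ * _); rewrite [LHS]mxE.
have [] := law_Ex_ae (f := fun w => lagged p (x ^~ w) p k 0 * lagged p (x ^~ w) p k' 0) i1.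
- by apply: measurable_funM; exact: measurable_lagged.
- by apply: filterS z_zs => w h; rewrite !h.
by move=> i2 e2; rewrite E_fin// e2.
Qed.

Lemma canonical_coercive v : c * (\sum_k v k ^+ 2) <= qform cov v.
Proof.
apply: symmetric_eig_min; last by rewrite -Sigma0_canonical.
by apply/matrixP => k k'; rewrite !mxE; congr Ex; apply/funext => u; rewrite mulrC.
Qed.

Hypotheses (p0 : (0 < p)%N) (pT : (p <= T)%N).
Variable s : nat.
Hypothesis sS : forall l, (#|supp S l| <= s)%N.

(** Both sides are the same bilinear expression in the scores, the entries of W^T eta; the partial
    inverse on the right is turned around by its symmetry. *)
Lemma Lambda_canonical l1 l2 j1 j2 : Lambda P T x eps S l1 l2 j1 j2 =
  Ex mu (fun u => ((Num.sqrt T%:R)^-1 * \sum_(j < T - p) influence mu X A (j1, l1) (T%:Z - j%:Z) u) *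
    ((Num.sqrt T%:R)^-1 * \sum_(j < T - p) influence mu X A (j2, l2) (T%:Z - j%:Z) u)).
Proof.
have T0 : 0 < T%:R :> R by rewrite ltr0n (leq_trans p0).
have imu := indep_coord_seq_law ind.
pose sc k l u := ((design p T (path_of X u))^T *m response p T (innov A (path_of X u)) l) k 0.
have hsc k l : mom mu (m / 2) (sc k l) (T%:R * ((Num.sqrt T%:R)^-1 * score_cst p alpha m M C c s)).
  have h := mom_score imu alpha0 m8 c0 canonical_srt eig canonical_wn0 canonical_wn1 canonical_coercive sS p0 pT k l.
  have q0 : 0 < m / 2 by rewrite divr_gt0.
  have := momZ T%:R q0 h; rewrite gtr0_norm//.
  have -> // : (fun w => T%:R * (T%:R^-1 *: ((design p T (path_of X w))^T *m response p T (innov A (path_of X w)) l)) k 0) = sc k l.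
  by apply/funext => u; rewrite scalemxE mulVKf// gt_eqF.
have q2 : 2 <= m / 2 by rewrite ler_pdivlMr//; apply: ltW; apply: le_lt_trans m8; rewrite -natrM ler_nat.
have iss k l k' l' := (mom2_prod q2 (hsc k l) (hsc k' l')).1.
pose F l := partial_inv (supp S l) cov.
have nsE jl u : (Num.sqrt T%:R)^-1 * (\sum_(j < T - p) influence mu X A jl (T%:Z - j%:Z) u) =
    (Num.sqrt T%:R)^-1 * \sum_k F jl.2 jl.1 k * sc k jl.2 u.
  rewrite influence_sum// [LHS]mulr_sumr [RHS]mulr_sumr; apply: eq_bigr => k _.
  rewrite scalemxE -/(sc k jl.2 u).
  have sT : 0 < Num.sqrt T%:R :> R by rewrite sqrtr_gt0.
  have -> : T%:R^-1 = (Num.sqrt T%:R)^-1 * (Num.sqrt T%:R)^-1 :> R by rewrite -invfM -expr2 sqr_sqrtr// ltW.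
  by rewrite /F; field; rewrite gt_eqF.
have -> : (fun u => ((Num.sqrt T%:R)^-1 * \sum_(j < T - p) influence mu X A (j1, l1) (T%:Z - j%:Z) u) *
    ((Num.sqrt T%:R)^-1 * \sum_(j < T - p) influence mu X A (j2, l2) (T%:Z - j%:Z) u)) = fun u =>
   \sum_k \sum_k' (T%:R^-1 * F l1 j1 k * F l2 j2 k') * (sc k l1 u * sc k' l2 u).
  apply/funext => u; rewrite !nsE /= mulrACA -invfM -expr2 sqr_sqrtr ?(ltW T0)//.
  rewrite mulr_suml mulr_sumr; apply: eq_bigr => k _; rewrite !mulr_sumr; apply: eq_bigr => k' _; ring.
rewrite Ex_sum => [|k _]; last by apply: itg_sum => k' _; exact: itgZ.
rewrite [LHS]mxE.
under eq_bigr => k' _ do rewrite [X in X * _]mxE mulr_suml.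
rewrite exchange_big; apply: eq_bigr => k _ /=.
rewrite Ex_sum => [|k' _]; last exact: itgZ.
apply: eq_bigr => k' _; rewrite ExZ// Sigma0_canonical -/(F l1) -/(F l2).
have -> : F l2 k' j2 = F l2 j2 k'.
  have covT : cov^T = cov by apply/matrixP => a b; rewrite !mxE; congr Ex; apply/funext => u; rewrite mulrC.
  by rewrite /F -{1}covT partial_inv_tr mxE.
rewrite scalemxE [mean_mx _ _ k k']mxE.
set f := (X in expectation P X).
have fE : f = fun w => ((design p T (x ^~ w))^T *m response p T (eps ^~ w) l1) k 0 *
     ((design p T (x ^~ w))^T *m response p T (eps ^~ w) l2) k' 0.
  apply/funext => w; rewrite /f /= -mulmxA -[X in _ *m X]trmxK trmx_mul trmxK mxE big_ord1.
  by congr (_ * _); rewrite [_^T _ _]mxE.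
have [] := law_Ex_ae (f := f) (iss k l1 k' l2).
- rewrite fE; apply: measurable_funM.
    apply: measurable_mulmx; last by apply: (measurable_response (x := fun w t => eps t w)).
    by apply: measurable_trmx; apply: (measurable_design (x := fun w t => x t w)).
  apply: measurable_mulmx; last by apply: (measurable_response (x := fun w t => eps t w)).
  by apply: measurable_trmx; apply: (measurable_design (x := fun w t => x t w)).
- apply: filterS2 path_canonical innov_canonical => w h1 h2; rewrite fE /sc.
  have -> : x ^~ w = path_of X (phi w) by apply/funext => t; rewrite h1.
  have -> // : eps ^~ w = innov A (path_of X (phi w)).
  by apply/funext => t; rewrite h2; congr (innov A _ t); apply/funext => t'; rewrite h1.
by move=> i2 e2; rewrite E_fin// e2 /=; ring.
Qed.

End Canonical.

(** * Bound at a fixed sample size *)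

Lemma fine_probU d (T : measurableType d) (R : realType) (P : probability T R) (A B : set T) :
  measurable A -> measurable B -> fine (P (A `|` B)) <= fine (P A) + fine (P B).
Proof.
move=> mA mB; rewrite -fineD ?fin_num_measure//; apply: fine_le; rewrite ?fin_num_measure//.
- exact: measurableU.
- by rewrite fin_numD !fin_num_measure.
- exact: measureU2.
Qed.

Lemma maxnorm_markov d (T : measurableType d) (R : realType) (P : probability T R) (K : finType)
    (V : K -> T -> R) q c (r : R) : 0 < q -> 0 < r -> 0 <= c -> (forall i, mom P q (V i) c) ->
  fine (P [set w | r <= maxnorm (V ^~ w)]) <= #|K|%:R * (c / r) `^ q.
Proof.
move=> q0 r0 c0 hV; have := mom_markov q0 r0 (mom_maxnorm q0 c0 hV).
have -> : [set w | r <= `|maxnorm (V ^~ w)|] = [set w | r <= maxnorm (V ^~ w)].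
  by apply/seteqP; split => w /=; rewrite ger0_norm ?maxnorm_ge0.
have cr : 0 <= c / r := divr_ge0 c0 (ltW r0).
move=> /le_trans; apply; rewrite -mulrA powRM ?powR_ge0//.
by rewrite -powRrM mulVf ?gt_eqF// powRr1.
Qed.

Lemma covariance_centered d (T : measurableType d) (R : realType) (Q : probability T R) (X Y : T -> R) :
  expectation Q X = 0%E -> expectation Q Y = 0%E -> itg Q (fun w => X w * Y w) ->
  covariance Q X Y = (Ex Q (fun w => X w * Y w))%:E.
Proof.
move=> X0 Y0 iXY; rewrite unlock X0 Y0 /= unlock -ExE//.
by apply: eq_integral => w _ /=; rewrite !fctE /= !subr0.
Qed.

Section SignedFamily.
Context d (T : measurableType d) (R : realType) (Q : probability T R) (I K : finType).
Variables (G : I -> T -> R) (Lam : I -> I -> R) (f : K -> I) (a : K -> R).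
Hypotheses (mG : forall i, measurable_fun setT (G i)) (nG : jointly_normal Q G).
Hypothesis mean0 : forall i, expectation Q (G i) = 0%E.
Hypothesis covG : forall i j, covariance Q (G i) (G j) = (Lam i j)%:E.
Local Notation H := (fun k w => a k * G (f k) w).

Lemma jointly_normal_scaled : jointly_normal Q H.
Proof.
move=> b; have [m [s h]] := nG (fun i => \sum_(k | f k == i) b k * a k).
exists m, s => B mB; rewrite -(h B mB); congr (Q _); apply/seteqP; split => w /=;
  rewrite (_ : \sum_i (\sum_(k | f k == i) b k * a k) * G i w = \sum_k b k * (a k * G (f k) w))//.
all: rewrite [RHS](partition_big f xpredT)//=; apply: eq_bigr => i _; rewrite mulr_suml.
all: by apply: eq_bigr => k /eqP <-; rewrite mulrA.
Qed.

Lemma scaled_mean0 k : expectation Q (H k) = 0%E.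
Proof.
rewrite unlock ExE; last by apply: itgZ; exact: (gauss_itg mG nG).
by rewrite ExZ ?(gauss_Ex0 mG nG mean0) ?mulr0//; exact: (gauss_itg mG nG).
Qed.

Lemma scaled_cov k k' : covariance Q (H k) (H k') = (a k * a k' * Lam (f k) (f k'))%:E.
Proof.
have e : (fun w => a k * G (f k) w * (a k' * G (f k') w)) = fun w => (a k * a k') * (G (f k) w * G (f k') w).
  by apply/funext => w; rewrite mulrACA.
have iG := gauss_itgM mG nG (f k) (f k').
rewrite covariance_centered ?scaled_mean0// e; last exact: itgZ.
by rewrite ExZ// (gauss_Ex2 mG nG mean0 covG).
Qed.

End SignedFamily.

Section FixedSample.
Context (R : realType) dsp (Om : measurableType dsp) (P : probability Om R) (e : int -> {RV P >-> R}).
Hypothesis ind : mutually_independent e.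
Context (p d T : nat).
Local Notation E := (prodR int R).
Local Notation mu := (seq_law e).
Local Notation phi := (seq_map e).
Variables (m alpha M C : R) (A : 'I_p -> 'M[R]_d) (Sig : 'M[R]_d).
Variables (x eps : int -> Om -> 'cV[R]_d) (g : int -> 'I_d -> (nat -> R) -> R).
Local Notation S := (coef_mx A).
Hypotheses (m8 : 8 < m) (alpha0 : 0 <= alpha) (d0 : (0 < d)%N).
Hypotheses (x_meas : forall t, measurable_mx (x t)) (eps_meas : forall t, measurable_mx (eps t)).
Hypotheses (x_VAR : is_VAR P A x eps) (eps_wn : white_noise P eps Sig).
Hypothesis mg : forall t i, measurable_seq_fun (g t i).
Hypothesis xg : forall t, {ae P, forall w, forall i, x t w i 0 = g t i (past (fun s => e s w) t)}.
Hypothesis hmom : forall t i, (Lnorm P m%:E (fun w => (x t w i 0)%:E) <= M%:E)%E.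
Hypothesis hdep : forall k : nat, (\sum_(k <= j <oo) dep_coef P m e g j <= (C * decay alpha k)%:E)%E.
Variable c : R.
Hypotheses (c0 : 0 < c)
  (eig : forall z : R[i], eigenvalue (map_mx (real_complex R) (companion_tr S)) z -> `|z| < 1)
  (Sigma0_eig : forall a, eigenvalue (Sigma0 P p x) a -> c < a).
Hypotheses (p0 : (0 < p)%N) (pT : (p <= T)%N).
Variable s : nat.
Hypothesis sS : forall l, (#|supp S l| <= s)%N.
Variables (St : Om -> 'M[R]_(p * d, d)) (lam thr c' : R).
Hypotheses (St_meas : measurable_mx St)
  (St_lasso : forall w, is_lasso T lam (fun t => x t w) (St w)).
Hypotheses (l0 : 0 < lam) (S_min : forall l j, j \in supp S l -> 2 * thr < `|S j l|).
Hypothesis c'0 : 0 < c'.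
Hypothesis Lambda_diag : forall l j, j \in supp S l -> c' < Lambda P T x eps S l l j j.
Context dsp' (Om' : measurableType dsp') (Q : probability Om' R) (Gam : Om' -> 'M[R]_(p * d, d)).
Hypotheses (Gam_meas : measurable_mx Gam)
  (Gam_normal : jointly_normal Q (fun (jl : 'I_(p * d) * 'I_d) w => Gam w jl.1 jl.2))
  (Gam_mean : forall j l, expectation Q (fun w => Gam w j l) = 0%E)
  (Gam_cov : forall j1 l1 j2 l2,
     covariance Q (fun w => Gam w j1 l1) (fun w => Gam w j2 l2) = (Lambda P T x eps S l1 l2 j1 j2)%:E).
Hypothesis supp0 : exists l, (0 < #|supp S l|)%N.

Definition active : finType := {jl : 'I_(p * d) * 'I_d | jl.1 \in supp S jl.2}.
(* The sign turns the maximum of absolute values into a maximum. *)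
Definition signed_active : finType := (bool * active)%type.
Local Notation K := signed_active.

Lemma card_signed_active : (0 < #|K|)%N /\ (#|K| <= 2 * s * d)%N.
Proof.
rewrite card_prod card_bool card_sig; split.
  have [l /card_gt0P[j jl]] := supp0; rewrite muln_gt0 /=; apply/card_gt0P; by exists (j, l).
rewrite -mulnA leq_mul2l /=.
have -> : #|[pred jl : 'I_(p * d) * 'I_d | jl.1 \in supp S jl.2]| = (\sum_l #|supp S l|)%N.
  rewrite -sum1_card (eq_bigl (fun jl : 'I_(p * d) * 'I_d => true && (jl.1 \in supp S jl.2)))//.
  rewrite -(pair_big_dep xpredT (fun j l => j \in supp S l) (fun _ _ => 1%N)) /=.
  by rewrite (exchange_big_dep xpredT)//=; apply: eq_bigr => l _; rewrite sum1_card.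
apply: (@leq_trans (\sum_(l < d) s)); first by apply: leq_sum => l _; exact: sS.
by rewrite sum_nat_const card_ord mulnC.
Qed.

Local Notation X := (canonical g).
Local Notation cov := (state_cov mu p X).
Let sg (i : K) : R := (-1) ^+ i.1.
Let jl (i : K) := val i.2.
Local Notation h := ((Num.sqrt (T%:R : R))^-1).

Variables (r r3 del beta a : R) (L k : nat).
Hypotheses (r0 : 0 < r) (rlam : r <= lam / 2) (rs : 16 * r * s%:R <= c / 2)
  (lb : 18 * s%:R * lam / c < thr) (r30 : 0 < r3) (del0 : 0 <= del) (beta0 : 0 < beta) (a0 : 0 < a).

Local Notation N := (#|K|%:R : R).
Local Notation gc := (gram_cst p alpha m M C).
Local Notation sc := (score_cst p alpha m M C c s).
Local Notation My := (influence_mom M c s).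
Local Notation Cy := (influence_tail p alpha M C c s).
Local Notation B0 := (sum_bound (m / 2) Cy).
Local Notation aE := (approx_error alpha (m / 2) Cy L).

(* r bounds the deviations of the Gram matrix and of the score, L is the length
   of the dependence windows, r3 the error of the window approximation, beta and
   del the inverse temperature and the slack of the smoothed maximum, a the
   truncation level and k the order of the moment in the bound of E max |G|. *)
Definition ks_bound : R :=
  ((p * d) ^ 2)%N%:R * ((h * gc) / r) `^ (m / 2) + (p * d * d)%N%:R * ((h * sc) / r) `^ (m / 2)
  + N * (aE / r3) `^ (m / 2) + 2 * N * expR (- (beta * del))
  + 2 * (52 * (beta ^+ 3 * ((T - p)%:R * ((2 * L + 1)%N%:R ^+ 2 * (h * (N `^ (m / 2)^-1 * (My + My))) ^+ 3)))
      + 3 * (beta ^+ 2 * (aE * (2 * B0 + aE))))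
  + (2 * del + (Num.sqrt T%:R * (2 * s%:R ^+ 3 * r ^+ 2 / c ^+ 2) + r3)) *
    ((a + N * ((B0 * B0) ^+ k.+1 * Ex (normal_prob (0 : R) 1) (fun u : measurableTypeR R => u ^+ (2 * k.+1))) / a ^+ (2 * k).+1) / c').

(** [Bad] collects a null set, large deviations of the Gram matrix or of the score, and large window
    errors. Off [Bad] the estimator equals S outside the supports, and on them its normalized error
    is within [rho] of the window sums. [sandwich] combines this with [sum_comparison] and
    [gauss_anticoncentration]. *)
Lemma ks_inequality y :
  `|fine (P [set w | \big[Num.max/0]_(j < p * d) \big[Num.max/0]_(l < d)
       (Num.sqrt T%:R * `|post_selection T thr (fun t => x t w) (St w) j l - S j l|) <= y]) -
    fine (Q [set w | \big[Num.max/0]_(l < d) \big[Num.max/0]_(j in supp S l) `|Gam w j l| <= y])| <= ks_bound.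
Proof.
have imu := indep_coord_seq_law ind.
have hX := canonical_srt m8 alpha0 d0 x_meas mg xg hmom hdep.
have wn0 := canonical_wn0 m8 alpha0 d0 x_meas eps_meas x_VAR eps_wn mg xg hmom hdep.
have wn1 := canonical_wn1 m8 alpha0 d0 x_meas eps_meas x_VAR eps_wn mg xg hmom hdep.
have coerc := canonical_coercive ind m8 alpha0 d0 x_meas eps_meas x_VAR eps_wn mg xg hmom hdep c0 eig Sigma0_eig.
have LamE := Lambda_canonical ind m8 alpha0 d0 x_meas eps_meas x_VAR eps_wn mg xg hmom hdep c0 eig Sigma0_eig p0 pT sS.
have [K0 _] := card_signed_active.
have q4 : 4 < m / 2 by move: m8; lra.
have q0 : 0 < m / 2 by apply: lt_trans q4.
have T0 : (0 < T)%N by apply: leq_trans pT.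
have nT : (T - p < T)%N by rewrite ltn_subrL p0.
have hinf := srt_influence imu alpha0 m8 c0 hX eig wn0 wn1 coerc sS p0 d0.
have sg1 i : sg i * sg i = 1 by rewrite -expr2 sqrr_sign.
have nsg i : `|sg i| = 1 by rewrite normr_sign.
pose y0 (i : K) t u := sg i * influence mu X A (jl i) t u.
have hy i : srt mu alpha (m / 2) My Cy (y0 i).
  by have := srtZ (sg i) q0 (hinf (jl i)).1; rewrite nsg !mul1r.
have Ey i t : Ex mu (y0 i t) = 0.
  have q1 : 1 <= m / 2 by move: q4; lra.
  by rewrite ExZ ?(hinf (jl i)).2 ?mulr0//; exact: (mom_itg q1 (srt_mom t (hinf (jl i)).1)).1.
pose G (i : K) w := sg i * Gam w (jl i).1 (jl i).2.
pose Lm i j := sg i * sg j * Lambda P T x eps S (jl i).2 (jl j).2 (jl i).1 (jl j).1.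
have mG0 (i : 'I_(p * d) * 'I_d) : measurable_fun setT (fun w => Gam w i.1 i.2) by exact: Gam_meas.
have mG i : measurable_fun setT (G i) by apply: measurable_funM => //; exact: Gam_meas.
have gm (i : 'I_(p * d) * 'I_d) := Gam_mean i.1 i.2.
have gcv (i j : 'I_(p * d) * 'I_d) := Gam_cov i.1 i.2 j.1 j.2.
have nG : jointly_normal Q G := jointly_normal_scaled jl sg Gam_normal.
have G0 i : expectation Q (G i) = 0%E := scaled_mean0 jl sg mG0 Gam_normal gm i.
have cG i j : covariance Q (G i) (G j) = (Lm i j)%:E := scaled_cov jl sg mG0 Gam_normal gm gcv i j.
pose ns := normalized_sum y0 (T - p) T.
have nsE i u : ns i u = sg i * (h * \sum_(j < T - p) influence mu X A (jl i) (T%:Z - j%:Z) u).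
  by rewrite /ns /normalized_sum -mulr_sumr mulrCA.
have hns i : mom mu (m / 2) (ns i) B0 := mom_normalized_sum imu q4 K0 hy Ey T0 nT i.
have q2 : 2 <= m / 2 by move: q4; lra.
have LmE i j : Lm i j = Ex mu (fun u => ns i u * ns j u).
  have [ins _] := mom2_prod q2 (hns i) (hns j).
  rewrite /Lm LamE -ExZ.
    by congr Ex; apply/funext => u; rewrite !nsE; case: (jl i) (jl j) => [j1 l1] [j2 l2]; ring.
  have := itgZ (sg i * sg j) ins.
  have -> // : (fun w => sg i * sg j * (ns i w * ns j w)) = fun u =>
    (h * \sum_(j0 < T - p) influence mu X A ((jl i).1, (jl i).2) (T%:Z - j0%:Z) u) *
    (h * \sum_(j0 < T - p) influence mu X A ((jl j).1, (jl j).2) (T%:Z - j0%:Z) u).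
  apply/funext => u; rewrite !nsE; case: (jl i) (jl j) (sg1 i) (sg1 j) => [j1 l1] [j2 l2] /= s1 s2.
  set a1 := h * _; set a2 := h * _.
  by transitivity ((sg i * sg i) * (sg j * sg j) * (a1 * a2)); [ring|rewrite s1 s2 !mul1r].
have [S1 dS hga] := sum_comparison imu L q4 K0 hy Ey T0 nT mG nG G0 cG LmE.
have mS1 i : measurable_fun setT (S1 i).
  have -> : S1 i = fun u => ns i u - (ns i u - S1 i u) by apply/funext => u; rewrite subKr.
  by apply: measurable_funB; [exact: mom_meas (hns i)|exact: mom_meas (dS i)].
pose gd (kk : 'I_(p * d) * 'I_(p * d)) u :=
  (T%:R^-1 *: ((design p T (path_of X u))^T *m design p T (path_of X u))) kk.1 kk.2 - cov kk.1 kk.2.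
pose sd (kl : 'I_(p * d) * 'I_d) u :=
  (T%:R^-1 *: ((design p T (path_of X u))^T *m response p T (innov A (path_of X u)) kl.2)) kl.1 0.
have hgd kk : mom mu (m / 2) (gd kk) (h * gc) := mom_gram imu alpha0 m8 c0 hX eig wn0 wn1 p0 pT kk.1 kk.2.
have hsd kl : mom mu (m / 2) (sd kl) (h * sc) := mom_score imu alpha0 m8 c0 hX eig wn0 wn1 coerc sS p0 pT kl.1 kl.2.
have [i0 _] : exists i : K, True by move/card_gt0P: K0 => [i _]; exists i.
have gc0 := mom_ge0 (hgd ((jl i0).1, (jl i0).1)).
have sc0 := mom_ge0 (hsd (jl i0)).
have aE0 := mom_ge0 (dS i0).
pose B1 := [set u : E | r <= maxnorm (gd ^~ u)].
pose B2 := [set u : E | r <= maxnorm (sd ^~ u)].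
pose B3 := [set u : E | r3 <= maxnorm (fun i => ns i u - S1 i u)].
have mB1 : measurable B1 by apply: measurable_ge_set; apply: measurable_maxnorm => i; exact: mom_meas (hgd i).
have mB2 : measurable B2 by apply: measurable_ge_set; apply: measurable_maxnorm => i; exact: mom_meas (hsd i).
have mB3 : measurable B3 by apply: measurable_ge_set; apply: (measurable_maxnorm (V := fun i u => ns i u - S1 i u)) => i; exact: mom_meas (dS i).
have mphi (B : set E) : measurable B -> measurable (phi @^-1` B).
  by move=> mB; rewrite -[_ @^-1` _]setTI; exact: measurable_seq_map.
(* N0 is a measurable null set off which the path is the canonical one and [eps] is the innovation
   of the path, at all times at once. *)
have := filterI (path_canonical xg) (innov_canonical x_VAR); case=> N0 [mN0 PN0 hN0].
pose Bad := N0 `|` (phi @^-1` B1 `|` (phi @^-1` B2 `|` phi @^-1` B3)).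
have mBad : measurable Bad by apply: measurableU => //; apply: measurableU; [exact: mphi|apply: measurableU; exact: mphi].
have PBad : fine (P Bad) <= ((p * d) ^ 2)%N%:R * ((h * gc) / r) `^ (m / 2)
   + (p * d * d)%N%:R * ((h * sc) / r) `^ (m / 2) + N * (aE / r3) `^ (m / 2).
  have h1 := maxnorm_markov q0 r0 gc0 hgd; have h2 := maxnorm_markov q0 r0 sc0 hsd.
  have h3 := maxnorm_markov q0 r30 aE0 dS.
  rewrite card_prod !card_ord in h1; rewrite card_prod !card_ord in h2.
  apply: le_trans (fine_probU _ _ _) _ => //; first by apply: measurableU; [exact: mphi|apply: measurableU; exact: mphi].
  rewrite PN0 add0r; apply: le_trans (fine_probU _ _ _) _; [exact: mphi|apply: measurableU; exact: mphi|].
  rewrite -addrA; apply: lerD; first exact: h1.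
  apply: le_trans (fine_probU _ _ _) _; [exact: mphi|exact: mphi|].
  by apply: lerD; [exact: h2|exact: h3].
have good w : ~ Bad w -> [/\ (forall t, x t w = path_of X (phi w) t),
    (forall t, eps t w = innov A (x ^~ w) t),
    maxnorm (gd ^~ (phi w)) < r, maxnorm (sd ^~ (phi w)) < r & maxnorm (fun i => ns i (phi w) - S1 i (phi w)) < r3].
  move=> nB; have [h1 h2] : (forall t, x t w = path_of X (phi w) t) /\ (forall t, eps t w = innov A (x ^~ w) t).
    by apply: contrapT => hc; apply: nB; left; apply: hN0 => hc'; apply: hc; split; [exact: hc'.1|exact: hc'.2].
  by split => //; rewrite ltNge; apply/negP => hc; apply: nB; right; [left|right; left|right; right].
pose ps w := post_selection T thr (fun t => x t w) (St w).
have lin w j l : ~ Bad w -> (j \notin supp S l -> ps w j l = S j l) /\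
   `|ps w j l - S j l - \sum_k partial_inv (supp S l) cov j k * sd (k, l) (phi w)| <= 2 * s%:R ^+ 3 * r ^+ 2 / c ^+ 2.
  move=> /good[h1 h2 h3 h4 _].
  have ex : (fun t => x t w) = path_of X (phi w) by apply/funext => t; rewrite h1.
  have ee : (fun t => eps t w) = innov A (path_of X (phi w)) by apply/funext => t; rewrite h2 ex.
  have yE l' : response p T (x ^~ w) l' = design p T (x ^~ w) *m col l' S + response p T (eps ^~ w) l'.
    exact: response_design.
  have hr i j' : `|(T%:R^-1 *: ((design p T (x ^~ w))^T *m design p T (x ^~ w))) i j' - cov i j'| <= r.
    by rewrite ex; apply: le_trans (ltW h3); exact: (maxnorm_ge (gd ^~ (phi w)) (i, j')).
  have hu l' i : `|(T%:R^-1 *: ((design p T (x ^~ w))^T *m response p T (eps ^~ w) l')) i 0| <= r.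
    by rewrite ee ex; apply: le_trans (ltW h4); exact: (maxnorm_ge (sd ^~ (phi w)) (i, l')).
  split; first exact: (post_selection_off T0 c0 l0 yE (St_lasso w) coerc hr hu rlam sS rs lb S_min).
  have := post_selection_linear T0 c0 l0 yE (St_lasso w) coerc hr hu rlam sS rs lb S_min j l.
  by rewrite ee /sd -ex.
pose rho := Num.sqrt T%:R * (2 * s%:R ^+ 3 * r ^+ 2 / c ^+ 2) + r3.
have sT0 : 0 <= Num.sqrt T%:R :> R by exact: sqrtr_ge0.
have rho0 : 0 <= rho.
  by rewrite addr_ge0 ?(ltW r30)// mulr_ge0// divr_ge0 ?sqr_ge0// !mulr_ge0 ?exprn_ge0// ltW.
have close w i : ~ Bad w -> `|Num.sqrt T%:R * (ps w (jl i).1 (jl i).2 - S (jl i).1 (jl i).2) * sg i - S1 i (phi w)| <= rho.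
  move=> nB; have [_ hl] := lin w (jl i).1 (jl i).2 nB; have [_ _ _ _ h5] := good w nB.
  have e5 := le_trans (maxnorm_ge (fun i => ns i (phi w) - S1 i (phi w)) i) (ltW h5).
  rewrite (_ : _ - _ = (Num.sqrt T%:R * (ps w (jl i).1 (jl i).2 - S (jl i).1 (jl i).2) * sg i - ns i (phi w)) + (ns i (phi w) - S1 i (phi w))); last by ring.
  apply: le_trans (ler_normD _ _) _; apply: lerD => //.
  rewrite nsE influence_sum// [sg i * _]mulrC -mulrBl -mulrBr normrM nsg mulr1 normrM ger0_norm//.
  by apply: ler_wpM2l.
apply: le_trans (@sandwich R K _ _ Om Om' P Q _ _ (fun i w => S1 i (phi w)) G Bad beta del rho
  (2 * (52 * (beta ^+ 3 * ((T - p)%:R * ((2 * L + 1)%N%:R ^+ 2 * (h * (N `^ (m / 2)^-1 * (My + My))) ^+ 3)))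
      + 3 * (beta ^+ 2 * (aE * (2 * B0 + aE)))))
  ((a + N * ((B0 * B0) ^+ k.+1 * Ex (normal_prob (0 : R) 1) (fun u : measurableTypeR R => u ^+ (2 * k.+1))) / a ^+ (2 * k).+1) / c')
  _ _ _ mG mBad beta0 del0 rho0 K0 _ _ _ _ _ y) _.
- apply: measurable_bigmax => j; apply: measurable_bigmax => l; apply: measurable_funM => //.
  apply: measurableT_comp => //; apply: measurable_funB => //.
  have mps : measurable_mx ps by apply: measurable_post_selection.
  exact: mps.
- apply: measurable_bigmax => l.
  have -> : (fun w => \big[Num.max/0]_(j in supp S l) `|Gam w j l|) = fun w => \big[Num.max/0]_(j <- enum (supp S l)) `|Gam w j l|.
    by apply/funext => w; rewrite big_enum.
  apply: measurable_bigmax => j; apply: measurableT_comp => //; exact: Gam_meas.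
- by move=> i; exact: (measurableT_comp (mS1 i) (measurable_seq_map e)).
- move=> w z; split => [Yz i|Gz].
    apply: le_trans (ler_norm _) _; rewrite normrM nsg mul1r; apply: le_trans Yz.
    apply: le_trans (le_bigmax _ (fun l => \big[Num.max/0]_(j in supp S l) `|Gam w j l|) (jl i).2).
    apply: (@le_bigmax_cond _ _ _ _ (jl i).1 (fun j => j \in supp S (jl i).2) (fun j => `|Gam w j (jl i).2|)).
    exact: valP i.2.
  have absz (v : active) : `|Gam w (val v).1 (val v).2| <= z.
    rewrite ler_norml; have := Gz (true, v); have := Gz (false, v); rewrite /G /sg /jl /= expr0 expr1; lra.
  (* The maxima start from the default 0; since some pair is active, z is nonnegative and the
     default does no harm. *)
  have z0 : 0 <= z := le_trans (normr_ge0 _) (absz i0.2).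
  apply: bigmax_le => // l _; apply: bigmax_le => // j jl'.
  exact: (absz (Sub (j, l) jl')).
- move=> w z nB Xz i; have := close w i nB.
  have : `|Num.sqrt T%:R * (ps w (jl i).1 (jl i).2 - S (jl i).1 (jl i).2) * sg i| <= z.
    rewrite normrM nsg mulr1 normrM ger0_norm//; apply: le_trans Xz.
    apply: le_trans (le_bigmax _ (fun l => Num.sqrt T%:R * `|ps w (jl i).1 l - S (jl i).1 l|) (jl i).2) _.
    exact: (le_bigmax _ (fun j => \big[Num.max/0]_(l < d) (Num.sqrt T%:R * `|ps w j l - S j l|)) (jl i).1).
  rewrite !ler_norml => /andP[_ h1] /andP[h2 _]; lra.
- move=> w z nB Sz.
  have act (v : active) : Num.sqrt T%:R * `|ps w (val v).1 (val v).2 - S (val v).1 (val v).2| <= z + rho.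
    rewrite -[Num.sqrt _]ger0_norm// -normrM ler_norml.
    have := close w (true, v) nB; have := close w (false, v) nB; have := Sz (true, v); have := Sz (false, v).
    rewrite /sg /jl /= expr0 expr1 !ler_norml => h1 h2 /andP[h3 h4] /andP[h5 h6].
    by apply/andP; split; lra.
  have zr : 0 <= z + rho by apply: le_trans (act i0.2); rewrite mulr_ge0.
  apply: bigmax_le => // j _; apply: bigmax_le => // l _.
  have [jS|jS] := boolP (j \in supp S l); first exact: (act (Sub (j, l) jS)).
  by have [h1 _] := lin w j l nB; rewrite -/(ps w) h1// subrr normr0 mulr0.
- move=> z.
  have mf : measurable_fun setT (fun u => lgs (fun i => beta * (S1 i u - z))).
    by apply: measurable_lgs => i; apply: measurable_funM => //; apply: measurable_funB.
  have bf w : `|lgs (fun i => beta * (S1 i (phi w) - z))| <= 1 by rewrite ger0_norm ?lgs_le1// ltW// lgs_gt0.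
  have mfp := measurableT_comp mf (measurable_seq_map e).
  by rewrite -(law_Ex mf (itg_bnd P mfp bf)).2; apply: hga; exact: ltW.
- move=> z hh.
  have LB i : Lm i i <= B0 * B0.
    by rewrite LmE; apply: le_trans (ler_norm _) _; exact: (mom2_prod q2 (hns i) (hns i)).2.
  have [iU EU] := gauss_maxnorm mG nG G0 cG k a0 LB.
  apply: (gauss_anticoncentration mG nG G0 cG beta0 c'0 _ _ _ iU EU).
  - by move=> i; rewrite /Lm sg1 mul1r; apply/ltW/Lambda_diag; exact: valP i.2.
  - by move=> w; exact: maxnorm_ge0.
  - by move=> i w; exact: (maxnorm_ge (G ^~ w)).
rewrite /ks_bound -/rho; apply: lerD => //; apply: lerD => //; apply: lerD => //.
Qed.

End FixedSample.

(** * Rates in T *)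

Section PowerOrder.
Context (R : realType).
Implicit Types (f g : nat -> R) (a b c : R).

(** O(T^a) for eventually nonnegative sequences; the sign lets bounds multiply without absolute
    values. *)
Definition ord f a : Prop := exists2 c, 0 <= c & \forall T \near \oo, 0 <= f T <= c * T%:R `^ a.

Lemma near_ge1 : \forall T \near \oo, 1 <= (T%:R : R).
Proof. by apply: filterS (nbhs_infty_ge 1) => T; rewrite ler1n. Qed.

Lemma ord_dom f g a : (\forall T \near \oo, 0 <= f T <= g T) -> ord g a -> ord f a.
Proof.
move=> fg [c c0 gc]; exists c => //; apply: filterS2 fg gc => T /andP[f0 fg] /andP[_ gc].
by rewrite f0 (le_trans fg).
Qed.

Lemma ordM f g a b : ord f a -> ord g b -> ord (fun T => f T * g T) (a + b).
Proof.
move=> [c c0 hf] [c' c'0 hg]; exists (c * c'); first exact: mulr_ge0.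
apply: filterS3 hf hg near_ge1 => T /andP[f0 fc] /andP[g0 gc] T1.
rewrite mulr_ge0//= powRD ?(gt_eqF (lt_le_trans ltr01 T1)) ?implybT// mulrACA.
exact: ler_pM.
Qed.

Lemma ordD f g a : ord f a -> ord g a -> ord (fun T => f T + g T) a.
Proof.
move=> [c c0 hf] [c' c'0 hg]; exists (c + c'); first exact: addr_ge0.
apply: filterS2 hf hg => T /andP[f0 fc] /andP[g0 gc].
by rewrite addr_ge0//= mulrDl lerD.
Qed.

Lemma ord_le f a b : a <= b -> ord f a -> ord f b.
Proof.
move=> ab [c c0 hf]; exists c => //; apply: filterS2 hf near_ge1 => T /andP[f0 fc] T1.
by rewrite f0 (le_trans fc)// ler_wpM2l// ler_powR.
Qed.

Lemma ord_cst c : 0 <= c -> ord (fun=> c) 0.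
Proof. by move=> c0; exists c => //; apply: nearW => T; rewrite powRr0 mulr1 c0 lexx. Qed.

Lemma ord_powR q f a : 0 <= q -> ord f a -> ord (fun T => f T `^ q) (a * q).
Proof.
move=> q0 [c c0 hf]; exists (c `^ q); first exact: powR_ge0.
apply: filterS hf => T /andP[f0 fc]; rewrite powR_ge0 powRrM -powRM ?powR_ge0//.
exact: ler_powR2.
Qed.

Lemma ordX n f a : ord f a -> ord (fun T => f T ^+ n) (a * n%:R).
Proof.
move=> hf; have := ord_powR (ler0n R n) hf; apply: ord_dom.
case: hf => c _; apply: filterS => T /andP[f0 _].
by rewrite -powR_mulrn// powR_ge0 lexx.
Qed.

Lemma ord_id a : ord (fun T => T%:R `^ a) a.
Proof. by exists 1 => //; apply: nearW => T; rewrite mul1r powR_ge0 lexx. Qed.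

Lemma ord_cvg f a : a < 0 -> ord f a -> f T @[T --> \oo] --> (0 : R).
Proof.
move=> a0 [c c0 hf]; apply/cvgrPdist_le => e e0.
have ce : 0 < e / (c + 1) by rewrite divr_gt0// ltr_wpDl.
have hT := nbhs_infty_ger ((e / (c + 1)) `^ a^-1).
apply: filterS3 hf near_ge1 hT => T /andP[f0 fc] T1 Te.
rewrite sub0r normrN ger0_norm//; apply: le_trans fc _.
have Tp := lt_le_trans ltr01 T1.
have h : T%:R `^ a <= e / (c + 1).
  have -> : e / (c + 1) = ((e / (c + 1)) `^ a^-1) `^ a by rewrite -powRrM mulVf ?lt_eqF// powRr1// ltW.
  rewrite -[a]opprK [leLHS]powRN [leRHS]powRN lef_pV2 ?posrE ?powR_gt0//.
  by rewrite opprK; apply: ler_powR2 => //; rewrite ?powR_ge0// oppr_ge0 ltW.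
apply: le_trans (ler_wpM2l c0 h) _; rewrite mulrCA ler_piMr ?(ltW e0)//.
by rewrite ler_pdivrMr ?mul1r ?lerDl// ltr_wpDl.
Qed.

Lemma expR_le_powR (y : R) (n : nat) : 0 < y -> expR (- y) <= (n.+1%:R / y) ^+ n.+1.
Proof.
move=> y0; have n0 : 0 < n.+1%:R :> R by rewrite ltr0n.
have -> : - y = (- (y / n.+1%:R)) * n.+1%:R by rewrite mulNr divfK ?gt_eqF.
rewrite expRM_natr lerXn2r ?nnegrE ?expR_ge0 ?divr_ge0 ?(ltW y0)//.
rewrite expRN -[leRHS]invrK lef_pV2 ?posrE ?expR_gt0 ?invr_gt0 ?divr_gt0// invf_div.
by apply: le_trans (expR_ge1Dx _); rewrite lerDr.
Qed.

(** exp (- y) <= (n / y)^n for every n >= 1, so the exponential beats any power of T. *)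
Lemma ord_expR e b : 0 < e -> ord (fun T => expR (- T%:R `^ e)) b.
Proof.
move=> e0; pose n := Num.truncn (`|b| / e).
have hn : (- e) * n.+1%:R <= b.
  have h : `|b| / e < n.+1%:R by exact: truncnS_gt.
  rewrite ltr_pdivrMr// in h; have := ler_norm (- b); rewrite normrN; lra.
apply: (ord_le hn); have h1 := ordM (ord_cst (ler0n R n.+1)) (ord_id (- e)).
have := ordX n.+1 h1; rewrite add0r; apply: ord_dom.
apply: filterS near_ge1 => T T1; rewrite expR_ge0/= powRN.
by apply: expR_le_powR; rewrite powR_gt0// (lt_le_trans ltr01 T1).
Qed.

Definition vanish f := exists2 a, a < 0 & ord f a.

Lemma vanishD f g : vanish f -> vanish g -> vanish (fun T => f T + g T).
Proof.
move=> [a a0 fa] [b b0 gb]; exists (Num.max a b); first by rewrite gt_max a0 b0.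
by apply: ordD; [apply: ord_le fa; rewrite le_max lexx|apply: ord_le gb; rewrite le_max lexx orbT].
Qed.

Lemma ord_sqrtV : ord (fun T => (Num.sqrt (T%:R : R))^-1) (- (1 / 2)).
Proof.
apply: ord_dom (ord_id _); apply: nearW => T; rewrite invr_ge0 sqrtr_ge0 powRN.
by rewrite -powR12_sqrt// mul1r lexx.
Qed.

Lemma ord_sqrt : ord (fun T => Num.sqrt (T%:R : R)) (1 / 2).
Proof.
apply: ord_dom (ord_id _); apply: nearW => T; rewrite sqrtr_ge0.
by rewrite -powR12_sqrt// mul1r lexx.
Qed.

Lemma ord_decay alpha l : 0 <= alpha -> ord (fun T => decay alpha (Num.truncn (T%:R `^ l : R))) (- (l * alpha)).
Proof.
move=> a0; apply: ord_dom (ord_id _); apply: filterS near_ge1 => T T1.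
rewrite powR_ge0 /decay !powRN; have Tp := lt_le_trans ltr01 T1.
rewrite lef_pV2 ?posrE ?powR_gt0 ?ltr_pwDl//.
rewrite /= powRrM; apply: ler_powR2; [exact: a0|exact: powR_ge0|].
by rewrite addrC natr1 ltW// truncnS_gt.
Qed.

Lemma ord_window l : 0 <= l -> ord (fun T => (2 * Num.truncn (T%:R `^ l : R) + 1)%N%:R) l.
Proof.
move=> l0; have := ordM (ord_cst (ler0n R 3)) (ord_id l); rewrite add0r; apply: ord_dom.
apply: filterS near_ge1 => T T1; rewrite ler0n/= natrD natrM.
have h1 : 1 <= T%:R `^ l :> R by have := ler_powR T1 l0; rewrite powRr0.
have h2 : (Num.truncn (T%:R `^ l : R))%:R <= T%:R `^ l :> R by rewrite truncn_le powR_ge0.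
lra.
Qed.

End PowerOrder.

(** * Orders of the terms of the bound *)

Section BoundVanishes.
Context (R : realType) (p d : nat -> nat) (A : forall T, 'I_(p T) -> 'M[R]_(d T)).
Variables (m alpha M C c c' : R) (s pm k : nat) (ad a' l e1 e2 e3 : R).
Hypotheses (m8 : 8 < m) (alpha1 : 1 < alpha) (M0 : 0 <= M) (C0 : 0 <= C) (c0 : 0 < c) (c'0 : 0 < c').
Hypotheses (l0 : 0 <= l) (hp : \forall T \near \oo, (p T <= pm)%N)
  (hd : ord (fun T => (d T)%:R : R) ad)
  (hN : \forall T \near \oo, (#|signed_active (@A T)| <= 2 * s * d T)%N).
Local Notation q := (m / 2).
(** Each term of [ks_bound] has its condition: [h1] the deviations of Gram matrix and score, [h3]
    the window error, [h4] the smoothing tails, [h5] the Stein error, [h6] the covariance error,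
    [h7] and [h8] the shift of the level times the size T^e2 of the Gaussian maximum, [h9] that size
    itself. *)
Hypotheses (h1 : 2 * ad + (- (1 / 2) + a') * q < 0)
  (h3 : ad + (- (l * alpha) + e1) * q < 0)
  (h4 : e1 < e3)
  (h5 : e3 * 3 + (1 + (l * 2 + (- (1 / 2) + ad / q) * 3)) < 0)
  (h6 : e3 * 2 - l * alpha < 0)
  (h7 : e2 < e1) (h8 : 1 / 2 - a' * 2 + e2 < 0) (h9 : ad - e2 * (2 * k).+1%:R <= e2).

Let alpha0 : 0 <= alpha. Proof. by apply: ltW; apply: lt_trans alpha1. Qed.
Let q0 : 0 <= q. Proof. by move: m8; lra. Qed.
Let op : ord (fun T => (p T)%:R : R) 0.
Proof.
apply: ord_dom (ord_cst (ler0n R pm)); apply: filterS hp => T hT.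
by rewrite ler0n/= ler_nat.
Qed.
Let oN : ord (fun T => #|signed_active (@A T)|%:R : R) ad.
Proof.
have := ordM (ord_cst (ler0n R (2 * s))) hd; rewrite add0r; apply: ord_dom.
by apply: filterS hN => T hT; rewrite ler0n -natrM ler_nat.
Qed.

Let M00 (f g : nat -> R) : ord f 0 -> ord g 0 -> ord (fun T => f T * g T) 0.
Proof. by move=> hf hg; have := ordM hf hg; rewrite addr0. Qed.

Let olag : ord (fun T => lag_cst (p T) alpha) 0.
Proof.
have := ord_powR alpha0 (ordD (ord_cst ler01) op); rewrite mul0r; exact.
Qed.
Let oM : ord (fun=> M) 0. Proof. exact: ord_cst. Qed.
Let oC : ord (fun=> C) 0. Proof. exact: ord_cst. Qed.
Let osq : ord (fun=> Num.sqrt (rio_cst q)) 0. Proof. exact/ord_cst/sqrtr_ge0. Qed.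
Let ogc : ord (fun T => gram_cst (p T) alpha m M C) 0.
Proof.
apply: ordD; last by apply: M00 => //; apply: M00.
by apply: M00 => //; apply: ordD; apply: M00 => //; apply: M00.
Qed.
Let Sm0 : 0 <= coef_bound M c. Proof. by rewrite addr_ge0// divr_ge0 ?mulr_ge0// ltW. Qed.
Let Me0 : 0 <= innov_mom M c s. Proof. by rewrite addr_ge0// !mulr_ge0. Qed.
Let otail : ord (fun T => innov_tail (p T) alpha M C c s) 0.
Proof.
apply: ordD => //; apply: M00; first exact: ord_cst.
by apply: M00; [exact: ord_cst|apply: M00].
Qed.
Let osc : ord (fun T => score_cst (p T) alpha m M C c s) 0.
Proof.
apply: M00 => //; apply: ordD; first exact: M00.
by apply: M00; [exact: ord_cst|apply: M00].
Qed.
Let oinf : ord (fun T => influence_tail (p T) alpha M C c s) 0.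
Proof.
apply: M00; first exact: ord_cst.
apply: M00; first by apply: ord_cst; rewrite invr_ge0 ltW.
apply: ordD; first exact: M00.
by apply: M00; [exact: ord_cst|apply: M00].
Qed.
Let oB0 : ord (fun T => sum_bound q (influence_tail (p T) alpha M C c s)) 0.
Proof. exact: M00. Qed.
Let Lf (T : nat) := Num.truncn (T%:R `^ l : R).
Let oaE : ord (fun T => approx_error alpha q (influence_tail (p T) alpha M C c s) (Lf T)) (- (l * alpha)).
Proof.
have := ordM (ordD oB0 (ord_cst ler01)) (ord_decay l alpha0); rewrite add0r; exact.
Qed.

Let powRV (a : R) (T : nat) : (T%:R `^ (- a))^-1 = T%:R `^ a :> R.
Proof. by rewrite powRN invrK. Qed.

Let vterm (n : nat -> R) (f : nat -> R) (b : R) (aa : R) : ord n aa -> ord f b -> aa + b * q < 0 ->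
  vanish (fun T => n T * f T `^ q).
Proof. by move=> hn hf hlt; exists (aa + b * q) => //; apply: ordM => //; exact: ord_powR. Qed.

Lemma vanish_ks_bound : vanish (fun T => ks_bound T m alpha M C (@A T) c s c'
  (T%:R `^ (- a')) (T%:R `^ (- e1)) (T%:R `^ (- e1)) (T%:R `^ e3) (T%:R `^ e2) (Lf T) k).
Proof.
have odd : ord (fun T => (d T)%:R * (d T)%:R : R) (2 * ad).
  by have := ordM hd hd; rewrite (_ : ad + ad = 2 * ad)//; ring.
rewrite /ks_bound; apply: vanishD; [apply: vanishD; [apply: vanishD; [apply: vanishD; [apply: vanishD|]|]|]|].
- apply: (vterm (b := - (1 / 2) + a') (aa := 2 * ad)) => //.
    have := ordM (M00 op op) odd; rewrite add0r; apply: ord_dom; apply: nearW => T.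
    by rewrite ler0n -!natrM ler_nat expnMn -!mulnn mulnACA leqnn.
  have -> : (fun T => (Num.sqrt (T%:R : R))^-1 * gram_cst (p T) alpha m M C / T%:R `^ (- a')) =
      fun T => (Num.sqrt (T%:R : R))^-1 * gram_cst (p T) alpha m M C * T%:R `^ a'.
    by apply/funext => T; rewrite powRV.
  by have := ordM (ordM (ord_sqrtV R) ogc) (ord_id a'); rewrite addr0.
- apply: (vterm (b := - (1 / 2) + a') (aa := 2 * ad)) => //.
    have := ordM op odd; rewrite add0r; apply: ord_dom; apply: nearW => T.
    by rewrite ler0n -!natrM ler_nat mulnA leqnn.
  have -> : (fun T => (Num.sqrt (T%:R : R))^-1 * score_cst (p T) alpha m M C c s / T%:R `^ (- a')) =
      fun T => (Num.sqrt (T%:R : R))^-1 * score_cst (p T) alpha m M C c s * T%:R `^ a'.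
    by apply/funext => T; rewrite powRV.
  by have := ordM (ordM (ord_sqrtV R) osc) (ord_id a'); rewrite addr0.
- apply: (vterm (b := - (l * alpha) + e1) (aa := ad)) => //.
  have -> : (fun T => approx_error alpha q (influence_tail (p T) alpha M C c s) (Lf T) / T%:R `^ (- e1)) =
      fun T => approx_error alpha q (influence_tail (p T) alpha M C c s) (Lf T) * T%:R `^ e1.
    by apply/funext => T; rewrite powRV.
  exact: ordM oaE (ord_id e1).
- have e31 : 0 < e3 - e1 by rewrite subr_gt0.
  exists (- 1); first by rewrite oppr_lt0.
  have := ordM (ordM (ord_cst (ler0n R 2)) oN) (ord_expR (- ad - 1) e31).
  rewrite add0r (_ : ad + (- ad - 1) = - 1); last by ring.
  apply: ord_dom; apply: filterS (near_ge1 R) => T T1.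
  rewrite -powRD ?lexx ?mulr_ge0 ?expR_ge0//.
  by rewrite (gt_eqF (lt_le_trans ltr01 T1)) implybT.
- have e5 : vanish (fun T => 52 * ((T%:R `^ e3) ^+ 3 * ((T - p T)%:R * ((2 * Lf T + 1)%N%:R ^+ 2 *
     ((Num.sqrt T%:R)^-1 * (#|signed_active (@A T)|%:R `^ q^-1 * (influence_mom M c s + influence_mom M c s))) ^+ 3)))).
    exists (e3 * 3 + (1 + (l * 2 + (- (1 / 2) + ad / q) * 3))) => //.
    have oT : ord (fun T => (T - p T)%:R : R) 1.
      apply: ord_dom (ord_id 1); apply: nearW => T.
      by rewrite ler0n powRr1// ler_nat leq_subr.
    have My0 : 0 <= influence_mom M c s + influence_mom M c s.
      by rewrite addr_ge0// !mulr_ge0 ?invr_ge0 ?(ltW c0).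
    have q0' : 0 <= q^-1 by rewrite invr_ge0.
    have o3 := ordM (ord_sqrtV R) (ordM (ord_powR q0' oN) (ord_cst My0)); rewrite addr0 in o3.
    have := ordM (ord_cst (ler0n R 52)) (ordM (ordX 3 (ord_id e3)) (ordM oT (ordM (ordX 2 (ord_window l0)) (ordX 3 o3)))).
    by rewrite add0r.
  have e6 : vanish (fun T => 3 * ((T%:R `^ e3) ^+ 2 * (approx_error alpha q (influence_tail (p T) alpha M C c s) (Lf T) *
      (2 * sum_bound q (influence_tail (p T) alpha M C c s) + approx_error alpha q (influence_tail (p T) alpha M C c s) (Lf T))))).
    exists (e3 * 2 - l * alpha) => //.
    have la : - (l * alpha) <= 0 by rewrite oppr_le0 mulr_ge0.
    have o4 := ordM oaE (ordD (M00 (ord_cst (ler0n R 2)) oB0) (ord_le la oaE)); rewrite addr0 in o4.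
    have := ordM (ord_cst (ler0n R 3)) (ordM (ordX 2 (ord_id e3)) o4).
    by rewrite add0r.
  have [b b0 ob] := vanishD e5 e6; exists b => //.
  by have := ordM (ord_cst (ler0n R 2)) ob; rewrite add0r.
have K0 : 0 <= Ex (normal_prob (0 : R) 1) (fun u : measurableTypeR R => u ^+ (2 * k.+1)).
  by apply: Ex_ge0 => u; rewrite exprM exprn_ge0// sqr_ge0.
have okap : ord (fun T => (T%:R `^ e2 + #|signed_active (@A T)|%:R * ((sum_bound q (influence_tail (p T) alpha M C c s)
    * sum_bound q (influence_tail (p T) alpha M C c s)) ^+ k.+1 *
    Ex (normal_prob (0 : R) 1) (fun u : measurableTypeR R => u ^+ (2 * k.+1))) / (T%:R `^ e2) ^+ (2 * k).+1) / c') e2.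
  have ci : 0 <= c'^-1 by rewrite invr_ge0 ltW.
  have o7 := ordX (2 * k).+1 (ord_id (- e2)).
  have oB2 := ordX k.+1 (M00 oB0 oB0); rewrite mul0r in oB2.
  have o8 := ordM (ordM oN (M00 oB2 (ord_cst K0))) o7.
  have -> : (fun T => (T%:R `^ e2 + #|signed_active (@A T)|%:R * ((sum_bound q (influence_tail (p T) alpha M C c s)
    * sum_bound q (influence_tail (p T) alpha M C c s)) ^+ k.+1 *
    Ex (normal_prob (0 : R) 1) (fun u : measurableTypeR R => u ^+ (2 * k.+1))) / (T%:R `^ e2) ^+ (2 * k).+1) / c') =
    fun T => (T%:R `^ e2 + #|signed_active (@A T)|%:R * ((sum_bound q (influence_tail (p T) alpha M C c s)
    * sum_bound q (influence_tail (p T) alpha M C c s)) ^+ k.+1 *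
    Ex (normal_prob (0 : R) 1) (fun u : measurableTypeR R => u ^+ (2 * k.+1))) * (T%:R `^ (- e2)) ^+ (2 * k).+1) * c'^-1.
    by apply/funext => T; rewrite powRN exprVn.
  rewrite -[e2 in X in ord _ X]addr0; apply: ordM; last exact: ord_cst.
  apply: ordD; first exact: ord_id.
  by apply: ord_le o8; rewrite addr0 mulNr.
set kap := (fun T => _ / c') in okap.
have v1 : vanish (fun T => 2 * T%:R `^ (- e1) * kap T).
  exists (- e1 + e2); first by rewrite addrC subr_lt0.
  by have := ordM (ordM (ord_cst (ler0n R 2)) (ord_id (- e1))) okap; rewrite add0r.
have v2 : vanish (fun T => Num.sqrt T%:R * (2 * s%:R ^+ 3 * (T%:R `^ (- a')) ^+ 2 / c ^+ 2) * kap T).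
  exists (1 / 2 - a' * 2 + e2) => //; apply: ordM => //; apply: ordM; first exact: ord_sqrt.
  have c1 : 0 <= 2 * s%:R ^+ 3 :> R by rewrite mulr_ge0// exprn_ge0.
  have c2 : 0 <= (c ^+ 2)^-1 by rewrite invr_ge0 exprn_ge0// ltW.
  by have := ordM (ordM (ord_cst c1) (ordX 2 (ord_id (- a')))) (ord_cst c2); rewrite add0r addr0 mulNr.
have v3 : vanish (fun T => T%:R `^ (- e1) * kap T).
  by exists (- e1 + e2); [rewrite addrC subr_lt0|exact: ordM (ord_id _) okap].
have := vanishD v1 (vanishD v2 v3).
by congr vanish; apply/funext => T; rewrite -!mulrDl.
Qed.

End BoundVanishes.

(* In [ks_bound]: r = T^-a', L = T^l, r3 = del = T^-e1, beta = T^e3, a = T^e2.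
   The bound on alpha_d leaves kap > 0 of room. *)
Lemma rate_exponents (R : realType) (m alpha ad al : R) : 8 < m -> 1 < alpha -> 0 <= ad ->
  ad < m * alpha / (2 + 24 * alpha) -> 0 < al -> al < 1 / 2 - 4 * ad / m ->
  exists (a' l e1 e2 e3 : R) (k : nat), [/\ al < a', 0 <= l & 0 < a'] /\
   [/\ 2 * ad + (- (1 / 2) + a') * (m / 2) < 0, ad + (- (l * alpha) + e1) * (m / 2) < 0, e1 < e3,
      e3 * 3 + (1 + (l * 2 + (- (1 / 2) + ad / (m / 2)) * 3)) < 0 & e3 * 2 - l * alpha < 0] /\
   [/\ e2 < e1, 1 / 2 - a' * 2 + e2 < 0 & ad - e2 * (2 * k).+1%:R <= e2].
Proof.
move=> m8 a1 ad0 adlt al0 allt.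
have m0 : 0 < m by lra.
have al00 : 0 < alpha by lra.
pose u := ad / m; pose ia := alpha^-1.
have adE : ad = u * m by rewrite /u divfK ?gt_eqF.
have u0 : 0 <= u by rewrite divr_ge0// ltW.
have ia0 : 0 < ia by rewrite invr_gt0.
have iaE : ia * alpha = 1 by rewrite /ia mulVf ?gt_eqF.
have ia1 : ia < 1 by rewrite invf_lt1.
have w0 : 0 <= u * ia by rewrite mulr_ge0// ltW.
have w1 : u * ia <= u by rewrite ler_piMr// ltW.
pose w := u * ia; pose kap := 1 - (2 * w + 24 * u).
have kap0 : 0 < kap.
  (* The bound on ad, divided by m; a further division by alpha reads 2 w + 24 u < 1, that is, 0 <
     kap. *)
  have h : u * (2 + 24 * alpha) < alpha.
    rewrite ltr_pdivlMr in adlt; last by lra.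
    by rewrite -(ltr_pM2l m0) mulrA [m * u]mulrC -adE.
  have : u * (2 + 24 * alpha) * ia < alpha * ia by rewrite ltr_pM2r.
  rewrite /kap /w (_ : alpha * ia = 1); last by rewrite mulrC.
  rewrite (_ : u * (2 + 24 * alpha) * ia = 2 * (u * ia) + 24 * u * (ia * alpha)); last by ring.
  by rewrite iaE mulr1; lra.
have allt' : al < 1 / 2 - 4 * u by rewrite /u mulrA.
have wE : w * alpha = u by rewrite /w -mulrA iaE mulr1.
have kaa : kap <= kap * alpha by rewrite ler_peMr ?(ltW kap0) ?(ltW a1).
have w0' : 0 <= w by [].
have w1' : w <= u by [].
(* A midpoint: above al, to make r small against lam; above 1/4, to make sqrt T r^2 vanish; below
   1/2 - 4 u, for the union bound over the entries of the Gram matrix. *)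
pose a' := (Num.max al (1 / 4) + (1 / 2 - 4 * u)) / 2.
have ha : al < a' /\ 1 / 4 < a' /\ a' < 1 / 2 - 4 * u.
  have h1 : al <= Num.max al (1 / 4) by rewrite le_max lexx.
  have h2 : 1 / 4 <= Num.max al (1 / 4) by rewrite le_max lexx orbT.
  have h3 : Num.max al (1 / 4) < 1 / 2 - 4 * u.
    by rewrite gt_max allt'/=; move: kap0; rewrite /kap; lra.
  by rewrite /a'; split; [|split]; lra.
have [ha1 [ha2 ha3]] := ha.
(* Positive, below e1 = kap / 80 and below the gain 2 a' - 1/2 of the quadratic remainder. *)
pose e2 := Num.min (kap / 80) (2 * a' - 1 / 2) / 2.
have he : 0 < e2 /\ e2 < kap / 80 /\ e2 < 2 * a' - 1 / 2.
  have h1 : Num.min (kap / 80) (2 * a' - 1 / 2) <= kap / 80 by rewrite ge_min lexx.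
  have h2 : Num.min (kap / 80) (2 * a' - 1 / 2) <= 2 * a' - 1 / 2 by rewrite ge_min lexx orbT.
  have h3 : 0 < Num.min (kap / 80) (2 * a' - 1 / 2) by rewrite lt_min; apply/andP; split; lra.
  by rewrite /e2; split; [|split]; lra.
have [he1 [he2 he3]] := he.
(* The exponent l lies just above 2 w = 2 ad / (m alpha), where the window error survives a union
   bound over T^ad variables. The order k gives ad <= e2 (2 k + 2), so that the Gaussian maximum is
   of order T^e2. *)
exists a', (2 * w + kap / 16), (kap / 80), e2, (kap / 40), (Num.truncn (ad / e2)).
have lE : (2 * w + kap / 16) * alpha = 2 * u + kap * alpha / 16.
  by rewrite mulrDl -mulrA wE mulrAC.
split; [split; lra|split; split]; rewrite ?lE.
- rewrite adE (_ : _ + _ = (a' - (1 / 2 - 4 * u)) * (m / 2)); last by field.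
  by rewrite pmulr_llt0 ?divr_gt0// subr_lt0.
- rewrite adE (_ : _ + _ = (kap / 80 - kap * alpha / 16) * (m / 2)); last by field.
  by rewrite pmulr_llt0 ?divr_gt0//; lra.
- lra.
- rewrite (_ : ad / (m / 2) = 2 * u); last by rewrite /u; field; rewrite gt_eqF.
  by move: kap0; rewrite /kap; lra.
- lra.
- exact: he2.
- lra.
have h : ad / e2 < (Num.truncn (ad / e2)).+1%:R by exact: truncnS_gt.
rewrite ltr_pdivrMr// in h; set k := Num.truncn _ in h *.
have k2 : (2 * k).+1%:R = 2 * k%:R + 1 :> R by rewrite -addn1 natrD natrM.
have k1 : k.+1%:R = k%:R + 1 :> R by rewrite -addn1 natrD.
rewrite k2; rewrite k1 in h; have k0 : 0 <= k%:R :> R by [].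
have : 0 <= e2 * k%:R by rewrite mulr_ge0// ltW.
by lra.
Qed.

Lemma tail_decay (R : realType) (alpha C : R) (k : nat) (x : \bar R) :
  (((1 + k%:R) `^ alpha)%:E * x <= C%:E)%E -> (x <= (C * decay alpha k)%:E)%E.
Proof.
have h0 : 0 < (1 + k%:R : R) `^ alpha by rewrite powR_gt0// ltr_pwDl.
rewrite /decay powRN -lee_pdivlMl// => /le_trans; apply.
by rewrite -EFinM mulrC.
Qed.

Lemma kolmogorov_dist_le (R : realType) dsp (Om : measurableType dsp) (P : probability Om R)
    (X : Om -> R) dsp' (Om' : measurableType dsp') (Q : probability Om' R) (Y : Om' -> R) (B : R) :
  measurable_fun setT X -> measurable_fun setT Y ->
  (forall y, `|fine (P [set w | X w <= y]) - fine (Q [set w | Y w <= y])| <= B) ->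
  (0 <= kolmogorov_dist P X Q Y <= B%:E)%E.
Proof.
move=> mX mY h; apply/andP; split.
  apply: (@le_trans _ _ `|P [set w | (X w <= 0)%R] - Q [set w | (Y w <= 0)%R]|%E); first exact: abse_ge0.
  by apply: ereal_sup_ubound; exists 0.
apply: ge_ereal_sup => _ [y _ <-].
rewrite -[X in (X - _)%E]fineK ?fin_num_measure//; last exact: measurable_le_set.
rewrite -[X in (_ - X)%E]fineK ?fin_num_measure//; last exact: measurable_le_set.
exact: h.
Qed.

Lemma supp_nonempty (R : realType) (p d : nat) (S : 'M[R]_(p * d, d)) :
  (0 < \max_(l < d) #|supp S l|)%N -> exists l, (0 < #|supp S l|)%N.
Proof.
move=> h; apply: contrapT => hn; move: h; rewrite big1// => l _.
by apply/eqP; rewrite eqn0Ngt; apply/negP => hl; apply: hn; exists l.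
Qed.

Lemma ord_bigO (R : realType) (f : nat -> R) (a : R) : (forall T, 0 <= f T) ->
  f =O_\oo (fun T => T%:R `^ a) -> ord f a.
Proof.
move=> f0 /eqO_exP[c c0 h]; exists c; first exact: ltW.
apply: filterS h => T; rewrite f0/= ger0_norm// => /le_trans; apply.
by rewrite ger0_norm// powR_ge0.
Qed.

Lemma bounded_nat_bigO (R : realType) (f : nat -> nat) :
  (fun T => (f T)%:R : R) =O_\oo (fun=> 1 : R) -> exists s, \forall T \near \oo, (f T <= s)%N.
Proof.
move=> /eqO_exP[c c0 h]; exists (Num.truncn c); apply: filterS h => T.
by rewrite normr1 mulr1 ger0_norm// truncn_ge_nat// ltW.
Qed.

Theorem theorem3 (R : realType)
    (* probability space, lag order, dimension, coefficients, innovation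
       covariance: all indexed by the sample size T *)
    (disp : nat -> measure_display) (Om : forall T, measurableType (disp T))
    (P : forall T, probability (Om T) R)
    (p d : nat -> nat)
    (A : forall T, 'I_(p T) -> 'M[R]_(d T))
    (Sigma_eps : forall T, 'M[R]_(d T))
    (x eps : forall T, int -> Om T -> 'cV[R]_(d T))
    (Stilde : forall T, Om T -> 'M[R]_(p T * d T, d T))
    (lam b : nat -> R)
    (m alpha alpha_d c_lam alpha_lam c c' : R)
    (* joint normal variables, on auxiliary probability spaces *)
    (disp' : nat -> measure_display) (Om' : forall T, measurableType (disp' T))
    (Q : forall T, probability (Om' T) R)
    (Gam : forall T, Om' T -> 'M[R]_(p T * d T, d T))
    (* vector autoregression with white noise innovations *)
    (x_meas : forall T t, measurable_mx (x T t))
    (eps_meas : forall T t, measurable_mx (eps T t))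
    (x_VAR : forall T, is_VAR (P T) (A T) (x T) (eps T))
    (eps_wn : forall T, white_noise (P T) (eps T) (Sigma_eps T))
    (* Lasso *)
    (Stilde_meas : forall T, measurable_mx (Stilde T))
    (Stilde_lasso : forall T w,
       is_lasso T (lam T) (fun t => x T t w) (Stilde T w))
    (* assumption (1) *)
    (m_gt8 : 8 < m) (alpha_gt1 : 1 < alpha)
    (x_srd : short_range_dependent P m alpha x)
    (p_O1 : (fun T => (p T)%:R : R) =O_\oo (fun=> 1 : R))
    (d_O : (fun T => (d T)%:R : R) =O_\oo (fun T => T%:R `^ alpha_d : R))
    (alpha_d_ge0 : 0 <= alpha_d)
    (alpha_d_lt : alpha_d < m * alpha / (2 + 24 * alpha))
    (* assumption (2) *)
    (lamE : forall T, lam T = c_lam * T%:R `^ (- alpha_lam))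
    (c_lam_gt0 : 0 < c_lam)
    (alpha_lam_gt0 : 0 < alpha_lam)
    (alpha_lam_lt : alpha_lam < 1 / 2 - 4 * alpha_d / m)
    (b_to0 : b T @[T --> \oo] --> (0 : R))
    (b_lam : b T / lam T @[T --> \oo] --> +oo)
    (B_O1 : (fun T => (\max_(l < d T) #|supp (coef_mx (A T)) l|)%:R : R)
              =O_\oo (fun=> 1 : R))
    (B_gt0 : forall T, (0 < \max_(l < d T) #|supp (coef_mx (A T)) l|)%N)
    (S_min : forall T l j, j \in supp (coef_mx (A T)) l ->
       2 * b T < `|coef_mx (A T) j l|)
    (Sdag_eig : forall T (z : R[i]),
       eigenvalue (map_mx (real_complex R) (companion_tr (coef_mx (A T)))) z ->
       `|z| < 1)
    (c_gt0 : 0 < c)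
    (Sigma0_eig : forall T (a : R),
       eigenvalue (Sigma0 (P T) (p T) (x T)) a -> c < a)
    (* assumption (3) *)
    (c'_gt0 : 0 < c')
    (Lambda_diag : \forall T \near \oo, forall l j,
       j \in supp (coef_mx (A T)) l ->
       c' < Lambda (P T) T (x T) (eps T) (coef_mx (A T)) l l j j)
    (* law of Gamma *)
    (Gam_meas : forall T, measurable_mx (Gam T))
    (Gam_normal : forall T, jointly_normal (Q T)
       (fun (jl : 'I_(p T * d T) * 'I_(d T)) w => Gam T w jl.1 jl.2))
    (Gam_mean : forall T j l, expectation (Q T) (fun w => Gam T w j l) = 0%E)
    (Gam_cov : forall T j1 l1 j2 l2,
       covariance (Q T) (fun w => Gam T w j1 l1) (fun w => Gam T w j2 l2)
       = (Lambda (P T) T (x T) (eps T) (coef_mx (A T)) l1 l2 j1 j2)%:E) :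
  kolmogorov_dist
    (P T) (fun w => \big[Num.max/0]_(j < p T * d T) \big[Num.max/0]_(l < d T)
       (Num.sqrt T%:R *
        `|post_selection T (b T) (fun t => x T t w) (Stilde T w) j l
          - coef_mx (A T) j l|))
    (Q T) (fun w => \big[Num.max/0]_(l < d T)
       \big[Num.max/0]_(j in supp (coef_mx (A T)) l) `|Gam T w j l|)
  @[T --> \oo] --> 0%E.

Proof.
have [a' [l [e1 [e2 [e3 [k [[al' l0 a'0] [[h1 h3 h4 h5 h6] [h7 h8 h9]]]]]]]]] :=
  rate_exponents m_gt8 alpha_gt1 alpha_d_ge0 alpha_d_lt alpha_lam_gt0 alpha_lam_lt.
have [e [g [[ind mg] xg _ [M1 hM1] [C1 hC1]]]] := x_srd.
(* The constants hidden in O(1) may be negative; nonnegative ones are taken. *)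
pose M := Num.max M1 0; pose C := Num.max C1 0.
have M0 : 0 <= M by rewrite le_max lexx orbT.
have C0 : 0 <= C by rewrite le_max lexx orbT.
have [pm hp] := bounded_nat_bigO p_O1; have [s hs] := bounded_nat_bigO B_O1.
have hd : ord (fun T => (d T)%:R : R) alpha_d by apply: ord_bigO => // T; exact: ler0n.
have supp0 T := supp_nonempty (B_gt0 T).
(* A nonempty support exhibits both a row index below p d and a column index below d, so p and d are
   positive. *)
have pd0 T : (0 < p T)%N /\ (0 < d T)%N.
  have [i hi] := supp0 T; split; last exact: leq_ltn_trans (ltn_ord i).
  move: hi; case: (p T) (A T) i => // A0 i.
  rewrite card_gt0 => /set0Pn[j _]; by case: j.
have pT : \forall T \near \oo, (p T <= T)%N.
  by apply: filterS2 hp (nbhs_infty_ge pm) => T; exact: leq_trans.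
have sS : \forall T \near \oo, forall i, (#|supp (coef_mx (A T)) i| <= s)%N.
  apply: filterS hs => T hT i; apply: leq_trans hT.
  exact: (@leq_bigmax _ (fun i => #|supp (coef_mx (A T)) i|) i).
have hN : \forall T \near \oo, (#|signed_active (A T)| <= 2 * s * d T)%N.
  by apply: filterS sS => T hT; have [] := card_signed_active hT (supp0 T).
have alpha0 : 0 <= alpha by apply: ltW; apply: lt_trans alpha_gt1.
pose bnd T := ks_bound T m alpha M C (A T) c s c' (T%:R `^ (- a')) (T%:R `^ (- e1)) (T%:R `^ (- e1))
  (T%:R `^ e3) (T%:R `^ e2) (Num.truncn (T%:R `^ l)) k.
have [ab ab0 ob] : vanish bnd := vanish_ks_bound m_gt8 alpha_gt1 M0 C0 c_gt0 c'_gt0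
  l0 hp hd hN h1 h3 h4 h5 h6 h7 h8 h9.
have lim0 := ord_cvg ab0 ob.
have lam0 : \forall T \near \oo, 0 < lam T.
  apply: filterS (near_ge1 R) => T T1; rewrite lamE mulr_gt0// powR_gt0//.
  exact: lt_le_trans T1.
(* The deviation radius T^(-a') is small against lam because alpha_lam < a'. *)
have rlam : \forall T \near \oo, T%:R `^ (- a') <= lam T / 2.
  have : T%:R `^ (alpha_lam - a') @[T --> \oo] --> (0 : R).
    by apply: (@ord_cvg _ _ (alpha_lam - a')); [rewrite subr_lt0|exact: ord_id].
  have c2 : 0 < c_lam / 2 by rewrite divr_gt0.
  move=> /cvgrPdist_le/(_ _ c2) hT; apply: filterS2 hT (near_ge1 R) => T.
  rewrite sub0r normrN ger0_norm ?powR_ge0// => hT T1.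
  have Tp : 0 < T%:R :> R by exact: lt_le_trans T1.
  rewrite lamE mulrAC (_ : - a' = (alpha_lam - a') + - alpha_lam); last by ring.
  rewrite powRD ?(gt_eqF Tp) ?implybT//.
  by rewrite ler_wpM2r// powR_ge0.
have rs : \forall T \near \oo, 16 * T%:R `^ (- a') * s%:R <= c / 2.
  have : T%:R `^ (- a') @[T --> \oo] --> (0 : R).
    by apply: (@ord_cvg _ _ (- a')); [rewrite oppr_lt0|exact: ord_id].
  have c2 : 0 < c / 2 / (16 * s.+1%:R) by rewrite divr_gt0 ?mulr_gt0 ?divr_gt0.
  move=> /cvgrPdist_le/(_ _ c2); apply: filterS => T.
  rewrite sub0r normrN ger0_norm ?powR_ge0// ler_pdivlMr ?mulr_gt0//.
  apply: le_trans; rewrite mulrAC mulrC ler_wpM2l ?powR_ge0// ler_wpM2l// ler_nat.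
  exact: leqnSn.
have lb : \forall T \near \oo, 18 * s%:R * lam T / c < b T.
  move/cvgryPgt: b_lam => /(_ (18 * s%:R / c)); apply: filterS2 lam0 => T l1.
  by rewrite ltr_pdivlMr// mulrAC.
apply: (@squeeze_cvge _ _ _ _ (cst 0%E) _ (fun T => (bnd T)%:E)); first last.
- by apply: cvg_EFin => //; exact: nearW.
- exact: cvg_cst.
near=> T.
have T0 : 0 < T%:R :> R by apply: (@lt_le_trans _ _ 1) => //; near: T; exact: near_ge1.
have hmom t i : (Lnorm (P T) m%:E (fun w => (x T t w i 0)%:E) <= M%:E)%E.
  apply: (@le_trans _ _ M1%:E); last by rewrite lee_fin le_max lexx.
  apply: (@le_trans _ _ (ereal_sup (range (fun ti : int * 'I_(d T) =>
      Lnorm (P T) m%:E (fun w => (x T ti.1 w ti.2 0)%:E)))));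
    last by near: T; exact: hM1.
  by apply: ereal_sup_ubound; exists (t, i).
have hdep j : (\sum_(j <= i <oo) dep_coef (P T) m (e T) (g T) i <= (C * decay alpha j)%:E)%E.
  apply: tail_decay; apply: (@le_trans _ _ C1%:E); last by rewrite lee_fin le_max lexx.
  apply: (@le_trans _ _ (ereal_sup (range (fun k : nat =>
      (((1 + k%:R) `^ alpha)%:E * \sum_(k <= j <oo) dep_coef (P T) m (e T) (g T) j)%E))));
    last by near: T; exact: hC1.
  by apply: ereal_sup_ubound; exists j.
have main y := @ks_inequality R _ _ (P T) (e T) (ind T) (p T) (d T) T m alpha M C (A T) (Sigma_eps T)
  (x T) (eps T) (g T) m_gt8 alpha0 (pd0 T).2 (x_meas T) (eps_meas T) (x_VAR T) (eps_wn T) (mg T)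
  (xg T) hmom hdep c c_gt0 (@Sdag_eig T) (@Sigma0_eig T) (pd0 T).1 _ s _ (Stilde T) (lam T) (b T) c'
  (Stilde_meas T) (Stilde_lasso T) _ (S_min T) c'_gt0 _ _ _ (Q T) (Gam T) (Gam_meas T)
  (Gam_normal T) (Gam_mean T) (Gam_cov T) (supp0 T) (T%:R `^ (- a')) (T%:R `^ (- e1)) (T%:R `^ (- e1))
  (T%:R `^ e3) (T%:R `^ e2) (Num.truncn (T%:R `^ l)) k (powR_gt0 _ T0) _ _ _
  (powR_gt0 _ T0) (powR_ge0 _ _) (powR_gt0 _ T0) (powR_gt0 _ T0) y.
apply: kolmogorov_dist_le => [||y].
- apply: measurable_bigmax => j; apply: measurable_bigmax => i.
  apply: measurable_funM => //; apply: measurableT_comp => //; apply: measurable_funB => //.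
  have mps : measurable_mx (fun w => post_selection T (b T) (fun t => x T t w) (Stilde T w)).
    exact: measurable_post_selection.
  exact: mps.
- apply: measurable_bigmax => i; under eq_fun do rewrite -big_enum.
  by apply: measurable_bigmax => j; apply: measurableT_comp => //; exact: Gam_meas.
- apply: main; near: T => //.
Unshelve. all: by end_near.
Qed.
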